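(* The BFS problem can be solved on directed or undirected graphs with $n$ vertices and $m$ edges in $O(n+m)$ time with $n\log_2 3+O((\log n)^2)$ bits of working memory.
   Context: Model of computation: a word RAM with word length $w\ge\log_2 n$ bits, with constant-time addition, subtraction and multiplication modulo $2^w$, integer division with truncation, left and right shifts, and bitwise AND, OR, XOR. The input graph $G=(V,E)$ (directed or undirected) with $V=\{1,\ldots,n\}$ and $|E|=m$ is given in read-only memory; $n$ can be determined in $O(n+m)$ time, and for each vertex $u$ one can iterate over the neighbors of $u$ (for a directed graph: over its inneighbors and outneighbors, distinguishably) in constant time plus time proportional to their number. Output is written to write-only memory; only working memory is counted in the space bound. The BFS problem asks to carry out a breadth-first search of $G$: repeatedly take as start vertex $s$ the first vertex (in the order $1,\ldots,n$) not yet reached, and output the not-yet-reached vertices reachable from $s$ in an order of nondecreasing distance from $s$ in $G$ (i.e., compute a shortest-path spanning forest of $G$ in top-down order). *)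

(* Defs.v *)
From mathcomp Require Import all_boot all_order all_algebra.
From mathcomp Require Import reals exp.

Set Implicit Arguments.
Unset Strict Implicit.
Unset Printing Implicit Defensive.

Definition log2 {R : realType} (x : R) : R := (ln x / ln 2)%R.

(* Vertices are 0, ..., n-1 instead of 1, ..., n, so that every vertex fits
   in a word of w >= log2 n bits.  The adjacency lists are part of the input
   and may be ordered arbitrarily.  A directed graph is an arbitrary binary
   relation; an undirected one is simple, and there the two lists of a vertex
   are one and the same list of neighbours. *)
Record graph (n : nat) := Graph {
  directed : bool;
  edge : rel 'I_n;
  outnbr : 'I_n -> seq 'I_n;
  innbr : 'I_n -> seq 'I_n;
  outnbr_uniq : forall u, uniq (outnbr u);
  innbr_uniq : forall u, uniq (innbr u);
  mem_outnbr : forall u v, (v \in outnbr u) = edge u v;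
  mem_innbr : forall u v, (v \in innbr u) = edge v u;
  undirected_sym : ~~ directed -> symmetric edge;
  undirected_irr : ~~ directed -> irreflexive edge;
  undirected_nbr : ~~ directed -> innbr =1 outnbr }.

Definition nedges n (G : graph n) : nat :=
  if directed G then #|[set p : 'I_n * 'I_n | edge G p.1 p.2]|
  else #|[set [set p.1; p.2] | p : 'I_n * 'I_n & edge G p.1 p.2]|.

Definition walk n (e : rel 'I_n) (k : nat) (s v : 'I_n) : bool :=
  [exists p : k.-tuple 'I_n, path e s p && (last s p == v)].

(* The length of a shortest path from s to v, and n if there is none. *)
Definition gdist n (e : rel 'I_n) (s v : 'I_n) : nat :=
  find (fun k => walk e k s v) (iota 0 n).

(* [bfs_tree e r s t]: if r is the set of vertices reached earlier, then t,
   a sequence of pairs (vertex, parent), is a shortest-path tree rooted at s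
   of the remaining vertices reachable from s, in top-down order.  The root
   is its own parent. *)
Definition bfs_tree n (e : rel 'I_n) (r : {set 'I_n}) (s : 'I_n)
    (t : seq ('I_n * 'I_n)) : Prop :=
  [/\ uniq (unzip1 t),
      forall v, (v \in unzip1 t) = (v \notin r) && connect e s v,
      sorted leq [seq gdist e s v | v <- unzip1 t]
    & forall v p, (v, p) \in t ->
        if v == s then p = s
        else [/\ p \in unzip1 t, e p v & gdist e s v = (gdist e s p).+1] ].

(* [bfs_forest e r o]: o is a legal continuation of the output of a
   breadth-first search that has already reached exactly the vertices in r. *)
Inductive bfs_forest n (e : rel 'I_n) :
    {set 'I_n} -> seq ('I_n * 'I_n) -> Prop :=
| BfsDone : bfs_forest e setT [::]
| BfsTree (r : {set 'I_n}) (s : 'I_n) t o :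
    s \notin r -> (forall u : 'I_n, u < s -> u \in r) ->
    bfs_tree e r s t ->
    bfs_forest e (r :|: [set v in unzip1 t]) o ->
    bfs_forest e r (t ++ o).

(* The words written by the machine list each vertex followed by its
   parent. *)
Definition bfs_output n (G : graph n) (ws : seq nat) : Prop :=
  exists2 o, bfs_forest (edge G) set0 o &
    ws = flatten [seq [:: nat_of_ord x.1; nat_of_ord x.2] | x <- o].

Inductive binop := Add | Sub | Mul | Div | Shl | Shr | And | Or | Xor.

(* In the instructions, r, x, y and a are register names and i is an iterator
   name.  Memory is addressed by the contents of register a.  Iterator i
   enumerates the outneighbours or the inneighbours, according to [out], of the
   vertex contained in register x. *)
Inductive instr :=
| Const (r c : nat)
| Bin (o : binop) (r x y : nat)
| ReadMem (r a : nat)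
| WriteMem (a x : nat)
| LastVertex (r : nat)
| Start (out : bool) (i x : nat)
| Next (i r : nat)
| Output (x : nat).

Inductive test := TestEq (x y : nat) | TestLt (x y : nat) | TestMore (i : nat).

Inductive prog :=
| Skip
| Do (c : instr)
| Seq (p q : prog)
| If (t : test) (p q : prog)
| While (t : test) (p : prog).

(* [iters] maps each iterator to the neighbours it has yet to enumerate. *)
Record state (n : nat) := State {
  regs : nat -> nat;
  cells : nat -> nat;
  iters : nat -> seq 'I_n;
  written : seq nat }.

Section Semantics.

(* w is the word length of the machine, on which the arithmetic depends.  The
   working memory granted to a computation consists of M memory cells and of
   the registers of the program, each of b <= w bits; the computation gets
   stuck if it attempts to store a number of more than b bits or to access a
   nonexisting cell.  The program cannot observe b or M.  Since w may be
   arbitrarily large compared with log2 n, charging w bits for every register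
   would preclude any space bound in terms of n alone. *)
Variables (n : nat) (G : graph n) (w b M : nat).

Definition eval_bin (o : binop) (x y : nat) : option nat :=
  match o with
  | Add => Some ((x + y) %% 2 ^ w)
  | Sub => Some ((x + (2 ^ w - y)) %% 2 ^ w)
  | Mul => Some ((x * y) %% 2 ^ w)
  | Div => if y == 0 then None else Some (x %/ y)
  | Shl => Some ((x * 2 ^ y) %% 2 ^ w)
  | Shr => Some (x %/ 2 ^ y)
  | And => Some (Nat.land x y)
  | Or  => Some (Nat.lor x y)
  | Xor => Some (Nat.lxor x y)
  end.

Definition eval_test (t : test) (s : state n) : bool :=
  match t with
  | TestEq x y => regs s x == regs s y
  | TestLt x y => regs s x < regs s y
  | TestMore i => iters s i != [::]
  end.

Definition set_reg (s : state n) (r v : nat) : option (state n) :=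
  if v < 2 ^ b
  then Some (State [eta regs s with r |-> v] (cells s) (iters s) (written s))
  else None.

Definition set_mem (s : state n) (a v : nat) : option (state n) :=
  if (a < M) && (v < 2 ^ b)
  then Some (State (regs s) [eta cells s with a |-> v] (iters s) (written s))
  else None.

Definition set_itr (s : state n) (i : nat) (l : seq 'I_n) : state n :=
  State (regs s) (cells s) [eta iters s with i |-> l] (written s).

Definition step (c : instr) (s : state n) : option (state n) :=
  match c with
  | Const r k => set_reg s r (k %% 2 ^ w)
  | Bin o r x y => obind (set_reg s r) (eval_bin o (regs s x) (regs s y))
  | ReadMem r a => if regs s a < M then set_reg s r (cells s (regs s a)) else None
  | WriteMem a x => set_mem s (regs s a) (regs s x)
  | LastVertex r => set_reg s r n.-1
  | Start d i x =>
      omap (fun u : 'I_n => set_itr s i (if d then outnbr G u else innbr G u))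
        (insub (regs s x))
  | Next i r =>
      if iters s i is v :: l then set_reg (set_itr s i l) r v else None
  | Output x => Some (State (regs s) (cells s) (iters s) (rcons (written s) (regs s x)))
  end.

(* The input format only guarantees that n can be determined in O(n + m)
   time. *)
Definition cost (c : instr) : nat :=
  if c is LastVertex _ then n + nedges G else 1.

(* [exec p s t s']: started in state s, p terminates in state s' after t time
   units. *)
Inductive exec : prog -> state n -> nat -> state n -> Prop :=
| ExecSkip s : exec Skip s 0 s
| ExecDo c s s' : step c s = Some s' -> exec (Do c) s (cost c) s'
| ExecSeq p q s1 s2 s3 t1 t2 :
    exec p s1 t1 s2 -> exec q s2 t2 s3 -> exec (Seq p q) s1 (t1 + t2) s3
| ExecIf c p q s s' t :
    exec (if eval_test c s then p else q) s t s' ->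
    exec (If c p q) s t.+1 s'
| ExecWhileDone c p s : ~~ eval_test c s -> exec (While c p) s 1 s
| ExecWhileStep c p s1 s2 s3 t1 t2 :
    eval_test c s1 -> exec p s1 t1 s2 -> exec (While c p) s2 t2 s3 ->
    exec (While c p) s1 (t1 + t2).+1 s3.

(* Working memory is not assumed to be initialized. *)
Definition initial (s : state n) : Prop :=
  [/\ forall r, regs s r < 2 ^ b, forall a, cells s a < 2 ^ b,
      forall i, iters s i = [::] & written s = [::]].

End Semantics.

(* One more than the largest register index, resp. iterator index, occurring
   in the program. *)
Definition nreg_instr (c : instr) : nat :=
  match c with
  | Const r _ => r.+1
  | Bin _ r x y => maxn r.+1 (maxn x.+1 y.+1)
  | ReadMem r a => maxn r.+1 a.+1
  | WriteMem a x => maxn a.+1 x.+1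
  | LastVertex r => r.+1
  | Start _ _ x => x.+1
  | Next _ r => r.+1
  | Output x => x.+1
  end.

Definition nitr_instr (c : instr) : nat :=
  match c with Start _ i _ | Next i _ => i.+1 | _ => 0 end.

Definition nreg_test (t : test) : nat :=
  match t with TestEq x y | TestLt x y => maxn x.+1 y.+1 | TestMore _ => 0 end.

Definition nitr_test (t : test) : nat :=
  if t is TestMore i then i.+1 else 0.

Fixpoint nreg (p : prog) : nat :=
  match p with
  | Skip => 0
  | Do c => nreg_instr c
  | Seq p q => maxn (nreg p) (nreg q)
  | If t p q => maxn (nreg_test t) (maxn (nreg p) (nreg q))
  | While t p => maxn (nreg_test t) (nreg p)
  end.

Fixpoint nitr (p : prog) : nat :=
  match p with
  | Skip => 0
  | Do c => nitr_instr c
  | Seq p q => maxn (nitr p) (nitr q)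
  | If t p q => maxn (nitr_test t) (maxn (nitr p) (nitr q))
  | While t p => maxn (nitr_test t) (nitr p)
  end.

(* The state of an iterator is given by a direction, a vertex and a position
   between 0 and n in an adjacency list of that vertex. *)
Definition itr_bits (n : nat) : nat := 1 + up_log 2 n + up_log 2 n.+1.

Definition space_bits (p : prog) (n b M : nat) : nat :=
  (nreg p + M) * b + nitr p * itr_bits n.

(* Main.v *)
(* One bit per vertex records what has been visited; within a layer a third
   status, "new", is needed.  As long as the next layer meets few groups of 64
   consecutive vertices, the set of these groups is stored, one bit per unvisited
   vertex in them tells which ones are new, and the groups are traversed again
   to update the statuses.  Otherwise the layer has Omega(n) vertices, so this
   happens O(1) times and the whole graph may be scanned.

   Such a dense layer is processed in place.  The bits are turned into ternary
   digits from the top position downwards, the digits filling the n log2 3 bits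
   of memory while the remaining bits still occupy the start of it.  To leave
   room for auxiliary data, the vertices of one piece keep one bit each
   throughout.  Before these bits are updated, the vertices whose only visited
   inneighbours lie in the piece must be reported, because their parents become
   indistinguishable from new vertices.  Those at high positions are already
   marked by digits; those at low positions are recorded separately.  For
   disjoint pieces these exceptional sets are disjoint, so by the pigeonhole
   principle some piece has few of them and a sparse encoding fits.

   For n below a constant, decision trees with hard-wired answers are used. *)

Require Import Defs.
From mathcomp Require Import all_boot all_order all_algebra.
From mathcomp Require Import reals exp.
From mathcomp Require Import boolp zify.

Set Implicit Arguments.
Unset Strict Implicit.
Unset Printing Implicit Defensive.

(** Only O((log n)^2) bits may exceed n log2 3, while a cell of b bits holds a whole number [k3] of
    trits and so wastes up to one trit; over all cells this amounts to order n / log n bits. The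
    piece, about n / 128 vertices that keep one bit each, has to pay for this loss and for the
    tables. Its own bits, the flags and the bits of the exceptional sets cost 1 + 1/4 + 1/6 = 17/12
    bits per vertex of the piece, which is less than log2 3.

    The low positions number twice the size of the piece because fewer trits than bits fit into a
    cell: when the conversion has come down to them, the gap between the remaining bits and the
    finished digits is just large enough for the new bits of the piece.

    Linear time is an amortization. Every group met by a sparse layer contains a new vertex, which
    pays for the traversals of that group, and a group has only 64 vertices that can be charged. A
    dense layer is paid for by its more than [thr] new vertices. *)

Module Language.

(** * A small imperative language, its compiler and its program logic *)

Inductive eop := oAdd | oSub | oMul | oDiv | oMod | oLt | oLe | oEq.

Inductive expr :=
| Var (r : nat)
| Cst (k : nat)
| Op (o : eop) (e1 e2 : expr)
| Fetch (e : expr)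
| More (i : nat).

Inductive cmd :=
| Nop
| Asg (r : nat) (e : expr)
| Wr (a e : expr)
| Iter (d : bool) (i : nat) (e : expr)
| Nxt (i r : nat)
| Out (e : expr)
| Sq (c1 c2 : cmd)
| Cond (e : expr) (c1 c2 : cmd)
| Loop (e : expr) (c : cmd).

Definition cop (o : eop) (d : nat) : prog :=
  match o with
  | oAdd => Do (Bin Add d d d.+1)
  | oSub => Do (Bin Defs.Sub d d d.+1)
  | oMul => Do (Bin Mul d d d.+1)
  | oDiv => Do (Bin Div d d d.+1)
  | oMod => Seq (Do (Bin Div d.+2 d d.+1))
              (Seq (Do (Bin Mul d.+2 d.+2 d.+1)) (Do (Bin Defs.Sub d d d.+2)))
  | oLt => If (TestLt d d.+1) (Do (Const d 1)) (Do (Const d 0))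
  | oLe => If (TestLt d.+1 d) (Do (Const d 0)) (Do (Const d 1))
  | oEq => If (TestEq d d.+1) (Do (Const d 1)) (Do (Const d 0))
  end.

Definition nvar : nat := 32.

(* [compile_expr e d] leaves the value of [e] in register d < nvar and uses
   the registers between d and nvar as scratch space; variable r lives in
   register nvar + r. *)
Fixpoint compile_expr (e : expr) (d : nat) : prog :=
  match e with
  | Var r => Do (Bin And d (nvar + r) (nvar + r))
  | Cst k => Do (Const d k)
  | Op o e1 e2 =>
      Seq (Seq (compile_expr e1 d) (compile_expr e2 d.+1)) (cop o d)
  | Fetch e => Seq (compile_expr e d) (Do (ReadMem d d))
  | More i => If (TestMore i) (Do (Const d 1)) (Do (Const d 0))
  end.

Fixpoint compile (c : cmd) : prog :=
  match c with
  | Nop => Skip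
  | Asg r e => Seq (compile_expr e 0) (Do (Bin And (nvar + r) 0 0))
  | Wr a e =>
      Seq (Seq (compile_expr a 0) (compile_expr e 1)) (Do (WriteMem 0 1))
  | Iter d i e => Seq (compile_expr e 0) (Do (Start d i 0))
  | Nxt i r => Do (Next i (nvar + r))
  | Out e => Seq (compile_expr e 0) (Do (Output 0))
  | Sq c1 c2 => Seq (compile c1) (compile c2)
  | Cond e c1 c2 => Seq (Seq (compile_expr e 0) (Do (Const 1 0)))
                      (If (TestEq 0 1) (compile c2) (compile c1))
  | Loop e c => Seq (Seq (compile_expr e 0) (Do (Const 1 0)))
      (While (TestLt 1 0)
         (Seq (compile c) (Seq (compile_expr e 0) (Do (Const 1 0)))))
  end.

Fixpoint expr_depth (e : expr) : nat :=
  match e with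
  | Op _ e1 e2 => maxn 3 (maxn (expr_depth e1) (expr_depth e2).+1)
  | Fetch e => expr_depth e
  | _ => 1
  end.

Lemma expr_depth_gt0 e : 0 < expr_depth e.
Proof. by elim: e => //= o e1 _ e2 _; rewrite leq_max. Qed.

Fixpoint expr_size (e : expr) : nat :=
  match e with
  | Op _ e1 e2 => expr_size e1 + expr_size e2 + 3
  | Fetch e => (expr_size e).+1
  | _ => 2
  end.

Fixpoint cmd_size (c : cmd) : nat :=
  match c with
  | Nop | Nxt _ _ => 1
  | Asg _ e | Iter _ _ e | Out e => (expr_size e).+1
  | Wr a e => (expr_size a + expr_size e).+1
  | Sq c1 c2 => cmd_size c1 + cmd_size c2
  | Cond e c1 c2 => expr_size e + 2 + (cmd_size c1 + cmd_size c2)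
  | Loop e c => (expr_size e + 2) + (cmd_size c + expr_size e + 2)
  end.

Record hst (n : nat) := Hst {
  vars : nat -> nat;
  hm : nat -> nat;
  its : nat -> seq 'I_n;
  outp : seq nat }.

Section Hoare.

Variables (n : nat) (G : graph n) (w b M : nat).
Hypotheses (b_gt0 : 0 < b) (b_le_w : b <= w).
Implicit Types (h : hst n) (s : state n) (e : expr) (c : cmd).

Definition setv h (r v : nat) := Hst [eta vars h with r |-> v] (hm h) (its h) (outp h).
Definition setm h (a v : nat) := Hst (vars h) [eta hm h with a |-> v] (its h) (outp h).
Definition seti h (i : nat) l := Hst (vars h) (hm h) [eta its h with i |-> l] (outp h).
Definition out h v := Hst (vars h) (hm h) (its h) (rcons (outp h) v).

Definition evop (o : eop) (x y : nat) : nat :=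
  match o with
  | oAdd => x + y | oSub => x - y | oMul => x * y | oDiv => x %/ y
  | oMod => x %% y | oLt => x < y | oLe => x <= y | oEq => x == y
  end.

(** Under these conditions the arithmetic modulo [2 ^ w] agrees with that of [nat]: no result of
    more than b bits, no borrow, no division by zero. *)
Definition okop (o : eop) (x y : nat) : Prop :=
  match o with
  | oAdd => x + y < 2 ^ b | oSub => y <= x | oMul => x * y < 2 ^ b
  | oDiv | oMod => 0 < y | _ => True
  end.

Fixpoint ev e h : nat :=
  match e with
  | Var r => vars h r
  | Cst k => k
  | Op o e1 e2 => evop o (ev e1 h) (ev e2 h)
  | Fetch e => hm h (ev e h)
  | More i => its h i != [::]
  end.

Fixpoint ok e h : Prop :=
  match e with
  | Var r => True
  | Cst k => k < 2 ^ b
  | Op o e1 e2 => [/\ ok e1 h, ok e2 h & okop o (ev e1 h) (ev e2 h)]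
  | Fetch e => ok e h /\ ev e h < M
  | More i => True
  end.

Definition bounded h :=
  (forall r, vars h r < 2 ^ b) /\ (forall a, hm h a < 2 ^ b).

Definition small s :=
  (forall r, regs s r < 2 ^ b) /\ (forall a, cells s a < 2 ^ b).

(** Registers below [nvar] are left out since they are scratch space for expressions. Smallness of
    the machine state is included so that reading a variable or a cell never requires a proof that
    its value fits into b bits. *)
Definition sim h s :=
  [/\ forall r, vars h r = regs s (nvar + r), hm h =1 cells s,
      its h =1 iters s, outp h = written s & small s].

Lemma sim_bounded h s : sim h s -> bounded h.
Proof. by case=> Ev Em _ _ [sr sc]; split=> x; rewrite ?Ev ?Em. Qed.

Lemma lt_pow_w x : x < 2 ^ b -> x < 2 ^ w.
Proof. by move/leq_trans; apply; rewrite leq_exp2l. Qed.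

Lemma modw x : x < 2 ^ b -> x %% 2 ^ w = x.
Proof. by move/lt_pow_w/modn_small. Qed.

Lemma bool_small (B : bool) : B < 2 ^ b.
Proof.
have H : 1 < 2 ^ b by rewrite -[1](expn0 2) ltn_exp2l.
by case: B => //; exact: ltnW.
Qed.

Lemma ev_small e h : bounded h -> ok e h -> ev e h < 2 ^ b.
Proof.
case=> bv bm; elim: e => //= [o e1 IH1 e2 IH2 [/IH1 l1 /IH2 l2]|i _]; last first.
  exact: bool_small.
case: o => //= H; try exact: bool_small.
- exact: leq_ltn_trans (leq_subr _ _) l1.
- exact: leq_ltn_trans (leq_div _ _) l1.
exact: leq_ltn_trans (leq_mod _ _) l1.
Qed.

Definition scratch d s s' :=
  [/\ forall r, (r < d) || (nvar <= r) -> regs s' r = regs s r,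
      cells s' = cells s, iters s' = iters s, written s' = written s
    & small s'].

Lemma scratch_trans d d' s1 s2 s3 : d <= d' ->
  scratch d s1 s2 -> scratch d' s2 s3 -> scratch d s1 s3.
Proof.
move=> le [r1 c1 i1 w1 _] [r2 c2 i2 w2 b2].
split=> //; try congruence.
move=> r hr; rewrite r2 ?r1 //; case/orP: hr => hr; last by rewrite hr orbT.
by rewrite (leq_trans hr le).
Qed.

Lemma sim_scratch d h s s' : sim h s -> scratch d s s' -> sim h s'.
Proof.
move=> [Ev Em Ei Ew _] [r2 c2 i2 w2 b2]; split=> //.
- by move=> r; rewrite Ev r2 // leq_addr orbT.
- by rewrite c2.
- by rewrite i2.
- by rewrite w2.
Qed.

Lemma exec_set d s v (c : instr) : small s -> d < nvar -> v < 2 ^ b ->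
  step G w b M c s = set_reg b s d v -> cost G c = 1 ->
  exists s', [/\ exec G w b M (Do c) s 1 s', scratch d s s' & regs s' d = v].
Proof.
move=> [sr sc] ld lv; rewrite /set_reg lv => st Ec; eexists; split.
- by rewrite -Ec; apply: ExecDo; exact: st.
- split=> //=; last first.
    split=> //= r; case: eqP => // _.
  move=> r hr; case: eqP => // Er; move: hr; rewrite Er ltnn /=.
  by rewrite leqNgt ld.
by rewrite /= eqxx.
Qed.

Lemma subw x y : x < 2 ^ b -> y <= x -> (x + (2 ^ w - y)) %% 2 ^ w = x - y.
Proof.
move=> lx le; have lw := lt_pow_w lx.
rewrite addnBA; last by apply: leq_trans le (ltnW lw).
rewrite -addnBAC // modnDr modn_small //.
exact: leq_ltn_trans (leq_subr _ _) lw.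
Qed.

Lemma exec_if_const t d s v : small s -> d < nvar ->
  v = (eval_test t s) :> nat ->
  exists s', [/\ exec G w b M (If t (Do (Const d 1)) (Do (Const d 0))) s 2 s',
    scratch d s s' & regs s' d = v].
Proof.
move=> ss ld ->.
have [|//|s' [E sc rv]] := @exec_set d s (eval_test t s) (Const d (eval_test t s))
  ss ld (bool_small _).
  by rewrite /= modw // bool_small.
exists s'; split=> //; constructor.
by case: (eval_test t s) E.
Qed.

Lemma exec_if_const' t d s v : small s -> d < nvar ->
  v = (~~ eval_test t s) :> nat ->
  exists s', [/\ exec G w b M (If t (Do (Const d 0)) (Do (Const d 1))) s 2 s',
    scratch d s s' & regs s' d = v].
Proof.
move=> ss ld ->.
have [|//|s' [E sc rv]] := @exec_set d s (~~ eval_test t s)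
  (Const d (~~ eval_test t s)) ss ld (bool_small _).
  by rewrite /= modw // bool_small.
exists s'; split=> //; constructor.
by case: (eval_test t s) E.
Qed.

Lemma exec_op o d s x y : small s -> d.+2 < nvar ->
  regs s d = x -> regs s d.+1 = y -> okop o x y ->
  exists t s', [/\ exec G w b M (cop o d) s t s', t <= 3,
    scratch d s s' & regs s' d = evop o x y].
Proof.
move=> ss ld rx ry.
have lx : x < 2 ^ b by rewrite -rx; case: ss.
have ly : y < 2 ^ b by rewrite -ry; case: ss.
have ld' : d < nvar by lia.
case: o => /= Ho.
- have [|//|s' [E sc rv]] := @exec_set d s _ (Bin Add d d d.+1) ss ld' Ho.
    by rewrite /= rx ry modw.
  by exists 1, s'.
- have [||s' [E sc rv]] := @exec_set d s (x - y) (Bin Defs.Sub d d d.+1) ss ld' _ _ erefl.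
  + exact: leq_ltn_trans (leq_subr _ _) lx.
  + by rewrite /= rx ry subw.
  by exists 1, s'.
- have [|//|s' [E sc rv]] := @exec_set d s _ (Bin Mul d d d.+1) ss ld' Ho.
    by rewrite /= rx ry modw.
  by exists 1, s'.
- have [||s' [E sc rv]] := @exec_set d s (x %/ y) (Bin Div d d d.+1) ss ld' _ _ erefl.
  + exact: leq_ltn_trans (leq_div _ _) lx.
  + by rewrite /= rx ry eqn0Ngt Ho.
  by exists 1, s'.
- have [||s1 [E1 sc1 rv1]] := @exec_set d.+2 s (x %/ y) (Bin Div d.+2 d d.+1) ss ld _ _ erefl.
  + exact: leq_ltn_trans (leq_div _ _) lx.
  + by rewrite /= rx ry eqn0Ngt Ho.
  have [rs1 _ _ _ ss1] := sc1.
  have lq : x %/ y * y <= x by rewrite leq_divM.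
  have lq' : x %/ y * y < 2 ^ b by apply: leq_ltn_trans lq lx.
  have [||s2 [E2 sc2 rv2]] := @exec_set d.+2 s1 (x %/ y * y) (Bin Mul d.+2 d.+2 d.+1) ss1 ld _ _ erefl.
  + exact: lq'.
  + by rewrite /= rv1 rs1 ?ry ?modw // ltnS leqnn.
  have [rs2 _ _ _ ss2] := sc2.
  have [||s3 [E3 sc3 rv3]] := @exec_set d s2 (x - x %/ y * y) (Bin Defs.Sub d d d.+2) ss2 ld' _ _ erefl.
  + exact: leq_ltn_trans (leq_subr _ _) lx.
  + rewrite /= rv2 rs2 ?rs1 ?rx ?subw //; by rewrite ltnS leqnSn.
  exists (1 + (1 + 1)), s3; split=> //.
  + by econstructor; [exact: E1|econstructor; [exact: E2|exact: E3]].
  + have H1 : scratch d s s1.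
      by apply: (@scratch_trans d d.+2 s s s1) => //; lia.
    have H2 : scratch d s s2.
      by apply: (@scratch_trans d d.+2 s s1 s2) => //; lia.
    exact: scratch_trans H2 sc3.
  + by rewrite rv3 {1}(divn_eq x y) addKn.
- have [|s' [E sc rv]] := @exec_if_const (TestLt d d.+1) d s (x < y) ss ld'.
    by rewrite /= rx ry.
  by exists 2, s'.
- have [|s' [E sc rv]] := @exec_if_const' (TestLt d.+1 d) d s (x <= y) ss ld'.
    by rewrite /= rx ry leqNgt.
  by exists 2, s'.
- have [|s' [E sc rv]] := @exec_if_const (TestEq d d.+1) d s (x == y) ss ld'.
    by rewrite /= rx ry.
  by exists 2, s'.
Qed.

Lemma exec_expr e d h s : sim h s -> ok e h -> d + expr_depth e <= nvar ->
  exists t s', [/\ exec G w b M (compile_expr e d) s t s', t <= expr_size e,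
    scratch d s s' & regs s' d = ev e h].
Proof.
elim: e d s => [r|k|o e1 IH1 e2 IH2|e IH|i] d s sh /=.
- move=> _ ld; case: (sh) => Ev _ _ _ ss.
  (* The machine has no move instruction; the conjunction of a register with itself copies it. *)
  have [|||s' [E sc rv]] := @exec_set d s (vars h r) (Bin And d (nvar + r) (nvar + r)) ss _ _ _ erefl.
  + lia.
  + by rewrite Ev; case: ss.
  + by rewrite /= PeanoNat.Nat.land_diag Ev.
  by exists 1, s'.
- move=> lk ld; case: (sh) => Ev _ _ _ ss.
  have [||s' [E sc rv]] := @exec_set d s k (Const d k) ss _ lk _ erefl.
  + lia.
  + by rewrite /= modw.
  by exists 1, s'.
- case=> ok1 ok2 okO ld.
  have {IH1} [|t1 [s1 [E1 l1 sc1 rv1]]] := IH1 d s sh ok1; first lia.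
  have sh1 := sim_scratch sh sc1.
  have {IH2} [|t2 [s2 [E2 l2 sc2 rv2]]] := IH2 d.+1 s1 sh1 ok2; first lia.
  have [r2 _ _ _ ss2] := sc2.
  have [||t3 [s3 [E3 l3 sc3 rv3]]] := @exec_op o d s2 (ev e1 h) (ev e2 h) ss2 _ _ rv2 okO.
  + lia.
  + by rewrite r2 // leqnn.
  exists (t1 + t2 + t3), s3; split=> //.
  + by econstructor; [econstructor; [exact: E1|exact: E2]|].
  + lia.
  + apply: scratch_trans sc3 => //; apply: scratch_trans sc2 => //.
- case=> ok1 lM ld.
  have {IH} [|t1 [s1 [E1 l1 sc1 rv1]]] := IH d s sh ok1; first lia.
  have [r2 Ec _ _ ss2] := sc1; case: (sh) => _ Em _ _ _.
  have [|||s' [E sc rv]] := @exec_set d s1 (hm h (ev e h)) (ReadMem d d) ss2 _ _ _ erefl.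
  + by have := expr_depth_gt0 e; lia.
  + by rewrite Em -Ec; case: ss2.
  + by rewrite /= rv1 lM Em Ec.
  exists (t1 + 1), s'; split=> //.
  + by econstructor; [exact: E1|].
  + lia.
  + exact: scratch_trans sc.
- move=> _ ld; case: (sh) => Ev _ Ei _ ss.
  have [||s' [E sc rv]] := @exec_if_const (TestMore i) d s (its h i != [::]) ss.
  + lia.
  + by rewrite /= Ei.
  by exists 2, s'.
Qed.

(* Time is counted in loop iterations: a command in the course of which j
   iterations are carried out takes at most [cmd_size c * (1 + j)] steps. *)
Record hwp c (Q : hst n -> nat -> Prop) h k : Prop := Hwp { hwpP :
  forall s, sim h s -> exists t s' h' j,
    [/\ exec G w b M (compile c) s t s', sim h' s',
        t <= cmd_size c * (1 + j) & Q h' (k + j)] }.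

Lemma hwp_imp c (Q Q' : hst n -> nat -> Prop) h k :
  hwp c Q h k -> (forall h k, Q h k -> Q' h k) -> hwp c Q' h k.
Proof.
by move=> [H] i; split=> s /H [t [s' [h' [j [? ? ? ?]]]]]; exists t, s', h', j; split; auto.
Qed.

(** Every simulated state is bounded, so a proof may use the bound on all values without carrying it
    in its invariants. *)
Lemma hwp_bounded c Q h k : (bounded h -> hwp c Q h k) -> hwp c Q h k.
Proof. by move=> H; split=> s sh; case: (H (sim_bounded sh)) => /(_ s sh). Qed.

Lemma hwp_nop Q h k : Q h k -> hwp Nop Q h k.
Proof.
by move=> q; split=> s sh; exists 0, s, h, 0; rewrite !addn0; split=> //=; exact: (ExecSkip G w b M s).
Qed.

(** The time bounds compose because sizes and iteration counts both add up: s1 (1 + j1) + s2 (1 +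
    j2) <= (s1 + s2) (1 + j1 + j2). It is this stability that allows later proofs to count loop
    iterations only. *)
Lemma hwp_seq c1 c2 Q h k :
  hwp c1 (hwp c2 Q) h k -> hwp (Sq c1 c2) Q h k.
Proof.
clear b_gt0 b_le_w; move=> [H]; split=> s /H [t1 [s1 [h1 [j1 [E1 sh1 l1 [/(_ s1 sh1)]]]]]].
move=> [t2 [s2 [h2 [j2 [E2 sh2 l2 q]]]]].
exists (t1 + t2), s2, h2, (j1 + j2); split=> //.
- by econstructor; [exact: E1|].
- rewrite /=; nia.
- by rewrite addnA.
Qed.

Lemma hwp_asg r e Q h k : expr_depth e <= nvar -> ok e h ->
  Q (setv h r (ev e h)) k -> hwp (Asg r e) Q h k.
Proof.
move=> le oke q; split=> s sh.
have lv := ev_small (sim_bounded sh) oke.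
have [t [s' [E l sc rv]]] := exec_expr (d := 0) sh oke le.
have [Ev Em Ei Ew [sr sm]] := sim_scratch sh sc.
exists (t + 1).
pose s2 := State [eta regs s' with nvar + r |-> ev e h] (cells s') (iters s') (written s').
exists s2, (setv h r (ev e h)), 0; split=> //.
- econstructor; first exact: E.
  apply: (@ExecDo _ G w b M (Bin And (nvar + r) 0 0)).
  by rewrite /= rv PeanoNat.Nat.land_diag /set_reg lv.
- split=> //= [x|]; first by rewrite eqn_add2l Ev.
  by split=> //= x; case: ifP.
- rewrite /=; lia.
- by rewrite !addn0.
Qed.

Lemma hwp_wr a e Q h k : expr_depth a <= nvar -> expr_depth e < nvar ->
  ok a h -> ok e h -> ev a h < M ->
  Q (setm h (ev a h) (ev e h)) k -> hwp (Wr a e) Q h k.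
Proof.
move=> la le oka oke lM q; split=> s sh.
have lv := ev_small (sim_bounded sh) oke.
have [t [s1 [E l sc rv]]] := exec_expr (d := 0) sh oka la.
have sh1 := sim_scratch sh sc.
have [t2 [s' [E2 l2 sc2 rv2]]] := exec_expr (d := 1) sh1 oke le.
have [Ev Em Ei Ew [sr sm]] := sim_scratch sh1 sc2.
exists (t + t2 + 1).
pose s2 := State (regs s') [eta cells s' with ev a h |-> ev e h] (iters s') (written s').
exists s2, (setm h (ev a h) (ev e h)), 0; split=> //.
- econstructor; first by econstructor; [exact: E|exact: E2].
  apply: (@ExecDo _ G w b M (WriteMem 0 1)).
  have [r2 _ _ _ _] := sc2.
  by rewrite /= r2 // rv rv2 /set_mem lM lv.
- split=> //=; last by split=> //= x; case: ifP.
  by move=> x /=; case: eqP => // _; exact: Em.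
- rewrite /=; lia.
- by rewrite !addn0.
Qed.

Lemma hwp_iter (d : bool) i e Q h k (u : 'I_n) : expr_depth e <= nvar ->
  ok e h -> ev e h = u ->
  Q (seti h i (if d then outnbr G u else innbr G u)) k -> hwp (Iter d i e) Q h k.
Proof.
move=> le oke Eu q; split=> s sh.
have [t [s' [E l sc rv]]] := exec_expr (d := 0) sh oke le.
have [Ev Em Ei Ew ss] := sim_scratch sh sc.
exists (t + 1).
eexists (set_itr s' i (if d then outnbr G u else innbr G u)), (seti h i _), 0.
split; last by rewrite !addn0; exact: q.
- econstructor; first exact: E.
  apply: (@ExecDo _ G w b M (Start d i 0)).
  by rewrite /= rv Eu valK.
- by split=> //= x /=; case: eqP => // _; exact: Ei.
- rewrite /=; lia.
Qed.

Lemma hwp_nxt i r Q h k u l : its h i = u :: l -> u < 2 ^ b ->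
  Q (setv (seti h i l) r u) k -> hwp (Nxt i r) Q h k.
Proof.
move=> Eu lu q; split=> s [Ev Em Ei Ew [sr sm]].
pose s2 := State [eta regs s with nvar + r |-> u : nat] (cells s) [eta iters s with i |-> l] (written s).
exists 1, s2, (setv (seti h i l) r u), 0; split; last by rewrite !addn0.
- apply: (@ExecDo _ G w b M (Next i (nvar + r))).
  by rewrite /= -Ei Eu /set_reg lu.
- split=> //=; last by split=> //= x; case: ifP.
    by move=> x; rewrite eqn_add2l Ev.
  by move=> x /=; case: eqP => // _; exact: Ei.
- by rewrite /=; lia.
Qed.

Lemma hwp_out e Q h k : expr_depth e <= nvar -> ok e h ->
  Q (out h (ev e h)) k -> hwp (Out e) Q h k.
Proof.
move=> le oke q; split=> s sh.
have [t [s' [E l sc rv]]] := exec_expr (d := 0) sh oke le.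
have [Ev Em Ei Ew ss] := sim_scratch sh sc.
exists (t + 1).
exists (State (regs s') (cells s') (iters s') (rcons (written s') (ev e h))), (out h (ev e h)), 0.
split; last by rewrite !addn0.
- econstructor; first exact: E.
  by apply: (@ExecDo _ G w b M (Output 0)); rewrite /= rv.
- by split=> //=; rewrite Ew.
- rewrite /=; lia.
Qed.

Lemma exec_test e h s : expr_depth e <= nvar -> ok e h -> sim h s ->
  exists t s', [/\ exec G w b M (Seq (compile_expr e 0) (Do (Const 1 0))) s t s',
    t <= expr_size e + 1, sim h s', regs s' 0 = ev e h & regs s' 1 = 0].
Proof.
move=> le oke sh.
have [t [s1 [E l sc rv]]] := exec_expr (d := 0) sh oke le.
have sh1 := sim_scratch sh sc; have [_ _ _ _ ss1] := sc.
have [|||s2 [E2 sc2 rv2]] := @exec_set 1 s1 0 (Const 1 0) ss1 _ _ _ erefl.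
- by [].
- by rewrite expn_gt0.
- by rewrite /= mod0n.
exists (t + 1), s2; split=> //.
- by econstructor; [exact: E|].
- lia.
- exact: sim_scratch sh1 sc2.
- by case: sc2 => -> //.
Qed.

Lemma hwp_cond e c1 c2 Q h k : expr_depth e <= nvar -> ok e h ->
  (ev e h <> 0 -> hwp c1 Q h k) -> (ev e h = 0 -> hwp c2 Q h k) ->
  hwp (Cond e c1 c2) Q h k.
Proof.
move=> le oke H1 H2; split=> s sh.
have [t [s' [E l sh' rv0 rv1]]] := exec_test le oke sh.
have : hwp (if eval_test (TestEq 0 1) s' then c2 else c1) Q h k.
  by rewrite /= rv0 rv1; case: eqP; auto.
move=> [] /(_ s' sh') [t2 [s2 [h2 [j [E2 sh2 l2 q]]]]].
exists (t + t2.+1), s2, h2, j; split=> //.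
- econstructor; first exact: E.
  by apply: ExecIf; move: E2; case: (eval_test _ s').
- move: l2; rewrite /=; case: (_ == _); nia.
Qed.

(** The index j bounds the number of rounds still to come and serves termination only; the round
    itself is charged by the increment of [k']. Since a round takes at most a constant times one
    plus the iterations nested in it, the number of all iterations, nested ones included, bounds the
    time. *)
Lemma hwp_loop e c (I : nat -> hst n -> nat -> Prop) (Q : hst n -> nat -> Prop) :
  expr_depth e <= nvar ->
  (forall j h k, I j h k -> [/\ ok e h, ev e h = 0 -> Q h k &
     ev e h <> 0 -> 0 < j /\ hwp c (fun h' k' => I j.-1 h' k'.+1) h k]) ->
  forall j h k, I j h k -> hwp (Loop e c) Q h k.
Proof.
move=> le HI.
suff W : forall j h k s, I j h k -> sim h s -> regs s 0 = ev e h -> regs s 1 = 0 ->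
   exists t s' h' i, [/\ exec G w b M (While (TestLt 1 0)
         (Seq (compile c) (Seq (compile_expr e 0) (Do (Const 1 0))))) s t s',
    sim h' s', t <= (cmd_size c + expr_size e + 2) * i + 1 & Q h' (k + i)].
  move=> j h k Ij; split=> s sh; have [oke _ _] := HI _ _ _ Ij.
  have [t [s' [E l sh' rv0 rv1]]] := exec_test le oke sh.
  have [t2 [s2 [h2 [i [E2 sh2 l2 q]]]]] := W j h k s' Ij sh' rv0 rv1.
  exists (t + t2), s2, h2, i; split=> //; first by econstructor; [exact: E|].
  rewrite /=; nia.
elim=> [|j IH] h k s Ij sh r0 r1; have [oke q0 q1] := HI _ _ _ Ij.
  have E0 : ev e h = 0 by apply/eqP/negPn/negP => /eqP /q1 [].
  exists 1, s, h, 0; rewrite !addn0; split=> //; [|lia|exact: q0].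
  by apply: ExecWhileDone; rewrite /= r0 r1 E0.
case: (ev e h =P 0) => [E0|nz].
  exists 1, s, h, 0; rewrite !addn0; split=> //; [|lia|exact: q0].
  by apply: ExecWhileDone; rewrite /= r0 r1 E0.
have [_ []] := q1 nz; move=> /(_ s sh) [t1 [s1 [h1 [j1 [E1 sh1 l1 I1]]]]].
have [oke1 _ _] := HI _ _ _ I1.
have [t2 [s2 [E2 l2 sh2 r20 r21]]] := exec_test le oke1 sh1.
have [t3 [s3 [h3 [i [E3 sh3 l3 q3]]]]] := IH h1 _ s2 I1 sh2 r20 r21.
exists ((t1 + t2) + t3).+1, s3, h3, (j1 + i.+1); split=> //.
- apply: ExecWhileStep; [|by econstructor; [exact: E1|exact: E2]|exact: E3].
  by rewrite /= r0 r1; lia.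
- nia.
- by move: q3; rewrite addSn -addnS -addnA.
Qed.

End Hoare.

End Language.
Import Language.

(** * Counting loops, packed arrays of digits, and lists of set bits *)

Module Numerals.

Declare Scope hl_scope.
Delimit Scope hl_scope with hl.
Coercion Cst : nat >-> expr.
Notation "$ r" := (Var r) (at level 2, format "$ r") : hl_scope.
Notation "x + y" := (Op oAdd x y) : hl_scope.
Notation "x - y" := (Op oSub x y) : hl_scope.
Notation "x * y" := (Op oMul x y) : hl_scope.
Notation "x %/ y" := (Op oDiv x y) : hl_scope.
Notation "x %% y" := (Op oMod x y) : hl_scope.
Notation "x < y" := (Op oLt x y) : hl_scope.
Notation "x <= y" := (Op oLe x y) : hl_scope.
Notation "x == y" := (Op oEq x y) : hl_scope.
Notation "'M[' a ]" := (Fetch a) (at level 2) : hl_scope.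
Notation "r ::= e" := (Asg r e%hl) (at level 75).
Notation "c1 ;; c2" := (Sq c1 c2) (at level 80, right associativity).

Definition For (r : nat) (e : expr) (c : cmd) : cmd :=
  Loop ($r < e)%hl (c ;; r ::= $r + 1).

Section For.

Variables (n : nat) (G : graph n) (w b M : nat).
Hypotheses (b_gt0 : 0 < b) (b_le_w : b <= w).

Lemma pow_gt1 : 1 < 2 ^ b.
Proof. by rewrite -[1](expn0 2) ltn_exp2l. Qed.

(** The bound [e] is evaluated anew before every round, hence the premise that the invariant fixes
    its value. *)
Lemma hwp_for r e c N (J : nat -> hst n -> nat -> Prop) (Q : hst n -> nat -> Prop)
    i0 h k :
  expr_depth e < nvar -> N < 2 ^ b -> i0 <= N -> vars h r = i0 -> J i0 h k ->
  (forall i h k, i <= N -> vars h r = i -> J i h k -> ok b M e h /\ ev e h = N) ->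
  (forall i h k, i < N -> vars h r = i -> J i h k ->
     hwp G w b M c (fun h' k' => vars h' r = i /\ J i.+1 (setv h' r i.+1) k'.+1) h k) ->
  (forall h k, vars h r = N -> J N h k -> Q h k) ->
  hwp G w b M (For r e c) Q h k.
Proof.
move=> de ltN le0 Er J0 He Hc HQ.
pose I j (h : hst n) k := exists i, [/\ i <= N, j = N - i, vars h r = i & J i h k].
apply: (@hwp_loop _ G w b M b_gt0 b_le_w _ _ I Q _ _ (N - i0)); last first.
- by exists i0.
- move=> j h1 k1 [i [lei -> Ei Ji]].
  have [oke eve] := He _ _ _ lei Ei Ji.
  split=> /=; first by [].
    rewrite Ei eve; case: ltnP => // geN _; have Ei' : i = N by lia.
    by apply: HQ; [rewrite Ei|rewrite -Ei'].
  rewrite Ei eve; case: ltnP => // ltN' _; split; first lia.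
  apply: hwp_seq; apply: (hwp_imp (Hc _ _ _ ltN' Ei Ji)) => h2 k2 [E2 J2].
  apply: hwp_asg => //=.
    by split=> //; [exact: pow_gt1|rewrite E2; lia].
  exists i.+1; split; [by []|lia|by rewrite /= eqxx E2 addn1|].
  by rewrite E2 addn1.
- rewrite /=; move: de; rewrite /nvar; lia.
Qed.

End For.

Definition dig (rho kap : nat) (m : nat -> nat) (base i : nat) : nat :=
  m (base + i %/ kap) %/ rho ^ (i %% kap) %% rho.

Section Digits.

Variables (rho : nat) (rho_gt1 : 1 < rho).

Let rho_gt0 : 0 < rho. Proof. exact: ltnW. Qed.
Let pow_gt0 i : 0 < rho ^ i. Proof. by rewrite expn_gt0 rho_gt0. Qed.

Lemma digit_split x j :
  x = x %/ rho ^ j.+1 * rho ^ j.+1 + (x %/ rho ^ j %% rho) * rho ^ j + x %% rho ^ j.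
Proof.
rewrite {1}(divn_eq x (rho ^ j)) {1}(divn_eq (x %/ rho ^ j) rho) mulnDl.
by rewrite -divnMA -mulnA -expnS -expnSr.
Qed.

Lemma digit_glue hi lo d j j' : lo < rho ^ j -> d < rho ->
  (hi * rho ^ j.+1 + d * rho ^ j + lo) %/ rho ^ j' %% rho =
  if j' == j then d else if j' < j then lo %/ rho ^ j' %% rho
  else hi %/ rho ^ (j' - j.+1) %% rho.
Proof.
move=> llo ld.
have E : hi * rho ^ j.+1 + d * rho ^ j + lo = (hi * rho + d) * rho ^ j + lo.
  by rewrite mulnDl -mulnA -expnS.
case: eqP => [->|/eqP ne].
  by rewrite E divnMDl // divn_small // addn0 modnMDl modn_small.
case: ltnP => [lt|ge].
  rewrite E -{1}(subnK (ltnW lt)) expnD mulnA divnMDl //.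
  by rewrite -modnDml -(subnSK lt) expnSr !mulnA modnMl.
have lj : j < j' by lia.
rewrite -{1}(subnKC lj) expnD divnMA -addnA divnMDl //.
rewrite [(d * _ + lo) %/ _]divn_small ?addn0 // expnS.
apply: leq_trans (_ : d.+1 * rho ^ j <= _); first by rewrite mulSn addnC ltn_add2r.
by rewrite leq_mul2r ld orbT.
Qed.

Lemma digit_put x j d j' : d < rho ->
  (x - (x %/ rho ^ j %% rho) * rho ^ j + d * rho ^ j) %/ rho ^ j' %% rho =
  if j' == j then d else x %/ rho ^ j' %% rho.
Proof.
move=> ld.
have lm : x %% rho ^ j < rho ^ j by rewrite ltn_mod.
have E : x - (x %/ rho ^ j %% rho) * rho ^ j + d * rho ^ j =
   x %/ rho ^ j.+1 * rho ^ j.+1 + d * rho ^ j + x %% rho ^ j.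
  move: (digit_split x j); set A := _ %/ rho ^ j.+1 * _; set B := _ %% rho * _;
  set C := x %% _; set D := d * _ => S; lia.
rewrite E digit_glue //.
have ld' : x %/ rho ^ j %% rho < rho by rewrite ltn_mod.
have := digit_glue (x %/ rho ^ j.+1) j' lm ld'; rewrite -digit_split => ->.
by case: eqP.
Qed.

Lemma digit_put_small x j d kap : d < rho -> j < kap -> x < rho ^ kap ->
  x - (x %/ rho ^ j %% rho) * rho ^ j + d * rho ^ j < rho ^ kap.
Proof.
move=> ld lj lx.
have lm : x %% rho ^ j < rho ^ j by rewrite ltn_mod.
have lh : x %/ rho ^ j.+1 < rho ^ (kap - j.+1).
  by rewrite ltn_divLR // -expnD subnK.
apply: leq_trans (_ : (x %/ rho ^ j.+1).+1 * rho ^ j.+1 <= _); last first.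
  by rewrite -{1}(subnK lj) expnD leq_mul2r lh orbT.
have : d.+1 * rho ^ j <= rho ^ j.+1 by rewrite expnS leq_mul2r ld orbT.
rewrite !mulSn.
move: (digit_split x j); set A := _ %/ rho ^ j.+1 * _; set B := _ %% rho * _.
set C := x %% _ in lm *; set D := d * _ => S; move: lm S.
move: A B C D (rho ^ j.+1) (rho ^ j) => *; lia.
Qed.

Lemma digit_le x j : (x %/ rho ^ j %% rho) * rho ^ j <= x.
Proof.
rewrite {2}(digit_split x j); move: (_ * rho ^ j.+1) (_ * rho ^ j) (x %% _) => *; lia.
Qed.

Lemma digit_mod x j kap : j < kap ->
  (x %% rho ^ kap) %/ rho ^ j %% rho = x %/ rho ^ j %% rho.
Proof.
move=> lj.
have E : x = x %/ rho ^ kap * rho ^ (kap - j) * rho ^ j + x %% rho ^ kap.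
  by rewrite -mulnA -expnD subnK ?(ltnW lj) // -divn_eq.
rewrite {2}E divnMDl // -modnDml -(subnSK lj) expnSr !mulnA modnMl.
by [].
Qed.

(** The old digit is subtracted and the new one added, so an update needs a single power of [rho],
    which can be looked up in a table. *)
Lemma dig_put kap m m' base i d : 0 < kap -> d < rho ->
  (forall a, m' a = if a == base + i %/ kap then
     m a - dig rho kap m base i * rho ^ (i %% kap) + d * rho ^ (i %% kap) else m a) ->
  forall i', dig rho kap m' base i' = if i' == i then d else dig rho kap m base i'.
Proof.
move=> k0 ld Em i'; rewrite /dig Em eqn_add2l.
case: (i' %/ kap =P i %/ kap) => [Eq|ne]; last first.
  by case: eqP => // Ei; case: ne; rewrite Ei.
rewrite Eq digit_put //.
have -> : (i' %% kap == i %% kap) = (i' == i); last by [].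
apply/eqP/eqP => [Er|-> //].
by rewrite (divn_eq i' kap) (divn_eq i kap) Eq Er.
Qed.

(* Before the new digit is stored, the cell is reduced modulo rho ^ kap, so
   that its contents may be arbitrary. *)
Lemma dig_put_mod kap m m' base i d : 0 < kap -> d < rho ->
  (forall a, m' a = if a == base + i %/ kap then
     m a %% rho ^ kap - dig rho kap m base i * rho ^ (i %% kap) + d * rho ^ (i %% kap)
   else m a) ->
  forall i', dig rho kap m' base i' = if i' == i then d else dig rho kap m base i'.
Proof.
move=> k0 ld Em.
pose m1 a := if a == base + i %/ kap then m a %% rho ^ kap else m a.
have E1 i' : dig rho kap m1 base i' = dig rho kap m base i'.
  by rewrite /dig /m1; case: ifP => // _; rewrite digit_mod // ltn_mod.
move=> i'; rewrite (@dig_put kap m1 m' base i d) // ?E1 // => a.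
by rewrite ?E1 Em /m1; case: eqP.
Qed.

Lemma dig_same kap m m' base i : m' (base + i %/ kap) = m (base + i %/ kap) ->
  dig rho kap m' base i = dig rho kap m base i.
Proof. by rewrite /dig => ->. Qed.

End Digits.

(** The bits are listed from the highest down because the traversal of a flag cell finds its leading
    bit in a table of logarithms and removes it. *)
Definition bits (t x : nat) : seq nat := [seq j <- rev (iota 0 t) | odd (x %/ 2 ^ j)].

Lemma mem_bits t x j : (j \in bits t x) = (j < t) && odd (x %/ 2 ^ j).
Proof. by rewrite mem_filter mem_rev mem_iota add0n andbC. Qed.

Lemma bits_uniq t x : uniq (bits t x).
Proof. by rewrite filter_uniq // rev_uniq iota_uniq. Qed.

Lemma bits0 t : bits t 0 = [::].
Proof.
by rewrite /bits -(@eq_filter _ pred0) ?filter_pred0 // => j; rewrite div0n.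
Qed.

(** One step of the traversal of a flag cell: the leading bit is the head of the list, and
    subtracting its power leaves the tail. *)
Lemma bits_high t x : 0 < x -> x < 2 ^ t ->
  bits t x = trunc_log 2 x :: bits t (x - 2 ^ trunc_log 2 x).
Proof.
move=> x0 xt; set l := trunc_log 2 x.
have /andP [l1 l2] : 2 ^ l <= x < 2 ^ l.+1 by exact: trunc_log_bounds.
have lt : l < t by rewrite -(@ltn_exp2l 2) //; apply: leq_ltn_trans xt.
rewrite /bits -/l.
have -> : iota 0 t = iota 0 l ++ l :: iota l.+1 (t - l.+1).
  rewrite -[LHS](cat_take_drop l) take_iota drop_iota add0n (minn_idPl (ltnW lt)).
  by congr (_ ++ _); rewrite -(subnSK lt) /= .
have Sx : x - 2 ^ l < 2 ^ l by move: l2; rewrite expnS; lia.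
have dv : x %/ 2 ^ l = 1.
  have := leq_div2r (2 ^ l) l1; rewrite divnn expn_gt0 /= => ?.
  have : x %/ 2 ^ l < 2 by rewrite ltn_divLR ?expn_gt0 // -expnS.
  lia.
rewrite rev_cat rev_cons -cats1 !filter_cat /= dv.
rewrite [(x - _) %/ 2 ^ l]divn_small //=.
have Z z : z < 2 ^ l.+1 -> [seq j <- rev (iota l.+1 (t - l.+1)) | odd (z %/ 2 ^ j)] = [::].
  move=> lz; rewrite -[RHS](filter_pred0 (rev (iota l.+1 (t - l.+1)))).
  apply: eq_in_filter => j; rewrite mem_rev mem_iota => /andP [lj _].
  by rewrite divn_small // (leq_trans lz) // leq_exp2l.
have Sx' : x - 2 ^ l < 2 ^ l.+1 by rewrite expnS; lia.
rewrite (Z x) // (Z (x - 2 ^ l)) //=; congr (_ :: _); apply: eq_in_filter => j.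
rewrite mem_rev mem_iota add0n => /andP [_ lj].
rewrite -{1}(subnK l1) -{2}(subnK (ltnW lj)) expnD addnC divnMDl ?expn_gt0 //.
by rewrite oddD oddX /= orbF -(subnSK lj).
Qed.

End Numerals.
Import Numerals.

(** * Breadth-first search by layers, without reference to the machine *)

Module Trees.

Section Layers.

Variables (n : nat) (e : rel 'I_n).
Implicit Types (r V : {set 'I_n}) (s u v : 'I_n) (t l o : seq ('I_n * 'I_n)).

Lemma walkP k s v :
  reflect (exists p, [/\ size p = k, path e s p & last s p = v]) (walk e k s v).
Proof.
apply: (iffP existsP) => [[p /andP [ep /eqP el]]|[p [Ek ep el]]].
  by exists p; rewrite size_tuple.
by have Ep : size p == k by [exact/eqP]; exists (Tuple Ep); rewrite ep el eqxx.
Qed.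

Lemma gdist_le k s v : walk e k s v -> gdist e s v <= k.
Proof.
(* For k >= n there is nothing to search for: [find] never exceeds the length n of the list, which
   is also its value when there is no walk. *)
move=> wk; case: (ltnP k n) => [lt|ge]; last first.
  by apply: leq_trans ge; rewrite -[X in _ <= X](size_iota 0 n) find_size.
rewrite leqNgt; apply/negP => /(before_find 0).
by rewrite nth_iota // add0n wk.
Qed.

Lemma walk_connect k s v : walk e k s v -> connect e s v.
Proof. by case/walkP => p [_ ep <-]; apply/connectP; exists p. Qed.

(** A walk can be shortened to a simple path, of length below n, so the search in [gdist]
    succeeds. *)
Lemma walk_gdist s v : connect e s v -> walk e (gdist e s v) s v.
Proof.
case/connectP => p ep ->; case/shortenP: ep => p' ep' up' _.
have ltn : size p' < n.
  by have := card_size (s :: p'); rewrite (card_uniqP up') => _; move: (max_card (mem (s :: p'))); rewrite (card_uniqP up') card_ord.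
have H : has (fun k => walk e k s (last s p')) (iota 0 n).
  by apply/hasP; exists (size p'); [rewrite mem_iota|apply/walkP; exists p'].
have := nth_find 0 H; rewrite nth_iota ?add0n //.
by move: H; rewrite has_find size_iota.
Qed.

Lemma gdist_edge s u v : connect e s u -> e u v -> gdist e s v <= (gdist e s u).+1.
Proof.
move=> /walk_gdist /walkP [p [Ek ep el]] euv.
apply/gdist_le/walkP; exists (rcons p v).
by rewrite size_rcons Ek rcons_path ep el euv last_rcons.
Qed.

Lemma gdist0 s v : connect e s v -> (gdist e s v <= 0) = (v == s).
Proof.
move=> c; apply/idP/eqP => [|->].
  rewrite leqn0 => /eqP E; have := walk_gdist c; rewrite E => /walkP [p [/size0nil -> _ <-]] //.
by apply/gdist_le/walkP; exists [::].
Qed.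

Lemma gdist_self s : gdist e s s = 0.
Proof. by apply/eqP; rewrite -leqn0 gdist0 ?connect0. Qed.

(** The set reached by complete trees is closed. A walk that enters it never leaves it again, so
    walks to unreached vertices avoid it and distances in the whole graph are the right ones for the
    next tree. *)
Definition closed_out V := forall u v, u \in V -> e u v -> v \in V.

Lemma closed_out_connect V s v : closed_out V -> s \in V -> connect e s v -> v \in V.
Proof.
move=> cV sV /connectP [p ep ->]; elim: p s sV ep => //= x p IH s sV /andP [es].
by apply: IH; exact: cV es.
Qed.

(** The specification of a tree cut off at depth d. Closedness of r is part of it since each new
    layer relies on it. *)
Definition tree_upto r s t d :=
  [/\ closed_out r /\ s \notin r, uniq (unzip1 t),
      forall v, (v \in unzip1 t) = [&& v \notin r, connect e s v & gdist e s v <= d],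
      sorted leq [seq gdist e s v | v <- unzip1 t]
    & forall v p, (v, p) \in t ->
        if v == s then p = s
        else [/\ p \in unzip1 t, e p v & gdist e s v = (gdist e s p).+1] ].

Definition new_nbr V v := (v \notin V) && [exists u, (u \in V) && e u v].

Definition layer V l :=
  [/\ uniq (unzip1 l), forall v, (v \in unzip1 l) = new_nbr V v &
      forall v p, (v, p) \in l -> p \in V /\ e p v].

Definition reached r t := r :|: [set v in unzip1 t].

Lemma tree_root r s : closed_out r -> s \notin r -> tree_upto r s [:: (s, s)] 0.
Proof.
move=> cr sr; split=> //= [v|v p].
- rewrite inE; case: (v =P s) => [->|/eqP ne].
    by rewrite sr connect0 gdist0 ?eqxx ?connect0.
  by symmetry; apply/and3P => -[_ c]; rewrite gdist0 // (negPf ne).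
- by rewrite inE => /eqP [-> ->]; rewrite eqxx.
Qed.

(** This recognizes the next layer without computing distances. Conversely, the last vertex but one
    of a shortest walk to a vertex at depth d + 1 has depth at most d and cannot lie in r, which is
    closed. *)
Lemma new_nbr_tree r s t d v : tree_upto r s t d -> 
  new_nbr (reached r t) v =
    [&& v \notin r, connect e s v & gdist e s v == d.+1].
Proof.
case=> [[cr sr] ut mt _ _]; rewrite /new_nbr !inE mt.
apply/idP/idP.
  case/andP; rewrite negb_or => /andP [vr nv] /existsP [u /andP []].
  rewrite !inE mt => /orP [/cr H /H|/and3P [ur cu du] euv]; first by rewrite (negPf vr).
  have cv : connect e s v by apply: connect_trans cu (connect1 euv).
  move: nv; rewrite vr cv /= -ltnNge => dv.
  by have := gdist_edge cu euv; rewrite eqn_leq dv; lia.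
case/and3P => vr cv /eqP dv; rewrite (negPf vr) cv dv ltnn /=.
have := walk_gdist cv; rewrite dv => /walkP [p [Ek ep el]].
case: (lastP p) Ek ep el => // q x; rewrite size_rcons => -[Eq].
rewrite rcons_path last_rcons => /andP [eq ex] Ex; subst x.
apply/existsP; exists (last s q); rewrite ex andbT !inE mt.
have wq : walk e d s (last s q) by apply/walkP; exists q.
rewrite (gdist_le wq) (walk_connect wq).
case: (boolP (_ \in r)) => //= /cr /(_ ex); by rewrite (negPf vr).
Qed.

(** Any visited inneighbour is a valid parent: it is not in r, since r is closed, and its depth is
    exactly d, since otherwise the child would have been reached earlier. *)
Lemma layer_tree r s t d l : tree_upto r s t d -> layer (reached r t) l ->
  tree_upto r s (t ++ l) d.+1.
Proof.
move=> T [ul ml pl]; have [[cr sr] ut mt st pt] := T.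
have mtl v : (v \in unzip1 (t ++ l)) = (v \in unzip1 t) || (v \in unzip1 l).
  by rewrite /unzip1 map_cat mem_cat.
have dl v : v \in unzip1 l -> gdist e s v = d.+1.
  by rewrite ml (new_nbr_tree _ T) => /and3P [_ _ /eqP].
split=> //.
- rewrite /unzip1 map_cat cat_uniq ut ul andbT /= -/(unzip1 t) -/(unzip1 l).
  apply/hasPn => v /dl dv; rewrite /= mt dv ltnn; by rewrite !andbF.
- move=> v; rewrite mtl mt ml (new_nbr_tree _ T) [_ <= d.+1]leq_eqVlt ltnS.
  by case: (v \notin r); case: (connect e s v) => //=; rewrite orbC.
- rewrite /unzip1 map_cat map_cat -/(unzip1 t) -/(unzip1 l).
  have -> : [seq gdist e s v | v <- unzip1 l] = nseq (size l) d.+1.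
    rewrite -[size l](size_map fst l) -/(unzip1 l).
    elim: (unzip1 l) dl => //= x q IH H.
    by rewrite H ?mem_head // IH // => v vq; rewrite H // inE vq orbT.
  have: all (fun x => x <= d) [seq gdist e s v | v <- unzip1 t].
    by apply/allP => x /mapP [v]; rewrite mt => /and3P [_ _ dv] ->.
  move: st; case: [seq gdist e s v | v <- unzip1 t] => [|x q] /=.
    by move=> _ _; elim: (size l) => //= -[|m] //= ->; rewrite leqnn.
  move=> sq /andP [xd qd]; rewrite cat_path sq /=.
  have: last x q <= d.+1.
    have: all (fun x => x <= d) (x :: q) by rewrite /= xd.
    by move/allP/(_ _ (mem_last x q)) => /leq_trans; apply.
  by elim: (size l) (last x q) => //= m IH y ->; rewrite IH ?leqnn.
- move=> v p; rewrite mem_cat => /orP [/pt|vp].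
    by case: ifP => // _ [pt1 ep dp]; split=> //; rewrite mtl pt1.
  have vl : v \in unzip1 l by apply/mapP; exists (v, p).
  have [pV epv] := pl _ _ vp.
  have dv := dl _ vl.
  have ns : v != s.
    apply: contraTneq vl => ->; rewrite ml /new_nbr !inE mt sr connect0 /=.
    by rewrite gdist_self (negPf sr).
  rewrite (negPf ns); move: pV; rewrite !inE => /orP [pr|pt1].
    by move: vl; rewrite ml /new_nbr !inE (cr _ _ pr epv) /=.
  split=> //; first by rewrite mtl pt1.
  move: pt1; rewrite mt => /and3P [_ cp dp].
  by have := gdist_edge cp epv; rewrite dv; lia.
Qed.

(** Without new neighbours the reached set is closed, so it contains everything reachable from s and
    the cut-off at depth d is void. *)
Lemma tree_done r s t d : tree_upto r s t d -> (forall v, ~~ new_nbr (reached r t) v) ->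
  bfs_tree e r s t /\ closed_out (reached r t).
Proof.
move=> T no; have [[cr sr] ut mt st pt] := T.
have cl : closed_out (reached r t).
  move=> u v uV euv; apply: contraT => vV.
  by have := no v; rewrite /new_nbr vV /=; case/negP; apply/existsP; exists u; rewrite uV.
split=> //; split=> // v; rewrite mt.
case: (boolP (v \in r)) => //= vr; case: (boolP (connect e s v)) => //= cv.
have sV : s \in reached r t.
  by rewrite !inE mt sr connect0 gdist_self orbT.
by have := closed_out_connect cl sV cv; rewrite !inE (negPf vr) /= mt vr cv.
Qed.

Lemma layer_exists V : exists l, layer V l.
Proof.
exists [seq (v, odflt v [pick u | (u \in V) && e u v]) | v <- enum [set v | new_nbr V v]].
have E : unzip1 [seq (v, odflt v [pick u | (u \in V) && e u v]) | v <- enum [set v | new_nbr V v]]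
   = enum [set v | new_nbr V v].
  by rewrite /unzip1 -map_comp map_id.
split; [by rewrite E enum_uniq|by move=> v; rewrite E mem_enum inE|move=> v p].
case/mapP => x; rewrite mem_enum inE => /andP [_ /existsP [u Hu]] [-> ->].
by case: pickP => [y /andP [] //|/(_ u)]; rewrite Hu.
Qed.

Lemma tree_exists r s : closed_out r -> s \notin r ->
  exists t, bfs_tree e r s t /\ closed_out (reached r t).
Proof.
move=> cr sr; have T0 := tree_root cr sr.
have: exists t d, tree_upto r s t d by exists [:: (s, s)], 0.
case=> t0 [d0]; have [m] := ubnP #|~: reached r t0|.
elim: m t0 d0 => // m IH t d lm T.
case: (boolP [forall v, ~~ new_nbr (reached r t) v]) => [/forallP no|].
  by exists t; exact: tree_done T no.
rewrite negb_forall => /existsP [v]; rewrite negbK => nv.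
have [l L] := layer_exists (reached r t).
apply: (IH (t ++ l) d.+1); last exact: layer_tree.
have [ul ml _] := L.
rewrite -ltnS; apply: leq_trans lm; rewrite ltnS; apply: proper_card; apply/properP; split.
  apply/subsetP => x; rewrite !inE /unzip1 map_cat mem_cat !negb_or.
  by case/and3P => -> ->.
exists v; first by rewrite inE; case/andP: nv.
by rewrite !inE negb_or /unzip1 map_cat mem_cat negb_or -/(unzip1 l) ml nv !andbF.
Qed.

(* o is a possible output up to the time when exactly V has been reached. *)
Definition bfs_prefix V o :=
  closed_out V /\ (forall o', bfs_forest e V o' -> bfs_forest e set0 (o ++ o')).

Lemma bfs_prefix0 : bfs_prefix set0 [::].
Proof. by split=> // u v; rewrite inE. Qed.

Lemma bfs_prefixT o : bfs_prefix setT o -> bfs_forest e set0 o.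
Proof. by case=> _ /(_ [::]); rewrite cats0; apply; constructor. Qed.

Lemma bfs_prefix_tree V o s t : bfs_prefix V o -> s \notin V ->
  (forall u : 'I_n, u < s -> u \in V) -> bfs_tree e V s t -> closed_out (reached V t) ->
  bfs_prefix (reached V t) (o ++ t).
Proof.
move=> [cV pV] sV lt bt ct; split=> // o' f; rewrite -catA; apply: pV.
exact: BfsTree bt f.
Qed.

(** Existence is what the hard-wired answers for small graphs are chosen from. *)
Lemma forest_exists : exists o, bfs_forest e set0 o.
Proof.
have: exists V o, bfs_prefix V o by exists set0, [::]; exact: bfs_prefix0.
case=> V0 [o0]; have [m] := ubnP #|~: V0|.
elim: m V0 o0 => // m IH V o lm P.
have [ET|nT] := eqVneq V setT.
  by exists o; apply: bfs_prefixT; rewrite -ET.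
have [x xV] : exists x, x \notin V.
  by apply/existsP; rewrite -negb_forall; apply: contra nT => /forallP a; apply/eqP/setP => y; rewrite inE a.
case: (@arg_minnP _ x [pred u | u \notin V] (@nat_of_ord n) xV) => s /= sV mins.
have [t [bt ct]] := tree_exists P.1 sV.
apply: (IH (reached V t) (o ++ t)); last first.
  apply: bfs_prefix_tree bt ct => // u lu; apply: contraTT lu => uV.
  by rewrite -leqNgt; exact: mins.
rewrite -ltnS; apply: leq_trans lm; rewrite ltnS; apply: proper_card; apply/properP; split.
  by apply/subsetP => y; rewrite !inE negb_or => /andP [].
exists s; first by rewrite inE.
by case: bt => _ mt _ _; rewrite !inE mt sV connect0 orbT.
Qed.

End Layers.

End Trees.
Import Trees.

(** * Memory layout and the inequalities behind the space bound *)

Module Layout.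

Section Sizes.

Variables (n b : nat).

(* k3 trits go into one cell, a piece has PP vertices, positions below QQ are
   the low ones, and tt group flags go into one cell. *)
Definition k3 := trunc_log 3 (2 ^ b).-1.
Definition hh := n.-1 %/ (128 * b).
Definition PP := b * hh.
Definition QQ := 2 * PP.
Definition len := n - PP.
Definition tt := b %/ 2.
Definition ngr := (n.-1 %/ 64).+1.
Definition nF := (ngr %/ tt).+1.
Definition thr := PP %/ 4.

(** Below [aX] lie the powers of two, the powers of three and a table of binary logarithms; a cell
    has only about b / 2 group flags so that this table has O(sqrt n) entries. From [aW] on two
    layouts share the memory. In a sparse layer the status bits are followed by the flags and lists
    of two sets of groups and, from [aBE] on, by the bits of the new vertices. In a dense layer
    ternary digits spread from the top down to [aT]. The extra cell before [aT] keeps every digit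
    strictly above the cell of the bit at the same position. *)
Definition aTAB := 2 * b.
Definition aX := aTAB + 2 ^ tt.
Definition aFL := aX + hh.
Definition aEB := aFL + (hh %/ 4).+1.
Definition aW := aEB + (hh %/ 6).+1.
Definition aT := aW + 1.
Definition MM := aT + (len %/ k3).+1.
Definition aBF := aW + 2 * hh.
Definition aCF := aW + (len %/ b).+1.
Definition aNF := aCF + nF.
Definition aCL := aNF + nF.
Definition aNL := aCL + nF.
Definition aBE := aNL + nF.

Hypothesis b_big : 64 * 64 <= b.
Hypothesis n_lo : 2 ^ b.-1 < n.
Hypothesis n_hi : n <= 2 ^ b.

Let pow2_gt0 m : 0 < 2 ^ m. Proof. by rewrite expn_gt0. Qed.

(** Strictness matters: the number [3 ^ k3] itself is kept in a register, as a modulus. *)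
Lemma k3_hi : 3 ^ k3 < 2 ^ b.
Proof.
have h : 1 < 2 ^ b by rewrite -[1](expn0 2) ltn_exp2l //; lia.
by have := @trunc_logP 3 (2 ^ b).-1 isT; rewrite -/k3; lia.
Qed.

Lemma k3_lo : 2 ^ b <= 3 ^ k3.+1.
Proof.
by have := @trunc_log_ltn 3 (2 ^ b).-1 isT; rewrite -/k3; have := pow2_gt0 b; lia.
Qed.

(** Here and in the next two lemmas rational numbers replace log2 3: by 3 < 4, 2 ^ 3 < 3 ^ 2 and 2 ^
    11 = 2048 < 2187 = 3 ^ 7 it is at most 2 and at least 3/2 and 11/7. *)
Lemma k3_half : b < 2 * k3.+1.
Proof.
rewrite -(@ltn_exp2l 2) // expnM; apply: leq_ltn_trans k3_lo _.
by rewrite ltn_exp2r.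
Qed.

Lemma k3_two_thirds : 3 * k3 <= 2 * b.
Proof.
rewrite -(@leq_exp2l 2) // !expnM.
rewrite (expnAC 2 2 b).
apply: leq_trans (_ : (3 ^ k3) ^ 2 <= _); last by rewrite leq_exp2r // ltnW // k3_hi.
by rewrite (expnAC 3 k3 2); case: (k3) => // m; rewrite leq_exp2r.
Qed.

Lemma k3_tight : 11 * k3 <= 7 * b.
Proof.
rewrite -(@leq_exp2l 2) // !expnM.
rewrite (expnAC 2 7 b).
apply: leq_trans (_ : (3 ^ k3) ^ 7 <= _); last by rewrite leq_exp2r // ltnW // k3_hi.
by rewrite (expnAC 3 k3 7); case: (k3) => // m; rewrite leq_exp2r.
Qed.

Lemma hh_bounds : 128 * PP <= n.-1 < 128 * (PP + b).
Proof.
have := divn_eq n.-1 (128 * b); have := ltn_pmod n.-1 (_ : 0 < 128 * b).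
rewrite -/hh /PP; lia.
Qed.

(** Up to a constant factor [hh] is at least 2 ^ b / b, which dwarfs a table of 2 ^ (b / 2) entries.
    The factor b on the left is there because [MM_space] multiplies the cells of the tables by
    [k3.+1]. *)
Lemma hh_big : b * (2 * b + 2 ^ tt + 4) + 257 <= hh.
Proof.
rewrite /hh leq_divRL; last lia.
apply: (@leq_trans (2 ^ b.-1)); last by lia.
pose q := b %/ 64.
have qb : 64 * q <= b by rewrite mulnC leq_divM.
have q64 : 64 <= q by rewrite /q leq_divRL.
(* Once the polynomial factors are bounded by powers of two, a linear inequality between exponents
   remains. *)
have bq : b <= 2 ^ (2 * q).
  have l1 : b < 64 * q.+1.
    by have := divn_eq b 64; have := ltn_pmod b (_ : 0 < 64); rewrite -/q; lia.
  apply: leq_trans (ltnW l1) _; rewrite (_ : 64 = 2 ^ 6) //.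
  apply: (@leq_trans (2 ^ 6 * 2 ^ q)); first by rewrite leq_mul2l ltn_expl.
  by rewrite -expnD leq_exp2l //; lia.
have tb : 2 * tt <= b by rewrite /tt mulnC leq_divM.
have tb' : b < 2 * tt.+1.
  by have := divn_eq b 2; have := ltn_pmod b (_ : 0 < 2); rewrite -/tt; lia.
have l2 : 2 * b + 4 <= 2 ^ tt.
  apply: (@leq_trans (2 ^ 2 * 2 ^ (2 * q))); first lia.
  by rewrite -expnD leq_exp2l //; lia.
set T := 2 ^ tt in l2 *.
apply: (@leq_trans (2 ^ 9 * (b * b) * T)).
  have H1 : 257 <= b * (2 * T) by apply: (@leq_trans (257 * 1)) => //; apply: leq_mul; lia.
  have H2 : b * (2 * b + T + 4) <= b * (2 * T) by rewrite leq_mul2l; lia.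
  apply: (@leq_trans ((b * (2 * T) + b * (2 * T)) * (128 * b))).
    by rewrite leq_mul2r leq_add ?orbT.
  rewrite (_ : 2 ^ 9 = 512) //; lia.
apply: (@leq_trans (2 ^ 9 * (2 ^ (2 * q) * 2 ^ (2 * q)) * T)).
  by rewrite leq_mul2r leq_mul2l leq_mul ?orbT.
rewrite /T -!expnD leq_exp2l //; lia.
Qed.

Lemma tt_bounds : 2 * tt <= b < 2 * tt.+1.
Proof.
by have := divn_eq b 2; have := ltn_pmod b (_ : 0 < 2); rewrite -/tt; lia.
Qed.

Lemma k3_gt0 : 0 < k3.
Proof. have := k3_half; lia. Qed.

(** This is the space bound in integers: a cell of b bits is worth at most [k3.+1] trits, because 2
    ^ b <= 3 ^ (k3 + 1). *)
Lemma MM_space : MM * k3.+1 <= n.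
Proof.
have k0 := k3_gt0; have kh := k3_half; have kt := k3_tight; have hb := hh_big.
have /andP [P1 P2] := hh_bounds.
have ek : len %/ k3 * k3 <= len by rewrite leq_divM.
have el : len + PP = n by rewrite /len subnK //; lia.
pose A := 2 * b + 2 ^ tt + hh + hh %/ 4 + hh %/ 6 + 4.
have EM : MM = A + len %/ k3 by rewrite /MM /aT /aW /aEB /aFL /aX /aTAB /A; lia.
have h4 : 4 * (hh %/ 4) <= hh by rewrite mulnC leq_divM.
have h6 : 6 * (hh %/ 6) <= hh by rewrite mulnC leq_divM.
have l1 : len %/ k3 <= 257 * hh.+1.
  have : len %/ k3 * k3 <= 257 * hh.+1 * k3.
    apply: leq_trans ek _; have bk : 128 * b <= 257 * k3 by lia.
    have : 128 * b * hh.+1 <= 257 * k3 * hh.+1 by rewrite leq_mul2r bk orbT.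
    rewrite /PP in P2 el; lia.
  by rewrite leq_mul2r eqn0Ngt k0.
(* The digits proper take at most len = n - PP trits. So the loss of one trit in each of their
   cells, together with the A auxiliary cells, has to fit into the PP trits that the piece does
   without. *)
suff S : k3.+1 * A + len %/ k3 <= PP.
  by rewrite EM; move: S ek el; move: (len %/ k3) => x; lia.
have l2 : 12 * (k3.+1 * A) <= k3.+1 * (12 * (2 * b + 2 ^ tt + 4) + 17 * hh).
  by rewrite mulnCA leq_mul2l /A; lia.
have l3 : k3.+1 * (2 * b + 2 ^ tt + 4) <= hh.
  apply: leq_trans (leq_trans (leq_addr 257 _) hb); rewrite leq_mul2r; lia.
(* A is about 17/12 hh, which 11 k3 <= 7 b turns into about 119/132 PP. The lost trits, about 257
   hh, find room in the rest because b is at least 4096. *)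
have l4 : 11 * (k3.+1 * (17 * hh)) <= 17 * (7 * b + 11) * hh.
  by have : 11 * k3 * hh <= 7 * b * hh; [rewrite leq_mul2r kt orbT|lia].
have l5 : 64 * 64 * hh <= PP by rewrite /PP leq_mul2r b_big orbT.
have hb2 : 257 <= hh by lia.
have l6 : 12 * (k3.+1 * A) <= 12 * hh + k3.+1 * (17 * hh) by lia.
have l7 : 11 * (12 * (k3.+1 * A)) <= 132 * hh + 119 * PP + 187 * hh by rewrite /PP; lia.
lia.
Qed.

Lemma MM_small : MM < 2 ^ b.
Proof.
have H0 := MM_space; have H1 := k3_gt0; have H2 : 0 < MM by rewrite /MM addnS.
have H3 : MM * 2 <= MM * k3.+1 by rewrite leq_mul2l ltnS H1 orbT.
apply: leq_trans (leq_trans (leq_trans H3 H0) n_hi); lia.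
Qed.

(** The low bits take 2 hh cells and the buffer for the new bits of the piece another hh. The digits
    of the higher positions start no earlier than 3 hh cells above [aT], since 3 k3 <= 2 b. *)
Lemma BF_fits : aBF + hh <= aT + QQ %/ k3.
Proof.
have k0 := k3_gt0; have k2 := k3_two_thirds.
have : 3 * hh <= QQ %/ k3 by rewrite leq_divRL // /QQ /PP; have : 3 * k3 * hh <= 2 * b * hh; [rewrite leq_mul2r k2 orbT|lia].
rewrite /aBF /aT; lia.
Qed.

(** A sparse layer meets at most [thr] groups, hence at most 16 PP vertices, whose bits take 16 hh
    cells. In units of hh, the status bits, the four areas of [nF] cells and these bits need about
    128 + 20 + 16, while the space laid out for digits provides at least 199. *)
Lemma BE_fits : aBE + 16 * hh <= MM.
Proof.
have k0 := k3_gt0; have kt := k3_tight; have hb := hh_big.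
have /andP [P1 P2] := hh_bounds; have /andP [t1 t2] := tt_bounds.
have el : len + PP = n by rewrite /len subnK //; lia.
have b0 : 0 < b by lia.
have t0 : 0 < tt by lia.
have v1 : len %/ b <= 128 * hh.+1.
  have : len %/ b * b <= 128 * hh.+1 * b.
    by have := leq_divM len b; rewrite /PP in P2 el; lia.
  by rewrite leq_mul2r eqn0Ngt b0.
have v2 : ngr <= 2 * b * hh.+1 + 1.
  by have := leq_divM n.-1 64; rewrite /ngr; rewrite /PP in P2; lia.
have v3 : ngr %/ tt <= 5 * hh.+1.
  have : ngr %/ tt * tt <= 5 * hh.+1 * tt.
    have := leq_divM ngr tt; have : 2 * b * hh.+1 <= (4 * tt + 2) * hh.+1 by rewrite leq_mul2r; lia.
    have : 3 * hh.+1 <= tt * hh.+1 by rewrite leq_mul2r; lia.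
    lia.
  by rewrite leq_mul2r eqn0Ngt t0.
have v4 : 199 * hh <= len %/ k3.
  rewrite leq_divRL //; have : 127 * PP <= len by lia.
  by have : 11 * k3 * hh <= 7 * b * hh; [rewrite leq_mul2r kt orbT|rewrite /PP; lia].
rewrite /aBE /aNL /aCL /aNF /aCF /nF /MM /aT; lia.
Qed.

End Sizes.

End Layout.
Import Layout.

(** * Reading and writing the status of a vertex *)

Module Status.

(** Registers below 25 hold constants, 25 to 27 control the outer loops, 30 to 35 hold the state of
    the search. The rest is scratch space in which inner commands use higher registers than the
    commands around them, so a frame condition is mostly a threshold on register numbers. *)
Notation rN1 := 0. Notation rB := 1. Notation rK3 := 2. Notation rT := 3.
Notation rH := 4. Notation rP := 5. Notation rQ := 6. Notation rLen := 7.
Notation rX := 8. Notation rTAB := 9. Notation rFL := 10. Notation rEB := 11.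
Notation rW := 12. Notation rTb := 13. Notation rBF := 14. Notation rTop := 15.
Notation rThr := 16. Notation rBE := 17. Notation rNF := 18. Notation rG := 19.
Notation rCFb := 20. Notation rNFb := 21. Notation rCLb := 22. Notation rNLb := 23.
Notation rM := 24.
Notation rcl := 30. Notation rnl := 31. Notation rng := 32. Notation rsa := 33.
Notation rlim := 34. Notation ra := 35.

Ltac sp := repeat match goal with
  | |- and3 _ _ _ => split | |- and _ _ => split | |- and4 _ _ _ _ => split
  | |- and5 _ _ _ _ _ => split | |- True => exact I end.

Definition bitE (base i : expr) : expr :=
  ((M[base + i %/ $rB] %/ M[i %% $rB]) %% 2)%hl.

Definition tritE (base i : expr) : expr :=
  ((M[base + i %/ $rK3] %/ M[$rB + i %% $rK3]) %% 3)%hl.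

Arguments bitE : simpl never.
Arguments tritE : simpl never.

Definition PutBit (base i d : expr) : cmd :=
  60 ::= base + i %/ $rB ;; 61 ::= M[i %% $rB] ;; 62 ::= M[$60] ;;
  Wr ($60)%hl ($62 - (($62 %/ $61) %% 2) * $61 + d * $61)%hl.

Definition PutTrit (base i d : expr) : cmd :=
  60 ::= base + i %/ $rK3 ;; 61 ::= M[$rB + i %% $rK3] ;;
  62 ::= M[$60] %% $rTop ;;
  Wr ($60)%hl ($62 - (($62 %/ $61) %% 3) * $61 + d * $61)%hl.

(* Register rsa holds the start of the piece whose bits are kept at rX.  The
   other vertices occupy the positions below rLen, the last PP vertices filling
   the gap left by the piece; positions from rlim on hold trits (0 unvisited,
   1 visited, 2 new), the others bits. *)
Definition Get (r : nat) : cmd :=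
  60 ::= 0 ;; Cond ($rsa <= $r)%hl (60 ::= ($r - $rsa) < $rP) Nop ;;
  Cond ($60)%hl (62 ::= bitE ($rX)%hl ($r - $rsa)%hl)
    (Cond ($r < $rLen)%hl (61 ::= $r) (61 ::= ($r - $rLen) + $rsa) ;;
     Cond ($61 < $rlim)%hl (62 ::= bitE ($rW)%hl ($61)%hl)
       (62 ::= tritE ($rTb)%hl ($61)%hl)).

Definition Scan (r : nat) : cmd :=
  51 ::= 0 ;; 52 ::= 0 ;; Iter false 1 ($r)%hl ;;
  Loop (More 1)
    (Nxt 1 50 ;; Get 50 ;;
     Cond ($62 == 1)%hl
       (60 ::= 0 ;; Cond ($ra <= $50)%hl (60 ::= ($50 - $ra) < $rP) Nop ;;
        Cond ($60)%hl (51 ::= 1 ;; 53 ::= $50) (52 ::= 1 ;; 54 ::= $50))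
       Nop).

Definition putd (rho kap : nat) (m : nat -> nat) (base i d a : nat) : nat :=
  if a == base + i %/ kap
  then m a - dig rho kap m base i * rho ^ (i %% kap) + d * rho ^ (i %% kap)
  else m a.

Definition putd_mod (rho kap : nat) (m : nat -> nat) (base i d a : nat) : nat :=
  if a == base + i %/ kap
  then m a %% rho ^ kap - dig rho kap m base i * rho ^ (i %% kap) + d * rho ^ (i %% kap)
  else m a.

Record large (n w b : nat) : Prop := Large {
  lg_big : 64 * 64 <= b;
  lg_w : b <= w;
  lg_lo : 2 ^ b.-1 < n;
  lg_hi : n <= 2 ^ b }.

Section Access.

Variables (n : nat) (G : graph n) (w b : nat).
Hypothesis LG : large n w b.

Let b_big := lg_big LG.
Let b_le_w := lg_w LG.
Let n_lo := lg_lo LG.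
Let n_hi := lg_hi LG.

Let b_gt0 : 0 < b. Proof. by have := lg_big LG; lia. Qed.
Let p0 : 0 < 2 ^ tt b. Proof. by rewrite expn_gt0. Qed.

Local Notation hh := (hh n b).
Local Notation PP := (PP n b).
Local Notation QQ := (QQ n b).
Local Notation len := (len n b).
Local Notation k3 := (k3 b).
Local Notation MM := (MM n b).
Local Notation hwp := (hwp G w b MM).
Local Notation hst := (hst n).

Definition cvals : seq nat :=
  [:: n.-1; b; k3; tt b; hh; PP; QQ; len; aX b; aTAB b; aFL n b; aEB n b; aW n b;
      aT n b; aBF n b; 3 ^ k3; thr n b; aBE n b; nF n b; ngr n; aCF n b; aNF n b;
      aCL n b; aNL n b; MM].

Definition Csts (h : hst) := forall i, i < 25 -> vars h i = nth 0 cvals i.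

Definition Tabs (m : nat -> nat) :=
  [/\ forall j, j < b -> m j = 2 ^ j, forall j, j < k3 -> m (b + j) = 3 ^ j
    & forall x, 0 < x < 2 ^ tt b -> m (aTAB b + x) = trunc_log 2 x].

Definition frm K (h h' : hst) :=
  [/\ forall x, x < K -> vars h' x = vars h x, hm h' = hm h,
      its h' = its h & outp h' = outp h].

Lemma setvE (h : hst) r v : vars (setv h r v) r = v :> nat.
Proof. by rewrite /= eqxx. Qed.

Lemma frm_refl K h : frm K h h. Proof. by []. Qed.

Lemma frm_setv K h h' r v : K <= r -> frm K h h' -> frm K h (setv h' r v).
Proof.
move=> le [a m i o]; split=> //= x lx; case: eqP => [Ex|_]; last exact: a.
by move: lx; rewrite Ex ltnNge le.
Qed.

Lemma CstsE h : Csts h ->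
  (vars h rN1 = n.-1) * (vars h rB = b) * (vars h rK3 = k3) * (vars h rT = tt b) *
  (vars h rH = hh) * (vars h rP = PP) * (vars h rQ = QQ) * (vars h rLen = len) *
  (vars h rX = aX b) * (vars h rTAB = aTAB b) * (vars h rFL = aFL n b) *
  (vars h rEB = aEB n b) * (vars h rW = aW n b) * (vars h rTb = aT n b) *
  (vars h rBF = aBF n b) * (vars h rTop = 3 ^ k3) * (vars h rThr = thr n b) *
  (vars h rBE = aBE n b) * (vars h rNF = nF n b) * (vars h rG = ngr n) *
  (vars h rCFb = aCF n b) * (vars h rNFb = aNF n b) * (vars h rCLb = aCL n b) *
  (vars h rNLb = aNL n b) * (vars h rM = MM).
Proof. by move=> H; rewrite !H. Qed.

Lemma Csts_eq h h' : Csts h -> (forall x, x < 25 -> vars h' x = vars h x) -> Csts h'.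
Proof. by move=> H E i li; rewrite E // H. Qed.

Lemma MM_lt x : x < MM -> x < 2 ^ b.
Proof. by move/ltn_trans; apply; exact: MM_small. Qed.

Lemma small_pow x : x < 64 * 64 -> x < 2 ^ b.
Proof.
move=> lx; apply: leq_trans lx (leq_trans b_big _); exact: ltnW (ltn_expl _ _).
Qed.

Lemma tab_fits : aX b < MM.
Proof. rewrite /Layout.MM /aT /aW /aEB /aFL; move: (len %/ _) => y; lia. Qed.

Lemma bitE_ok h base i : Csts h -> Tabs (hm h) -> ok b MM base h -> ok b MM i h ->
  ev base h + ev i h %/ b < MM ->
  ok b MM (bitE base i) h /\ ev (bitE base i) h = dig 2 b (hm h) (ev base h) (ev i h).
Proof.
move=> C [T2 _ _] ob oi lM; rewrite /bitE /= !(CstsE C).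
have lb : ev i h %% b < b by rewrite ltn_mod.
rewrite T2 //; split=> //; split=> //=; last exact: small_pow.
split=> //=; [split=> //|split=> //|by rewrite expn_gt0].
  by split=> //; exact: MM_lt.
by apply: ltn_trans tab_fits; rewrite /aX /aTAB; lia.
Qed.

Lemma tritE_ok h base i : Csts h -> Tabs (hm h) -> ok b MM base h -> ok b MM i h ->
  ev base h + ev i h %/ k3 < MM ->
  ok b MM (tritE base i) h /\ ev (tritE base i) h = dig 3 k3 (hm h) (ev base h) (ev i h).
Proof.
move=> C [_ T3 _] ob oi lM; rewrite /tritE /= !(CstsE C).
have k0 := k3_gt0 b_big n_lo n_hi.
have k2 := k3_two_thirds b_big n_lo n_hi.
have lb : ev i h %% k3 < k3 by rewrite ltn_mod.
rewrite T3 //.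
have lm : b + ev i h %% k3 < MM.
  by apply: ltn_trans tab_fits; rewrite /aX /aTAB; lia.
split=> //; split=> //=; last exact: small_pow.
split=> //=; [split=> //|split=> //|by rewrite expn_gt0].
  by split=> //; exact: MM_lt.
by split=> //; exact: MM_lt.
Qed.

(** The command overwrites registers 60 to 62 before it has finished evaluating its arguments, hence
    the premise that these do not depend on registers from 60 on. *)
Lemma hwp_putbit base i d Q h k : Csts h -> Tabs (hm h) ->
  expr_depth base <= 20 -> expr_depth i <= 20 -> expr_depth d <= 20 ->
  (forall h', frm 60 h h' -> [/\ ok b MM base h', ok b MM i h', ok b MM d h',
     ev base h' = ev base h & ev i h' = ev i h /\ ev d h' = ev d h]) ->
  ev base h + ev i h %/ b < MM -> ev d h < 2 ->
  (forall h', (forall x, x < 60 -> vars h' x = vars h x) -> its h' = its h ->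
     outp h' = outp h ->
     hm h' =1 putd 2 b (hm h) (ev base h) (ev i h) (ev d h) -> Q h' k) ->
  hwp (PutBit base i d) Q h k.
Proof.
move=> C [T2 T3 T4] db di dd H lM ld HQ.
have [ob oi od _ _] := H h (frm_refl 60 h).
have lb : ev i h %% b < b by rewrite ltn_mod.
apply: hwp_bounded => -[bv bm].
have lb' : ev i h %% b < MM.
  by apply: ltn_trans lb (leq_ltn_trans _ tab_fits); move: p0; rewrite /aX /aTAB; lia.
apply: hwp_seq; apply: (hwp_asg _ b_gt0 b_le_w) => /=.
- by move: db di dd; clear; rewrite /nvar; lia.
- by rewrite !(CstsE C); split=> //; exact: MM_lt.
rewrite !(CstsE C); set h1 := setv _ _ _.
have f1 : frm 60 h h1 by apply: frm_setv.
have [ob1 oi1 od1 _ [Ei1 _]] := H _ f1.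
have C1 : Csts h1 by apply: Csts_eq C _ => x lx; case: f1 => -> //; lia.
apply: hwp_seq; apply: (hwp_asg _ b_gt0 b_le_w) => /=.
- by move: db di dd; clear; rewrite /nvar; lia.
- by rewrite ?(CstsE C1) ?(CstsE C) Ei1.
rewrite Ei1 !(CstsE C) [hm _ _]T2 //; set h2 := setv _ _ _.
have f2 : frm 60 h h2 by apply: frm_setv.
apply: hwp_seq; apply: (hwp_asg _ b_gt0 b_le_w) => //=.
set h3 := setv _ _ _.
have f3 : frm 60 h h3 by apply: frm_setv.
have [ob3 oi3 od3 _ [Ei3 Ed3]] := H _ f3.
set x := hm h (ev base h + ev i h %/ b) in h3 f3 ob3 oi3 od3 Ei3 Ed3 *.
have lx : x < 2 ^ b by exact: bm.
have lp := digit_put_small (rho := 2) isT ld lb lx.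
have ly := digit_le (rho := 2) isT x (ev i h %% b).
apply: (hwp_wr _ b_gt0 b_le_w) => //=.
- by move: db di dd; clear; rewrite /nvar; lia.
- rewrite Ed3; have l1 := leq_ltn_trans ly lx.
  have l2 : ev d h * 2 ^ (ev i h %% b) < 2 ^ b by apply: leq_ltn_trans lp; exact: leq_addl.
  have l3 : 2 < 2 ^ b by exact: small_pow.
  have l4 : 0 < 2 ^ (ev i h %% b) by rewrite expn_gt0.
  by sp.
rewrite Ed3; apply: HQ => //=.
  by case: f3.
by move=> a; rewrite /= /putd; case: eqP => // ->.
Qed.

Lemma hwp_puttrit base i d Q h k : Csts h -> Tabs (hm h) ->
  expr_depth base <= 20 -> expr_depth i <= 20 -> expr_depth d <= 20 ->
  (forall h', frm 60 h h' -> [/\ ok b MM base h', ok b MM i h', ok b MM d h',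
     ev base h' = ev base h & ev i h' = ev i h /\ ev d h' = ev d h]) ->
  ev base h + ev i h %/ k3 < MM -> ev d h < 3 ->
  (forall h', (forall x, x < 60 -> vars h' x = vars h x) -> its h' = its h ->
     outp h' = outp h ->
     hm h' =1 putd_mod 3 k3 (hm h) (ev base h) (ev i h) (ev d h) -> Q h' k) ->
  hwp (PutTrit base i d) Q h k.
Proof.
move=> C [T2 T3 T4] db di dd H lM ld HQ.
have [ob oi od _ _] := H h (frm_refl 60 h).
have k0 := k3_gt0 b_big n_lo n_hi.
have k2 := k3_two_thirds b_big n_lo n_hi.
have k9 := k3_hi b_big n_lo n_hi.
have lb : ev i h %% k3 < k3 by rewrite ltn_mod.
have lb' : b + ev i h %% k3 < MM.
  by apply: ltn_trans tab_fits; rewrite /aX /aTAB; lia.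
apply: hwp_seq; apply: (hwp_asg _ b_gt0 b_le_w) => /=.
- by move: db di dd; clear; rewrite /nvar; lia.
- by rewrite !(CstsE C); sp => //; exact: MM_lt.
rewrite !(CstsE C); set h1 := setv _ _ _.
have f1 : frm 60 h h1 by apply: frm_setv.
have [ob1 oi1 od1 _ [Ei1 _]] := H _ f1.
have C1 : Csts h1 by apply: Csts_eq C _ => x lx; case: f1 => -> //; lia.
apply: hwp_seq; apply: (hwp_asg _ b_gt0 b_le_w) => /=.
- by move: db di dd; clear; rewrite /nvar; lia.
- by rewrite ?(CstsE C1) ?(CstsE C) Ei1; sp => //; exact: MM_lt.
rewrite Ei1 !(CstsE C) [hm _ _]T3 //; set h2 := setv _ _ _.
have f2 : frm 60 h h2 by apply: frm_setv.
apply: hwp_seq; apply: (hwp_asg _ b_gt0 b_le_w) => //=.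
- by rewrite !(CstsE C) expn_gt0; sp.
rewrite !(CstsE C); set h3 := setv _ _ _.
have f3 : frm 60 h h3 by apply: frm_setv.
have [ob3 oi3 od3 _ [Ei3 Ed3]] := H _ f3.
set x := hm h (ev base h + ev i h %/ k3) %% 3 ^ k3 in h3 f3 ob3 oi3 od3 Ei3 Ed3 *.
have lx : x < 3 ^ k3 by rewrite ltn_mod expn_gt0.
have lx' := ltn_trans lx k9.
have lp := ltn_trans (digit_put_small (rho := 3) isT ld lb lx) k9.
have ly := digit_le (rho := 3) isT x (ev i h %% k3).
apply: (hwp_wr _ b_gt0 b_le_w) => //=.
- by move: db di dd; clear; rewrite /nvar; lia.
- rewrite Ed3; have l1 := leq_ltn_trans ly lx'.
  have l2 : ev d h * 3 ^ (ev i h %% k3) < 2 ^ b by apply: leq_ltn_trans lp; exact: leq_addl.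
  have l3 : 3 < 2 ^ b by exact: small_pow.
  have l4 : 0 < 3 ^ (ev i h %% k3) by rewrite expn_gt0.
  by sp.
rewrite Ed3; apply: HQ => //=.
  by case: f3.
move=> a; rewrite /= /putd_mod; case: eqP => // ->.
by rewrite /x /dig digit_mod.
Qed.

Definition rd (m : nat -> nat) (sa lim u : nat) : nat :=
  if (sa <= u) && (u - sa < PP) then dig 2 b m (aX b) (u - sa)
  else let p := if u < len then u else u - len + sa in
       if p < lim then dig 2 b m (aW n b) p else dig 3 k3 m (aT n b) p.

(** With [sa = len] the last [PP] vertices are themselves the piece and no gap has to be filled.
    Otherwise the piece lies above the low positions and is disjoint from the last [PP] vertices,
    which move into its gap. *)
Definition geo (sa lim : nat) :=
  (sa = len \/ QQ <= sa /\ sa + PP <= len) /\ lim <= len.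

Lemma len_n : len + PP = n /\ 126 * PP <= len /\ 0 < hh.
Proof.
have /andP [h1 _] := hh_bounds b_big n_lo n_hi.
have h2 := hh_big b_big n_lo n_hi.
by rewrite /Layout.len; lia.
Qed.

Lemma adrX j : j < PP -> aX b + j %/ b < aFL n b.
Proof. by move=> lj; rewrite /aFL ltn_add2l ltn_divLR // mulnC. Qed.

Lemma aFL_MM : aFL n b < MM.
Proof. rewrite /Layout.MM /aT /aW /aEB; move: (len %/ _) => y; lia. Qed.

Lemma adrT p : p < len -> aT n b + p %/ k3 < MM.
Proof. by move=> lp; rewrite /Layout.MM ltn_add2l ltnS leq_div2r // ltnW. Qed.

(** This makes the conversion in place possible: since fewer trits than bits fit into a cell and
    [aT] is one cell ahead, writing the digit of position p cannot touch the bit of any position up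
    to p. *)
Lemma adrW p : aW n b + p %/ b < aT n b + p %/ k3.
Proof.
rewrite /aT addn1 addSn ltnS leq_add2l.
have k0 := k3_gt0 b_big n_lo n_hi; have k2 := k3_two_thirds b_big n_lo n_hi.
by apply: leq_div2l => //; lia.
Qed.

Lemma rd_pos sa lim u : geo sa lim -> u < n -> ~~ ((sa <= u) && (u - sa < PP)) ->
  (if u < len then u else u - len + sa) < len.
Proof. have [? [? ?]] := len_n; case=> H _; case: ifP; lia. Qed.

Lemma hwp_get r Q h k : r < 60 -> Csts h -> Tabs (hm h) ->
  geo (vars h rsa) (vars h rlim) -> vars h r < n ->
  (forall h', frm 60 h h' ->
     vars h' 62 = rd (hm h) (vars h rsa) (vars h rlim) (vars h r) -> Q h' k) ->
  hwp (Get r) Q h k.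
Proof.
move=> lr C T ge lu HQ.
have nr x : 60 <= x -> r == x = false by move=> lx; apply/eqP; lia.
have [eln [_ h0]] := len_n.
set u := vars h r in lu HQ *; set sa := vars h rsa in ge HQ *.
set lim := vars h rlim in ge HQ *.
have Tn x : x < n -> x < 2 ^ b by move/leq_trans; apply.
have d20 : 0 < 2 ^ b by rewrite expn_gt0.
apply: hwp_seq; apply: (hwp_asg _ b_gt0 b_le_w) => //=.
set h1 := setv _ _ _.
have f1 : frm 60 h h1 by apply: frm_setv.
apply: hwp_seq.
apply: (@hwp_imp _ _ _ _ _ _ (fun h2 k2 => [/\ frm 60 h h2, k2 = k &
   vars h2 60 = ((sa <= u) && (u - sa < PP)) :> nat])).
  apply: (hwp_cond b_gt0 b_le_w) => //=; rewrite /= nr //.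
    rewrite -/u -/sa; case: (leqP sa u) => //= le _; apply: (hwp_asg _ b_gt0 b_le_w) => //=.
      by rewrite nr //; sp.
    rewrite (CstsE C) nr //; split=> //; exact: frm_setv.
  rewrite -/u -/sa; case: (leqP sa u) => //= le _; exact: hwp_nop.
move=> h2 k2 [f2 -> E2]; have [a2 m2 i2 o2] := f2.
have C2 : Csts h2 by apply: Csts_eq C _ => x lx; apply: a2; lia.
have T2 : Tabs (hm h2) by rewrite m2.
have [Er Es] : vars h2 r = u /\ vars h2 rsa = sa by rewrite !a2.
apply: (hwp_cond b_gt0 b_le_w) => //=; rewrite E2 /rd.
  case: andP => // -[le1 le2] _.
  have [|||o1 e1] := @bitE_ok h2 ($rX)%hl ($r - $rsa)%hl C2 T2.
  - by [].
  - by rewrite /= Er Es; sp.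
  - by rewrite /= (CstsE C2) Er Es; apply: ltn_trans (adrX le2) aFL_MM.
  apply: (hwp_asg _ b_gt0 b_le_w) => //.
  apply: HQ; first exact: frm_setv.
  by rewrite setvE e1 /rd /= (CstsE C2) Er Es m2 le1 le2.
case: (boolP (_ && _)) => // nX _.
have lp := rd_pos ge lu nX.
set p := (if u < len then u else _) in lp *.
apply: hwp_seq.
apply: (@hwp_imp _ _ _ _ _ _ (fun h3 k3 => [/\ frm 60 h h3, k3 = k & vars h3 61 = p])).
  apply: (hwp_cond b_gt0 b_le_w) => //=; rewrite (CstsE C2) Er /p.
    case: ltnP => // lul _; apply: (hwp_asg _ b_gt0 b_le_w) => //=.
    by rewrite Er; split=> //; exact: frm_setv.
  case: ltnP => // lul _; apply: (hwp_asg _ b_gt0 b_le_w) => //=.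
    rewrite (CstsE C2) Er Es; sp => //; apply: Tn.
    by move: lp; rewrite /p [u < len]ltnNge lul /= => /leq_trans; apply; exact: leq_subr.
  by rewrite (CstsE C2) Er Es; split=> //; exact: frm_setv.
move=> h3 k3' [f3 -> E3]; have [a3 m3 i3 o3] := f3.
have C3 : Csts h3 by apply: Csts_eq C _ => x lx; apply: a3; lia.
have T3 : Tabs (hm h3) by rewrite m3.
have El : vars h3 rlim = lim by rewrite a3.
apply: (hwp_cond b_gt0 b_le_w) => //=; rewrite El E3; case: ltnP => // lpl _.
  have [//|//||o1 e1] := @bitE_ok h3 ($rW)%hl ($61)%hl C3 T3.
    by rewrite /= (CstsE C3) E3; apply: ltn_trans (adrW p) (adrT lp).
  apply: (hwp_asg _ b_gt0 b_le_w) => //.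
  apply: HQ; first exact: frm_setv.
  by rewrite setvE e1 /rd /= (CstsE C3) E3 m3 (negPf nX) -/p lpl.
have [//|//||o1 e1] := @tritE_ok h3 ($rTb)%hl ($61)%hl C3 T3.
  by rewrite /= (CstsE C3) E3; exact: adrT lp.
apply: (hwp_asg _ b_gt0 b_le_w) => //.
apply: HQ; first exact: frm_setv.
by rewrite setvE e1 /rd /= (CstsE C3) E3 m3 (negPf nX) -/p ltnNge lpl.
Qed.

End Access.

End Status.
Import Status.

(** * Searching the inneighbours of a vertex for visited ones *)

Module Scans.

Section Scanning.

Variables (n : nat) (G : graph n) (w b : nat).
Hypothesis LG : large n w b.

Let b_le_w := lg_w LG.
Let b_gt0 : 0 < b. Proof. by have := lg_big LG; lia. Qed.

Local Notation hh := (hh n b).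
Local Notation PP := (PP n b).
Local Notation QQ := (QQ n b).
Local Notation len := (len n b).
Local Notation k3 := (k3 b).
Local Notation MM := (MM n b).
Local Notation hwp := (hwp G w b MM).
Local Notation hst := (hst n).

Definition inpc (a u : nat) : bool := (a <= u) && (u - a < PP).

(** The window a is a parameter of its own, besides the piece sa whose bits are currently at [aX]:
    candidate pieces are compared before any of them is swapped in. *)
Definition srcI m sa lim a (u : 'I_n) := (rd n b m sa lim u == 1) && inpc a u.
Definition srcO m sa lim a (u : 'I_n) := (rd n b m sa lim u == 1) && ~~ inpc a u.

Definition env (h : hst) :=
  [/\ Csts b h, Tabs b (hm h) & geo n b (vars h rsa) (vars h rlim)].

Lemma env_eq h h' : env h -> hm h' = hm h ->
  (forall x, x < 36 -> vars h' x = vars h x) -> env h'.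
Proof.
move=> [C T g] Em Ev; split; rewrite ?Em ?Ev //.
by apply: Csts_eq C _ => x lx; apply: Ev; lia.
Qed.

Definition scanned (h : hst) (v : 'I_n) (h' : hst) :=
  let I := srcI (hm h) (vars h rsa) (vars h rlim) (vars h ra) in
  let O := srcO (hm h) (vars h rsa) (vars h rlim) (vars h ra) in
  [/\ (forall x, x < 50 -> vars h' x = vars h x) /\ hm h' = hm h, outp h' = outp h,
     vars h' 51 = has I (innbr G v) /\ vars h' 52 = has O (innbr G v),
     has I (innbr G v) -> exists2 u : 'I_n, vars h' 53 = u & u \in innbr G v /\ I u
   & has O (innbr G v) -> exists2 u : 'I_n, vars h' 54 = u & u \in innbr G v /\ O u].

Lemma hwp_scan r (v : 'I_n) Q h k : r < 50 -> vars h r = v -> env h ->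
  (forall h', scanned h v h' -> Q h' (k + size (innbr G v))) ->
  hwp (Scan r) Q h k.
Proof.
move=> lr Er en HQ; have [C T g] := en.
have nr x : 50 <= x -> (r == x) = false by move=> lx; apply/eqP; lia.
have d20 : 1 < 2 ^ b by exact: pow_gt1.
set I := srcI (hm h) (vars h rsa) (vars h rlim) (vars h ra) in HQ *.
set O := srcO (hm h) (vars h rsa) (vars h rlim) (vars h ra) in HQ *.
have lun (u : 'I_n) : u < 2 ^ b by apply: leq_trans (ltn_ord u) (lg_hi LG).
apply: hwp_seq; apply: (hwp_asg _ b_gt0 b_le_w) => //=; first exact: ltnW.
apply: hwp_seq; apply: (hwp_asg _ b_gt0 b_le_w) => //=; first exact: ltnW.
apply: hwp_seq; apply: (hwp_iter (u := v) b_gt0 b_le_w) => //=; first by rewrite !nr.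
set h1 := seti _ _ _.
pose inv j (h' : hst) k' := exists p l, [/\ innbr G v = p ++ l, j = size l, its h' 1 = l,
  k' = k + size p & [/\ (forall x, x < 50 -> vars h' x = vars h x) /\ hm h' = hm h, outp h' = outp h,
     vars h' 51 = has I p /\ vars h' 52 = has O p,
     has I p -> exists2 u : 'I_n, vars h' 53 = u & u \in p /\ I u
   & has O p -> exists2 u : 'I_n, vars h' 54 = u & u \in p /\ O u]].
apply: (@hwp_loop _ G w b MM b_gt0 b_le_w _ _ inv _ _ _ (size (innbr G v)) h1 k) => //; last first.
  exists [::], (innbr G v); split=> //; first by rewrite addn0.
  split=> //=; split=> // x lx.
  by case: eqP => [Ex|_]; [lia|case: eqP => [Ex|_]; [lia|]].
move=> j h2 k2 [p [l [Ep -> El -> [[a2 m2] o2 [e51 e52] I53 O54]]]]; split=> //=.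
  rewrite El; case: l Ep El => //= Ep El _.
  rewrite cats0 in Ep; rewrite -Ep; apply: HQ; rewrite /scanned Ep -/I -/O.
  by split.
rewrite El; case: l Ep El => [//|u l] Ep El _; split=> //.
apply: hwp_seq; apply: (@hwp_nxt _ G w b MM b_gt0 b_le_w 1 50 _ _ _ u l El (lun u)).
set h3 := setv _ _ _.
have a3 x : x < 50 -> vars h3 x = vars h x.
  by move=> lx; rewrite /= a2 //; case: eqP => // Ex; lia.
have en3 : env h3 by apply: env_eq en _ _ => //= x lx; apply: a3; lia.
apply: hwp_seq; apply: (@hwp_get _ G _ _ LG) => //.
- by case: en3.
- by case: en3.
- by case: en3.
- by rewrite /=; exact: ltn_ord.
move=> h4 [a4 m4 i4 o4]; rewrite [vars h3 50]/= !a3 // [hm h3]/= m2 => e62.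
have f5 x : x < 50 -> vars h4 x = vars h x by move=> lx; rewrite a4 ?a3 //; lia.
have C4 : Csts b h4 by apply: Csts_eq C _ => x lx; apply: f5; lia.
have Eu : vars h4 50 = u by rewrite a4.
have E51 : vars h4 51 = has I p by rewrite a4.
have E52 : vars h4 52 = has O p by rewrite a4.
have E53 : vars h4 53 = vars h2 53 by rewrite a4.
have E54 : vars h4 54 = vars h2 54 by rewrite a4.
have El4 : its h4 1 = l by rewrite i4.
have Em4 : hm h4 = hm h by rewrite m4 /= m2.
have Eo4 : outp h4 = outp h by rewrite o4 /= o2.
have fin h5 : (forall x, x < 50 -> vars h5 x = vars h4 x) -> hm h5 = hm h4 ->
    its h5 = its h4 -> outp h5 = outp h4 ->
    (vars h5 51 = I u || has I p :> nat) -> (vars h5 52 = O u || has O p :> nat) ->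
    (if I u then vars h5 53 = u else vars h5 53 = vars h4 53) ->
    (if O u then vars h5 54 = u else vars h5 54 = vars h4 54) ->
    inv (size l) h5 (k + size p).+1.
  move=> a5 m5 i5 o5 F51 F52 F53 F54.
  exists (rcons p u), l; split=> //; first by rewrite cat_rcons.
  - by rewrite i5.
  - by rewrite size_rcons addnS.
  split; rewrite ?has_rcons ?o5 ?m5 //.
  - by split=> // x lx; rewrite a5 // f5.
  - case: (boolP (I u)) F53 => [Iu F53 _|nI F53 /= hp]; rewrite F53.
      by exists u => //; rewrite mem_rcons mem_head.
    have [u' E' [up Iu']] := I53 hp; exists u'; first by rewrite E53.
    by rewrite mem_rcons inE up orbT; split.
  - case: (boolP (O u)) F54 => [Iu F54 _|nI F54 /= hp]; rewrite F54.
      by exists u => //; rewrite mem_rcons mem_head.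
    have [u' E' [up Iu']] := O54 hp; exists u'; first by rewrite E54.
    by rewrite mem_rcons inE up orbT; split.
have EI : I u = (vars h4 62 == 1) && inpc (vars h ra) u by rewrite e62.
have EO : O u = (vars h4 62 == 1) && ~~ inpc (vars h ra) u by rewrite e62.
have setE (h' : hst) r' v' x : x < r' -> vars (setv h' r' v') x = vars h' x.
  by move=> lx /=; case: eqP => // Ex; move: lx; rewrite Ex ltnn.
apply: (hwp_cond b_gt0 b_le_w) => //=; case: eqP => e1 // _; last first.
  by apply: hwp_nop; apply: fin; rewrite // ?EI ?EO; case: eqP.
have e1' : vars h4 62 == 1 by apply/eqP.
rewrite e1' /= in EI EO.
apply: hwp_seq; apply: (hwp_asg _ b_gt0 b_le_w) => //=; first exact: ltnW.
set h5 := setv _ _ _.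
have f6 x : x < 60 -> vars h5 x = vars h4 x by apply: setE.
apply: hwp_seq; apply: (@hwp_imp _ _ _ _ _ _ (fun h6 k6 => [/\ frm 60 h4 h6, k6 = k + size p &
   vars h6 60 = inpc (vars h ra) u :> nat])).
  apply: (hwp_cond b_gt0 b_le_w) => //=; rewrite Eu f5 // /inpc.
    case: (leqP (vars h ra) u) => //= le _; apply: (hwp_asg _ b_gt0 b_le_w) => //=.
      by rewrite Eu f5 //; sp.
    by rewrite Eu f5 // (CstsE C4); split=> //; exact: frm_setv.
  by case: (leqP (vars h ra) u) => //= le _; apply: hwp_nop; split=> //; exact: frm_setv.
move=> h6 k6 [[a6 m6 i6 o6] -> E60].
apply: (hwp_cond b_gt0 b_le_w) => //=; rewrite E60.
  case: (boolP (inpc _ _)) => // In _.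
  apply: hwp_seq; apply: (hwp_asg _ b_gt0 b_le_w) => //=.
  apply: (hwp_asg _ b_gt0 b_le_w) => //=.
  apply: fin => //=; rewrite ?EI ?EO ?In /= ?a6 //.
  by move=> x lx; rewrite a6; [case: eqP => [Ex|_]; [lia|case: eqP => // Ex; lia]|lia].
case: (boolP (inpc _ _)) => // In _.
apply: hwp_seq; apply: (hwp_asg _ b_gt0 b_le_w) => //=.
apply: (hwp_asg _ b_gt0 b_le_w) => //=.
apply: fin => //=; rewrite ?EI ?EO ?(negPf In) /= ?a6 //.
by move=> x lx; rewrite a6; [case: eqP => [Ex|_]; [lia|case: eqP => // Ex; lia]|lia].
Qed.

End Scanning.

End Scans.
Import Scans.

(** * Sets of groups as packed flags with a list of the nonzero cells *)

Module GroupSets.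

Definition Insert : cmd :=
  56 ::= $55 %/ $rT ;; 57 ::= M[$55 %% $rT] ;; 58 ::= M[$rNFb + $56] ;;
  Cond ($58 == 0)%hl (Wr ($rNLb + $rnl)%hl ($56)%hl ;; rnl ::= $rnl + 1) Nop ;;
  Cond (($58 %/ $57) %% 2 == 0)%hl
    (Wr ($rNFb + $56)%hl ($58 + $57)%hl ;; rng ::= $rng + 1) Nop.

(* Calls [body] with the members of a set of groups in register 39.  The set
   is represented by its flags, t per cell from address F on, and the list of
   the nonzero flag cells. *)
Definition ForEach (rF rL rl : nat) (body : cmd) : cmd :=
  36 ::= 0 ;;
  Loop ($36 < $rl)%hl
    (37 ::= M[$rL + $36] ;; 38 ::= M[$rF + $37] ;;
     Loop (0 < $38)%hl
       (39 ::= M[$rTAB + $38] ;; 38 ::= $38 - M[$39] ;;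
        39 ::= $37 * $rT + $39 ;; body) ;;
     36 ::= $36 + 1).

Section GroupSets.

Variables (t c0 : nat).
Hypothesis t_gt0 : 0 < t.
Implicit Types (m : nat -> nat) (F L l g c : nat).

Definition cellist m L l := [seq m (L + i) | i <- iota 0 l].
Definition celgrp m F c := [seq c * t + j | j <- bits t (m (F + c))].
Definition groups m F L l := flatten [seq celgrp m F c | c <- cellist m L l].

(** The list lets a set be traversed and cleared in time proportional to its size; going through all
    flag cells would take order n / log n steps in every layer. *)
Definition setok m F L l :=
  [/\ uniq (cellist m L l), forall c, c \in cellist m L l -> c < c0,
      forall c, c < c0 -> (m (F + c) == 0) = (c \notin cellist m L l)
    & forall c, c < c0 -> m (F + c) < 2 ^ t].

Lemma celgrpP m F c g : (g \in celgrp m F c) =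
  (c == g %/ t) && odd (m (F + g %/ t) %/ 2 ^ (g %% t)).
Proof.
apply/mapP/andP => [[j]|[/eqP -> o]].
  rewrite mem_bits => /andP [lj o] ->.
  by rewrite divnMDl // divn_small // addn0 modnMDl modn_small.
by exists (g %% t); [rewrite mem_bits ltn_mod t_gt0|rewrite -divn_eq].
Qed.

Lemma mem_groups m F L l g : setok m F L l ->
  (g \in groups m F L l) = (g %/ t < c0) && odd (m (F + g %/ t) %/ 2 ^ (g %% t)).
Proof.
case=> _ ac zc _; apply/flattenP/andP => [[s /mapP [c cl ->]]|[lc o]].
  by rewrite celgrpP => /andP [/eqP <- ->]; split=> //; exact: ac.
exists (celgrp m F (g %/ t)); last by rewrite celgrpP eqxx.
apply: map_f; apply: contraLR o; rewrite -zc // => /eqP ->.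
by rewrite div0n.
Qed.

Lemma uniq_groups m F L l : setok m F L l -> uniq (groups m F L l).
Proof.
case=> + _ _ _; rewrite /groups; elim: (cellist m L l) => //= c s IH /andP [cs us].
rewrite cat_uniq IH // andbT map_inj_uniq ?bits_uniq //; last by move=> x y /addnI.
apply/hasPn => g /flattenP [_ /mapP [c' c's ->]].
rewrite celgrpP => /andP [/eqP Ec' _]; apply: contra cs.
by rewrite celgrpP => /andP [/eqP -> _]; rewrite -Ec'.
Qed.

Lemma setok_size m F L l : setok m F L l -> l <= c0.
Proof.
case=> u a _ _; rewrite -[l](size_iota 0) -(size_map (fun i => m (L + i))) -/(cellist m L l).
rewrite -[c0](size_iota 0); apply: uniq_leq_size => // c /a.
by rewrite mem_iota.
Qed.

Lemma setok0 m F L : (forall c, c < c0 -> m (F + c) = 0) -> setok m F L 0.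
Proof. by move=> z; split=> // c lc; rewrite z ?expn_gt0. Qed.

Lemma bit_add x j j' : ~~ odd (x %/ 2 ^ j) ->
  odd ((x + 2 ^ j) %/ 2 ^ j') = (j' == j) || odd (x %/ 2 ^ j').
Proof.
move=> ev; have := digit_put (rho := 2) isT x j j' (d := 1) isT.
rewrite !modn2 (negPf ev) mul0n subn0 mul1n => H.
by rewrite -[LHS]oddb H; case: (j' == j) => //=; rewrite oddb.
Qed.

Lemma bit_add_small x j : ~~ odd (x %/ 2 ^ j) -> j < t -> x < 2 ^ t -> x + 2 ^ j < 2 ^ t.
Proof.
move=> ev lj lx; have := digit_put_small (rho := 2) isT (d := 1) isT lj lx.
by rewrite modn2 (negPf ev) mul0n subn0 mul1n.
Qed.


Lemma insert_new m m' F L l l' g : setok m F L l -> g %/ t < c0 ->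
  ~~ odd (m (F + g %/ t) %/ 2 ^ (g %% t)) ->
  (forall c, c < c0 -> m' (F + c) =
     if c == g %/ t then m (F + c) + 2 ^ (g %% t) else m (F + c)) ->
  cellist m' L l' = (if m (F + g %/ t) == 0 then rcons (cellist m L l) (g %/ t)
                     else cellist m L l) ->
  setok m' F L l' /\ perm_eq (groups m' F L l') (g :: groups m F L l).
Proof.
move=> so lc o Em Ec; have [u a z s] := so.
have so' : setok m' F L l'.
  rewrite /setok Ec; case: ifP => E0.
    have nin : g %/ t \notin cellist m L l by rewrite -z.
    split=> [|c|c lc'|c lc'].
    - by rewrite rcons_uniq nin.
    - by rewrite mem_rcons inE => /orP [/eqP ->|/a].
    - rewrite Em // mem_rcons inE negb_or; have [->|ne] /= := eqVneq c (g %/ t).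
        by rewrite addn_eq0 expn_eq0 andbF.
      exact: z.
    - rewrite Em //; have [->|ne] := eqVneq c (g %/ t); last exact: s.
      by apply: bit_add_small; rewrite ?ltn_mod ?s.
  split=> // c lc'; rewrite Em //; have [->|ne] := eqVneq c (g %/ t).
  - by rewrite addn_eq0 expn_eq0 andbF -z // E0.
  - exact: z.
  - by apply: bit_add_small; rewrite ?ltn_mod ?s.
  - exact: s.
split=> //; apply: uniq_perm; first exact: uniq_groups.
  by rewrite /= uniq_groups // mem_groups // (negPf o) andbF.
move=> g'; rewrite inE !mem_groups //.
case: (ltnP (g' %/ t) c0) => lc' /=; last first.
  by rewrite orbF; symmetry; apply/eqP => E; move: lc'; rewrite E leqNgt lc.
rewrite Em //; case: (g' %/ t =P g %/ t) => [Eq|ne].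
  rewrite Eq bit_add //; congr (_ || _).
  by apply/eqP/eqP => [Er|-> //]; rewrite (divn_eq g' t) (divn_eq g t) Eq Er.
by case: eqP => // E; case: ne; rewrite E.
Qed.

End GroupSets.

End GroupSets.
Import GroupSets.

(** * Insertion into a set of groups and traversal of such a set *)

Module GroupOps.

Section GroupLoops.

Variables (n : nat) (G : graph n) (w b : nat).
Hypothesis LG : large n w b.

Let b_le_w := lg_w LG.
Let b_gt0 : 0 < b. Proof. by have := lg_big LG; lia. Qed.

Local Notation MM := (MM n b).
Local Notation hwp := (hwp G w b MM).
Local Notation hst := (hst n).
Local Notation t := (tt b).
Local Notation nF := (nF n b).
Local Notation setok := (setok t nF).
Local Notation groups := (groups t).

Lemma t_gt0 : 0 < t.
Proof. by have := lg_big LG; rewrite /tt divn_gt0 //; lia. Qed.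

Lemma t_le_b : t <= b.
Proof. exact: leq_div. Qed.

Lemma area_le : [/\ aCF n b + nF = aNF n b, aNF n b + nF = aCL n b,
  aCL n b + nF = aNL n b, aNL n b + nF = aBE n b & aBE n b <= MM].
Proof.
split=> //; apply: leq_trans (BE_fits (lg_big LG) (lg_lo LG) (lg_hi LG)).
exact: leq_addr.
Qed.

Lemma ngr_lt : ngr n < 2 ^ b.
Proof.
have h1 := lg_lo LG; have h2 := lg_hi LG; have h3 := lg_big LG.
have : 2 <= 2 ^ b.-1 by rewrite -{1}[2]expn1 leq_exp2l //; lia.
rewrite /ngr; have := leq_divM n.-1 64; lia.
Qed.

Lemma grp_cell g : g < ngr n -> g %/ t < nF.
Proof. by move=> lg; rewrite /Layout.nF ltnS leq_div2r // ltnW. Qed.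

Definition nxt (h : hst) := groups (hm h) (aNF n b) (aNL n b) (vars h rnl).

Definition nxtok (h : hst) :=
  [/\ setok (hm h) (aNF n b) (aNL n b) (vars h rnl), vars h rng = size (nxt h)
    & forall g, g \in nxt h -> g < ngr n].

Lemma groups_eq m m' F L l : l <= nF -> (forall c, c \in cellist m L l -> c < nF) ->
  (forall i, i < nF -> m' (F + i) = m (F + i) /\ m' (L + i) = m (L + i)) ->
  groups m' F L l = groups m F L l /\ cellist m' L l = cellist m L l.
Proof.
move=> ll la E.
have Ec : cellist m' L l = cellist m L l.
  apply/eq_in_map => i; rewrite mem_iota => /andP [_ li].
  by case: (E i) => //; lia.
split=> //; rewrite /GroupSets.groups Ec; congr flatten; apply/eq_in_map => c /la lc.
by rewrite /celgrp; case: (E c lc) => ->.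
Qed.

Lemma setok_eq m m' F L l : setok m F L l ->
  (forall i, i < nF -> m' (F + i) = m (F + i) /\ m' (L + i) = m (L + i)) ->
  setok m' F L l /\ groups m' F L l = groups m F L l.
Proof.
move=> so E; have lf := setok_size so; have [u a z s] := so.
have [Eg Ec] := groups_eq lf a E; split=> //.
by rewrite /GroupSets.setok Ec; split=> // c lc; case: (E c lc) => -> _; auto.
Qed.

Lemma hwp_insert Q h k : Csts b h -> Tabs b (hm h) -> nxtok h -> vars h 55 < ngr n ->
  (forall h', (forall x, x < 56 -> x != rnl -> x != rng -> vars h' x = vars h x) ->
     its h' = its h -> outp h' = outp h ->
     (forall a, ~~ (aNF n b <= a < aCL n b) -> ~~ (aNL n b <= a < aBE n b) ->
        hm h' a = hm h a) ->
     nxtok h' -> nxt h' =i vars h 55 :: nxt h -> Q h' k) ->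
  hwp Insert Q h k.
Proof.
move=> C T [so En gn] lg HQ; have [T2 _ _] := T.
have [r1 r2 r3 r4 r5] := area_le.
have t0 := t_gt0; have lc := grp_cell lg.
set g := vars h 55 in lg HQ lc *; set c := g %/ t in lc *; set j := g %% t.
have lj : j < t by rewrite ltn_mod.
have ljb : j < b by apply: leq_trans lj t_le_b.
have lM a : a < aBE n b -> a < MM by move=> la; apply: leq_trans la r5.
have lMp a : a < aBE n b -> a < 2 ^ b.
  by move=> la; apply: (MM_lt LG); exact: lM.
have lcM : aNF n b + c < aBE n b by lia.
have p0 : 0 < 2 ^ t by rewrite expn_gt0.
have lbX : b <= aX b by rewrite /aX /aTAB; lia.
have ljM : j < MM by exact: leq_trans ljb (leq_trans lbX (ltnW (tab_fits LG))).
have p1 : 1 < 2 ^ b by exact: pow_gt1.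
have p00 : 0 < 2 ^ b := ltnW p1.
have MMs := MM_small (lg_big LG) (lg_lo LG) (lg_hi LG).
apply: hwp_seq; apply: (hwp_asg _ b_gt0 b_le_w) => //=; rewrite !(CstsE C) //.
apply: hwp_seq; apply: (hwp_asg _ b_gt0 b_le_w) => //=; rewrite !(CstsE C) //.
rewrite -/g -/j -/c [hm h j]T2 //.
apply: hwp_seq; apply: (hwp_asg _ b_gt0 b_le_w) => //=; rewrite !(CstsE C) -/c.
  by sp => //; [exact: lMp|exact: lM].
set x := hm h (aNF n b + c).
set h1 := setv _ _ _.
have [u a z s] := so.
have lx : x < 2 ^ t by exact: s.
have lxb : x < 2 ^ b by apply: leq_trans lx _; rewrite leq_exp2l // t_le_b.
set nl := vars h rnl in so En gn u a z s.
have lnl := setok_size so.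
case: (boolP (odd (x %/ 2 ^ j))) => ox.
  have x0 : x != 0 by apply: contraL ox => /eqP ->; rewrite div0n.
  apply: hwp_seq; apply: (hwp_cond b_gt0 b_le_w) => //=; rewrite (negPf x0) // => _.
  apply: hwp_nop; apply: (hwp_cond b_gt0 b_le_w) => //=;
    [by sp => //; [rewrite expn_gt0|exact: (small_pow LG)]|by rewrite modn2 ox|move=> _].
  apply: hwp_nop; apply: HQ => //=.
  - by move=> y ly n1 n2; rewrite /h1 /=; do 3![case: eqP => [Ey|_]; [lia|]].
  - move=> g'; rewrite inE; case: eqP => // ->.
    by rewrite (mem_groups t0 _ so) lc ox.
pose m' a := if a == aNF n b + c then x + 2 ^ j
  else if (x == 0) && (a == aNL n b + nl) then c else hm h a.
pose nl' := if x == 0 then nl.+1 else nl.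
have Ec : cellist m' (aNL n b) nl' = if x == 0 then rcons (cellist (hm h) (aNL n b) nl) c
                     else cellist (hm h) (aNL n b) nl.
  have E1 : cellist m' (aNL n b) nl = cellist (hm h) (aNL n b) nl.
    apply/eq_in_map => i; rewrite mem_iota => /andP [_ li]; rewrite /m'.
    case: eqP => [|_]; first lia.
    by have -> : (aNL n b + i == aNL n b + nl) = false; [apply/eqP; lia|rewrite andbF].
  rewrite /nl'; case: eqP => // x0.
  rewrite /cellist -{1}[nl.+1]addn1 iotaD map_cat -/(cellist m' _ nl) E1 /= add0n cats1.
  by rewrite /m' x0 eqxx eqxx /=; case: eqP => //; lia.
have Em c' : c' < nF -> m' (aNF n b + c') =
     if c' == g %/ t then hm h (aNF n b + c') + 2 ^ (g %% t) else hm h (aNF n b + c').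
  move=> lc'; rewrite /m' eqn_add2l -/c; case: eqP => [->|_] //.
  by have -> : (aNF n b + c' == aNL n b + nl) = false; [apply/eqP; lia|rewrite andbF].
have [so' Pg] := insert_new t0 so lc ox Em Ec.
have lnl' := setok_size so'.
have Sg : size (groups m' (aNF n b) (aNL n b) nl') = (size (nxt h)).+1 by rewrite (perm_size Pg).
have gn' g' : g' \in groups m' (aNF n b) (aNL n b) nl' -> g' < ngr n.
  by rewrite (perm_mem Pg) inE => /orP [/eqP ->|/gn].
(* The members are distinct group numbers, so their counter cannot overflow. *)
have Sn : size (groups m' (aNF n b) (aNL n b) nl') <= ngr n.
  rewrite -[X in _ <= X](size_iota 0); apply: uniq_leq_size; first exact: (uniq_groups t0 so').
  by move=> g' /gn' lg'; rewrite mem_iota.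
have xb : x + 2 ^ j < 2 ^ b.
  by apply: leq_trans (bit_add_small ox lj lx) _; rewrite leq_exp2l // t_le_b.
have fin h' : vars h' rnl = nl' -> vars h' rng = (size (nxt h)).+1 ->
   (forall x, x < 56 -> x != rnl -> x != rng -> vars h' x = vars h x) ->
   its h' = its h -> outp h' = outp h -> hm h' =1 m' -> Q h' k.
  move=> e1 e2 e3 e4 e5 e6.
  have En' : nxt h' = groups m' (aNF n b) (aNL n b) nl'.
    rewrite /nxt e1; case: (@groups_eq m' (hm h') (aNF n b) (aNL n b) nl' lnl') => [|i li|-> //].
      by case: so'.
    by rewrite !e6.
  apply: HQ => //.
  - move=> a' n1 n2; rewrite e6 /m'; case: eqP => [|_]; first lia.
    case: eqP => [x0|//]; case: eqP => //= Ea; move: lnl'; rewrite /nl' x0 /=; lia.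
  - rewrite /nxtok En' e1 e2 Sg; split=> //.
    by case: (setok_eq (m' := hm h') so') => // i li; rewrite !e6.
  - by move=> g'; rewrite En' (perm_mem Pg).
apply: hwp_seq.
apply: (@hwp_imp _ _ _ _ _ _ (fun h2 k2 => [/\ k2 = k, its h2 = its h, outp h2 = outp h,
   vars h2 rnl = nl' & [/\ (forall y, y < 59 -> y != rnl -> vars h2 y = vars h1 y) &
    forall a, hm h2 a = if (x == 0) && (a == aNL n b + nl) then c else hm h a]])).
  apply: (hwp_cond b_gt0 b_le_w) => //=; case: eqP => x0 // _; last first.
    by apply: hwp_nop; split=> //; rewrite /nl'; case: eqP.
  have lnl2 : nl < nF by move: lnl'; rewrite /nl' x0.
  apply: hwp_seq; apply: (hwp_wr _ b_gt0 b_le_w) => //=.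
  - by rewrite (CstsE C) -/nl; sp => //; apply: (lMp); lia.
  - by rewrite (CstsE C) -/nl; apply: lM; lia.
  apply: (hwp_asg _ b_gt0 b_le_w) => //=.
    by rewrite -/nl; sp => //; apply: (lMp); lia.
  split=> //=; first by rewrite /nl' x0 -/nl addn1.
  split=> [y ly ny|a']; first by rewrite (negPf ny).
  by rewrite (CstsE C) -/nl; case: eqP.
move=> h2 k2 [-> i2 o2 e2 [a2 m2]].
have C2 : Csts b h2.
  apply: Csts_eq C _ => y ly; rewrite a2 //; try lia.
  by rewrite /h1 /=; do 3![case: eqP => [Ey|_]; [lia|]].
have e58 : vars h2 58 = x by rewrite a2.
have e57 : vars h2 57 = 2 ^ j by rewrite a2.
have e56 : vars h2 56 = c by rewrite a2.
have e32 : vars h2 rng = size (nxt h) by rewrite a2.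
apply: (hwp_cond b_gt0 b_le_w) => //=; rewrite ?e57 ?e58;
  [by sp => //; [rewrite expn_gt0|exact: (small_pow LG)]|move=> _|by rewrite modn2 (negPf ox)].
apply: hwp_seq; apply: (hwp_wr _ b_gt0 b_le_w) => //=.
- by rewrite (CstsE C2) e56; sp => //; exact: lMp.
- by rewrite e57 e58; sp.
- by rewrite (CstsE C2) e56; exact: lM.
apply: (hwp_asg _ b_gt0 b_le_w) => //=.
  rewrite e32; sp => //; rewrite addn1 -Sg; exact: leq_ltn_trans Sn ngr_lt.
apply: fin => //=.
- by rewrite e32 addn1.
- move=> y ly n1 n2; rewrite (negPf n2) a2 //; last lia.
  by rewrite /h1 /=; do 3![case: eqP => [Ey|_]; [lia|]].
- by move=> a'; rewrite /= (CstsE C2) e56 e57 e58 m2 /m'.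
Qed.

(** The invariant is indexed by the groups still to come and is monotone in the time, so that credit
    may be discarded. Each call of the body is charged two iterations: one of the inner loop, and
    one that the first group of a cell passes on to the outer loop. *)
Lemma hwp_foreach rF rL rl body F L l m0 (J : seq nat -> hst -> nat -> Prop)
    (Q : hst -> nat -> Prop) h k :
  rF < 36 -> rL < 36 -> rl < 36 -> setok m0 F L l -> F + nF <= MM -> L + nF <= MM ->
  (forall g, g \in groups m0 F L l -> g < ngr n) ->
  (forall rem h k, J rem h k -> [/\ Csts b h, Tabs b (hm h), vars h rF = F, vars h rL = L &
     vars h rl = l /\ forall i, i < nF -> hm h (F + i) = m0 (F + i) /\ hm h (L + i) = m0 (L + i)]) ->
  (forall rem h k r v, 36 <= r < 40 -> J rem h k -> J rem (setv h r v) k) ->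
  (forall rem h k k', k' <= k -> J rem h k -> J rem h k') ->
  (forall g rem h k, g \in groups m0 F L l -> J (g :: rem) h k -> vars h 39 = g ->
     hwp body (fun h' k' => J rem h' k'.+2 /\
                 (forall x, 36 <= x < 39 -> vars h' x = vars h x)) h k) ->
  J (groups m0 F L l) h k -> (forall h k, J [::] h k -> Q h k) ->
  hwp (ForEach rF rL rl body) Q h k.
Proof.
move=> lF lL ll so fF fL gn JF Jv Jk Jb J0 HQ.
have t0 := t_gt0; have lnF := setok_size so; have [u a z s] := so.
have p1 : 1 < 2 ^ b by exact: pow_gt1.
have p00 : 0 < 2 ^ b := ltnW p1.
have MMs := MM_small (lg_big LG) (lg_lo LG) (lg_hi LG).
have lMp x : x < MM -> x < 2 ^ b by exact: (MM_lt LG).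
set cs := cellist m0 L l in u a z.
have Sc : size cs = l by rewrite size_map size_iota.
have Ecs i : i < l -> nth 0 cs i = m0 (L + i).
  by move=> li; rewrite (nth_map 0) ?size_iota // nth_iota.
have nr r' x : r' < 36 -> 36 <= x -> (r' == x) = false by move=> l1 l2; apply/eqP; lia.
apply: hwp_seq; apply: (hwp_asg _ b_gt0 b_le_w) => //=.
pose inv j (h : hst) k := exists i, [/\ j = l - i, i <= l, vars h 36 = i &
  J (flatten [seq celgrp t m0 F c | c <- drop i cs]) h k].
apply: (@hwp_loop _ G w b MM b_gt0 b_le_w _ _ inv _ _ _ l _ k) => //; last first.
  by exists 0; rewrite subn0 drop0; split=> //; exact: Jv.
move=> _ h1 k1 [i [-> li Ei Ji]]; have [C1 T1 eF eL [el em]] := JF _ _ _ Ji.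
rewrite /= Ei el; split=> //; case: ltnP => // li' _.
  by apply: HQ; move: Ji; rewrite drop_oversize // Sc.
split; first lia.
have lc : nth 0 cs i < nF by apply: a; rewrite mem_nth // Sc.
have Edr : drop i cs = nth 0 cs i :: drop i.+1 cs by rewrite (drop_nth 0) // Sc.
set c := nth 0 cs i in lc Edr.
have ex0 : m0 (F + c) != 0.
  by rewrite z // negbK; apply: mem_nth; rewrite Sc.
have lx0 : m0 (F + c) < 2 ^ t by exact: s.
apply: hwp_seq; apply: (hwp_asg _ b_gt0 b_le_w) => //=; rewrite ?eL ?Ei.
  by sp => //; [apply: (lMp)|]; lia.
have -> : hm h1 (L + i) = c.
  by case: (em i) => [|_ ->]; [lia|rewrite /c Ecs].
apply: hwp_seq; apply: (hwp_asg _ b_gt0 b_le_w) => //=; rewrite ?nr // ?eF.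
  by sp => //; [apply: (lMp)|]; lia.
have [-> _] := em c lc.
set x0 := m0 (F + c) in ex0 lx0 *.
set h2 := setv _ _ _.
set rest := flatten [seq celgrp t m0 F c | c <- drop i.+1 cs].
have Ji2 : J ([seq c * t + j | j <- bits t x0] ++ rest) h2 k1.
  by apply: (Jv) => //; apply: (Jv) => //; move: Ji; rewrite Edr /= .
apply: hwp_seq.
(* The summand [x != x0] is the credit for the outer round. It is earned as soon as one group of the
   cell has been treated, and a listed cell is nonzero, so there is such a group. *)
pose inn j (h : hst) k := exists x, [/\ j = size (bits t x), x < 2 ^ t,
   [/\ vars h 36 = i, vars h 37 = c & vars h 38 = x],
   J ([seq c * t + j | j <- bits t x] ++ rest) h (k + (x != x0)) &
   {subset [seq c * t + j | j <- bits t x] <= groups m0 F L l}].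
apply: (@hwp_loop _ G w b MM b_gt0 b_le_w _ _ inn _ _ _ (size (bits t x0)) h2 k1) => //; last first.
  exists x0; rewrite eqxx addn0; split=> //.
  move=> g gi; apply/flattenP; exists (celgrp t m0 F c) => //.
  by apply: map_f; apply: mem_nth; rewrite Sc.
move=> _ h3 k3 [x [-> lx [E36 E37 E38] J3 sub]]; rewrite /= E38.
split; first by sp => //; exact: ltnW.
  case: posnP => // x00 _; rewrite x00 bits0 /= eq_sym ex0 in J3.
  have [C3 T3 eF3 eL3 [el3 em3]] := JF _ _ _ J3.
  apply: (hwp_asg _ b_gt0 b_le_w) => //=.
    by rewrite E36; sp => //; apply: leq_ltn_trans MMs; lia.
  exists i.+1; rewrite /= E36 addn1; split=> //; first lia.
  by apply: (Jv) => //; move: J3; rewrite addn1.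
case: posnP => // xp _.
have Eb := bits_high xp lx; set jj := trunc_log 2 x in Eb.
have ljj : jj < t.
  by have : jj \in bits t x by [rewrite Eb mem_head]; rewrite mem_bits => /andP [].
have lpx : 2 ^ jj <= x by case/andP: (trunc_log_bounds (isT : 1 < 2) xp).
rewrite Eb; split=> //.
have [C3 T3 eF3 eL3 [el3 em3]] := JF _ _ _ J3.
have [T32 _ T3t] := T3.
have lX := tab_fits LG.
have gin : c * t + jj \in groups m0 F L l by apply: sub; rewrite Eb mem_head.
have lgn := gn _ gin.
have lgp : c * t + jj < 2 ^ b by exact: ltn_trans lgn ngr_lt.
apply: hwp_seq; apply: (hwp_asg _ b_gt0 b_le_w) => //=; rewrite ?(CstsE C3) ?E38.
  by sp => //; [apply: (lMp)|]; apply: leq_ltn_trans lX; rewrite /aX leq_add2l ltnW.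
rewrite T3t ?xp // -/jj.
apply: hwp_seq; apply: (hwp_asg _ b_gt0 b_le_w) => //=; rewrite ?E38.
  have ljb : jj < b by apply: leq_trans ljj t_le_b.
  sp => //; last by rewrite T32.
  by apply: ltn_trans lX; apply: leq_trans ljb _; rewrite /aX /aTAB; lia.
rewrite T32; last by apply: leq_trans ljj t_le_b.
apply: hwp_seq; apply: (hwp_asg _ b_gt0 b_le_w) => //=; rewrite ?(CstsE C3) ?E37.
  by sp => //; apply: leq_ltn_trans lgp; exact: leq_addr.
set h4 := setv _ _ _.
have J4 : J (c * t + jj :: ([seq c * t + j | j <- bits t (x - 2 ^ jj)] ++ rest)) h4 k3.
  do 3!apply: (Jv) => //; apply: (Jk _ _ _ _ (leq_addr (x != x0 : nat) _)).
  by move: J3; rewrite {1}Eb.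
apply: (hwp_imp (Jb _ _ _ _ gin J4 (setvE _ _ _))).
move=> h5 k5 [J5 a5]; exists (x - 2 ^ jj); split=> //.
- lia.
- by rewrite !a5 // /h4 /= ?E36 ?E37; sp.
- apply: Jk J5; have p2 : 0 < 2 ^ jj by rewrite expn_gt0. 
  by case: (_ != _) => /=; lia.
- by move=> g' gi'; apply: sub; rewrite Eb inE gi' orbT.
Qed.

End GroupLoops.

End GroupOps.
Import GroupOps.

(** * Traversal of the vertices of a set of groups *)

Module VertexLoops.

Definition GroupLoop (body : cmd) : cmd :=
  40 ::= 0 ;;
  For 40 (Cst 64) (41 ::= $39 * 64 + $40 ;; Cond ($41 <= $rN1)%hl body Nop).

Definition PutV (r : nat) : cmd :=
  Cond ($r < $rLen)%hl (PutBit ($rW)%hl ($r)%hl (Cst 1))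
    (PutBit ($rX)%hl ($r - $rLen)%hl (Cst 1)).

Section Vertices.

Variables (n : nat) (G : graph n) (w b : nat).
Hypothesis LG : large n w b.

Let b_le_w := lg_w LG.
Let b_gt0 : 0 < b. Proof. by have := lg_big LG; lia. Qed.

Local Notation MM := (MM n b).
Local Notation len := (len n b).
Local Notation PP := (PP n b).
Local Notation hh := (hh n b).
Local Notation hwp := (hwp G w b MM).
Local Notation hst := (hst n).
Local Notation t := (tt b).
Local Notation nF := (nF n b).
Local Notation setok := (setok t nF).
Local Notation groups := (groups t).

Definition verts_from (x c : nat) : seq 'I_n := pmap insub (iota x c).
Definition verts (g : nat) : seq 'I_n := verts_from (64 * g) 64.

Lemma mem_verts_from x c (v : 'I_n) : (v \in verts_from x c) = (x <= v < x + c).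
Proof. by rewrite /verts_from mem_pmap_sub mem_iota. Qed.

Lemma mem_verts g (v : 'I_n) : (v \in verts g) = (v %/ 64 == g).
Proof.
rewrite mem_verts_from; apply/idP/eqP => [/andP [h1 h2]|<-].
  have := divn_eq v 64; have := ltn_pmod v (isT : 0 < 64); lia.
have := divn_eq v 64; have := ltn_pmod v (isT : 0 < 64); lia.
Qed.

Lemma uniq_verts g : uniq (verts g).
Proof. by rewrite pmap_sub_uniq // iota_uniq. Qed.

Lemma size_verts g : size (verts g) <= 64.
Proof. by rewrite size_pmap (leq_trans (count_size _ _)) // size_iota. Qed.

Lemma verts_fromS x c : verts_from x c.+1 =
  if insub x is Some v then v :: verts_from x.+1 c else verts_from x.+1 c.
Proof. by rewrite /verts_from /=; case: insub. Qed.

Lemma verts_from0 x : verts_from x 0 = [::].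
Proof. by []. Qed.

Lemma vertsE g : verts g = verts_from (64 * g) 64.
Proof. by []. Qed.

Opaque verts_from verts.

Definition allverts (gs : seq nat) := flatten [seq verts g | g <- gs].

Lemma mem_allverts gs (v : 'I_n) : (v \in allverts gs) = (v %/ 64 \in gs).
Proof.
apply/flattenP/idP => [[_ /mapP [g gi ->]]|vi].
  by rewrite mem_verts => /eqP ->.
by exists (verts (v %/ 64)); [exact: map_f|rewrite mem_verts].
Qed.

Lemma uniq_allverts gs : uniq gs -> uniq (allverts gs).
Proof.
elim: gs => //= g gs IH /andP [gi ug]; rewrite cat_uniq uniq_verts IH // andbT.
apply/hasPn => v; rewrite mem_allverts mem_verts; apply: contraL => /eqP ->.
by rewrite gi.
Qed.

Lemma size_allverts gs : size (allverts gs) <= 64 * size gs.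
Proof.
elim: gs => //= g gs IH; rewrite size_cat mulnS leq_add //; exact: size_verts.
Qed.

(** The constant 66 consists of 64 iterations over the members of the group and the two iterations
    charged for the group itself. *)
Definition gcost (cost : 'I_n -> nat) (g : nat) := 66 + \sum_(v <- verts g) cost v.

(** Since 64 divides [2 ^ b], even the vertex numbers beyond n that are formed in the last group fit
    into b bits. *)
Lemma pow64 x : x < 2 ^ b -> x %/ 64 * 64 + 64 <= 2 ^ b.
Proof.
move=> lx; have -> : 2 ^ b = 2 ^ (b - 6) * 64.
  by rewrite -[64]/(2 ^ 6) -expnD subnK //; have := lg_big LG; lia.
rewrite -mulSnr leq_mul2r /= ltn_divLR // -[64]/(2 ^ 6) -expnD subnK //.
by have := lg_big LG; lia.
Qed.

Lemma hwp_forverts rF rL rl body F L l m0 (J : seq 'I_n -> hst -> Prop) (cost : 'I_n -> nat)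
    (Q : hst -> nat -> Prop) h k :
  rF < 36 -> rL < 36 -> rl < 36 -> setok m0 F L l -> F + nF <= MM -> L + nF <= MM ->
  (forall g, g \in groups m0 F L l -> g < ngr n) ->
  (forall rem h, J rem h -> [/\ Csts b h, Tabs b (hm h), vars h rF = F, vars h rL = L &
     vars h rl = l /\ forall i, i < nF -> hm h (F + i) = m0 (F + i) /\ hm h (L + i) = m0 (L + i)]) ->
  (forall rem h r v, 36 <= r < 42 -> J rem h -> J rem (setv h r v)) ->
  (forall p v rem h k, allverts (groups m0 F L l) = p ++ v :: rem -> J (v :: rem) h ->
     vars h 41 = v ->
     hwp body (fun h' k' => [/\ J rem h', k' <= k + cost v &
                 (forall x, 36 <= x < 41 -> vars h' x = vars h x)]) h k) ->
  J (allverts (groups m0 F L l)) h ->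
  (forall h' k', J [::] h' -> k' <= k + \sum_(g <- groups m0 F L l) gcost cost g -> Q h' k') ->
  hwp (ForEach rF rL rl (GroupLoop body)) Q h k.
Proof.
move=> lF lL ll so fF fL gn JF Jv Jb J0 HQ.
set gs := groups m0 F L l in gn Jb J0 HQ *.
pose J' (rem : seq nat) (h' : hst) k' := [/\ J (allverts rem) h',
  k' + \sum_(g <- rem) gcost cost g <= k + \sum_(g <- gs) gcost cost g &
  exists pg, gs = pg ++ rem].
apply: (@hwp_foreach _ G _ _ LG _ _ _ _ F L l m0 J') => //.
- by move=> rem h' k' [/JF].
- move=> rem h' k' r v /andP [r1 r2] [J1 J2 J3]; split=> //; apply: (Jv) => //.
  by rewrite r1; lia.
- by move=> rem h' k1 k2 le [J1 J2 J3]; split=> //; apply: leq_trans J2; rewrite leq_add2r.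
- move=> g rem h1 k1 gi [J1 J2 [pg Epg]] E39.
  have d1 : 64 < 2 ^ b by exact: (small_pow LG).
  rewrite big_cons in J2.
  pose R := allverts rem.
  pose inv i (h' : hst) k' := [/\ J (verts_from (64 * g + i) (64 - i) ++ R) h',
    k' + \sum_(v <- verts_from (64 * g + i) (64 - i)) cost v <= k1 + i + \sum_(v <- verts g) cost v,
    (forall x, 36 <= x < 40 -> vars h' x = vars h1 x) &
    exists q, verts g = q ++ verts_from (64 * g + i) (64 - i)].
  have p41 : 0 < 2 ^ b by rewrite expn_gt0.
  have lgN : g * 64 + 64 <= 2 ^ b.
    have ln1 : n.-1 < 2 ^ b by have := lg_hi LG; have := lg_lo LG; lia.
    apply: leq_trans (pow64 ln1); rewrite leq_add2r leq_mul2r /=.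
    by have := gn _ gi; rewrite /ngr ltnS.
  apply: hwp_seq; apply: (hwp_asg _ b_gt0 b_le_w) => //=.
  apply: (@hwp_for _ G w b MM b_gt0 b_le_w _ _ _ 64 inv _ 0) => //.
  + rewrite /inv addn0 subn0 -vertsE; split.
    * by apply: (Jv) => //; exact: J1.
    * by rewrite addn0.
    * by move=> x /andP [x1 x2] /=; case: eqP => // Ex; lia.
    * by exists [::].
  + move=> i h2 k2 li E40 [I1 I2 I3 [q Eq]].
    have [C2 T2 _ _ _] := JF _ _ I1.
    have E39' : vars h2 39 = g by rewrite I3.
    apply: hwp_seq; apply: (hwp_asg _ b_gt0 b_le_w) => //=; rewrite E39' E40.
      by sp => //; apply: leq_trans lgN; lia.
    set x := g * 64 + i; set h3 := setv _ _ _.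
    have Ex : 64 * g + i = x by rewrite mulnC.
    have I1' : J (verts_from (64 * g + i) (64 - i) ++ R) h3 by apply: (Jv).
    rewrite -(subnSK li) Ex verts_fromS in I1' I2 Eq.
    have nx : x.+1 = 64 * g + i.+1 by rewrite -Ex addnS.
    apply: (hwp_cond b_gt0 b_le_w) => //=; rewrite (CstsE C2).
      case: leqP => // lx _; have lxn : x < n by have := lg_lo LG; lia.
      rewrite insubT /= in I1' I2 Eq.
      set v := Sub x lxn in I1' I2 Eq.
      have Eall : exists p, allverts gs = p ++ v :: (verts_from x.+1 (64 - i.+1) ++ R).
        exists (allverts pg ++ q); rewrite Epg /allverts map_cat flatten_cat /= -/(allverts rem) -/R Eq.
        by rewrite -!catA /=.
      have [p Ep] := Eall.
      rewrite big_cons in I2.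
      apply: (hwp_imp (Jb _ _ _ _ _ Ep I1' _)); first by [].
      move=> h4 k4 [J4 k4b a4]; split; first by rewrite a4 //= E40.
      split; rewrite -?nx.
      * exact: Jv.
      * by rewrite addSn addnS; move: k4b I2; set S := \sum_(v <- verts_from _ _) _; lia.
      * move=> y /andP [y1 y2] /=; case: eqP => [Ey|_]; first lia.
        rewrite a4; last lia. rewrite /=; case: eqP => [Ey|_]; first lia.
        by apply: I3; rewrite y1.
      * by exists (rcons q v); rewrite cat_rcons.
    case: leqP => // lx _; rewrite insubN /= in I1' I2 Eq; last by rewrite -leqNgt; lia.
    apply: hwp_nop; split; first by rewrite /= E40.
    split; rewrite -?nx.
    * exact: Jv.
    * by lia.
    * move=> y /andP [y1 y2] /=; case: eqP => [Ey|_]; first lia.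
      case: eqP => [Ey|_]; first lia.
      by apply: I3; rewrite y1.
    * by exists q.
  + move=> h2 k2 E40 [I1 I2 I3 _]; rewrite subnn verts_from0 big_nil addn0 in I1 I2.
    split; last by move=> x /andP [x1 x2]; apply: I3; lia.
    split=> //; last by exists (rcons pg g); rewrite cat_rcons.
    by move: J2; rewrite {1}/gcost => J2; lia.
- by split=> //; exists [::].
- by move=> h' k' [J1 J2 _]; apply: HQ => //; move: J2; rewrite big_nil addn0.
Qed.

(** The resting state between layers: no digit is in use, since [rlim = len], and with [rsa = len]
    the last [PP] vertices act as the piece, so that their bits lie at [aX] and the other vertices
    occupy their own positions. *)
Definition nc (h : hst) (V : {set 'I_n}) :=
  [/\ env b h, vars h rsa = len, vars h rlim = len &
      forall u : 'I_n, rd n b (hm h) len len u = (u \in V)].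

Lemma addr_order : [/\ aX b + hh = aFL n b, aFL n b <= aEB n b, aEB n b <= aW n b,
  aW n b <= aCF n b & b <= aX b].
Proof.
have p0 : 0 < 2 ^ t by rewrite expn_gt0.
by rewrite /aCF /aW /aEB /aX /aTAB; split=> //; try lia; exact: leq_addr.
Qed.

Lemma Tabs_ext m m' : (forall a, a < aX b -> m' a = m a) -> Tabs b m -> Tabs b m'.
Proof.
have [_ _ _ _ lbX] := addr_order.
have k2 := k3_two_thirds (lg_big LG) (lg_lo LG) (lg_hi LG).
have p0 : 0 < 2 ^ t by rewrite expn_gt0.
move=> E [T1 T2 T3]; split=> [j lj|j lj|x /andP [x0 lx]].
- by rewrite E ?T1 //; lia.
- by rewrite E ?T2 //; rewrite /aX /aTAB; lia.
- by rewrite E ?T3 ?x0 // /aX ltn_add2l.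
Qed.

Lemma rd_ext m m' (u : 'I_n) :
  (forall a, aX b <= a < aFL n b -> m' a = m a) ->
  (forall a, aW n b <= a < aCF n b -> m' a = m a) ->
  rd n b m' len len u = rd n b m len len u.
Proof.
move=> E1 E2; rewrite /rd; have lu := ltn_ord u.
have [eln _] := len_n LG.
case: ifP => [/andP [h1 h2]|nX].
  by apply: dig_same; apply: E1; rewrite leq_addr /= (adrX LG h2).
have lu' : u < len by case: ltnP => // h1; move: nX; rewrite h1 /=; lia.
rewrite lu' lu'; apply: dig_same; apply: E2; rewrite leq_addr /= /aCF ltn_add2l ltnS.
by apply: leq_div2r; exact: ltnW.
Qed.

Lemma nc_ext h h' V : nc h V -> (forall x, x < 36 -> x != rnl -> x != rng -> x != rcl -> vars h' x = vars h x) ->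
  (forall a, a < aCF n b -> hm h' a = hm h a) -> nc h' V.
Proof.
move=> [[C T g] e1 e2 R] Ev Em; have [o1 o2 o3 o4 o5] := addr_order.
split; rewrite ?Ev //.
- split; rewrite ?Ev //; last by apply: Tabs_ext T => a la; apply: Em; lia.
  by apply: Csts_eq C _ => x lx; apply: Ev; lia.
- move=> u; rewrite -R; apply: rd_ext => a /andP [h1 h2]; apply: Em; lia.
Qed.

Lemma hwp_putv r (v : 'I_n) V Q h k : r < 60 -> nc h V -> vars h r = v ->
  (forall h', (forall x, x < 60 -> vars h' x = vars h x) -> its h' = its h ->
     outp h' = outp h -> (forall a, aCF n b <= a -> hm h' a = hm h a) ->
     nc h' (v |: V) -> Q h' k) ->
  hwp (PutV r) Q h k.
Proof.
move=> lr [[C T g] e1 e2 R] Er HQ; have [o1 o2 o3 o4 o5] := addr_order.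
have [eln _] := len_n LG; have lv := ltn_ord v.
have d1 : 1 < 2 ^ b by exact: pow_gt1.
have q0 := leq0n (v %/ b); have q1 := leq0n ((v - len) %/ b).
have fin h' : (forall x, x < 60 -> vars h' x = vars h x) -> its h' = its h ->
     outp h' = outp h -> (forall a, aCF n b <= a -> hm h' a = hm h a) ->
     (forall a, a < aX b -> hm h' a = hm h a) ->
     (forall u : 'I_n, rd n b (hm h') len len u = if u == v then 1 else rd n b (hm h) len len u) -> Q h' k.
  move=> a1 a2 a3 a4 a5 a6; apply: HQ => //; split; rewrite ?a1 //.
    split; rewrite ?a1 //; last exact: Tabs_ext T.
    by apply: Csts_eq C _ => x lx; apply: a1; lia.
  by move=> u; rewrite a6 R !inE; case: eqP.
apply: (hwp_cond b_gt0 b_le_w) => //=; rewrite (CstsE C) Er; case: ltnP => // lvl _.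
  have aM : aW n b + v %/ b < aCF n b by rewrite /aCF ltn_add2l ltnS leq_div2r // ltnW.
  apply: (@hwp_putbit _ G _ _ LG) => //=.
  - by move=> h' [a1 _ _ _]; rewrite !a1 //; sp.
  - rewrite (CstsE C) Er; apply: leq_trans aM _; have [? ? ? ? ?] := area_le LG; lia.
  rewrite (CstsE C) Er => h' a1 i1 p1 m1; apply: fin => //.
  - by move=> a la; rewrite m1 /putd; case: eqP => // Ea; lia.
  - by move=> a la; rewrite m1 /putd; case: eqP => // Ea; lia.
  move=> u; have lu := ltn_ord u; rewrite /rd; case: ifP => [/andP [h1 h2]|nX].
    case: eqP => [Eu|_]; first by move: h1; rewrite Eu; lia.
    apply: dig_same; rewrite m1 /putd; case: eqP => // Ea.
    by have := adrX LG h2; lia.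
  have lu' : u < len by case: ltnP => // h1; move: nX; rewrite h1 /=; lia.
  by rewrite lu' lu' (dig_put (rho := 2) isT b_gt0 (isT : 1 < 2) m1) -val_eqE.
have lx : v - len < PP by lia.
have lxF := adrX LG lx.
apply: (@hwp_putbit _ G _ _ LG) => //=.
- by move=> h' [a1 _ _ _]; rewrite !a1 // (CstsE C) Er; sp.
- rewrite !(CstsE C) Er; apply: (ltn_trans lxF); first [exact: aFL_MM|exact: (aFL_MM LG)].
rewrite !(CstsE C) Er => h' a1 i1 p1 m1; apply: fin => //.
- by move=> a la; rewrite m1 /putd; case: eqP => // Ea; lia.
- by move=> a la; rewrite m1 /putd; case: eqP => // Ea; lia.
move=> u; have lu := ltn_ord u; rewrite /rd; case: ifP => [/andP [h1 h2]|nX].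
  rewrite (dig_put (rho := 2) isT b_gt0 (isT : 1 < 2) m1) -val_eqE.
  by have -> : (u - len == v - len) = (val u == v); [apply/eqP/eqP => /=; lia|].
have lu' : u < len by case: ltnP => // h1; move: nX; rewrite h1 /=; lia.
case: eqP => [Eu|_]; first by move: lu'; rewrite Eu; lia.
have q2 := leq0n (u %/ b).
by rewrite lu' lu'; apply: dig_same; rewrite m1 /putd; case: eqP => // Ea; lia.
Qed.

End Vertices.

End VertexLoops.
Import VertexLoops.

(** * Sparse layers: finding the groups that contain new vertices *)

Module Probing.

Definition BodyA : cmd :=
  Get 41 ;;
  Cond ($62 == 1)%hl
    (Iter true 0 ($41)%hl ;;
     Loop (More 0)
       (Nxt 0 42 ;; Get 42 ;;
        Cond ($62 == 0)%hl (55 ::= $42 %/ 64 ;; Insert) Nop))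
    Nop.

(** All visited vertices of a current group are probed, not only those of the last layer, because
    nothing records when a vertex was visited. The amortization tolerates this: outside dense layers
    a group becomes current at most once for each of its 64 vertices. *)
Definition PhaseA : cmd := ForEach rCFb rCLb rcl (GroupLoop BodyA).

Definition BodyB : cmd :=
  Get 41 ;;
  Cond ($62 == 0)%hl
    (Scan 41 ;; 44 ::= 0 < $51 + $52 ;;
     Cond ($51)%hl (45 ::= $53) (45 ::= $54) ;;
     Cond ($44)%hl (Out ($41)%hl ;; Out ($45)%hl) Nop ;;
     PutBit ($rBE)%hl ($43)%hl ($44)%hl ;; 43 ::= $43 + 1)
    Nop.

(** Marking the new vertices is left to a second pass, because a vertex marked at once could be
    taken for a parent by another vertex of the same layer. *)
Definition PhaseB : cmd := 43 ::= 0 ;; ForEach rNFb rNLb rnl (GroupLoop BodyB).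

Definition BodyC : cmd :=
  Get 41 ;;
  Cond ($62 == 0)%hl
    (44 ::= bitE ($rBE)%hl ($43)%hl ;; 43 ::= $43 + 1 ;; Cond ($44)%hl (PutV 41) Nop)
    Nop.

Definition PhaseC : cmd := 43 ::= 0 ;; ForEach rNFb rNLb rnl (GroupLoop BodyC).

Definition flat n (l : seq ('I_n * 'I_n)) : seq nat :=
  flatten [seq [:: nat_of_ord x.1; nat_of_ord x.2] | x <- l].

Section Phases.

Variables (n : nat) (G : graph n) (w b : nat).
Hypothesis LG : large n w b.

Let b_le_w := lg_w LG.
Let b_gt0 : 0 < b. Proof. by have := lg_big LG; lia. Qed.

Local Notation MM := (MM n b).
Local Notation len := (len n b).
Local Notation PP := (PP n b).
Local Notation hh := (hh n b).
Local Notation hwp := (hwp G w b MM).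
Local Notation hst := (hst n).
Local Notation t := (tt b).
Local Notation nF := (nF n b).
Local Notation setok := (setok t nF).
Local Notation groups := (groups t).
Local Notation e := (edge G).
Local Notation nc := (nc b).
Local Notation nxt := (nxt b).
Local Notation nxtok := (nxtok b).

Lemma flat_cat (l1 l2 : seq ('I_n * 'I_n)) : flat (l1 ++ l2) = flat l1 ++ flat l2.
Proof. by rewrite /flat map_cat flatten_cat. Qed.

Lemma flat_rcons (l : seq ('I_n * 'I_n)) x : flat (rcons l x) = rcons (rcons (flat l) x.1) x.2.
Proof. by rewrite -cats1 flat_cat /flat /= -!cats1 -catA. Qed.

Definition curok (h : hst) := setok (hm h) (aCF n b) (aCL n b) (vars h rcl) /\
  forall g, g \in groups (hm h) (aCF n b) (aCL n b) (vars h rcl) -> g < ngr n.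
Definition cur (h : hst) := groups (hm h) (aCF n b) (aCL n b) (vars h rcl).

Definition whitenbr (V : {set 'I_n}) (g : nat) (u : 'I_n) :=
  (u \in V) && has (fun v : 'I_n => (v \notin V) && (v %/ 64 == g)) (outnbr G u).

Lemma ord_pow (u : 'I_n) : u < 2 ^ b.
Proof. by apply: leq_trans (ltn_ord u) (lg_hi LG). Qed.

Lemma ord_grp (u : 'I_n) : u %/ 64 < ngr n.
Proof. by rewrite /ngr ltnS leq_div2r //; have := ltn_ord u; lia. Qed.

Lemma hwp_phaseA V o Q h k : nc h V -> curok h -> nxtok h -> nxt h = [::] -> outp h = o ->
  (forall h' k', nc h' V -> nxtok h' -> outp h' = o ->
     (forall x, x < 36 -> x != rnl -> x != rng -> vars h' x = vars h x) ->
     (forall i, i < nF -> hm h' (aCF n b + i) = hm h (aCF n b + i) /\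
                          hm h' (aCL n b + i) = hm h (aCL n b + i)) ->
     (forall g, (g \in nxt h') = has (whitenbr V g) (allverts n (cur h))) ->
     k' <= k + \sum_(g <- cur h) gcost (fun u => size (outnbr G u)) g -> Q h' k') ->
  hwp PhaseA Q h k.
Proof.
move=> N [so gn] X0 E0 Eo HQ; have [r1 r2 r3 r4 r5] := area_le LG.
have q1 : 1 < 2 ^ b by exact: pow_gt1.
have q64 : 64 < 2 ^ b by exact: (small_pow LG).
have q0 : 0 < 2 ^ b by exact: ltnW.
pose base (h' : hst) := [/\ nc h' V, nxtok h', outp h' = o,
   forall x, x < 36 -> x != rnl -> x != rng -> vars h' x = vars h x &
   forall a, a < aNF n b \/ aCL n b <= a < aNL n b -> hm h' a = hm h a].
pose J rem (h' : hst) := base h' /\ exists2 p, allverts n (cur h) = p ++ rem &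
   forall g, (g \in nxt h') = has (whitenbr V g) p.
have baseS h' r v : 36 <= r -> base h' -> base (setv h' r v).
  move=> lr [B1 B2 B3 B4 B5]; have E x : x < 36 -> vars (setv h' r v) x = vars h' x.
    by move=> lx /=; case: eqP => // Ex; lia.
  split=> //.
  - by apply: (nc_ext LG B1) => // x lx _ _ _; exact: E.
  - by move: B2; rewrite /nxtok /nxt !E.
  - by move=> x lx x1 x2; rewrite E // B4.
apply: (@hwp_forverts _ G w b LG _ _ _ _ _ _ _ _ J (fun u => size (outnbr G u)) _ _ _ _ _ _ so) => //.
- have [[C _ _] _ _ _] := N; rewrite /=; lia.
- lia.
- move=> rem h' [[[[C T _] _ _ _] _ _ a B5] _]; split=> //; rewrite ?(CstsE C) //.
  split; first by rewrite a.
  by move=> i li; split; apply: B5; lia.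
- move=> rem h' r v /andP [r1' r2'] [B [p Ep Hp]]; split; first exact: baseS.
  exists p => // g; rewrite -Hp; congr (_ \in _); rewrite /nxt /=.
  by case: eqP => // Ex; lia.
- move=> p0 v rem h1 k1 Ep0 [B [p Ep Hp]] E41.
  have p_p0 : p = p0.
    have : size p + size (v :: rem) = size p0 + size (v :: rem) by rewrite -!size_cat -Ep -Ep0.
    move/addIn => Es; have := congr1 (take (size p)) (etrans (esym Ep) Ep0).
    by rewrite take_size_cat // take_size_cat.
  subst p0; have [B1 B2 B3 B4 B5] := B; have [[C T gg] e33 e34 R] := B1.
  have Ep' : allverts n (cur h) = rcons p v ++ rem by rewrite cat_rcons.
  apply: hwp_seq; apply: (@hwp_get _ G _ _ LG) => //; first by rewrite E41.
  move=> h2 [a2 m2 i2 o2]; rewrite e33 e34 E41 R => e62.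
  have base2 : base h2.
    split; rewrite ?o2 ?m2 //.
    - by apply: (nc_ext LG B1) => [x lx _ _ _|a _]; rewrite ?m2 // a2 //; lia.
    - by move: B2; rewrite /nxtok /nxt m2 !a2.
    - by move=> x lx x1 x2; rewrite a2 ?B4 //; lia.
  have En2 : nxt h2 = nxt h1 by rewrite /nxt m2 a2.
  have d62 : ok b MM ($62 == 1)%hl h2 by rewrite /=.
  apply: (hwp_cond b_gt0 b_le_w) => //=; rewrite e62; last first.
    case: (boolP (v \in V)) => // nv _; apply: hwp_nop; split=> //.
    + split=> //; exists (rcons p v) => // g.
      by rewrite En2 Hp has_rcons /whitenbr (negPf nv).
    + exact: leq_addr.
    + by move=> x /andP [x1 x2]; rewrite a2 //; lia.
  case: (boolP (v \in V)) => // vV _.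
  apply: hwp_seq; apply: (hwp_iter (u := v) b_gt0 b_le_w) => //=; first by rewrite a2.
  set h3 := seti _ _ _.
  pose P q g (v : 'I_n) := has (fun v : 'I_n => (v \notin V) && (v %/ 64 == g)) q.
  pose inv j (h' : hst) k' := exists q l, [/\ outnbr G v = q ++ l, j = size l, its h' 0 = l,
     k' = k1 + size q & [/\ base h', (forall x, 36 <= x < 42 -> vars h' x = vars h1 x) &
       forall g, (g \in nxt h') = has (whitenbr V g) p || P q g v]].
  apply: (@hwp_loop _ G w b MM b_gt0 b_le_w _ _ inv _ _ _ (size (outnbr G v)) h3 k1) => //; last first.
    exists [::], (outnbr G v); rewrite addn0; split=> //; split.
    + by [].
    + by move=> x /andP [x1 x2]; rewrite /= a2 //; lia.
    + by move=> g; rewrite orbF -Hp -En2.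
  move=> j h4 k4 [q [l [Eq -> El -> [b4 a4 n4]]]]; split=> //=.
    rewrite El; case: l Eq El => //= Eq El _; rewrite cats0 in Eq; rewrite Eq; split=> //.
    + split=> //; exists (rcons p v) => // g.
      by rewrite n4 has_rcons orbC /whitenbr vV Eq.
    + by move=> x /andP [x1 x2]; apply: a4; lia.
  rewrite El; case: l Eq El => [//|u l] Eq El _; split=> //.
  apply: hwp_seq; apply: (@hwp_nxt _ G w b MM b_gt0 b_le_w 0 42 _ _ _ u l El (ord_pow u)).
  set h5 := setv _ _ _.
  have b5 : base h5 by apply: (@baseS (seti h4 0 l)).
  have [B51 B52 B53 B54 B55] := b5; have [[C5 T5 gg5] e335 e345 R5] := B51.
  apply: hwp_seq; apply: (@hwp_get _ G _ _ LG) => //=.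
  move=> h6 [a6 m6 i6 o6]; rewrite [vars h4 33]e335 [vars h4 34]e345 [rd _ _ _ _ _ _]R5 => e626.
  have base6 : base h6.
    split; rewrite ?o6 ?m6 //.
    - by apply: (nc_ext LG B51) => [x lx _ _ _|a _]; rewrite ?m6 // a6 //; lia.
    - by move: B52; rewrite /nxtok /nxt m6 !a6.
    - by move=> x lx x1 x2; rewrite a6 ?B54 //; lia.
  have En6 : nxt h6 = nxt h4 by rewrite /nxt m6 a6.
  have a6' x : 36 <= x < 42 -> vars h6 x = vars h1 x.
    move=> /andP [x1 x2]; rewrite a6; last lia.
    rewrite /=; case: eqP => [Ex|_]; [lia|apply: a4; lia].
  have fin h7 : base h7 -> its h7 = its h6 -> (forall x, 36 <= x < 42 -> vars h7 x = vars h1 x) ->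
     (forall g, (g \in nxt h7) = (g \in nxt h6) || ((u \notin V) && (u %/ 64 == g))) ->
     inv (size l) h7 (k1 + size q).+1.
    move=> b7 i7 a7 n7; exists (rcons q u), l; split=> //; first by rewrite cat_rcons.
    + by rewrite i7 i6.
    + by rewrite size_rcons addnS.
    split=> // g; rewrite n7 En6 n4 /P has_rcons.
    by rewrite -orbA; congr (_ || _); rewrite orbC.
  apply: (hwp_cond b_gt0 b_le_w) => //=; rewrite e626; last first.
    case: (boolP (u \in V)) => // uV _; apply: hwp_nop; apply: fin => // g.
    by rewrite uV orbF.
  case: (boolP (u \in V)) => // nu _.
  have E42 : vars h6 42 = u by rewrite a6.
  apply: hwp_seq; apply: (hwp_asg _ b_gt0 b_le_w) => //=; rewrite E42.
  set h7 := setv _ _ _; have b7 : base h7 by apply: baseS.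
  have [B71 B72 B73 B74 B75] := b7; have [[C7 T7 gg7] e337 e347 R7] := B71.
  apply: (@hwp_insert _ G _ _ LG) => //; first exact: ord_grp.
  move=> h8 a8 i8 o8 m8 x8 n8; apply: fin => //.
  + split=> //.
    - apply: (nc_ext LG B71) => [x lx x1 x2 _|a la]; first by apply: a8 => //; lia.
      by apply: m8; lia.
    - by rewrite o8.
    - by move=> x lx x1 x2; rewrite a8 ?B74 //; lia.
    - by move=> a la; rewrite m8 ?B75 //; lia.
  + move=> x hx; have /andP [x1 x2] := hx.
    rewrite a8; [|lia|by apply/eqP; lia|by apply/eqP; lia].
    by rewrite /=; case: eqP => [Ex|_]; [lia|exact: a6'].
  + move=> g; rewrite n8 inE nu /= orbC; congr (_ || _); exact: eq_sym.
- split; last by exists [::] => // g; rewrite E0.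
  by split=> // [[C T _] _ _ _].
- move=> h' k' [[B1 B2 B3 B4 B5] [p Ep Hp]] lk; apply: HQ => //.
  + by move=> i li; split; apply: B5; lia.
  + by move=> g; rewrite Hp Ep cats0.
Qed.

End Phases.

End Probing.
Import Probing.

(** * Sparse layers: reporting and marking the new vertices *)

Module Expansion.

Section PhasesBC.

Variables (n : nat) (G : graph n) (w b : nat).
Hypothesis LG : large n w b.

Let b_le_w := lg_w LG.
Let b_gt0 : 0 < b. Proof. by have := lg_big LG; lia. Qed.

Local Notation MM := (MM n b).
Local Notation len := (len n b).
Local Notation PP := (PP n b).
Local Notation hh := (hh n b).
Local Notation hwp := (hwp G w b MM).
Local Notation hst := (hst n).
Local Notation t := (tt b).
Local Notation nF := (nF n b).
Local Notation setok := (setok t nF).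
Local Notation groups := (groups t).
Local Notation e := (edge G).
Local Notation nc := (nc b).
Local Notation nxt := (nxt b).
Local Notation nxtok := (nxtok b).
Local Notation newv V v := (new_nbr e V v).

(** In a sparse layer the division by the window is immaterial: the two kinds of visited
    inneighbours together are all of them, whatever [ra] contains. *)
Lemma scan_found (h : hst) V (v : 'I_n) h' : nc h V -> v \notin V -> scanned G b h v h' ->
  newv V v = (0 < vars h' 51 + vars h' 52) /\
  (newv V v -> exists2 p : 'I_n, (if vars h' 51 != 0 then vars h' 53 else vars h' 54) = p &
     p \in V /\ e p v).
Proof.
move=> [_ e33 e34 R] nv [_ _ [-> ->] HI HO]; rewrite e33 e34 in HI HO *.
set I := srcI _ _ _ _ _ in HI *; set O := srcO _ _ _ _ _ in HO *.
have IO u : I u || O u = (u \in V).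
  by rewrite /I /O /srcI /srcO !R; case: (u \in V) => //=; case: inpc.
have E : newv V v = has I (innbr G v) || has O (innbr G v).
  rewrite /new_nbr nv /= -has_predU; apply/existsP/hasP => [[u /andP [uV uv]]|[u uv /=]].
    by exists u; rewrite ?mem_innbr //= IO.
  by rewrite IO => uV; exists u; rewrite uV -mem_innbr.
split; first by rewrite E; do 2 case: (has _ _).
rewrite E; case: (boolP (has I _)) HI => [_ /(_ isT) [u -> [uv Iu]] _|_ _ /= hO].
  by exists u => //; split; [rewrite -IO Iu|rewrite -mem_innbr].
have [u -> [uv Ou]] := HO hO; exists u => //.
by split; [rewrite -IO Ou orbT|rewrite -mem_innbr].
Qed.

Definition whites (V : {set 'I_n}) (p : seq 'I_n) := [seq v <- p | v \notin V].

Lemma prefix_eq (T : Type) (p p0 q : seq T) : p ++ q = p0 ++ q -> p = p0.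
Proof.
move=> E; have : size p + size q = size p0 + size q by rewrite -!size_cat E.
by move/addIn => Es; have := congr1 (take (size p)) E; rewrite take_size_cat // take_size_cat.
Qed.

Lemma adrBE i : i < 16 * PP -> aBE n b + i %/ b < MM.
Proof.
move=> li; apply: leq_trans (BE_fits (lg_big LG) (lg_lo LG) (lg_hi LG)).
rewrite ltn_add2l ltn_divLR //; move: li; rewrite /Layout.PP; lia.
Qed.

(** Bit i belongs to the i-th unvisited vertex in the order of traversal. The second pass visits the
    same vertices in the same order, so no list of vertices is stored. *)
Lemma hwp_phaseB V o Q h k : nc h V -> nxtok h -> outp h = o ->
  64 * size (nxt h) <= 16 * PP ->
  (forall h' k' l, nc h' V -> outp h' = o ++ flat l ->
     (forall x, x < 36 -> vars h' x = vars h x) ->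
     (forall a, a < aBE n b -> hm h' a = hm h a) ->
     unzip1 l = [seq v <- allverts n (nxt h) | newv V v] ->
     (forall v p, (v, p) \in l -> p \in V /\ e p v) ->
     (forall i, i < size (whites V (allverts n (nxt h))) ->
        dig 2 b (hm h') (aBE n b) i =
        nth false [seq newv V v | v <- whites V (allverts n (nxt h))] i) ->
     k' <= k + \sum_(g <- nxt h) gcost (fun u => size (innbr G u)) g -> Q h' k') ->
  hwp PhaseB Q h k.
Proof.
move=> N [so En gn] Eo lE HQ; have [r1 r2 r3 r4 r5] := area_le LG.
have [o1 o2 o3 o4 o5] := addr_order LG.
have q1 : 1 < 2 ^ b by exact: pow_gt1.
have q2 : 2 < 2 ^ b by exact: (small_pow LG).
have q0 : 0 < 2 ^ b by exact: ltnW.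
set all := allverts n (nxt h) in HQ.
have lall : size all <= 16 * PP := leq_trans (size_allverts _ _) lE.
pose good (h' : hst) p l := [/\ nc h' V, outp h' = o ++ flat l,
     (forall x, x < 36 -> vars h' x = vars h x), (forall a, a < aBE n b -> hm h' a = hm h a) &
     [/\ unzip1 l = [seq v <- p | newv V v],
     (forall v p, (v, p) \in l -> p \in V /\ e p v),
     (forall i, i < size (whites V p) ->
        dig 2 b (hm h') (aBE n b) i = nth false [seq newv V v | v <- whites V p] i) &
     vars h' 43 = size (whites V p)]].
pose J rem (h' : hst) := exists p l, all = p ++ rem /\ good h' p l.
have goodS h' p l r v : 36 <= r -> r != 43 -> good h' p l -> good (setv h' r v) p l.
  move=> lr nr [B1 B2 B3 B4 [B5 B6 B7 B8]]; have E x : x < 36 -> vars (setv h' r v) x = vars h' x.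
    by move=> lx /=; case: eqP => // Ex; lia.
  split=> //.
  - by apply: (nc_ext LG B1) => // x lx _ _ _; exact: E.
  - by move=> x lx; rewrite E // B3.
  - by split=> //=; case: eqP => // E43; rewrite -E43 in nr.
apply: hwp_seq; apply: (hwp_asg _ b_gt0 b_le_w) => //=; set h0 := setv _ _ _.
apply: (@hwp_forverts _ G w b LG _ _ _ _ (aNF n b) (aNL n b) (vars h rnl) (hm h) J (fun u => size (innbr G u))) => //.
- lia.
- move=> rem h' [p [l [_ [[[C T _] _ _ _] _ a m _]]]]; split=> //; rewrite ?(CstsE C) //.
  split; first by rewrite a.
  by move=> i li; split; apply: m; lia.
- move=> rem h' r v /andP [r1' r2'] [p [l [Ep B]]]; exists p, l; split=> //.
  by apply: goodS => //; apply/eqP; lia.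
- move=> p0 v rem h1 k1 Ep0 [p [l [Ep B]]] E41.
  have {Ep0} Ep' : p = p0 by apply: (@prefix_eq _ _ _ (v :: rem)); rewrite -Ep -Ep0.
  subst p0; have [B1 B2 B3 B4 [B5 B6 B7 B8]] := B; have [[C T gg] e33 e34 R] := B1.
  have Ep' : all = rcons p v ++ rem by rewrite cat_rcons.
  have lp : size p < 16 * PP.
    by apply: leq_trans lall; rewrite Ep size_cat /= addnS ltnS leq_addr.
  have lw : size (whites V p) < 16 * PP.
    by apply: leq_ltn_trans lp; rewrite size_filter count_size.
  apply: hwp_seq; apply: (@hwp_get _ G _ _ LG) => //; first by rewrite E41.
  move=> h2 [a2 m2 i2 o2']; rewrite e33 e34 E41 R => e62.
  have B' : good h2 p l.
    split; rewrite ?o2' ?m2 //.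
    - by apply: (nc_ext LG B1) => [x lx _ _ _|a _]; rewrite ?m2 // a2 //; lia.
    - by move=> x lx; rewrite a2 ?B3 //; lia.
    - by rewrite a2.
  have a2' x : 36 <= x < 41 -> vars h2 x = vars h1 x by move=> /andP [_ ?]; apply: a2; lia.
  apply: (hwp_cond b_gt0 b_le_w) => //=; rewrite e62; last first.
    case: (boolP (v \in V)) => // vV _; apply: hwp_nop; split=> //; last exact: leq_addr.
    exists (rcons p v), l; split=> //.
    have [D1 D2 D3 D4 [D5 D6 D7 D8]] := B'.
    have ew : whites V (rcons p v) = whites V p by rewrite /whites filter_rcons vV.
    split=> //; rewrite ew; split=> //.
    by rewrite filter_rcons /new_nbr vV.
  case: (boolP (v \in V)) => // nv _.
  have ew : whites V (rcons p v) = rcons (whites V p) v by rewrite /whites filter_rcons nv.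
  have [D1 D2 D3 D4 [D5 D6 D7 D8]] := B'; have [env2 e33' e34' R2] := D1.
  apply: hwp_seq; apply: (@hwp_scan _ G _ _ LG _ v) => //; first by rewrite a2.
  move=> h3 S3; have [En3 F3] := scan_found D1 nv S3.
  have [[a3 m3] o3' [e51 e52] _ _] := S3.
  have l51 : vars h3 51 <= 1 by rewrite e51; case: has.
  have l52 : vars h3 52 <= 1 by rewrite e52; case: has.
  apply: hwp_seq; apply: (hwp_asg _ b_gt0 b_le_w) => //=; first by sp => //; lia.
  rewrite -En3; set h4 := setv _ _ _.
  apply: hwp_seq.
  apply: (@hwp_imp _ _ _ _ _ _ (fun h5 k5 => [/\ k5 = k1 + size (innbr G v), hm h5 = hm h2,
     outp h5 = outp h2, (forall x, x < 44 -> vars h5 x = vars h2 x) &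
     vars h5 44 = newv V v /\ (newv V v -> exists2 p : 'I_n, vars h5 45 = p & p \in V /\ e p v)])).
    apply: (hwp_cond b_gt0 b_le_w) => //= /eqP E51;
      apply: (hwp_asg _ b_gt0 b_le_w) => //=; split=> //=.
    + by move=> x lx; do 2 (case: eqP => [Ex|_]; [lia|]); apply: a3; lia.
    + by split=> // /F3; rewrite E51.
    + by move=> x lx; do 2 (case: eqP => [Ex|_]; [lia|]); apply: a3; lia.
    + by split=> // /F3; rewrite E51.
  move=> h5 _ [-> m5 o5' a5 [e44 e45]].
  have a5' x : 36 <= x < 41 -> vars h5 x = vars h1 x.
    by move=> hx; rewrite a5 ?a2' //; move/andP: hx; lia.
  pose l' := if newv V v then rcons l (v, odflt v (insub (vars h5 45))) else l.
  apply: hwp_seq.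
  apply: (@hwp_imp _ _ _ _ _ _ (fun h6 k6 => [/\ k6 = k1 + size (innbr G v), hm h6 = hm h2,
     outp h6 = o ++ flat l' & vars h6 = vars h5])).
    apply: (hwp_cond b_gt0 b_le_w) => //=; rewrite e44 /l'; case: (boolP (newv V v)) e45 => // nn e45 _.
      have [q Eq _] := e45 isT.
      apply: hwp_seq; apply: (hwp_out _ b_gt0 b_le_w) => //=.
      apply: (hwp_out _ b_gt0 b_le_w) => //=; split=> //=.
      by rewrite o5' D2 flat_rcons /= Eq valK /= !rcons_cat a5 // a2 // E41.
    by apply: hwp_nop; rewrite o5' D2.
  move=> h6 _ [-> m6 o6' v6].
  have C6 : Csts b h6 by apply: Csts_eq C _ => x lx; rewrite v6 a5 ?a2 //; lia.
  have T6 : Tabs b (hm h6) by rewrite m6 m2.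
  have e43 : vars h6 43 = size (whites V p) by rewrite v6 a5.
  have e44' : vars h6 44 = newv V v by rewrite v6.
  apply: hwp_seq; apply: (@hwp_putbit _ G _ _ LG) => //=.
  - by move=> h' [a' _ _ _]; rewrite !a' //; sp.
  - by rewrite (CstsE C6) e43; exact: adrBE.
  - by rewrite e44'; case: (newv _ _).
  rewrite (CstsE C6) e43 e44' => h7 a7 i7 o7 m7.
  have e437 : vars h7 43 = size (whites V p) by rewrite a7.
  apply: (hwp_asg _ b_gt0 b_le_w) => //=.
    rewrite e437; sp => //; have := adrBE lw; have := MM_small (lg_big LG) (lg_lo LG) (lg_hi LG).
    have [_ [h126 _]] := len_n LG; have := lg_hi LG; have := len_n LG => -[? _]; lia.
  rewrite e437 addn1; split=> //; last first.
    by move=> x hx; rewrite /= (_ : x == 43 = false); [rewrite a7 ?v6 ?a5' //; move/andP: hx|apply/eqP; move/andP: hx]; lia.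
  have m7' a : a < aBE n b -> hm h7 a = hm h2 a.
    move=> la; rewrite m7 /putd m6; case: eqP => // Ea.
    by have := leq_addr (size (whites V p) %/ b) (aBE n b); lia.
  have E36 x : x < 36 -> vars (setv h7 43 (size (whites V p)).+1) x = vars h2 x.
    by move=> lx; rewrite /= (_ : x == 43 = false); [rewrite a7 ?v6 ?a5 //; lia|apply/eqP; lia].
  have ol' : outp h7 = o ++ flat l' by rewrite o7.
  exists (rcons p v), l'; split=> //; split=> //.
  - apply: (nc_ext LG D1) => [x lx _ _ _|a la]; first exact: E36.
    by apply: m7'; rewrite /aBE /aNL /aCL /aNF; lia.
  - by move=> x lx; rewrite E36 // D3.
  - by move=> a la; rewrite m7' // D4.
  rewrite ew size_rcons map_rcons filter_rcons /l'; split=> //.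
  - case: ifP => // nn; by rewrite /unzip1 map_rcons -/(unzip1 l) D5.
  - case: ifP => // nn v' q; rewrite mem_rcons inE => /orP [/eqP [-> ->]|]; last exact: D6.
    by have [q' -> H] := e45 nn; rewrite valK.
  - move=> i li; rewrite (dig_put (rho := 2) isT b_gt0 (_ : newv V v < 2) m7); last by case: (newv _ _).
    rewrite nth_rcons size_map; case: (i =P _) => [->|ne]; first by rewrite ltnn ?eqxx.
    have lt : i < size (whites V p) by lia.
    by rewrite lt -D7 //; apply: dig_same; rewrite m6.
- exists [::], [::]; split=> //; split=> //=.
  - by apply: (nc_ext LG N) => // x lx _ _ _ /=; case: eqP => // Ex; lia.
  - by rewrite cats0.
  - by move=> x lx; case: eqP => // Ex; lia.
- move=> h' k' [p [l [Ep [B1 B2 B3 B4 [B5 B6 B7 B8]]]]] lk.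
  rewrite cats0 in Ep; apply: (HQ h' k' l); rewrite ?Ep //.
Qed.

Lemma hwp_phaseC V o Q h k : nc h V -> nxtok h -> outp h = o ->
  64 * size (nxt h) <= 16 * PP ->
  (forall i, i < size (whites V (allverts n (nxt h))) ->
        dig 2 b (hm h) (aBE n b) i =
        nth false [seq newv V v | v <- whites V (allverts n (nxt h))] i) ->
  (forall h' k', nc h' (V :|: [set v in allverts n (nxt h) | newv V v]) -> outp h' = o ->
     (forall x, x < 36 -> vars h' x = vars h x) ->
     (forall a, aCF n b <= a -> hm h' a = hm h a) ->
     k' <= k + \sum_(g <- nxt h) gcost (fun _ : 'I_n => 0) g -> Q h' k') ->
  hwp PhaseC Q h k.
Proof.
move=> N [so En gn] Eo lE HB HQ; have [r1 r2 r3 r4 r5] := area_le LG.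
have [o1 o2 o3 o4 o5] := addr_order LG.
have q1 : 1 < 2 ^ b by exact: pow_gt1.
have q0 : 0 < 2 ^ b by exact: ltnW.
set all := allverts n (nxt h) in HB HQ.
have t0 := t_gt0 LG; have ug := uniq_groups t0 so.
have uall : uniq all by first [exact: (uniq_allverts LG ug)|exact: (uniq_allverts n ug)].
have lall : size all <= 16 * PP := leq_trans (size_allverts _ _) lE.
pose good (h' : hst) p := [/\ nc h' (V :|: [set v in p | newv V v]), outp h' = o,
     (forall x, x < 36 -> vars h' x = vars h x), (forall a, aCF n b <= a -> hm h' a = hm h a) &
     vars h' 43 = size (whites V p)].
pose J rem (h' : hst) := exists p, all = p ++ rem /\ good h' p.
have goodS h' p r v : 36 <= r -> r != 43 -> good h' p -> good (setv h' r v) p.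
  move=> lr nr [B1 B2 B3 B4 B5]; have E x : x < 36 -> vars (setv h' r v) x = vars h' x.
    by move=> lx /=; case: eqP => // Ex; lia.
  split=> //.
  - by apply: (nc_ext LG B1) => // x lx _ _ _; exact: E.
  - by move=> x lx; rewrite E // B3.
  - by rewrite /=; case: eqP => // E43; rewrite -E43 in nr.
apply: hwp_seq; apply: (hwp_asg _ b_gt0 b_le_w) => //=; set h0 := setv _ _ _.
apply: (@hwp_forverts _ G w b LG _ _ _ _ (aNF n b) (aNL n b) (vars h rnl) (hm h) J (fun u => 0)) => //.
- lia.
- move=> rem h' [p [_ [[[C T _] _ _ _] _ a m _]]]; split=> //; rewrite ?(CstsE C) //.
  split; first by rewrite a.
  by move=> i li; split; apply: m; lia.
- move=> rem h' r v /andP [r1' r2'] [p [Ep B]]; exists p; split=> //.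
  by apply: goodS => //; apply/eqP; lia.
- move=> p0 v rem h1 k1 Ep0 [p [Ep B]] E41.
  have {Ep0} Ep' : p = p0 by apply: (@prefix_eq _ _ _ (v :: rem)); rewrite -Ep -Ep0.
  subst p0; have [B1 B2 B3 B4 B8] := B; have [[C T gg] e33 e34 R] := B1.
  have Ep' : all = rcons p v ++ rem by rewrite cat_rcons.
  have nvp : v \notin p.
    by move: uall; rewrite Ep' cat_uniq rcons_uniq => /andP [/andP []].
  (* The updates have touched only vertices of the prefix p. So v still shows its old status, and
     the counter in register 43 still numbers the vertices outside the old set V. *)
  have ER : (v \in V :|: [set v in p | newv V v]) = (v \in V).
    by rewrite !inE (negPf nvp) /= orbF.
  have lw : size (whites V p) < 16 * PP.
    have lp : size p < 16 * PP.
      by apply: leq_trans lall; rewrite Ep size_cat /= addnS ltnS leq_addr.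
    by apply: leq_ltn_trans lp; rewrite size_filter count_size.
  apply: hwp_seq; apply: (@hwp_get _ G _ _ LG) => //; first by rewrite E41.
  move=> h2 [a2 m2 i2 o2']; rewrite e33 e34 E41 R ER => e62.
  have B' : good h2 p.
    split; rewrite ?o2' ?m2 //.
    - by apply: (nc_ext LG B1) => [x lx _ _ _|a _]; rewrite ?m2 // a2 //; lia.
    - by move=> x lx; rewrite a2 ?B3 //; lia.
    - by rewrite a2.
  have a2' x : 36 <= x < 41 -> vars h2 x = vars h1 x by move=> /andP [_ ?]; apply: a2; lia.
  have ES : (V :|: [set v0 in rcons p v | newv V v0]) =
     if newv V v then v |: (V :|: [set v0 in p | newv V v0]) else V :|: [set v0 in p | newv V v0].
    apply/setP => u; case: (boolP (newv V v)) => nn; rewrite !inE ?mem_rcons ?inE.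
      by have [->|] := eqVneq u v; rewrite ?nn ?orbT.
    by have [->|] := eqVneq u v; rewrite ?(negPf nn) ?andbF.
  apply: (hwp_cond b_gt0 b_le_w) => //=; rewrite e62; last first.
    case: (boolP (v \in V)) => // vV _; apply: hwp_nop; split=> //; last exact: leq_addr.
    exists (rcons p v); split=> //.
    have [D1 D2 D3 D4 D8] := B'.
    have ew : whites V (rcons p v) = whites V p by rewrite /whites filter_rcons vV.
    split=> //; rewrite ?ew //.
    by rewrite ES /new_nbr vV.
  case: (boolP (v \in V)) => // nv _.
  have ew : whites V (rcons p v) = rcons (whites V p) v by rewrite /whites filter_rcons nv.
  have [D1 D2 D3 D4 D8] := B'; have [[C2 T2 g2] e33' e34' R2] := D1.
  have ewall : whites V all = whites V p ++ v :: whites V rem.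
    by rewrite Ep /whites filter_cat /= nv.
  have [|||k1' E1] := @bitE_ok n w b LG h2 ($rBE)%hl ($43)%hl C2 T2.
  - by [].
  - by [].
  - by rewrite /= (CstsE C2) D8; exact: adrBE.
  apply: hwp_seq; apply: (hwp_asg _ b_gt0 b_le_w) => //.
  rewrite E1 [ev ($17)%hl h2]/= [ev ($43)%hl h2]/= (CstsE C2) D8.
  have -> : dig 2 b (hm h2) (aBE n b) (size (whites V p)) = newv V v.
    have -> : dig 2 b (hm h2) (aBE n b) (size (whites V p)) = dig 2 b (hm h) (aBE n b) (size (whites V p)).
      by apply: dig_same; apply: D4; apply: leq_trans (leq_addr _ _); rewrite /aBE /aNL /aCL /aNF; lia.
    rewrite HB ewall ?size_cat /= ?addnS ?ltnS ?leq_addr //.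
    by rewrite map_cat nth_cat size_map ltnn subnn.
  set h3 := setv _ _ _.
  have b3 : good h3 p by apply: goodS.
  apply: hwp_seq; apply: (hwp_asg _ b_gt0 b_le_w) => //=.
    rewrite D8; sp => //.
    have [_ [h126 _]] := len_n LG; have := lg_hi LG; have := len_n LG => -[? _]; lia.
  rewrite D8 addn1; set h4 := setv _ _ _.
  have [F1 F2 F3 F4 F8] := b3.
  have n4 : nc h4 (V :|: [set v in p | newv V v]).
    by apply: (nc_ext LG F1) => // x lx _ _ _; rewrite /h4 [LHS]/=; case: eqP => // Ex; lia.
  have v4 x : x < 42 -> vars h4 x = vars h2 x.
    by move=> lx; rewrite /h4 /h3 /=; do 2 (case: eqP => [Ex|_]; [lia|]).
  apply: (hwp_cond b_gt0 b_le_w) => //=; case: (boolP (newv V v)) ES => // nn ES _.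
    apply: (@hwp_putv _ G _ _ LG 41 v _ _ _ _ _ n4) => //; first by rewrite v4 ?a2.
    move=> h5 a5 i5 o5' m5 n5; split=> //; last first.
    - by move=> x hx; rewrite a5 ?v4 ?a2' //; move/andP: hx; lia.
    - exact: leq_addr.
    exists (rcons p v); split=> //; split; rewrite ?ES ?ew ?size_rcons ?o5' //.
    - by move=> x lx; rewrite a5 ?v4 ?D3 //; lia.
    - by move=> a la; rewrite m5 //; exact: D4.
    - by rewrite a5.
  apply: hwp_nop; split=> //; last first.
  - by move=> x hx; rewrite v4 ?a2' //; move/andP: hx; lia.
  - exact: leq_addr.
  exists (rcons p v); split=> //; split; rewrite ?ES ?ew ?size_rcons //.
  by move=> x lx; rewrite v4 ?D3 //; lia.
- exists [::]; split=> //; split=> //=.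
  - have -> : V :|: [set v in [::] | newv V v] = V by apply/setP => u; rewrite !inE orbF.
    by apply: (nc_ext LG N) => // x lx _ _ _ /=; case: eqP => // Ex; lia.
  - by move=> x lx; case: eqP => // Ex; lia.
- move=> h' k' [p [Ep [B1 B2 B3 B4 B5]]] lk.
  by rewrite cats0 in Ep; apply: (HQ h' k'); rewrite ?Ep.
Qed.

End PhasesBC.

End Expansion.
Import Expansion.

(** * Maintenance of the current and the next set of groups *)

Module Frontier.

Definition Clear : cmd :=
  36 ::= 0 ;;
  For 36 ($rcl)%hl (37 ::= M[$rCLb + $36] ;; Wr ($rCFb + $37)%hl (Cst 0)) ;;
  rcl ::= 0.

Definition Move : cmd :=
  36 ::= 0 ;;
  For 36 ($rnl)%hl
    (37 ::= M[$rNLb + $36] ;; Wr ($rCLb + $36)%hl ($37)%hl ;;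
     Wr ($rCFb + $37)%hl (M[$rNFb + $37])%hl ;; Wr ($rNFb + $37)%hl (Cst 0)) ;;
  rcl ::= $rnl ;; rnl ::= 0 ;; rng ::= 0.

Definition Reset : cmd :=
  36 ::= $rCFb ;; For 36 ($rCLb)%hl (Wr ($36)%hl (Cst 0)) ;;
  rcl ::= 0 ;; rnl ::= 0 ;; rng ::= 0.

Definition InsertAll : cmd := 49 ::= 0 ;; For 49 ($rG)%hl (55 ::= $49 ;; Insert).

Section SetLoops.

Variables (n : nat) (G : graph n) (w b : nat).
Hypothesis LG : large n w b.

Let b_le_w := lg_w LG.
Let b_gt0 : 0 < b. Proof. by have := lg_big LG; lia. Qed.

Local Notation MM := (MM n b).
Local Notation len := (len n b).
Local Notation hwp := (hwp G w b MM).
Local Notation hst := (hst n).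
Local Notation t := (tt b).
Local Notation nF := (nF n b).
Local Notation setok := (setok t nF).
Local Notation groups := (groups t).
Local Notation nc := (nc b).
Local Notation nxt := (nxt b).
Local Notation nxtok := (nxtok b).
Local Notation cur := (cur b).
Local Notation curok := (curok b).

(** Every listed cell is nonzero and so contains a group. Thus passes over the cell list are paid
    for by the groups. *)
Lemma cells_le m F L l : setok m F L l -> l <= size (groups m F L l).
Proof.
move=> so; have t0 := t_gt0 LG; have [u a z s] := so.
have -> : l = size (cellist m L l) by rewrite size_map size_iota.
rewrite -[X in _ <= X](size_map (fun g => g %/ t)); apply: uniq_leq_size => // c.
have -> : size (cellist m L l) = l by rewrite size_map size_iota.
move=> ci.
have lc := a _ ci; have x0 : 0 < m (F + c) by rewrite lt0n z // negbK.
apply/mapP; exists (c * t + trunc_log 2 (m (F + c))).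
  apply/flattenP; exists (celgrp t m F c); first exact: map_f.
  by apply: map_f; rewrite (bits_high x0 (s _ lc)) mem_head.
have lj : trunc_log 2 (m (F + c)) < t.
  have : trunc_log 2 (m (F + c)) \in bits t (m (F + c)) by rewrite (bits_high x0 (s _ lc)) mem_head.
  by rewrite mem_bits => /andP [].
by rewrite divnMDl // divn_small // addn0.
Qed.

Lemma nF_pow : nF < 2 ^ b.
Proof.
have [r1 r2 r3 r4 r5] := area_le LG.
apply: leq_ltn_trans (MM_small (lg_big LG) (lg_lo LG) (lg_hi LG)); lia.
Qed.

Definition same_regs (h h' : hst) := forall x, x < 36 -> x != rcl -> x != rnl -> x != rng -> vars h' x = vars h x.

Lemma hwp_clear V Q h k : nc h V -> curok h ->
  (forall h', nc h' V -> outp h' = outp h -> same_regs h h' -> vars h' rcl = 0 ->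
     vars h' rnl = vars h rnl -> vars h' rng = vars h rng ->
     (forall c, c < nF -> hm h' (aCF n b + c) = 0) ->
     (forall a, ~~ (aCF n b <= a < aNF n b) -> hm h' a = hm h a) ->
     Q h' (k + vars h rcl)) ->
  hwp Clear Q h k.
Proof.
move=> N [so gn] HQ; have [r1 r2 r3 r4 r5] := area_le LG.
have lnF := setok_size so; have [u a z s] := so.
have q0 : 0 < 2 ^ b by rewrite expn_gt0.
have lP := nF_pow.
set l := vars h rcl in so lnF u a z s HQ.
set cs := cellist (hm h) (aCL n b) l in u a z.
have Sc : size cs = l by rewrite size_map size_iota.
have Ecs i : i < l -> nth 0 cs i = hm h (aCL n b + i).
  by move=> li; rewrite (nth_map 0) ?size_iota // nth_iota.
pose J i (h' : hst) k' := [/\ nc h' V, outp h' = outp h, forall x, x < 36 -> vars h' x = vars h x,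
  k' = k + i & (forall c, c < nF -> hm h' (aCF n b + c) = if c \in take i cs then 0 else hm h (aCF n b + c)) /\
  (forall a, ~~ (aCF n b <= a < aNF n b) -> hm h' a = hm h a)].
apply: hwp_seq; apply: (hwp_asg _ b_gt0 b_le_w) => //=.
have ncS h' r v : 36 <= r -> nc h' V -> nc (setv h' r v) V.
  move=> lr B; apply: (nc_ext LG B) => // x lx _ _ _ /=; case: eqP => // Ex; lia.
apply: hwp_seq; apply: (@hwp_for _ G w b MM b_gt0 b_le_w _ _ _ l J _ 0) => //.
- exact: leq_ltn_trans lnF lP.
- split=> //=; first exact: ncS.
  + by move=> x lx; case: eqP => // Ex; lia.
  + by rewrite addn0.
  + by split=> // c lc; rewrite take0.
- by move=> i h' k' _ _ [_ _ a' _ _]; rewrite /= a'.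
- move=> i h1 k1 li E36 [N1 o1 a1 -> [m1 m1']]; have [[C T g] e33 e34 R] := N1.
  have lc : nth 0 cs i < nF by apply: a; rewrite mem_nth // Sc.
  have lb x : x < MM -> x < 2 ^ b by exact: (MM_lt LG).
  apply: hwp_seq; apply: (hwp_asg _ b_gt0 b_le_w) => //=; rewrite (CstsE C) E36.
    by sp => //; [apply: lb|]; lia.
  rewrite m1' -?Ecs //; last by apply/negP; lia.
  set c := nth 0 cs i in lc *; set h2 := setv _ _ _.
  apply: (hwp_wr _ b_gt0 b_le_w) => //=; rewrite (CstsE C).
  + by sp => //; apply: lb; lia.
  + lia.
  split=> //; split=> //=.
  + apply: ncS => //; apply: (nc_ext LG N1) => //= [x lx _ _ _|a' la'].
      by case: eqP => // Ex; lia.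
    by case: eqP => // Ea; lia.
  + by move=> x lx; do 2 (case: eqP => [Ex|_]; [lia|]); exact: a1.
  + by rewrite addnS.
  split=> [c' lc'|a' na'].
    rewrite eqn_add2l m1 // (take_nth 0) ?Sc // mem_rcons inE -/c.
    by case: (c' == c).
  by case: eqP => [Ea|_]; [move/negP: na'; lia|exact: m1'].
move=> h1 k1 E36 [N1 o1 a1 -> [m1 m1']].
apply: (hwp_asg _ b_gt0 b_le_w) => //=; apply: HQ => //=.
- apply: (nc_ext LG N1) => //= x lx _ _ nx; by rewrite (negPf nx).
- by move=> x lx nx _ _ /=; rewrite (negPf nx) a1.
- by rewrite a1.
- by rewrite a1.
- move=> c lc; rewrite m1 // take_oversize ?Sc //; case: ifP => // /negbT nc'.
  by apply/eqP; rewrite z.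
Qed.

Lemma hwp_move V Q h k : nc h V -> nxtok h -> (forall c, c < nF -> hm h (aCF n b + c) = 0) ->
  (forall h', nc h' V -> outp h' = outp h -> same_regs h h' -> curok h' -> nxtok h' ->
     nxt h' = [::] -> cur h' = nxt h -> Q h' (k + vars h rnl)) ->
  hwp Move Q h k.
Proof.
move=> N [so En gn] zC HQ; have [r1 r2 r3 r4 r5] := area_le LG.
have lnF := setok_size so; have [u a z s] := so.
have q0 : 0 < 2 ^ b by rewrite expn_gt0.
have lP := nF_pow.
set l := vars h rnl in so lnF u a z s HQ.
set cs := cellist (hm h) (aNL n b) l in u a z.
have Sc : size cs = l by rewrite size_map size_iota.
have Ecs i : i < l -> nth 0 cs i = hm h (aNL n b + i).
  by move=> li; rewrite (nth_map 0) ?size_iota // nth_iota.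
pose J i (h' : hst) k' := [/\ nc h' V, outp h' = outp h, forall x, x < 36 -> vars h' x = vars h x,
  k' = k + i & [/\ (forall c, c < nF -> hm h' (aCF n b + c) = if c \in take i cs then hm h (aNF n b + c) else 0),
  (forall c, c < nF -> hm h' (aNF n b + c) = if c \in take i cs then 0 else hm h (aNF n b + c)),
  (forall j, j < i -> hm h' (aCL n b + j) = hm h (aNL n b + j)) &
  (forall a, ~~ (aCF n b <= a < aNL n b) -> hm h' a = hm h a)]].
apply: hwp_seq; apply: (hwp_asg _ b_gt0 b_le_w) => //=.
have ncS h' r v : 36 <= r -> nc h' V -> nc (setv h' r v) V.
  move=> lr B; apply: (nc_ext LG B) => // x lx _ _ _ /=; case: eqP => // Ex; lia.
apply: hwp_seq; apply: (@hwp_for _ G w b MM b_gt0 b_le_w _ _ _ l J _ 0) => //.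
- exact: leq_ltn_trans lnF lP.
- split=> //=; first exact: ncS.
  + by move=> x lx; case: eqP => // Ex; lia.
  + by rewrite addn0.
  + by split=> // c lc; rewrite take0 ?zC.
- by move=> i h' k' _ _ [_ _ a' _ _]; rewrite /= a'.
- move=> i h1 k1 li E36 [N1 o1 a1 -> [mC mN mL m1']]; have [[C T g] e33 e34 R] := N1.
  have lc : nth 0 cs i < nF by apply: a; rewrite mem_nth // Sc.
  have lb x : x < MM -> x < 2 ^ b by exact: (MM_lt LG).
  apply: hwp_seq; apply: (hwp_asg _ b_gt0 b_le_w) => //=; rewrite (CstsE C) E36.
    by sp => //; [apply: lb|]; lia.
  rewrite m1' -?Ecs //; last by apply/negP; lia.
  set c := nth 0 cs i in lc *.
  have nci : c \notin take i cs.
    by rewrite in_take_leq ?Sc //; [rewrite index_uniq ?Sc // ltnn|exact: ltnW].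
  apply: hwp_seq; apply: (hwp_wr _ b_gt0 b_le_w) => //=; rewrite !(CstsE C) ?E36.
  + by sp => //; apply: lb; lia.
  + lia.
  apply: hwp_seq; apply: (hwp_wr _ b_gt0 b_le_w) => //=; rewrite !(CstsE C).
  + by sp => //; apply: lb; lia.
  + by sp => //; [apply: lb|]; lia.
  + lia.
  have -> : (aNF n b + c == aCL n b + i) = false by apply/eqP; lia.
  rewrite mN // (negPf nci).
  apply: (hwp_wr _ b_gt0 b_le_w) => //=; rewrite !(CstsE C).
  + by sp => //; apply: lb; lia.
  + lia.
  split=> //; split=> //=.
  + apply: ncS => //; apply: (nc_ext LG N1) => //= [x lx _ _ _|a' la'].
      by case: eqP => // Ex; lia.
    by do 3 (case: eqP => [Ea|_]; [lia|]).
  + by move=> x lx; do 2 (case: eqP => [Ex|_]; [lia|]); exact: a1.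
  + by rewrite addnS.
  have Et c' : (c' \in take i.+1 cs) = (c' == c) || (c' \in take i cs).
    by rewrite (take_nth 0) ?Sc // mem_rcons inE.
  split=> [c' lc'|c' lc'|j lj|a' na'].
  + have -> : (aCF n b + c' == aNF n b + c) = false by apply/eqP; lia.
    have -> : (aCF n b + c' == aCL n b + i) = false by apply/eqP; lia.
    by rewrite eqn_add2l Et mC //; case: eqP => [->|].
  + have -> : (aNF n b + c' == aCF n b + c) = false by apply/eqP; lia.
    have -> : (aNF n b + c' == aCL n b + i) = false by apply/eqP; lia.
    by rewrite eqn_add2l Et mN //; case: eqP.
  + have -> : (aCL n b + j == aNF n b + c) = false by apply/eqP; lia.
    have -> : (aCL n b + j == aCF n b + c) = false by apply/eqP; lia.
    rewrite eqn_add2l; case: eqP => [->|ne]; first by rewrite /c Ecs.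
    by apply: mL; lia.
  + by move/negP: na' => na'; do 3 (case: eqP => [Ea|_]; [lia|]); apply: m1'; apply/negP; lia.
move=> h1 k1 E36 [N1 o1 a1 -> [mC mN mL m1']].
have tcs : take l cs = cs by rewrite take_oversize ?Sc.
rewrite tcs in mC mN.
apply: hwp_seq; apply: (hwp_asg _ b_gt0 b_le_w) => //=.
apply: hwp_seq; apply: (hwp_asg _ b_gt0 b_le_w) => //=.
apply: (hwp_asg _ b_gt0 b_le_w) => //=; rewrite a1 // -/l.
have Ecl : cellist (hm h1) (aCL n b) l = cs.
  by apply/eq_in_map => i; rewrite mem_iota => /andP [_ li]; rewrite mL.
have soC : setok (hm h1) (aCF n b) (aCL n b) l.
  rewrite /GroupSets.setok Ecl; split=> // c lc; rewrite mC //.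
    by rewrite -z //; case: ifP => // /negbT; rewrite -z // => /eqP ->.
  by case: ifP => _; [exact: s|rewrite expn_gt0].
have Eg : groups (hm h1) (aCF n b) (aCL n b) l = nxt h.
  rewrite /GroupOps.nxt /GroupSets.groups Ecl -/l -/cs; congr flatten; apply/eq_in_map => c ci.
  by rewrite /celgrp mC ?ci //; exact: a.
have soN : setok (hm h1) (aNF n b) (aNL n b) 0.
  apply: setok0 => c lc; rewrite mN //; case: ifP => // /negbT; rewrite -z //.
  by move/eqP.
apply: HQ => //=.
- by apply: (nc_ext LG N1) => //= x lx n1 n2 n3; rewrite (negPf n1) (negPf n2) (negPf n3).
- by move=> x lx n1 n2 n3; rewrite /= (negPf n1) (negPf n2) (negPf n3) a1.
- by split=> //= g; rewrite Eg; exact: gn.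
Qed.

(** A dense layer overwrites the areas of both sets with digits and bits, so nothing is known about
    their flags afterwards. *)
Lemma hwp_reset V Q h k : nc h V ->
  (forall h', nc h' V -> outp h' = outp h -> same_regs h h' -> nxtok h' ->
     vars h' rcl = 0 -> nxt h' = [::] ->
     (forall c, c < nF -> hm h' (aCF n b + c) = 0) -> Q h' (k + 2 * nF)) ->
  hwp Reset Q h k.
Proof.
move=> N HQ; have [r1 r2 r3 r4 r5] := area_le LG.
have [[C0 _ _] _ _ _] := N.
have q0 : 0 < 2 ^ b by rewrite expn_gt0.
have MMs := MM_small (lg_big LG) (lg_lo LG) (lg_hi LG).
pose J i (h' : hst) k' := [/\ nc h' V, outp h' = outp h, forall x, x < 36 -> vars h' x = vars h x,
  k' + aCF n b = k + i & aCF n b <= i /\ (forall a, aCF n b <= a < i -> hm h' a = 0)].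
apply: hwp_seq; apply: (hwp_asg _ b_gt0 b_le_w) => //=.
have ncS h' r v : 36 <= r -> nc h' V -> nc (setv h' r v) V.
  move=> lr B; apply: (nc_ext LG B) => // x lx _ _ _ /=; case: eqP => // Ex; lia.
apply: hwp_seq; apply: (@hwp_for _ G w b MM b_gt0 b_le_w _ _ _ (aCL n b) J _ (aCF n b)) => //.
- lia.
- lia.
- by rewrite /= (CstsE C0).
- split=> //=; first exact: ncS.
  + by move=> x lx; case: eqP => // Ex; lia.
  + by split=> // a ha; lia.
- by move=> i h' k' _ _ [[[C _ _] _ _ _] _ a' _ _]; rewrite /= (CstsE C).
- move=> i h1 k1 li E36 [N1 o1 a1 Ek [li' m1]].
  apply: (hwp_wr _ b_gt0 b_le_w) => //=; rewrite E36; first lia.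
  split=> //.
  split=> //=.
  + apply: ncS => //; apply: (nc_ext LG N1) => //= a' la'.
    by case: eqP => // Ea; lia.
  + by move=> x lx; case: eqP => [Ex|_]; [lia|exact: a1].
  + lia.
  + split=> [|a ha]; first lia.
    by case: eqP => // ne; apply: m1; lia.
move=> h1 k1 E36 [N1 o1 a1 Ek [_ m1]].
have -> : k1 = k + 2 * nF by lia.
apply: hwp_seq; apply: (hwp_asg _ b_gt0 b_le_w) => //=.
apply: hwp_seq; apply: (hwp_asg _ b_gt0 b_le_w) => //=.
apply: (hwp_asg _ b_gt0 b_le_w) => //=.
apply: HQ => //=.
- by apply: (nc_ext LG N1) => //= x lx n1 n2 n3; rewrite (negPf n1) (negPf n2) (negPf n3).
- by move=> x lx n1 n2 n3; rewrite /= (negPf n1) (negPf n2) (negPf n3) a1.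
- split=> //=; apply: setok0 => c lc; apply: m1; lia.
- by move=> c lc; apply: m1; lia.
Qed.

(** After a dense layer it is not known which groups received new vertices; taking all of them costs
    O(n + m), which the new vertices of that layer can pay. *)
Lemma hwp_insertall V Q h k : nc h V -> nxtok h -> nxt h = [::] -> 
  (forall h', nc h' V -> outp h' = outp h -> same_regs h h' -> nxtok h' -> vars h' rcl = vars h rcl ->
     (forall g, g < ngr n -> g \in nxt h') ->
     (forall c, c < nF -> hm h' (aCF n b + c) = hm h (aCF n b + c)) -> Q h' (k + ngr n)) ->
  hwp InsertAll Q h k.
Proof.
move=> N X E0 HQ; have [r1 r2 r3 r4 r5] := area_le LG.
have q0 : 0 < 2 ^ b by rewrite expn_gt0.
pose J i (h' : hst) k' := [/\ nc h' V, outp h' = outp h, same_regs h h' /\ vars h' rcl = vars h rcl,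
  k' = k + i & [/\ nxtok h', forall g, g < i -> g \in nxt h' &
   (forall c, c < nF -> hm h' (aCF n b + c) = hm h (aCF n b + c))]].
apply: hwp_seq; apply: (hwp_asg _ b_gt0 b_le_w) => //=.
have ncS h' r v : 36 <= r -> nc h' V -> nc (setv h' r v) V.
  move=> lr B; apply: (nc_ext LG B) => // x lx _ _ _ /=; case: eqP => // Ex; lia.
apply: (@hwp_for _ G w b MM b_gt0 b_le_w _ _ _ (ngr n) J _ 0) => //.
- exact: ngr_lt LG.
- split=> //=; first exact: ncS.
  + by split=> // x lx _ _ _ /=; case: eqP => // Ex; lia.
  + by rewrite addn0.
- by move=> i h' k' _ _ [[[C _ _] _ _ _] _ _ _ _]; rewrite /= (CstsE C).
- move=> i h1 k1 li E49 [N1 o1 [a1 a1'] -> [X1 g1 m1]].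
  apply: hwp_seq; apply: (hwp_asg _ b_gt0 b_le_w) => //=; rewrite E49.
  set h2 := setv _ _ _; have N2 : nc h2 V by exact: ncS.
  have [[C2 T2 _] _ _ _] := N2.
  apply: (@hwp_insert _ G _ _ LG) => // h3 a3 i3 o3 m3 X3 n3.
  have N3 : nc h3 V.
    by apply: (nc_ext LG N2) => [x lx y1 y2 _|a la]; [apply: a3 => //; lia|apply: m3; lia].
  split; first by rewrite a3.
  split=> //=.
  + exact: ncS.
  + by rewrite o3.
  + split=> [x lx y0 y1 y2 /=|]; last by rewrite /= a3.
    case: eqP => [Ex|_]; first lia.
    rewrite a3 //; last lia. by rewrite /= (_ : x == 55 = false) ?a1 //; apply/eqP; lia.
  + by rewrite addnS.
  split=> //.
  + move=> g; rewrite ltnS leq_eqVlt => /orP [/eqP ->|lg]; rewrite /GroupOps.nxt /= -/(nxt h3) n3 inE.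
      by rewrite eqxx.
    by apply/orP; right; exact: (g1 _ lg).
  + by move=> c lc; rewrite /= m3 ?m1 //; lia.
- by move=> h1 k1 E49 [N1 o1 [a1 a1'] -> [X1 g1 m1]]; exact: HQ.
Qed.

End SetLoops.

End Frontier.
Import Frontier.

(** * Exchange of pieces, positions, and the test of a single vertex *)

Module Pieces.

Definition Swap : cmd :=
  38 ::= $rW + $ra %/ $rB ;; 36 ::= 0 ;;
  For 36 ($rH)%hl
    (39 ::= M[$rX + $36] ;; Wr ($rX + $36)%hl (M[$38 + $36])%hl ;;
     Wr ($38 + $36)%hl ($39)%hl).

Definition Excl : cmd :=
  44 ::= 0 ;; Get 37 ;;
  Cond ($62 == 0)%hl (Scan 37 ;; Cond ($51)%hl (Cond ($52)%hl Nop (44 ::= 1)) Nop) Nop.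

Definition Test : cmd :=
  Get 37 ;; 48 ::= $62 ;;
  Cond ($62 == 0)%hl
    (Scan 37 ;;
     Cond ($51)%hl (48 ::= 2 ;; Out ($37)%hl ;; Out ($53)%hl)
       (Cond ($52)%hl (48 ::= 2 ;; Out ($37)%hl ;; Out ($54)%hl) Nop)) Nop.

(* A vertex for which $49 is set was reported already, while the bits of the
   piece were still those of the previous layer. *)
Definition Test2 : cmd :=
  Get 37 ;; 48 ::= $62 ;;
  Cond ($62 == 0)%hl
    (Scan 37 ;;
     Cond ($49)%hl (48 ::= 2)
       (Cond ($52)%hl (48 ::= 2 ;; Out ($37)%hl ;; Out ($54)%hl) Nop)) Nop.

Section Critical.

Variables (n : nat) (G : graph n) (w b : nat).
Hypothesis LG : large n w b.

Let b_le_w := lg_w LG.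
Let b_gt0 : 0 < b. Proof. by have := lg_big LG; lia. Qed.

Local Notation MM := (MM n b).
Local Notation len := (len n b).
Local Notation PP := (PP n b).
Local Notation QQ := (QQ n b).
Local Notation hh := (hh n b).
Local Notation k3 := (k3 b).
Local Notation hwp := (hwp G w b MM).
Local Notation hst := (hst n).
Local Notation inpc := (inpc n b).
Local Notation e := (edge G).
Local Notation nc := (nc b).
Local Notation env := (env b).
Implicit Types (V D Z : {set 'I_n}) (h : hst).

(** Vertices of the piece have no position; the value [len] places them beyond all positions, so a
    comparison such as [ppos a u < lim] also excludes the piece. *)
Definition ppos (a u : nat) := if inpc a u then len else if u < len then u else u - len + a.
Definition vert (a p : nat) := if inpc a p then p - a + len else p.

(** A piece consists of whole cells, so that it can be exchanged cell by cell. It starts at [QQ] or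
    later, so the low positions are ordinary vertices, and it ends by [len], so it is disjoint from
    the last [PP] vertices that fill its gap. *)
Definition piece (a : nat) := [/\ QQ <= a, a + PP <= len & a %% b = 0].

Lemma vertP a p : piece a -> p < len -> vert a p < n /\ ppos a (vert a p) = p.
Proof.
have [eln [_ _]] := len_n LG; move=> [a1 a2 _] lp; rewrite /ppos /vert /Scans.inpc.
case: (boolP ((a <= p) && (p - a < PP))) => h; case: (boolP (_ && _)) => h2; try case: ifP => h3; lia.
Qed.

Lemma pposP a u : piece a -> u < n -> ppos a u < len -> vert a (ppos a u) = u.
Proof.
have [eln [_ _]] := len_n LG; move=> [a1 a2 _] lp; rewrite /ppos /vert /Scans.inpc.
case: (boolP ((a <= u) && (u - a < PP))) => h; first lia.
by case: ifP => h3 lp2; case: (boolP (_ && _)) => h2; lia.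
Qed.

Lemma ppos_lt a u : piece a -> u < n -> (ppos a u < len) = ~~ inpc a u.
Proof.
have [eln [_ _]] := len_n LG; move=> [a1 a2 _] lp; rewrite /ppos /Scans.inpc.
case: (boolP ((a <= u) && (u - a < PP))) => h; first lia.
by case: ifP; lia.
Qed.

Lemma ppos_low a p : piece a -> p < QQ -> ppos a p = p /\ vert a p = p.
Proof.
have [eln [h126 h0]] := len_n LG; move=> [a1 a2 _] lp; rewrite /ppos /vert /Scans.inpc.
have -> : (a <= p) && (p - a < PP) = false by lia.
by have -> : p < len by lia.
Qed.

Lemma rdE m sa lim u : rd n b m sa lim u =
  if inpc sa u then dig 2 b m (aX b) (u - sa)
  else if ppos sa u < lim then dig 2 b m (aW n b) (ppos sa u) else dig 3 k3 m (aT n b) (ppos sa u).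
Proof. by rewrite /rd /ppos /Scans.inpc; case: ifP. Qed.

(** Going down, the cell that receives digit p lies above the cells of all remaining bits, and the
    digits of higher positions are preserved as other digits of the array. *)
Lemma rd_conv m m' a p d u : piece a -> p < len -> d < 3 -> u < n ->
  m' =1 putd_mod 3 k3 m (aT n b) p d ->
  rd n b m' a p u = if ppos a u == p then d else rd n b m a p.+1 u.
Proof.
move=> pa lp ld lu Em; have [_ _ o3 o4 _] := addr_order LG; have [o1 o2 _ _ _] := addr_order LG.
have k0 := k3_gt0 (lg_big LG) (lg_lo LG) (lg_hi LG).
have D := dig_put_mod (rho := 3) isT k0 ld Em.
have Elow x : x < aW n b -> m' x = m x.
  move=> lx; rewrite Em /putd_mod; case: eqP => // Ex; have := leq0n (p %/ k3); rewrite /aT in Ex; lia.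
rewrite !rdE; case: (boolP (inpc a u)) => iu.
  have -> : ppos a u == p = false by rewrite /ppos iu; lia.
  apply: dig_same; apply: Elow; move: iu => /andP [_ l2]; have := adrX LG l2; lia.
have lpu : ppos a u < len by rewrite ppos_lt.
rewrite ltnS; case: (ltngtP (ppos a u) p) => [l1|l1|->].
- apply: dig_same; rewrite Em /putd_mod; case: eqP => // Ex.
  have := adrW LG p; have := leq_div2r b (ltnW l1); rewrite -[X in _ < X]Ex; lia.
- by rewrite D (gtn_eqF l1).
- by rewrite D eqxx.
Qed.

(** The mirror image: going up, the cell that receives bit p lies below the cells of all digits
    still to be read. *)
Lemma rd_back m m' a p d u : piece a -> p < len -> d < 2 -> u < n ->
  m' =1 putd 2 b m (aW n b) p d ->
  rd n b m' a p.+1 u = if ppos a u == p then d else rd n b m a p u.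
Proof.
move=> pa lp ld lu Em; have [o1 o2 o3 o4 _] := addr_order LG.
have D := dig_put (rho := 2) isT b_gt0 ld Em.
have Elow x : x < aW n b -> m' x = m x.
  move=> lx; rewrite Em /putd; case: eqP => // Ex; have := leq0n (p %/ b); lia.
rewrite !rdE; case: (boolP (inpc a u)) => iu.
  have -> : ppos a u == p = false by rewrite /ppos iu; lia.
  apply: dig_same; apply: Elow; move: iu => /andP [_ l2]; have := adrX LG l2; lia.
have lpu : ppos a u < len by rewrite ppos_lt.
rewrite ltnS; case: (ltngtP (ppos a u) p) => [l1|l1|->].
- by rewrite D (ltn_eqF l1).
- apply: dig_same; rewrite Em /putd; case: eqP => // Ex.
  have := adrW LG p; have := leq_div2r k3 (ltnW l1); rewrite -Ex; lia.
- by rewrite D eqxx.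
Qed.

Definition swapped (m m' : nat -> nat) a :=
  [/\ forall j, j < hh -> m' (aX b + j) = m (aW n b + a %/ b + j),
      forall j, j < hh -> m' (aW n b + a %/ b + j) = m (aX b + j)
    & forall x, x < aW n b -> ~~ (aX b <= x < aX b + hh) -> m' x = m x] /\
  (forall x, aW n b <= x -> ~~ (aW n b + a %/ b <= x < aW n b + a %/ b + hh) -> m' x = m x).

Lemma dig_shift m m' x y i j : i %% b = j %% b -> m' (x + i %/ b) = m (y + j %/ b) ->
  dig 2 b m' x i = dig 2 b m y j.
Proof. by rewrite /dig => -> ->. Qed.

Lemma divmod_sub a u : a %% b = 0 -> a <= u ->
  (u - a) %% b = u %% b /\ u %/ b = a %/ b + (u - a) %/ b.
Proof.
move=> a0 le; have Ea : a = a %/ b * b by have := divn_eq a b; rewrite a0 addn0.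
have Eu : u = a %/ b * b + (u - a) by rewrite -Ea subnKC.
have E1 := modnMDl (a %/ b) (u - a) b; have E2 := divnMDl (a %/ b) (u - a) b_gt0.
by rewrite -Eu in E1 E2; rewrite E1 E2.
Qed.

Lemma divb_lt x : x < PP -> x %/ b < hh.
Proof. by move=> lx; rewrite ltn_divLR // mulnC. Qed.

(** The exchange brings the bits of the piece to [aX] and those of the last [PP] vertices into the
    gap; changing [rsa] from [len] to a makes the reading follow. *)
Lemma rd_swap_in m m' a u : piece a -> swapped m m' a -> u < n ->
  rd n b m' a len u = rd n b m len len u.
Proof.
move=> pa [[s1 s2 s3] s4] lu; have [eln [h126 h0]] := len_n LG.
have [o1 o2 o3 o4 _] := addr_order LG; have [a1 a2 a3] := pa.
rewrite !rdE; case: (boolP (inpc a u)) => iu.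
  have /andP [i1 i2] := iu.
  have ni : inpc len u = false by rewrite /Scans.inpc; lia.
  have ul : u < len by lia.
  have -> : ppos len u = u by rewrite /ppos ni ul.
  rewrite ni.
  have -> : u < len by lia.
  have [E1 E2] := divmod_sub a3 i1.
  by apply: dig_shift => //; rewrite s1 ?divb_lt // E2 addnA.
have lpu : ppos a u < len by rewrite ppos_lt.
rewrite lpu; case: (boolP (inpc len u)) => iu2.
  have /andP [i1 i2] := iu2.
  have -> : ppos a u = u - len + a by rewrite /ppos (negPf iu); case: ifP; lia.
  have [E1 E2] := @divmod_sub a (u - len + a) a3 (leq_addl _ _).
  rewrite addnK in E1 E2.
  by apply: dig_shift => //; rewrite E2 addnA s2 ?divb_lt.
have lu2 : u < len by move: iu2; rewrite /Scans.inpc; lia.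
have -> : ppos len u = u by rewrite /ppos (negPf iu2) lu2.
have -> : ppos a u = u by rewrite /ppos (negPf iu) lu2.
rewrite lu2; apply: dig_same; apply: s4; first exact: leq_addr.
(* As a is a multiple of b, the exchanged cells hold the bits of exactly the numbers in the piece,
   and u is not one of them. *)
apply/negP => /andP [h1 h2]; case/negP: iu.
have Ea : a = a %/ b * b by have := divn_eq a b; rewrite a3 addn0.
have h1' : a %/ b <= u %/ b by lia.
have h2' : u %/ b < a %/ b + hh by lia.
have g1 : a <= u by rewrite Ea; apply: leq_trans (leq_divM u b); rewrite leq_mul2r h1' orbT.
rewrite /Scans.inpc g1 /=.
have : u < (a %/ b + hh) * b by rewrite -ltn_divLR.
by rewrite mulnDl -Ea /Layout.PP; lia.
Qed.

Lemma rd_swap_out m m' a u : piece a -> swapped m m' a -> u < n ->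
  rd n b m' len len u = rd n b m a len u.
Proof.
move=> pa [[s1 s2 s3] s4] lu; have [eln [h126 h0]] := len_n LG.
have [o1 o2 o3 o4 _] := addr_order LG; have [a1 a2 a3] := pa.
rewrite !rdE; case: (boolP (inpc a u)) => iu.
  have /andP [i1 i2] := iu.
  have ni : inpc len u = false by rewrite /Scans.inpc; lia.
  have ul : u < len by lia.
  have -> : ppos len u = u by rewrite /ppos ni ul.
  rewrite ni.
  have -> : u < len by lia.
  have [E1 E2] := divmod_sub a3 i1.
  by apply: dig_shift => //; rewrite E2 addnA s2 ?divb_lt.
have lpu : ppos a u < len by rewrite ppos_lt.
rewrite lpu; case: (boolP (inpc len u)) => iu2.
  have /andP [i1 i2] := iu2.
  have -> : ppos a u = u - len + a by rewrite /ppos (negPf iu); case: ifP; lia.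
  have [E1 E2] := @divmod_sub a (u - len + a) a3 (leq_addl _ _).
  rewrite addnK in E1 E2.
  by apply: dig_shift => //; rewrite s1 ?divb_lt // E2 addnA.
have lu2 : u < len by move: iu2; rewrite /Scans.inpc; lia.
have -> : ppos len u = u by rewrite /ppos (negPf iu2) lu2.
have -> : ppos a u = u by rewrite /ppos (negPf iu) lu2.
rewrite lu2; apply: dig_same; apply: s4; first exact: leq_addr.
apply/negP => /andP [h1 h2]; case/negP: iu.
have Ea : a = a %/ b * b by have := divn_eq a b; rewrite a3 addn0.
have h1' : a %/ b <= u %/ b by lia.
have h2' : u %/ b < a %/ b + hh by lia.
have g1 : a <= u by rewrite Ea; apply: leq_trans (leq_divM u b); rewrite leq_mul2r h1' orbT.
rewrite /Scans.inpc g1 /=.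
have : u < (a %/ b + hh) * b by rewrite -ltn_divLR.
by rewrite mulnDl -Ea /Layout.PP; lia.
Qed.

Lemma piece_MM a : piece a -> aW n b + a %/ b + hh <= MM.
Proof.
move=> [a1 a2 a3]; have l2 : a %/ b + hh <= len %/ b.
  by rewrite leq_divRL // mulnDl; have := leq_divM a b; rewrite /Layout.PP in a2; lia.
have k0 := k3_gt0 (lg_big LG) (lg_lo LG) (lg_hi LG).
have k2 := k3_two_thirds (lg_big LG) (lg_lo LG) (lg_hi LG).
have l3 : len %/ b <= len %/ k3 by apply: leq_div2l => //; lia.
by rewrite /Layout.MM /aT; move: (len %/ k3) (len %/ b) (a %/ b) l2 l3 => x y z; lia.
Qed.

Lemma hwp_swap a Q h k : piece a -> Csts b h -> vars h ra = a ->
  (forall h', (forall x, x < 36 -> vars h' x = vars h x) -> its h' = its h -> outp h' = outp h ->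
     swapped (hm h) (hm h') a -> Q h' (k + hh)) ->
  hwp Swap Q h k.
Proof.
move=> pa C Era HQ; have q0 : 0 < 2 ^ b by rewrite expn_gt0.
have [o1 o2 o3 o4 o5] := addr_order LG; have pM := piece_MM pa.
have lM x : x < MM -> x < 2 ^ b by exact: (MM_lt LG).
have lhM : hh < MM by have := leq0n (a %/ b); lia.
have [_ [_ h0]] := len_n LG; have qa := leq0n (a %/ b).
pose m := hm h.
pose J i (h' : hst) k' := [/\ (forall x, x < 36 -> vars h' x = vars h x) /\ vars h' 38 = aW n b + a %/ b,
  its h' = its h, outp h' = outp h, k' = k + i &
  forall x, hm h' x = if (aX b <= x) && (x < aX b + i) then m (aW n b + a %/ b + (x - aX b))
    else if (aW n b + a %/ b <= x) && (x < aW n b + a %/ b + i) then m (aX b + (x - (aW n b + a %/ b)))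
    else m x].
have C' (h' : hst) : (forall x, x < 36 -> vars h' x = vars h x) -> Csts b h'.
  by move=> E; apply: Csts_eq C _ => x lx; apply: E; lia.
apply: hwp_seq; apply: (hwp_asg _ b_gt0 b_le_w) => //=; rewrite !(CstsE C) Era.
  by sp => //; apply: lM; lia.
apply: hwp_seq; apply: (hwp_asg _ b_gt0 b_le_w) => //=.
apply: (@hwp_for _ G w b MM b_gt0 b_le_w _ _ _ hh J _ 0) => //.
- exact: lM.
- split=> //=.
  + by split=> // x lx; do 2 (case: eqP => [?|_]; [lia|]).
  + by rewrite addn0.
  + by move=> x; case: ifP => h1; [lia|case: ifP => h2; [lia|]].
- by move=> i h' k' _ _ [[a1 _] _ _ _ _]; rewrite /= (CstsE (C' _ a1)).
- move=> i h1 k1 li E36 [[a1 e38] i1 oo1 -> m1]; have C1 := C' _ a1.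
  apply: hwp_seq; apply: (hwp_asg _ b_gt0 b_le_w) => //=; rewrite (CstsE C1) E36.
    by sp => //; [apply: lM|]; lia.
  apply: hwp_seq; apply: (hwp_wr _ b_gt0 b_le_w) => //=; rewrite ?(CstsE C1) E36 ?e38.
  + by sp => //; apply: lM; lia.
  + by sp => //; [apply: lM|]; lia.
  + lia.
  apply: (hwp_wr _ b_gt0 b_le_w) => //=; rewrite E36 e38.
  + by sp => //; apply: lM; lia.
  + lia.
  split=> //; split=> //=.
  + split=> [x lx|]; last exact: e38.
    by do 2 (case: eqP => [?|_]; [lia|]); exact: a1.
  + by rewrite addnS.
  move=> x; rewrite !m1; move: (leq0n (a %/ b)) => q1.
  have -> : (aX b <= aX b + i) && (aX b + i < aX b + i) = false by lia.
  have -> : (aW n b + a %/ b <= aX b + i) && (aX b + i < aW n b + a %/ b + i) = false by lia.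
  have -> : (aX b <= aW n b + a %/ b + i) && (aW n b + a %/ b + i < aX b + i) = false by lia.
  have -> : (aW n b + a %/ b <= aW n b + a %/ b + i) && (aW n b + a %/ b + i < aW n b + a %/ b + i) = false by lia.
  case: eqP => [->|n1].
    have -> : (aX b <= aW n b + a %/ b + i) && (aW n b + a %/ b + i < aX b + i.+1) = false by lia.
    have -> : (aW n b + a %/ b <= aW n b + a %/ b + i) && (aW n b + a %/ b + i < aW n b + a %/ b + i.+1) = true by lia.
    by congr m; lia.
  case: eqP => [->|n2].
    have -> : (aX b <= aX b + i) && (aX b + i < aX b + i.+1) = true by lia.
    by congr m; lia.
  have -> : (aX b <= x) && (x < aX b + i.+1) = (aX b <= x) && (x < aX b + i) by lia.
  have -> : (aW n b + a %/ b <= x) && (x < aW n b + a %/ b + i.+1) =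
     (aW n b + a %/ b <= x) && (x < aW n b + a %/ b + i) by lia.
  by [].
move=> h1 k1 E36 [[a1 e38] i1 oo1 -> m1]; apply: HQ => //; move: (leq0n (a %/ b)) => q1.
split; first split=> [j lj|j lj|x lx nx]; rewrite ?m1.
- have -> : (aX b <= aX b + j) && (aX b + j < aX b + hh) = true by lia.
  by rewrite addKn.
- have -> : (aX b <= aW n b + a %/ b + j) && (aW n b + a %/ b + j < aX b + hh) = false by lia.
  have -> : (aW n b + a %/ b <= aW n b + a %/ b + j) && (aW n b + a %/ b + j < aW n b + a %/ b + hh) = true by lia.
  by rewrite addKn.
- by rewrite (negPf nx); case: ifP => //; lia.
- by move=> x lx nx; rewrite m1 (negPf nx); case: ifP => //; lia.
Qed.

Definition exI (V : {set 'I_n}) a v := has (fun u : 'I_n => (u \in V) && inpc a u) (innbr G v).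
Definition exO (V : {set 'I_n}) a v := has (fun u : 'I_n => (u \in V) && ~~ inpc a u) (innbr G v).
(** These new vertices lose all recognizable parents when the bits of the piece are updated; they
    are the exceptional ones. *)
Definition excl (V : {set 'I_n}) a (v : 'I_n) := [&& v \notin V, exI V a v & ~~ exO V a v].

Lemma newE V a v : new_nbr e V v = (v \notin V) && (exI V a v || exO V a v).
Proof.
rewrite /new_nbr; congr andb; apply/existsP/orP.
  case=> u /andP [uV euv]; have ui : u \in innbr G v by rewrite mem_innbr.
  by case: (boolP (inpc a u)) => iu; [left|right]; apply/hasP; exists u; rewrite ?uV ?iu.
by case=> /hasP [u]; rewrite mem_innbr => euv /andP [uV _]; exists u; rewrite uV.
Qed.

Lemma hwp_scan2 r (v : 'I_n) (Z : {set 'I_n}) Q h k : r < 50 -> vars h r = v -> env h ->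
  (forall u : 'I_n, (rd n b (hm h) (vars h rsa) (vars h rlim) u == 1) = (u \in Z)) ->
  (forall h', (forall x, x < 50 -> vars h' x = vars h x) -> hm h' = hm h -> outp h' = outp h ->
     vars h' 51 = exI Z (vars h ra) v -> vars h' 52 = exO Z (vars h ra) v ->
     (exI Z (vars h ra) v -> exists2 u : 'I_n, vars h' 53 = u & u \in Z /\ e u v) ->
     (exO Z (vars h ra) v -> exists2 u : 'I_n, vars h' 54 = u & [/\ u \in Z, ~~ inpc (vars h ra) u & e u v]) ->
     Q h' (k + size (innbr G v))) ->
  hwp (Scan r) Q h k.
Proof.
move=> lr Er en HZ HQ; apply: (hwp_scan LG lr Er en) => h' [[a1 m1] o1 [e1 e2] p1 p2].
have EI : has (srcI b (hm h) (vars h rsa) (vars h rlim) (vars h ra)) (innbr G v) = exI Z (vars h ra) v.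
  by apply: eq_has => u; rewrite /srcI HZ.
have EO : has (srcO b (hm h) (vars h rsa) (vars h rlim) (vars h ra)) (innbr G v) = exO Z (vars h ra) v.
  by apply: eq_has => u; rewrite /srcO HZ.
rewrite EI in e1 p1; rewrite EO in e2 p2.
apply: HQ => //.
- by case/p1 => u Eu [ui]; rewrite /srcI HZ mem_innbr in ui * => /andP [uZ _]; exists u.
- by case/p2 => u Eu [ui]; rewrite /srcO HZ mem_innbr in ui * => /andP [uZ iu]; exists u.
Qed.

(** Within a layer any order of output is legal, so the progress is described by the set D of
    vertices dealt with, and the order in which they are treated is free. *)
Definition part V (D : {set 'I_n}) l := [/\ uniq (unzip1 l),
  forall v, (v \in unzip1 l) = (v \in D) && new_nbr e V v &
  forall v p, (v, p) \in l -> p \in V /\ e p v].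

Definition indeg (v : 'I_n) := (size (innbr G v)).+1.
Definition cst (D : {set 'I_n}) := \sum_(v in D) indeg v.

Lemma part0 V : part V set0 [::].
Proof. by split=> // v; rewrite inE. Qed.

Lemma part_eq V (D D' : {set 'I_n}) l : part V D l -> D =i D' -> part V D' l.
Proof. by move=> [p1 p2 p3] E; split=> // v; rewrite -E. Qed.

Lemma part_step V (D D' : {set 'I_n}) v l l' : part V D l -> v \notin D ->
  (forall u, (u \in D') = (u == v) || (u \in D)) ->
  (if new_nbr e V v then exists2 p, p \in V /\ e p v & l' = rcons l (v, p) else l' = l) ->
  part V D' l'.
Proof.
move=> [p1 p2 p3] nv ED; case: ifP => [nn [p [pV ep] ->]|nn ->].
  split; rewrite /unzip1 ?map_rcons.
  - by rewrite rcons_uniq p1 andbT p2 (negPf nv).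
  - move=> u; rewrite mem_rcons inE p2 ED /=; case: eqP => [->|_] //=; by rewrite nn.
  - by move=> u q; rewrite mem_rcons inE => /orP [/eqP [-> ->]|/p3].
split=> // u; rewrite p2 ED; case: eqP => [->|_] //=; by rewrite nn (negPf nv).
Qed.

Lemma cst_step (D D' : {set 'I_n}) v : v \notin D ->
  (forall u, (u \in D') = (u == v) || (u \in D)) -> cst D' = cst D + indeg v.
Proof.
move=> nv ED; have -> : D' = v |: D by apply/setP => u; rewrite ED !inE.
by rewrite /cst big_setU1 // addnC.
Qed.

Lemma cst_le D : cst D <= cst setT.
Proof.
rewrite /cst big_mkcond [X in _ <= X]big_mkcond; apply: leq_sum => v _.
by rewrite in_setT; case: ifP.
Qed.

Definition upto o V (D : {set 'I_n}) (h : hst) := exists l, part V D l /\ outp h = o ++ flat l.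

(** Only status 1 counts as visited. New vertices that already carry digit 2 are ignored, which is
    what keeps them from becoming parents in their own layer. *)
Lemma hwp_test (v : 'I_n) V D D' o Q h k : env h -> vars h 37 = v ->
  (forall u : 'I_n, (rd n b (hm h) (vars h rsa) (vars h rlim) u == 1) = (u \in V)) ->
  rd n b (hm h) (vars h rsa) (vars h rlim) v = (v \in V) ->
  v \notin D -> (forall u, (u \in D') = (u == v) || (u \in D)) -> upto o V D h ->
  (forall h' k', (forall x, x < 48 -> vars h' x = vars h x) -> hm h' = hm h -> upto o V D' h' ->
     vars h' 48 = (if v \in V then 1 else if new_nbr e V v then 2 else 0) ->
     k' <= k + size (innbr G v) -> Q h' k') ->
  hwp Test Q h k.
Proof.
move=> en E37 HZ Rv nD ED [l [pl Eo]] HQ; have [C T g] := en.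
have q0 : 0 < 2 ^ b by rewrite expn_gt0.
have q1 : 1 < 2 ^ b by exact: pow_gt1.
have q2 : 2 < 2 ^ b by exact: (small_pow LG).
have setE (h' : hst) r' v' x : x < r' -> vars (setv h' r' v') x = vars h' x.
  by move=> lx /=; case: eqP => // Ex; lia.
apply: hwp_seq; apply: (@hwp_get _ G _ _ LG) => //; first by rewrite E37.
move=> h1 [a1 m1 i1 o1]; rewrite E37 Rv => e62.
apply: hwp_seq; apply: (hwp_asg _ b_gt0 b_le_w) => //=; rewrite e62; set h2 := setv _ _ _.
have a2 x : x < 48 -> vars h2 x = vars h x by move=> lx; rewrite setE // a1 //; lia.
have en2 : env h2 by apply: (env_eq LG en) => [|x lx]; [rewrite /= m1|apply: a2; lia].
apply: (hwp_cond b_gt0 b_le_w) => //=; rewrite e62; last first.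
  case: (boolP (v \in V)) => // vV _; apply: hwp_nop; apply: HQ => //; last exact: leq_addr.
  - exists l; split; last by rewrite /= o1.
    by apply: part_step pl nD ED _; rewrite /new_nbr vV.
  - by rewrite /h2 /= vV.
case: (boolP (v \in V)) => // nV _.
apply: hwp_seq; apply: (hwp_scan2 (v := v) (Z := V)) => //; first by rewrite a2.
  by move=> u; rewrite !a2 //= m1 HZ.
move=> h3 a3 m3 o3; rewrite a2 //; set a := vars h ra => e51 e52 p53 p54.
have a3' x : x < 48 -> vars h3 x = vars h x by move=> lx; rewrite a3 ?a2 //; lia.
have Nw := newE V a v; rewrite nV /= in Nw.
apply: (hwp_cond b_gt0 b_le_w) => //=; rewrite e51.
  case: (boolP (exI V a v)) Nw p53 => //= xI Nw /(_ isT) [u Eu [uV eu]] _.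
  apply: hwp_seq; apply: (hwp_asg _ b_gt0 b_le_w) => //=.
  apply: hwp_seq; apply: (hwp_out _ b_gt0 b_le_w) => //=.
  apply: (hwp_out _ b_gt0 b_le_w) => //=.
  apply: HQ; rewrite ?Nw ?(negPf nV) //=.
  - by move=> x lx; case: eqP => [?|_]; [lia|exact: a3'].
  - by rewrite m3 /= m1.
  - exists (rcons l (v, u)); split; last by rewrite /= flat_rcons -!rcons_cat /= -Eo o3 /= o1 a3' // E37 Eu.
    by apply: part_step pl nD ED _; rewrite Nw; exists u.
case: (boolP (exI V a v)) Nw => //= xI Nw _.
apply: (hwp_cond b_gt0 b_le_w) => //=; rewrite e52.
  case: (boolP (exO V a v)) Nw p54 => //= xO Nw /(_ isT) [u Eu [uV _ eu]] _.
  apply: hwp_seq; apply: (hwp_asg _ b_gt0 b_le_w) => //=.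
  apply: hwp_seq; apply: (hwp_out _ b_gt0 b_le_w) => //=.
  apply: (hwp_out _ b_gt0 b_le_w) => //=.
  apply: HQ; rewrite ?Nw ?(negPf nV) //=.
  - by move=> x lx; case: eqP => [?|_]; [lia|exact: a3'].
  - by rewrite m3 /= m1.
  - exists (rcons l (v, u)); split; last by rewrite /= flat_rcons -!rcons_cat /= -Eo o3 /= o1 a3' // E37 Eu.
    by apply: part_step pl nD ED _; rewrite Nw; exists u.
case: (boolP (exO V a v)) Nw => //= xO Nw _; apply: hwp_nop.
apply: HQ => //; rewrite ?Nw ?(negPf nV) //=.
- by rewrite m3 /= m1.
- exists l; split; last by rewrite o3 /= o1.
  by apply: part_step pl nD ED _; rewrite Nw.
- by rewrite a3 //= (negPf nV).
Qed.

(* In the second phase the visited vertices inside the piece cannot be used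
   as parents anymore, but then v is not one of the vertices reported before
   for which they are needed. *)
Lemma hwp_test2 (v : 'I_n) V Z D D' o Q h k : env h -> vars h 37 = v ->
  (forall u : 'I_n, (rd n b (hm h) (vars h rsa) (vars h rlim) u == 1) = (u \in Z)) ->
  (forall u : 'I_n, ~~ inpc (vars h ra) u -> (u \in Z) = (u \in V)) ->
  rd n b (hm h) (vars h rsa) (vars h rlim) v = (v \in V) ->
  vars h 49 = excl V (vars h ra) v -> (v \in D) = excl V (vars h ra) v ->
  (forall u, (u \in D') = (u == v) || (u \in D)) -> upto o V D h ->
  (forall h' k', (forall x, x < 48 -> vars h' x = vars h x) -> hm h' = hm h -> upto o V D' h' ->
     vars h' 48 = (if v \in V then 1 else if new_nbr e V v then 2 else 0) ->
     k' <= k + size (innbr G v) -> Q h' k') ->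
  hwp Test2 Q h k.
Proof.
move=> en E37 HZ HZV Rv E49 vD ED [l [pl Eo]] HQ; have [C T g] := en.
have q0 : 0 < 2 ^ b by rewrite expn_gt0.
have q1 : 1 < 2 ^ b by exact: pow_gt1.
have q2 : 2 < 2 ^ b by exact: (small_pow LG).
have setE (h' : hst) r' v' x : x < r' -> vars (setv h' r' v') x = vars h' x.
  by move=> lx /=; case: eqP => // Ex; lia.
set a := vars h ra in HZV E49 vD.
have EO : exO Z a v = exO V a v.
  by apply: eq_has => u; case: (boolP (inpc a u)) => iu; rewrite ?andbF ?andbT ?HZV.
have Nw := newE V a v.
apply: hwp_seq; apply: (@hwp_get _ G _ _ LG) => //; first by rewrite E37.
move=> h1 [a1 m1 i1 o1]; rewrite E37 Rv => e62.
apply: hwp_seq; apply: (hwp_asg _ b_gt0 b_le_w) => //=; rewrite e62; set h2 := setv _ _ _.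
have a2 x : x < 48 -> vars h2 x = vars h x by move=> lx; rewrite setE // a1 //; lia.
have en2 : env h2 by apply: (env_eq LG en) => [|x lx]; [rewrite /= m1|apply: a2; lia].
apply: (hwp_cond b_gt0 b_le_w) => //=; rewrite e62; last first.
  case: (boolP (v \in V)) => // vV _; apply: hwp_nop; apply: HQ => //; last exact: leq_addr.
  - exists l; split; last by rewrite /= o1.
    by apply: part_step pl _ ED _; [rewrite vD /excl vV|rewrite /new_nbr vV].
  - by rewrite /h2 /= vV.
case: (boolP (v \in V)) => // nV _; rewrite nV /= in Nw.
apply: hwp_seq; apply: (hwp_scan2 (v := v) (Z := Z)) => //; first by rewrite a2.
  by move=> u; rewrite !a2 //= m1 HZ.
move=> h3 a3 m3 o3; rewrite a2 // -/a EO => e51 e52 p53 p54.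
have a3' x : x < 48 -> vars h3 x = vars h x by move=> lx; rewrite a3 ?a2 //; lia.
have e49 : vars h3 49 = excl V a v by rewrite a3 // [LHS]/= a1.
apply: (hwp_cond b_gt0 b_le_w) => //=; rewrite e49.
  case: (boolP (excl V a v)) vD => // xv vD _; have /and3P [_ x1 x2] := xv.
  apply: (hwp_asg _ b_gt0 b_le_w) => //=.
  apply: HQ => //=; rewrite ?(negPf nV) ?Nw ?x1 //.
  - by move=> x lx; case: eqP => [?|_]; [lia|exact: a3'].
  - by rewrite m3 /= m1.
  - exists l; split; last by rewrite /= o3 /= o1.
    by apply: part_eq pl _ => u; rewrite ED; case: eqP => [->|].
case: (boolP (excl V a v)) vD => //; rewrite /excl nV /= => nx vD _.
(* Since v is not exceptional, it is new exactly if it has a visited inneighbour outside the piece,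
   where the statuses are still reliable. *)
have Nw' : new_nbr e V v = exO V a v by rewrite Nw; move: nx; case: exI; case: exO.
apply: (hwp_cond b_gt0 b_le_w) => //=; rewrite e52.
  case: (boolP (exO V a v)) Nw' p54 => //= xO Nw' /(_ isT) [u Eu [uZ iu eu]] _.
  apply: hwp_seq; apply: (hwp_asg _ b_gt0 b_le_w) => //=.
  apply: hwp_seq; apply: (hwp_out _ b_gt0 b_le_w) => //=.
  apply: (hwp_out _ b_gt0 b_le_w) => //=.
  apply: HQ; rewrite ?Nw' ?(negPf nV) //=.
  - by move=> x lx; case: eqP => [?|_]; [lia|exact: a3'].
  - by rewrite m3 /= m1.
  - exists (rcons l (v, u)); split; last by rewrite /= flat_rcons -!rcons_cat /= -Eo o3 /= o1 a3' // E37 Eu.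
    by apply: part_step pl _ ED _; [rewrite vD|rewrite Nw'; exists u => //; rewrite -HZV].
case: (boolP (exO V a v)) Nw' => //= xO Nw' _; apply: hwp_nop.
apply: HQ => //; rewrite ?Nw' ?(negPf nV) //=.
- by rewrite m3 /= m1.
- exists l; split; last by rewrite o3 /= o1.
  by apply: part_step pl _ ED _; [rewrite vD|rewrite Nw'].
- by rewrite a3 //= (negPf nV).
Qed.

Lemma hwp_excl (v : 'I_n) V Q h k : nc h V -> vars h 37 = v ->
  (forall h' k', (forall x, x < 50 -> x != 44 -> vars h' x = vars h x) -> hm h' = hm h ->
     outp h' = outp h -> vars h' 44 = excl V (vars h ra) v ->
     (excl V (vars h ra) v -> exists2 u : 'I_n, vars h' 53 = u & u \in V /\ e u v) ->
     k' <= k + size (innbr G v) -> Q h' k') ->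
  hwp Excl Q h k.
Proof.
move=> [en e33 e34 R] E37 HQ; have [C T g] := en.
have q0 : 0 < 2 ^ b by rewrite expn_gt0.
have q1 : 1 < 2 ^ b by exact: pow_gt1.
apply: hwp_seq; apply: (hwp_asg _ b_gt0 b_le_w) => //=; set h1 := setv _ _ _.
have a1 x : x < 50 -> x != 44 -> vars h1 x = vars h x by move=> lx nx /=; rewrite (negPf nx).
have en1 : env h1 by apply: (env_eq LG en) => // x lx; apply: a1; lia.
have [C1 T1 g1] := en1.
apply: hwp_seq; apply: (@hwp_get _ G _ _ LG) => //; first by rewrite a1 // E37.
move=> h2 [a2 m2 i2 o2]; rewrite !a1 // e33 e34 E37 R => e62.
have a2' x : x < 50 -> x != 44 -> vars h2 x = vars h x by move=> lx nx; rewrite a2 ?a1 //; lia.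
have e44 : vars h2 44 = 0 by rewrite a2.
apply: (hwp_cond b_gt0 b_le_w) => //=; rewrite e62; last first.
  case: (boolP (v \in V)) => // vV _; apply: hwp_nop; apply: HQ => //; rewrite ?m2 ?o2 //.
  - by rewrite /excl vV.
  - by rewrite /excl vV.
  - exact: leq_addr.
case: (boolP (v \in V)) => // nV _.
have en2 : env h2 by apply: (env_eq LG en) => [|x lx]; [rewrite m2|apply: a2'; lia].
apply: hwp_seq; apply: (hwp_scan2 (v := v) (Z := V)) => //; first by rewrite a2'.
  by move=> u; rewrite !a2' // m2 e33 e34 R; case: (u \in V).
move=> h3 a3 m3 o3; rewrite a2' //; set a := vars h ra => e51 e52 p53 p54.
have a3' x : x < 50 -> x != 44 -> vars h3 x = vars h x by move=> lx nx; rewrite a3 ?a2' //; lia.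
have m3' : hm h3 = hm h by rewrite m3 m2.
have o3' : outp h3 = outp h by rewrite o3 o2.
have e44' : vars h3 44 = 0 by rewrite a3.
have X : excl V a v = exI V a v && ~~ exO V a v by rewrite /excl nV.
apply: (hwp_cond b_gt0 b_le_w) => //=; rewrite e51; last first.
  case: (boolP (exI V a v)) X => //= xI X _.
  by apply: hwp_nop; apply: HQ => //; rewrite ?X.
case: (boolP (exI V a v)) X p53 => //= xI X /(_ isT) [u Eu [uV eu]] _.
apply: (hwp_cond b_gt0 b_le_w) => //=; rewrite e52.
  case: (boolP (exO V a v)) X => //= xO X _.
  by apply: hwp_nop; apply: HQ => //; rewrite ?X.
case: (boolP (exO V a v)) X => //= xO X _.
apply: (hwp_asg _ b_gt0 b_le_w) => //=.
apply: HQ => //=; rewrite ?X //.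
- by move=> x lx nx; rewrite (negPf nx) a3'.
- by exists u.
Qed.

End Critical.

End Pieces.
Import Pieces.

(** * Choice of the piece and encoding of its exceptional vertices *)

Module Selection.

Definition Count : cmd :=
  40 ::= 0 ;; 36 ::= 0 ;;
  For 36 ($rQ)%hl (37 ::= $36 ;; Excl ;; 40 ::= $40 + $44).

(** The 96 candidates fill the numbers from 2 PP to 98 PP, and [len] is at least 126 PP. With 96 of
    them, eight bits for each of the QQ / 96 exceptional vertices amount to PP / 6 bits. *)
Definition Choose : cmd :=
  47 ::= $rQ ;; 38 ::= 0 ;;
  For 38 (Cst 96)
    (ra ::= $rQ + $38 * $rP ;; Count ;;
     Cond ($40 <= $rQ %/ Cst 96)%hl (47 ::= $ra) Nop) ;;
  ra ::= $47.

(** A flag stands for eight consecutive low vertices. The area may contain remnants of an earlier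
    layer, so a flag is cleared when its block is entered. *)
Definition MkFlags : cmd :=
  36 ::= 0 ;;
  For 36 ($rQ)%hl
    (Cond (($36 %% Cst 8) == Cst 0)%hl (PutBit ($rFL)%hl ($36 %/ Cst 8)%hl (Cst 0)) Nop ;;
     37 ::= $36 ;; Excl ;;
     Cond ($44)%hl (PutBit ($rFL)%hl ($36 %/ Cst 8)%hl (Cst 1)) Nop).

(** The vertices are taken in descending order because the conversion of the low positions, which
    reads these bits back one after another, descends too. *)
Definition MkEB : cmd :=
  46 ::= 0 ;; 36 ::= 0 ;;
  For 36 ($rQ)%hl
    (37 ::= ($rQ - 1) - $36 ;;
     Cond (bitE ($rFL)%hl ($37 %/ Cst 8)%hl)
       (Excl ;; PutBit ($rEB)%hl ($46)%hl ($44)%hl ;; 46 ::= $46 + 1 ;;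
        Cond ($44)%hl (Out ($37)%hl ;; Out ($53)%hl) Nop) Nop).

Section Choice.

Variables (n : nat) (G : graph n) (w b : nat).
Hypothesis LG : large n w b.

Let b_le_w := lg_w LG.
Let b_gt0 : 0 < b. Proof. by have := lg_big LG; lia. Qed.

Local Notation MM := (MM n b).
Local Notation len := (len n b).
Local Notation PP := (PP n b).
Local Notation QQ := (QQ n b).
Local Notation hh := (hh n b).
Local Notation hwp := (hwp G w b MM).
Local Notation hst := (hst n).
Local Notation inpc := (inpc n b).
Local Notation e := (edge G).
Local Notation nc := (nc b).
Local Notation excl := (excl G b).
Local Notation exI := (exI G b).
Local Notation exO := (exO G b).
Local Notation cst := (cst G).
Local Notation part := (part G).
Local Notation upto := (upto G).
Local Notation piece := (piece n b).
Implicit Types (V D Z : {set 'I_n}) (h : hst).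

(** Extending the predicate to all numbers allows counts over [iota] in place of counts over
    vertices. *)
Definition xcl V a (p : nat) := if insub p is Some v then excl V a v else false.

Lemma xclE V a (v : 'I_n) : xcl V a v = excl V a v.
Proof. by rewrite /xcl valK. Qed.

Definition xcount V a := count (xcl V a) (iota 0 QQ).

Lemma nc_ext2 h h' V : nc h V -> (forall x, x < 35 -> vars h' x = vars h x) ->
  (forall a, ~~ (aFL n b <= a < aW n b) -> hm h' a = hm h a) -> nc h' V.
Proof.
move=> [[C T g] e1 e2 R] Ev Em; have [o1 o2 o3 o4 o5] := addr_order LG.
split; rewrite ?Ev //.
- split; rewrite ?Ev //; last by apply: (Tabs_ext LG) T => a la; apply: Em; lia.
  by apply: Csts_eq C _ => x lx; apply: Ev; lia.
- by move=> u; rewrite -R; apply: (rd_ext LG) => a /andP [h1 h2]; apply: Em; lia.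
Qed.

Lemma QQ_lt : QQ < n /\ 98 * PP <= len /\ QQ < 2 ^ b.
Proof.
have [eln [h126 h0]] := len_n LG.
have P0 : 0 < PP by rewrite /Layout.PP muln_gt0 b_gt0.
have h1 : QQ < n by rewrite /Layout.QQ; lia.
by split=> //; split; [lia|exact: leq_trans h1 (lg_hi LG)].
Qed.

Lemma cst_upto (i : nat) (v : 'I_n) : v = i :> nat ->
  cst [set u : 'I_n | u < i.+1] = cst [set u : 'I_n | u < i] + indeg G v.
Proof.
move=> Ev; apply: cst_step => [|u]; first by rewrite inE Ev ltnn.
by rewrite !inE -val_eqE /= Ev; lia.
Qed.

Lemma hwp_count V Q h k : nc h V ->
  (forall h' k', (forall x, x < 50 -> x \notin [:: 36; 37; 40; 44] -> vars h' x = vars h x) ->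
     hm h' = hm h -> outp h' = outp h -> vars h' 40 = xcount V (vars h ra) ->
     k' <= k + cst setT -> Q h' k') ->
  hwp Count Q h k.
Proof.
move=> N HQ; have [ql [p98 qb]] := QQ_lt.
have q0 : 0 < 2 ^ b by rewrite expn_gt0.
set a := vars h ra in HQ *.
pose J i (h' : hst) k' := [/\ forall x, x < 50 -> x \notin [:: 36; 37; 40; 44] -> vars h' x = vars h x,
  hm h' = hm h, outp h' = outp h, vars h' 40 = count (xcl V a) (iota 0 i) &
  k' <= k + cst [set u : 'I_n | u < i]].
have ncJ h' : (forall x, x < 50 -> x \notin [:: 36; 37; 40; 44] -> vars h' x = vars h x) ->
    hm h' = hm h -> nc h' V.
  move=> E1 E2; apply: (nc_ext2 N) => [x lx|x _]; last by rewrite E2.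
  by apply: E1; [lia|rewrite !inE; lia].
apply: hwp_seq; apply: (hwp_asg _ b_gt0 b_le_w) => //=.
apply: hwp_seq; apply: (hwp_asg _ b_gt0 b_le_w) => //=.
apply: (@hwp_for _ G w b MM b_gt0 b_le_w _ _ _ QQ J _ 0) => //.
- split=> //=; last exact: leq_addr.
  by move=> x lx; rewrite !inE !negb_or => /and4P [/negPf n1 /negPf n2 /negPf n3 /negPf n4]; rewrite n1 n3.
- by move=> i h' k' _ _ [E1 E2 _ _ _]; have [[C _ _] _ _ _] := ncJ _ E1 E2; rewrite /= (CstsE C).
- move=> i h1 k1 li E36 [a1 m1 o1 e40 lk]; have li' : i < n by exact: ltn_trans li ql.
  pose v := Ordinal li'.
  apply: hwp_seq; apply: (hwp_asg _ b_gt0 b_le_w) => //=; rewrite E36; set h2 := setv _ _ _.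
  have a2 x : x < 50 -> x \notin [:: 36; 37; 40; 44] -> vars h2 x = vars h x.
    move=> lx nx; move: (nx); rewrite !inE !negb_or => /and4P [_ /negPf n2 _ _].
    by rewrite [LHS]/= n2 a1.
  apply: hwp_seq; apply: (hwp_excl LG (v := v) (V := V)) => //; first exact: ncJ.
  rewrite a2 // -/a => h3 k3 a3 m3 o3 e44 _ lk3.
  have lc : count (xcl V a) (iota 0 i) <= i by rewrite -{2}(size_iota 0 i) count_size.
  have e40' : vars h3 40 = count (xcl V a) (iota 0 i) by rewrite a3.
  have cS : count (xcl V a) (iota 0 i.+1) = count (xcl V a) (iota 0 i) + excl V a v.
    by rewrite -[i.+1]addn1 iotaD count_cat /= addn0 add0n -(xclE V a v).
  apply: (hwp_asg _ b_gt0 b_le_w) => //=; rewrite e44 e40'.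
    by sp => //; have := leq_b1 (excl V a v); lia.
  split; first by rewrite /= a3.
  split=> //=.
  + move=> x lx nx; move: (nx); rewrite !inE !negb_or => /and4P [/negPf n1 /negPf n2 /negPf n3 n4].
    by rewrite n1 n3 a3 ?a2.
  + by rewrite m3.
  + by rewrite o3.
  + by rewrite (cst_upto (v := v)) // /indeg; lia.
- move=> h1 k1 E36 [a1 m1 o1 e40 lk]; apply: HQ => //.
  by apply: leq_trans lk _; rewrite leq_add2l cst_le.
Qed.

(** A low vertex is exceptional for at most one of the disjoint pieces, because it has a visited
    inneighbour and all of these lie in the piece. So the m counts add up to at most [QQ]. *)
Lemma pigeon V m : 0 < m -> exists2 i, i < m & xcount V (QQ + i * PP) <= QQ %/ m.
Proof.
move=> m0; have /existsP [i le] : [exists i : 'I_m, xcount V (QQ + i * PP) <= QQ %/ m]; last by exists i.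
rewrite -[X in is_true X]negbK; apply/negP; rewrite negb_exists => /forallP all.
suff : \sum_(i < m) xcount V (QQ + i * PP) <= QQ.
  apply/negP; rewrite -ltnNge.
  apply: leq_trans (_ : \sum_(i < m) (QQ %/ m).+1 <= _).
    by rewrite sum_nat_const card_ord mulnC ltn_ceil.
  by apply: leq_sum => i _; rewrite ltnNge.
have E i : xcount V (QQ + i * PP) = \sum_(p <- iota 0 QQ) xcl V (QQ + i * PP) p.
  by rewrite /xcount -sum1_count big_mkcond; apply: eq_bigr => p _; case: ifP.
have -> : \sum_(i < m) xcount V (QQ + i * PP) =
    \sum_(i < m) \sum_(p <- iota 0 QQ) (xcl V (QQ + i * PP) p : nat).
  by apply: eq_bigr => i _; exact: E.
rewrite exchange_big /=.
apply: leq_trans (_ : \sum_(p <- iota 0 QQ) 1 <= _); last by rewrite sum1_size size_iota.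
apply: leq_sum => p _; case: (pickP (fun i : 'I_m => xcl V (QQ + i * PP) p)) => [i xi|no]; last first.
  by rewrite big1 // => i _; rewrite no.
rewrite (bigD1 i) //= xi big1 // => j ji; apply/eqP; rewrite eqb0.
move: xi; rewrite /xcl; case: insub => // v /and3P [_ /hasP [u ui /andP [uV iu]] _].
rewrite /Pieces.excl; apply/negP => /and3P [_ _ /negP []]; apply/hasP; exists u => //.
rewrite uV /=; apply/negP => ju; move/eqP: ji; apply; apply/val_inj => /=.
move: iu ju; rewrite /Scans.inpc; have [eln _] := len_n LG.
case: (ltngtP j i) => // lji.
  by have : j.+1 * PP <= i * PP; [rewrite leq_mul2r lji orbT|rewrite mulSn; lia].
by have : i.+1 * PP <= j * PP; [rewrite leq_mul2r lji orbT|rewrite mulSn; lia].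
Qed.

Lemma piece_i i : i < 96 -> piece (QQ + i * PP).
Proof.
move=> li; have [_ [p98 _]] := QQ_lt; split; first exact: leq_addr.
  have : i.+1 * PP <= 96 * PP by rewrite leq_mul2r li orbT.
  by rewrite mulSn /Layout.QQ; lia.
have -> : QQ + i * PP = (2 * hh + i * hh) * b by rewrite /Layout.QQ /Layout.PP mulnDl -!mulnA (mulnC hh b).
by rewrite modnMl.
Qed.

Definition chosen V a := piece a /\ xcount V a <= QQ %/ 96.

Lemma hwp_choose V Q h k : nc h V ->
  (forall h' k', nc h' V -> (forall x, x < 35 -> vars h' x = vars h x) ->
     hm h' = hm h -> outp h' = outp h -> chosen V (vars h' ra) ->
     k' <= k + 96 * (cst setT).+1 -> Q h' k') ->
  hwp Choose Q h k.
Proof.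
move=> N HQ; have [ql [p98 qb]] := QQ_lt.
have q0 : 0 < 2 ^ b by rewrite expn_gt0.
have s96 : 96 < 2 ^ b by exact: (small_pow LG).
have [eln _] := len_n LG; have nb := lg_hi LG.
pose J i (h' : hst) k' := [/\ forall x, x < 35 -> vars h' x = vars h x,
  hm h' = hm h, outp h' = outp h, k' <= k + i * (cst setT).+1 &
  exists2 j, j < 96 & vars h' 47 = QQ + j * PP /\
    ((exists2 i', i' < i & xcount V (QQ + i' * PP) <= QQ %/ 96) -> xcount V (QQ + j * PP) <= QQ %/ 96)].
have ncJ h' : (forall x, x < 35 -> vars h' x = vars h x) -> hm h' = hm h -> nc h' V.
  by move=> E1 E2; apply: (nc_ext2 N) => // x _; rewrite E2.
have [[C0 _ _] _ _ _] := N.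
apply: hwp_seq; apply: (hwp_asg _ b_gt0 b_le_w) => //=; rewrite (CstsE C0).
apply: hwp_seq; apply: (hwp_asg _ b_gt0 b_le_w) => //=.
apply: hwp_seq; apply: (@hwp_for _ G w b MM b_gt0 b_le_w _ _ _ 96 J _ 0) => //.
- split=> //=; [|by rewrite addn0|].
    by move=> x lx; do 2 (case: eqP => [?|_]; [lia|]).
  by exists 0 => //; split; [rewrite addn0|case].
- move=> i h1 k1 li E38 [a1 m1 o1 lk [j lj [e47 Hj]]].
  have N1 := ncJ _ a1 m1; have [[C1 _ _] _ _ _] := N1.
  have [p1 p2 p3] := piece_i li.
  have P0 : 0 < PP by have [_ [_ h0]] := len_n LG; rewrite /Layout.PP muln_gt0 b_gt0.
  have ib : i * PP < 2 ^ b by lia.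
  have aib : QQ + i * PP < 2 ^ b by lia.
  apply: hwp_seq; apply: (hwp_asg _ b_gt0 b_le_w) => //=; rewrite !(CstsE C1) E38; try by sp.
  set h2 := setv _ _ _.
  have a2 x : x < 35 -> vars h2 x = vars h x by move=> lx /=; case: eqP => [?|_]; [lia|exact: a1].
  apply: hwp_seq; apply: (hwp_count (V := V)); first exact: ncJ.
  move=> h3 k3 a3 m3 o3; have -> : vars h2 ra = QQ + i * PP by [].
  move=> e40 lk3.
  have a3' x : x < 35 -> vars h3 x = vars h x by move=> lx; rewrite a3 ?a2 // ?inE; lia.
  have [[C3 _ _] _ _ _] : nc h3 V by apply: ncJ; rewrite ?m3.
  have e35 : vars h3 ra = QQ + i * PP by rewrite a3.
  have lk4 : k3.+1 <= k + i.+1 * (cst setT).+1 by rewrite mulSn; lia.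
  apply: (hwp_cond b_gt0 b_le_w) => //=; rewrite ?(CstsE C3) ?e40; try by sp.
    case: leqP => // le _; apply: (hwp_asg _ b_gt0 b_le_w) => //=; rewrite e35.
    split; first by rewrite a3.
    split=> //=.
    + by move=> x lx; do 2 (case: eqP => [?|_]; [lia|]); exact: a3'.
    + by rewrite m3.
    + by rewrite o3.
    + by exists i.
  case: leqP => // gt _; apply: hwp_nop; split; first by rewrite a3.
  split=> //=.
  + by move=> x lx; case: eqP => [?|_]; [lia|exact: a3'].
  + by rewrite m3.
  + by rewrite o3.
  + exists j => //; split; first by rewrite a3.
    case=> i' li' le; apply: Hj; exists i' => //; move: li'; rewrite ltnS leq_eqVlt => /orP [/eqP Ei|//].
    by move: gt; rewrite -Ei ltnNge le.
- move=> h1 k1 E38 [a1 m1 o1 lk [j lj [e47 Hj]]].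
  apply: (hwp_asg _ b_gt0 b_le_w) => //=; rewrite e47; set h2 := setv _ _ _.
  have a2 x : x < 35 -> vars h2 x = vars h x by move=> lx /=; case: eqP => [?|_]; [lia|exact: a1].
  apply: HQ => //; first exact: ncJ.
  have -> : vars h2 ra = QQ + j * PP by [].
  split; first exact: piece_i.
  by apply: Hj; have [i li le] := pigeon V (isT : 0 < 96); exists i.
Qed.

Definition flp V a q := has (fun p => xcl V a p && (p %/ 8 == q)) (iota 0 QQ).

Lemma flp_xcl V a p : p < QQ -> xcl V a p -> flp V a (p %/ 8).
Proof. by move=> lp xp; apply/hasP; exists p; rewrite ?mem_iota ?xp //=. Qed.

Lemma adrFL q : q * 8 < QQ -> aFL n b + q %/ b < aEB n b.
Proof.
move=> lq; rewrite /aEB ltn_add2l ltn_divLR //.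
have h4 : hh < (hh %/ 4).+1 * 4 by rewrite ltn_ceil.
have h5 : b * hh <= b * ((hh %/ 4).+1 * 4) by rewrite leq_mul2l (ltnW h4) orbT.
by move: lq h5; rewrite /Layout.QQ /Layout.PP; lia.
Qed.

Lemma aEB_MM : aEB n b <= MM.
Proof. by rewrite /Layout.MM /aT /aW; move: (len %/ _) => y; lia. Qed.

Lemma hwp_mkflags V Q h k : nc h V ->
  (forall h' k', nc h' V -> (forall x, x < 36 -> vars h' x = vars h x) ->
     (forall x, ~~ (aFL n b <= x < aEB n b) -> hm h' x = hm h x) -> outp h' = outp h ->
     (forall q, q * 8 < QQ -> dig 2 b (hm h') (aFL n b) q = flp V (vars h ra) q) ->
     k' <= k + cst setT -> Q h' k') ->
  hwp MkFlags Q h k.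
Proof.
move=> N HQ; have [ql [p98 qb]] := QQ_lt.
have q0 : 0 < 2 ^ b by rewrite expn_gt0.
have q1 : 1 < 2 ^ b by exact: pow_gt1.
have s8 : 8 < 2 ^ b by exact: (small_pow LG).
have [o1 o2 o3 o4 o5] := addr_order LG; have aM := aEB_MM.
have lM x : x < MM -> x < 2 ^ b by exact: (MM_lt LG).
set a := vars h ra in HQ *.
pose fl i q := has (fun p => xcl V a p && (p %/ 8 == q)) (iota 0 i).
(* The parameter d delimits the flags that are already meaningful; in the middle of a round, when
   the block of vertex i has been opened but i is not yet tested, it is one ahead of i. *)
pose J0 i d (h' : hst) := [/\ forall x, x < 36 -> vars h' x = vars h x,
  forall x, ~~ (aFL n b <= x < aEB n b) -> hm h' x = hm h x, outp h' = outp h &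
  forall q, q * 8 < d -> dig 2 b (hm h') (aFL n b) q = fl i q].
pose J i (h' : hst) k' := J0 i i h' /\ k' <= k + cst [set u : 'I_n | u < i].
have ncJ i d h' : J0 i d h' -> nc h' V.
  move=> [E1 E2 _ _]; apply: (nc_ext2 N) => [x lx|x nx]; first by apply: E1; lia.
  by apply: E2; lia.
have J0S i d h' r v : 36 <= r -> J0 i d h' -> J0 i d (setv h' r v).
  move=> lr [E1 E2 E3 E4]; split=> // x lx /=; case: eqP => [?|_]; [lia|exact: E1].
apply: hwp_seq; apply: (hwp_asg _ b_gt0 b_le_w) => //=.
apply: (@hwp_for _ G w b MM b_gt0 b_le_w _ _ _ QQ J _ 0) => //.
- split; last exact: leq_addr.
  by split=> //= x lx; case: eqP => [?|_]; [lia|].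
- by move=> i h' k' _ _ [Ji _]; have [[C _ _] _ _ _] := ncJ _ _ _ Ji; rewrite /= (CstsE C).
move=> i h1 k1 li E36 [J1 lk]; have li' : i < n by exact: ltn_trans li ql.
pose v := Ordinal li'.
have i8 : i %/ 8 * 8 <= i by exact: leq_divM.
have lF : aFL n b + i %/ 8 %/ b < aEB n b by apply: adrFL; lia.
have put (h2 : hst) (d : nat) Q2 k2 : J0 i d h2 -> vars h2 36 = i -> forall v : nat, v < 2 ->
    (forall h3, (forall x, x < 60 -> vars h3 x = vars h2 x) -> outp h3 = outp h ->
      (forall x, ~~ (aFL n b <= x < aEB n b) -> hm h3 x = hm h x) ->
      (forall q, dig 2 b (hm h3) (aFL n b) q = if q == i %/ 8 then v else dig 2 b (hm h2) (aFL n b) q) -> Q2 h3 k2) ->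
    hwp (PutBit ($rFL)%hl ($36 %/ Cst 8)%hl (Cst v)) Q2 h2 k2.
  move=> J2 E2 v' lv H2; have N2 := ncJ _ _ _ J2; have [[C2 T2 _] _ _ _] := N2; have [E1 E3 E4 E5] := J2.
  apply: (@hwp_putbit _ G _ _ LG) => //=.
  + move=> h3 [a3 _ _ _]; split=> //=; [|by rewrite a3|by rewrite a3].
    by apply: leq_ltn_trans (_ : 1 < _) => //; lia.
  + by rewrite (CstsE C2) E2; lia.
  rewrite (CstsE C2) E2 => h3 a3 _ o3' m3; apply: H2 => //; first by rewrite o3'.
    move=> x nx; rewrite m3 /putd; case: eqP => [Ex|_]; last exact: E3.
    by move/negP: nx; case; rewrite Ex leq_addr.
  exact: (dig_put (rho := 2) isT b_gt0 lv m3).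
have flnew : i %% 8 = 0 -> fl i (i %/ 8) = false.
  move=> z; apply/hasP => -[p]; rewrite mem_iota => /andP [_ lp] /andP [_ /eqP Ep].
  have := divn_eq i 8; have := divn_eq p 8; have := ltn_pmod p (isT : 0 < 8); lia.
apply: hwp_seq.
apply: (@hwp_imp _ _ _ _ _ _ (fun h2 k2 => [/\ J0 i i.+1 h2, vars h2 36 = i & k2 = k1])).
  have [E1 E2 E3 E4] := J1.
  apply: (hwp_cond b_gt0 b_le_w) => //=; rewrite E36; try by sp.
    case: eqP => // z _; apply: (put _ i) => // h2 a2 oo2 m2 d2; split=> //; last by rewrite a2.
    split=> // [x lx|q lq]; first by rewrite a2 ?E1 //; lia.
    rewrite d2; case: eqP => [->|nq]; first by rewrite flnew.
    by apply: E4; have := divn_eq i 8; lia.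
  case: eqP => // nz _; apply: hwp_nop; split=> //; split=> // q lq; apply: E4.
  by have : q * 8 != i by [apply/eqP => Eq; case: nz; rewrite -Eq modnMl]; lia.
move=> h2 k2 [J2 E36' ->]; have N2 := ncJ _ _ _ J2.
apply: hwp_seq; apply: (hwp_asg _ b_gt0 b_le_w) => //=; rewrite E36'; set h3 := setv _ _ _.
have J3 : J0 i i.+1 h3 by apply: J0S.
apply: hwp_seq; apply: (hwp_excl LG (v := v) (V := V)) => //; first exact: ncJ J3.
have -> : vars h3 ra = a by case: J3 => ->.
move=> h4 k4 a4 m4 oo4 e44 _ lk4.
have e36 : vars h4 36 = i by rewrite a4.
have J4 : J0 i i.+1 h4.
  by case: J3 => E1 E2 E3 E4; split; rewrite ?m4 ?oo4 // => x lx; rewrite a4 ?E1 //; lia.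
have flS q : fl i.+1 q = fl i q || (excl V a v && (i %/ 8 == q)).
  by rewrite /fl -[i.+1]addn1 iotaD has_cat /= orbF add0n -(xclE V a v).
have fin h5 : (forall x, x < 60 -> vars h5 x = vars h4 x) -> outp h5 = outp h ->
   (forall x, ~~ (aFL n b <= x < aEB n b) -> hm h5 x = hm h x) ->
   (forall q, q * 8 < i.+1 -> dig 2 b (hm h5) (aFL n b) q = fl i.+1 q) ->
   vars h5 36 = i /\ J i.+1 (setv h5 36 i.+1) k4.+1.
  move=> a5 o5' m5 d5; split; first by rewrite a5.
  split; last by rewrite (cst_upto (v := v)) // /indeg; lia.
  apply: J0S => //; split=> // x lx; rewrite a5; last lia.
  by case: J4 => ->.
have [F1 F2 F3 F4] := J4.
apply: (hwp_cond b_gt0 b_le_w) => //=; rewrite e44; case: (boolP (excl V a v)) flS => // xv flS _.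
  apply: (put _ i.+1) => // h5 a5 o5' m5 d5; apply: fin => // q lq; rewrite d5 flS /= eq_sym.
  by case: eqP => [_|ne]; rewrite ?orbT // orbF F4.
by apply: hwp_nop; apply: fin => // q lq; rewrite F4 // flS orbF.
move=> h1 k1 E36 [J1 lk]; have N1 := ncJ _ _ _ J1; have [F1 F2 F3 F4] := J1; apply: HQ => //.
by apply: leq_trans lk _; rewrite leq_add2l cst_le.
Qed.

(** As the list of bits is built downwards, the bit of a vertex p in a flagged block has index
    [cntF V a p.+1]. *)
Definition cntF V a lo := count (fun p => flp V a (p %/ 8)) (iota lo (QQ - lo)).

Lemma cntFS V a p : p < QQ -> cntF V a p = flp V a (p %/ 8) + cntF V a p.+1.
Proof. by move=> lp; rewrite /cntF -[QQ - p](subnSK lp). Qed.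

Lemma cntF_mono V a p p' : p <= p' -> cntF V a p' <= cntF V a p.
Proof.
move/subnKC <-; elim: (p' - p) => [|d IH]; first by rewrite addn0.
apply: leq_trans IH; rewrite addnS; case: (ltnP (p + d) QQ) => l; first by rewrite (cntFS _ _ l) leq_addl.
by rewrite /cntF; have -> : QQ - (p + d).+1 = 0 by lia.
Qed.

(** Every flagged block of eight contains an exceptional vertex, and a chosen piece has at most QQ /
    96 of these. *)
Lemma cntF_le V a p : chosen V a -> cntF V a p <= 8 * (QQ %/ 96).
Proof.
move=> [_ xc]; apply: leq_trans (cntF_mono V a (leq0n p)) _.
apply: leq_trans (_ : 8 * xcount V a <= _); last by rewrite leq_mul2l xc.
rewrite /cntF subn0 -size_filter /xcount -size_filter.
set s := [seq x <- _ | xcl V a x].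
have E : 8 * size s = size (flatten [seq iota (x %/ 8 * 8) 8 | x <- s]).
  by elim: s => //= x s IH; rewrite mulnS IH.
rewrite E; apply: uniq_leq_size; first by rewrite filter_uniq ?iota_uniq.
move=> x; rewrite mem_filter => /andP [/hasP [y yi /andP [xy /eqP Ey]] _].
apply/flattenP; exists (iota (y %/ 8 * 8) 8).
  by apply/mapP; exists y => //; rewrite mem_filter xy.
have := divn_eq x 8; have := ltn_pmod x (isT : 0 < 8); rewrite -Ey mem_iota; lia.
Qed.

(** 8 QQ / 96 = PP / 6 bits occupy hh / 6 cells, rounded up. *)
Lemma adrEB V a p c : chosen V a -> c < cntF V a p -> aEB n b + c %/ b < aW n b.
Proof.
move=> ch lc; have := cntF_le p ch; move: (QQ %/ 96) (leq_divM QQ 96) => z hz le.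
rewrite /aW ltn_add2l ltn_divLR //.
have h4 : hh < (hh %/ 6).+1 * 6 by rewrite ltn_ceil.
have h5 : b * hh <= b * ((hh %/ 6).+1 * 6) by rewrite leq_mul2l (ltnW h4) orbT.
by move: hz h5; rewrite /Layout.QQ /Layout.PP; lia.
Qed.

Lemma aW_MM : aW n b < MM.
Proof. by rewrite /Layout.MM /aT; move: (len %/ _) => y; lia. Qed.

Definition Xset V a lo := [set v : 'I_n | (lo <= v < QQ) && excl V a v].

Definition ebok V a (m : nat -> nat) lo := forall p, lo <= p < QQ -> flp V a (p %/ 8) ->
  dig 2 b m (aEB n b) (cntF V a p.+1) = xcl V a p.

Lemma hwp_mkeb V o Q h k : nc h V -> chosen V (vars h ra) -> outp h = o ->
  (forall q, q * 8 < QQ -> dig 2 b (hm h) (aFL n b) q = flp V (vars h ra) q) ->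
  (forall h' k', nc h' V -> (forall x, x < 36 -> vars h' x = vars h x) ->
     (forall q, q * 8 < QQ -> dig 2 b (hm h') (aFL n b) q = flp V (vars h ra) q) ->
     ebok V (vars h ra) (hm h') 0 -> upto o V (Xset V (vars h ra) 0) h' ->
     k' <= k + cst setT -> Q h' k') ->
  hwp MkEB Q h k.
Proof.
move=> N ch Eo dF HQ; have [ql [p98 qb]] := QQ_lt.
have q0 : 0 < 2 ^ b by rewrite expn_gt0.
have q1 : 1 < 2 ^ b by exact: pow_gt1.
have s8 : 8 < 2 ^ b by exact: (small_pow LG).
have [o1 o2 o3 o4 o5] := addr_order LG; have aM := aW_MM; have aM' := aEB_MM.
have lM x : x < MM -> x < 2 ^ b by exact: (MM_lt LG).
set a := vars h ra in ch dF HQ *.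
pose J0 i (h' : hst) := [/\ forall x, x < 36 -> vars h' x = vars h x,
  forall x, ~~ (aEB n b <= x < aW n b) -> hm h' x = hm h x, vars h' 46 = cntF V a (QQ - i),
  ebok V a (hm h') (QQ - i) & upto o V (Xset V a (QQ - i)) h'].
pose lowset i := [set u : 'I_n | QQ - i <= u < QQ].
pose J i (h' : hst) k' := J0 i h' /\ k' <= k + cst (lowset i).
have nc0 h' : (forall x, x < 36 -> vars h' x = vars h x) ->
    (forall x, ~~ (aEB n b <= x < aW n b) -> hm h' x = hm h x) -> nc h' V.
  move=> E1 E2; apply: (nc_ext2 N) => [x lx|x nx]; first by apply: E1; lia.
  by apply: E2; lia.
have dF' h' : (forall x, ~~ (aEB n b <= x < aW n b) -> hm h' x = hm h x) ->
    forall q, q * 8 < QQ -> dig 2 b (hm h') (aFL n b) q = flp V a q.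
  by move=> E2 q lq; rewrite -dF //; apply: dig_same; apply: E2; have := adrFL lq; lia.
apply: hwp_seq; apply: (hwp_asg _ b_gt0 b_le_w) => //=.
apply: hwp_seq; apply: (hwp_asg _ b_gt0 b_le_w) => //=.
apply: (@hwp_for _ G w b MM b_gt0 b_le_w _ _ _ QQ J _ 0) => //.
- split; last exact: leq_addr.
  split=> //=; rewrite ?subn0.
  + by move=> x lx; do 2 (case: eqP => [?|_]; [lia|]).
  + by rewrite /cntF subnn.
  + by move=> p hp; lia.
  + exists [::]; split; last by rewrite cats0.
    by apply: part_eq (part0 G V) _ => u; rewrite !inE; lia.
- by move=> i h' k' _ _ [[E1 E2 _ _ _] _]; have [[C _ _] _ _ _] := nc0 _ E1 E2; rewrite /= (CstsE C).
- move=> i h1 k1 li E36 [[a1 m1 e46 eb1 [l [pl El]]] lk].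
  pose p := QQ - i.+1; have Ep : QQ - i = p.+1 by rewrite /p; lia.
  have lp : p < QQ by rewrite /p; lia.
  have lp' : p < n by exact: ltn_trans lp ql.
  pose v := Ordinal lp'.
  have N1 := nc0 _ a1 m1; have [[C1 _ _] _ _ _] := N1.
  have cstS : cst (lowset i.+1) = cst (lowset i) + indeg G v.
    apply: cst_step => [|u]; first by rewrite inE /= -/p; lia.
    by rewrite !inE -val_eqE /= -/p; lia.
  apply: hwp_seq; apply: (hwp_asg _ b_gt0 b_le_w) => //=; rewrite (CstsE C1) E36; try by sp => //; lia.
  have -> : QQ - 1 - i = p by rewrite /p; lia.
  set h2 := setv _ _ _.
  have a2 x : x < 36 -> vars h2 x = vars h x by move=> lx /=; case: eqP => [?|_]; [lia|exact: a1].
  have N2 : nc h2 V by exact: nc0.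
  have [[C2 T2 _] _ _ _] := N2.
  have p8 : p %/ 8 * 8 <= p by exact: leq_divM.
  have Efl : ev ($rFL)%hl h2 = aFL n b by rewrite -[LHS]/(vars h2 rFL) (CstsE C2).
  have Ep8 : ev ($37 %/ Cst 8)%hl h2 = p %/ 8 by [].
  have [//| |o2' E2] := @bitE_ok n w b LG h2 ($rFL)%hl ($37 %/ Cst 8)%hl C2 T2 I.
  + by rewrite Efl Ep8; apply: leq_trans aM'; apply: adrFL; lia.
  rewrite Efl Ep8 dF' // in E2; last lia.
  rewrite Ep in e46 eb1 pl.
  have cF := cntFS V a lp.
  have XE : ~~ excl V a v -> Xset V a p =i Xset V a p.+1.
    move=> nx u; rewrite !inE; case: (eqVneq u v) => [->|ne]; first by rewrite (negPf nx) !andbF.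
    by congr andb; move/eqP: ne => ne; have : u <> p :> nat by [move=> Eu; apply: ne; apply: val_inj]; lia.
  apply: (hwp_cond b_gt0 b_le_w); rewrite ?E2 //; last first.
    case: (boolP (flp V a (p %/ 8))) cF => //= nf cF _; rewrite add0n in cF.
    apply: hwp_nop; split=> //.
    have nx : ~~ excl V a v by apply: contra nf => xv; apply: flp_xcl => //; rewrite (xclE V a v).
    split; last by rewrite cstS /indeg; lia.
    split=> //; rewrite -/p.
    + by move=> x lx /=; case: eqP => [?|_]; [lia|exact: a2].
    + by rewrite [LHS]/= e46 cF.
    + move=> p' hp' fp'; apply: eb1 => //; case: (eqVneq p' p) => [Ep'|]; last by lia.
      by rewrite -Ep' fp' in nf.
    + exists l; split=> //; apply: part_eq pl _ => u; exact: esym (XE nx u).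
  case: (boolP (flp V a (p %/ 8))) cF => //= fp cF _; rewrite add1n in cF.
  apply: hwp_seq; apply: (hwp_excl LG (v := v) (V := V)) => //.
  have -> : vars h2 ra = a by exact: a2.
  move=> h3 k3 a3 m3 o3' e44 p53 lk3.
  have a3' x : x < 36 -> vars h3 x = vars h x by move=> lx; rewrite a3 ?a2 //; lia.
  have N3 : nc h3 V by apply: nc0 => // x nx; rewrite m3; exact: m1.
  have [[C3 T3 _] _ _ _] := N3.
  have e46' : vars h3 46 = cntF V a p.+1 by rewrite a3.
  have lE : aEB n b + cntF V a p.+1 %/ b < aW n b by apply: (@adrEB V a p) => //; lia.
  have cb : cntF V a p.+1 < QQ.
    by have := cntF_le p ch; move: (leq_divM QQ 96); move: (QQ %/ 96) => z; lia.
  apply: hwp_seq; apply: (@hwp_putbit _ G _ _ LG) => //=.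
  + move=> h4 [a4 _ _ _]; split=> //=; rewrite ?a4 //.
  + by rewrite (CstsE C3) e46'; lia.
  + by rewrite e44; case: (excl V a v).
  rewrite (CstsE C3) e46' e44 => h4 a4 i4 o4' m4.
  have lx2 : (excl V a v : nat) < 2 by case: (excl V a v).
  have d4 := dig_put (rho := 2) isT b_gt0 lx2 m4.
  have m4' x : ~~ (aEB n b <= x < aW n b) -> hm h4 x = hm h x.
    move=> nx; rewrite m4 /putd; case: eqP => [Ex|_]; last by rewrite m3; exact: m1.
    by move/negP: nx; case; rewrite Ex leq_addr.
  have eb4 : ebok V a (hm h4) p.
    move=> p' hp' fp'; rewrite d4; case: (eqVneq p' p) => [->|ne].
      by rewrite eqxx (xclE V a v).
    have l1 : p'.+1 <= QQ by lia.
    have c1 := cntFS V a l1; rewrite fp' in c1.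
    have c2 : cntF V a p' <= cntF V a p.+1 by apply: cntF_mono; lia.
    have -> : cntF V a p'.+1 == cntF V a p.+1 = false by lia.
    by rewrite m3; apply: eb1 => //; lia.
  apply: hwp_seq; apply: (hwp_asg _ b_gt0 b_le_w) => //=; rewrite a4 // e46'; try by sp => //; lia.
  rewrite addn1 -cF; set h5 := setv _ _ _.
  have fin h6 : (forall x, x < 50 -> vars h6 x = vars h5 x) -> hm h6 = hm h4 ->
      upto o V (Xset V a p) h6 -> vars h6 36 = i /\ J i.+1 (setv h6 36 i.+1) k3.+1.
    move=> a6 m6 u6; split; first by rewrite a6 //= a4 // a3.
    split; last by rewrite cstS /indeg; lia.
    split=> //; rewrite -/p.
    + move=> x lx /=; case: eqP => [?|_]; first lia.
      rewrite a6; last lia. rewrite /= (_ : x == 46 = false) ?a4 ?a3' //; lia.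
    + by move=> x nx; rewrite /= m6; exact: m4'.
    + by rewrite [LHS]/= a6.
    + by rewrite /= m6.
  have o5' : outp h5 = outp h1 by rewrite /= o4' o3'.
  have e44' : vars h5 44 = excl V a v by rewrite /= a4.
  apply: (hwp_cond b_gt0 b_le_w) => //=; rewrite a4 // e44; last first.
    case: (boolP (excl V a v)) XE => // nx /(_ isT) XE _; apply: hwp_nop; apply: fin => //.
    by exists l; split; [apply: part_eq pl _ => u; exact: esym (XE u)|rewrite o5'].
  case: (boolP (excl V a v)) p53 => // xv /(_ isT) [u Eu [uV eu]] _.
  have e37 : vars h4 37 = v by rewrite a4 // a3.
  have e53 : vars h4 53 = u by rewrite a4.
  apply: hwp_seq; apply: (hwp_out _ b_gt0 b_le_w) => //.
  apply: (hwp_out _ b_gt0 b_le_w) => //; apply: fin => //.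
  exists (rcons l (v, u)); split; last by rewrite /= e37 e53 o4' o3' [outp h2]/= El flat_rcons -!rcons_cat.
  apply: (part_step (v := v) pl).
  + by rewrite inE /= ltnn.
  + move=> u'; rewrite !inE -val_eqE /=; case: (eqVneq (u' : nat) p) => [Eu'|ne] /=.
      have -> : u' = v by apply: val_inj.
      by rewrite /= leqnn lp xv.
    by congr andb; lia.
  + have -> : new_nbr e V v by move/and3P: (xv) => [x1 x2 x3]; rewrite (newE G b V a) x1 x2.
    by exists u.
- move=> h1 k1 E36 [[a1 m1 e46 eb1 u1] lk]; rewrite subnn in eb1 u1.
  apply: HQ => //; first exact: nc0.
  + exact: dF'.
  + by apply: leq_trans lk _; rewrite leq_add2l cst_le.
Qed.

End Choice.

End Selection.
Import Selection.

(** * Dense layers: conversion to ternary digits and back *)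

Module Dense.

Definition Vert : cmd :=
  37 ::= $rlim - 1 ;;
  Cond ($rsa <= $37)%hl
    (Cond (($37 - $rsa) < $rP)%hl (37 ::= ($37 - $rsa) + $rLen) Nop) Nop.

Definition Conv (T : cmd) : cmd :=
  Vert ;; T ;; PutTrit ($rTb)%hl ($rlim - 1)%hl ($48)%hl ;; rlim ::= $rlim - 1.

Definition ConvHi : cmd := Loop ($rQ < $rlim)%hl (Conv Test).

(** The new bits are collected in a buffer first, because the old ones are needed until the last
    vertex of the piece has been tested. *)
Definition PieceNew : cmd :=
  36 ::= 0 ;;
  For 36 ($rP)%hl
    (37 ::= $ra + $36 ;; Test ;; PutBit ($rBF)%hl ($36)%hl (Cst 0 < $48)%hl) ;;
  36 ::= 0 ;; For 36 ($rH)%hl (Wr ($rX + $36)%hl (M[$rBF + $36])%hl).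

Definition ELook : cmd :=
  49 ::= 0 ;;
  Cond (bitE ($rFL)%hl (($rlim - 1) %/ Cst 8)%hl)
    (49 ::= bitE ($rEB)%hl ($46)%hl ;; 46 ::= $46 + 1) Nop.

Definition ConvLo : cmd := 46 ::= 0 ;; Loop (Cst 0 < $rlim)%hl (ELook ;; Conv Test2).

Definition Back : cmd :=
  Loop ($rlim < $rLen)%hl
    (PutBit ($rW)%hl ($rlim)%hl (Cst 0 < tritE ($rTb)%hl ($rlim)%hl)%hl ;; rlim ::= $rlim + 1).

Definition Crit : cmd :=
  Choose ;; MkFlags ;; MkEB ;; Swap ;; rsa ::= $ra ;; ConvHi ;; PieceNew ;; ConvLo ;;
  Back ;; Swap ;; rsa ::= $rLen.

Section Crit.

Variables (n : nat) (G : graph n) (w b : nat).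
Hypothesis LG : large n w b.

Let b_le_w := lg_w LG.
Let b_gt0 : 0 < b. Proof. by have := lg_big LG; lia. Qed.

Local Notation MM := (MM n b).
Local Notation len := (len n b).
Local Notation PP := (PP n b).
Local Notation QQ := (QQ n b).
Local Notation hh := (hh n b).
Local Notation k3 := (k3 b).
Local Notation hwp := (hwp G w b MM).
Local Notation hst := (hst n).
Local Notation inpc := (inpc n b).
Local Notation e := (edge G).
Local Notation env := (env b).
Local Notation nc := (nc b).
Local Notation excl := (excl G b).
Local Notation cst := (cst G).
Local Notation part := (part G).
Local Notation upto := (upto G).
Local Notation piece := (piece n b).
Local Notation ppos := (ppos n b).
Local Notation vert := (vert n b).
Local Notation Xset := (Xset G b).
Local Notation flp := (flp G b).
Local Notation ebok := (ebok G b).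
Local Notation cntF := (cntF G b).
Local Notation new := (new_nbr e).
Implicit Types (V D Z : {set 'I_n}) (h : hst) (u v : 'I_n).

Definition vfin V := V :|: [set u : 'I_n | new V u].

(* The status of a vertex once the positions from lim on hold ternary digits;
   the flag tells whether the new vertices of the piece are included. *)
Definition fst3 V a (B : bool) lim u : nat :=
  if inpc a u then (if B then (u \in vfin V : nat) else (u \in V : nat))
  else if u \in V then 1 else if new V u && (lim <= ppos a u) then 2 else 0.

Definition stA V a B lim h := [/\ env h, vars h rsa = a, vars h ra = a, vars h rlim = lim &
  forall u, rd n b (hm h) a lim u = fst3 V a B lim u].

(** The vertices that read as visited. After the update of the piece its new vertices are among
    them; this is the ambiguity on account of which the exceptional vertices were recorded. *)
Definition Zs V a (B : bool) := if B then V :|: [set u : 'I_n | new V u && inpc a u] else V.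

Lemma fst3_src V a B lim u : (fst3 V a B lim u == 1) = (u \in Zs V a B).
Proof.
rewrite /fst3 /Zs /vfin; case: B; case: (boolP (inpc a u)) => [iu|/negPf iu];
  rewrite ?inE ?iu ?andbT ?andbF ?orbF;
  by case: (u \in V) => //=; case: (new V u) => //=; case: (lim <= _).
Qed.

Lemma Zs_out V a B u : ~~ inpc a u -> (u \in Zs V a B) = (u \in V).
Proof. by rewrite /Zs; case: B => // iu; rewrite !inE (negPf iu) andbF orbF. Qed.

(** A position that is not yet converted still holds its old bit, so when its turn comes the vertex
    knows its own status, even if statuses inside the piece are ambiguous. *)
Lemma fst3_at V a B lim u : ppos a u < lim -> lim <= len -> fst3 V a B lim u = (u \in V).
Proof.
move=> l1 l2; rewrite /fst3; have -> : inpc a u = false.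
  by apply/negP => iu; move: l1; rewrite /Pieces.ppos iu; lia.
by have -> : lim <= ppos a u = false by [lia]; rewrite andbF; case: (u \in V).
Qed.

Lemma geo_piece a lim : piece a -> lim <= len -> geo n b a lim.
Proof. by move=> [a1 a2 _] l; split=> //; right. Qed.

Lemma len_b : len < 2 ^ b.
Proof.
have [eln [_ h0]] := len_n LG; have := lg_hi LG; have : 0 < PP by rewrite /Layout.PP muln_gt0 b_gt0.
lia.
Qed.

Lemma low_ext h h' : Tabs b (hm h) -> (forall x, x < aX b -> hm h' x = hm h x) -> Tabs b (hm h').
Proof. by move=> T E; apply: (Tabs_ext LG) T. Qed.

Lemma hwp_vert a p Q h k : piece a -> p < len -> Csts b h -> vars h rsa = a -> vars h rlim = p.+1 ->
  (forall h', (forall x, x != 37 -> vars h' x = vars h x) -> hm h' = hm h -> outp h' = outp h ->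
     vars h' 37 = vert a p -> Q h' k) ->
  hwp Vert Q h k.
Proof.
move=> pa lp C Es El HQ; have lb := len_b; have [p1 p2 p3] := pa.
have q0 : 0 < 2 ^ b by rewrite expn_gt0.
have q1 : 1 < 2 ^ b by exact: pow_gt1.
have [eln [_ h0]] := len_n LG; have nb := lg_hi LG.
apply: hwp_seq; apply: (hwp_asg _ b_gt0 b_le_w) => //=; rewrite El ?subn1 /=; try by sp.
set h1 := setv _ _ _.
have a1 x : x != 37 -> vars h1 x = vars h x by move=> nx /=; rewrite (negPf nx).
apply: (hwp_cond b_gt0 b_le_w) => //=; rewrite Es; last first.
  case: leqP => // lt _; apply: hwp_nop; apply: HQ => //=.
  by rewrite /Pieces.vert /Scans.inpc leqNgt lt.
case: leqP => // le _.
apply: (hwp_cond b_gt0 b_le_w) => //=; rewrite ?Es ?(CstsE C); try by sp.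
  case: ltnP => // lt _; apply: (hwp_asg _ b_gt0 b_le_w) => //=; rewrite Es (CstsE C).
    by sp => //; lia.
  apply: HQ => //=; first by move=> x nx; rewrite (negPf nx).
  by rewrite /Pieces.vert /Scans.inpc le lt.
case: ltnP => // lt _; apply: hwp_nop; apply: HQ => //=.
by rewrite /Pieces.vert /Scans.inpc le ltnNge lt.
Qed.

(** The test is a parameter because the low positions use the variant that consults the recorded
    exceptions. *)
Lemma hwp_conv T V a B p v D' o Q h k : piece a -> stA V a B p.+1 h -> p < len -> v = vert a p :> nat ->
  (forall h1, vars h1 37 = v -> (forall x, x != 37 -> vars h1 x = vars h x) -> hm h1 = hm h ->
     outp h1 = outp h -> forall Q1 : hst -> nat -> Prop,
     (forall h' k', (forall x, x < 48 -> vars h' x = vars h1 x) -> hm h' = hm h1 -> upto o V D' h' ->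
        vars h' 48 = (if v \in V then 1 else if new V v then 2 else 0) ->
        k' <= k + size (innbr G v) -> Q1 h' k') -> hwp T Q1 h1 k) ->
  (forall h' k', stA V a B p h' -> (forall x, x < 48 -> x != 37 -> x != rlim -> vars h' x = vars h x) ->
     (forall x, x < aW n b -> hm h' x = hm h x) -> upto o V D' h' ->
     k' <= k + size (innbr G v) -> Q h' k') ->
  hwp (Conv T) Q h k.
Proof.
move=> pa [[C T0 g] Es Ea El R] lp Ev HT HQ; have lb := len_b.
have q0 : 0 < 2 ^ b by rewrite expn_gt0.
have q1 : 1 < 2 ^ b by exact: pow_gt1.
have k0 := k3_gt0 (lg_big LG) (lg_lo LG) (lg_hi LG).
have [o1 o2 o3 o4 o5] := addr_order LG.
have [_ pv] := vertP LG pa lp; rewrite -Ev in pv.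
apply: hwp_seq; apply: (hwp_vert pa lp C Es El) => h1 a1 m1 oo1 e37.
apply: hwp_seq; apply: HT => //; first by rewrite e37 Ev.
move=> h2 k2 a2 m2 u2 e48 lk2.
have a2' x : x < 48 -> x != 37 -> vars h2 x = vars h x by move=> lx nx; rewrite a2 ?a1.
have C2 : Csts b h2 by apply: Csts_eq C _ => x lx; apply: a2'; lia.
have T2 : Tabs b (hm h2) by rewrite m2 m1.
have E34 : vars h2 rlim = p.+1 by rewrite a2'.
set d := (if v \in V then 1 else _) in e48.
have ld : d < 3 by rewrite /d; case: ifP => //; case: ifP.
have aTp := adrT lp.
apply: hwp_seq; apply: (@hwp_puttrit _ G _ _ LG) => //=.
- move=> h3 [a3 _ _ _]; rewrite !a3 //; sp => //; by rewrite E34.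
- by rewrite (CstsE C2) E34 subn1.
- by rewrite e48.
rewrite (CstsE C2) E34 subn1 /= e48 => h3 a3 i3 o3' m3.
have a3' x : x < 48 -> x != 37 -> vars h3 x = vars h x by move=> lx nx; rewrite a3 ?a2' //; lia.
have m3' x : x < aW n b -> hm h3 x = hm h x.
  move=> lx; rewrite m3 /putd_mod; case: eqP => [Ex|_]; last by rewrite m2 m1.
  by have := leq0n (p %/ k3); rewrite /aT in Ex; lia.
apply: (hwp_asg _ b_gt0 b_le_w) => //=; rewrite a3 // E34 ?subn1 /=; try by sp.
set h4 := setv _ _ _.
have a4 x : x < 48 -> x != 37 -> x != rlim -> vars h4 x = vars h x.
  by move=> lx nx ny; rewrite [LHS]/= (negPf ny) a3'.
apply: HQ => //.
- split.
  + split; first by apply: Csts_eq C _ => x lx; apply: a4; lia.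
      by apply: (low_ext T0) => x lx; apply: m3'; lia.
    by rewrite a4 // Es [vars h4 rlim]/=; apply: geo_piece => //; exact: ltnW.
  + by rewrite a4.
  + by rewrite a4.
  + by [].
  move=> u; rewrite (rd_conv LG pa lp ld (ltn_ord u) m3) /= m2 m1 R.
  case: eqP => [Eu|ne].
    have Euv : u = v.
      by apply: val_inj; rewrite /= Ev; have := pposP LG pa (ltn_ord u); rewrite Eu => ->.
    subst u; rewrite /fst3 Eu leqnn andbT /d.
    by have -> : inpc a v = false by [apply/negP => iv; move: Eu; rewrite /Pieces.ppos iv; lia].
  rewrite /fst3; case: ifP => // _; case: (u \in V) => //.
  by have -> : (p < ppos a u) = (p <= ppos a u) by [move/eqP: ne; lia].
- by case: u2 => l [pl El2]; exists l; rewrite [outp h4]/= o3'.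
Qed.

(** The exceptional vertices belong to both sets from the start, since they were reported when they
    were recorded. A vertex of the piece has position [len], which [Dhi] excludes and [Dlo]
    includes. *)
Definition Dhi V a lim := [set v : 'I_n | (v \in Xset V a 0) || (lim <= ppos a v < len)].
Definition Dlo V a lim := [set v : 'I_n | (v \in Xset V a 0) || (lim <= ppos a v)].

Lemma in_Dhi V a lim u : (u \in Dhi V a lim) = (u \in Xset V a 0) || (lim <= ppos a u < len).
Proof. by rewrite [LHS]in_set. Qed.

Lemma in_Dlo V a lim u : (u \in Dlo V a lim) = (u \in Xset V a 0) || (lim <= ppos a u).
Proof. by rewrite [LHS]in_set. Qed.

Lemma ppos_vert a v p : piece a -> p < len -> (ppos a v == p) = (v == vert a p :> nat).
Proof.
move=> pa lp; have [_ pv] := vertP LG pa lp; apply/eqP/eqP => [E|E].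
  by rewrite -E (pposP LG pa) ?E.
by rewrite E.
Qed.

Lemma hwp_convhi V a o Q h k : piece a -> stA V a false len h -> upto o V (Xset V a 0) h ->
  (forall h' k', stA V a false QQ h' -> (forall x, x < 36 -> x != rlim -> vars h' x = vars h x) ->
     (forall x, x < aW n b -> hm h' x = hm h x) -> upto o V (Dhi V a QQ) h' ->
     k' <= k + cst setT -> Q h' k') ->
  hwp ConvHi Q h k.
Proof.
move=> pa S U HQ; have [ql [p98 qb]] := QQ_lt LG; have [pa1 pa2 _] := pa.
pose I j h' k' := exists lim, [/\ j = lim - QQ, QQ <= lim <= len, stA V a false lim h' &
  [/\ (forall x, x < 36 -> x != rlim -> vars h' x = vars h x), (forall x, x < aW n b -> hm h' x = hm h x),
    upto o V (Dhi V a lim) h' & k' <= k + cst [set v : 'I_n | lim <= ppos a v < len]]].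
apply: (@hwp_loop _ G w b MM b_gt0 b_le_w _ _ I _ _ _ (len - QQ)) => //; last first.
  exists len; split=> //; first by lia.
  split=> //; last exact: leq_addr.
  case: U => l [pl El]; exists l; split=> //; apply: part_eq pl _ => u; rewrite !inE; lia.
move=> j h1 k1 [lim [-> /andP [l1 l2] S1 [a1 m1 u1 lk]]]; have [[C T g] Es Ea El R] := S1.
split=> //=; rewrite (CstsE C) El; case: ltnP => // lt _.
  have El2 : lim = QQ by lia.
  rewrite El2 in S1 u1 lk; apply: HQ => //.
  by apply: leq_trans lk _; rewrite leq_add2l cst_le.
split; first lia.
pose p := lim.-1; have Elim : lim = p.+1 by rewrite /p; lia.
have lp : p < len by lia.
have [lv pv] := vertP LG pa lp; pose v := Ordinal lv.
rewrite Elim in S1 u1 lk.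
have Evu u : (u == v) = (ppos a u == p) by rewrite (ppos_vert u pa lp).
have Xlo u : u \in Xset V a 0 -> ppos a u < QQ.
  by rewrite inE => /andP [/andP [_ lu] _]; have [-> _] := ppos_low LG pa lu.
have SD u : (u \in Dhi V a p) = (u == v) || (u \in Dhi V a p.+1).
  by rewrite !in_Dhi Evu; move: (u \in Xset V a 0) => X; lia.
have nD : v \notin Dhi V a p.+1.
  by rewrite in_set negb_or pv ltnn andbT; apply/negP => /Xlo; rewrite pv; lia.
apply: (hwp_conv (v := v) (D' := Dhi V a p) (o := o) pa S1 lp) => //.
- move=> h2 e37 a2 m2 o2 Q1 HQ1.
  apply: (hwp_test LG (v := v) (V := V) (D := Dhi V a p.+1) (D' := Dhi V a p) (o := o)) => //.
  + split; rewrite ?m2 //; last by rewrite !a2.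
    by apply: Csts_eq C _ => x lx; apply: a2; lia.
  + by move=> u; rewrite !a2 // m2 Es El R fst3_src.
  + by rewrite !a2 // m2 Es El R fst3_at // pv Elim.
  + by case: u1 => l [pl El1]; exists l; rewrite o2.
- move=> h2 k2 S2 a2 m2 u2 lk2; exists p; split=> //; first lia.
  + by apply/andP; split; lia.
  split=> //.
  + by move=> x lx nx; rewrite a2 ?a1 //; lia.
  + by move=> x lx; rewrite m2 ?m1.
  + rewrite (@cst_step _ G [set v : 'I_n | p.+1 <= ppos a v < len] _ v).
    * by rewrite /indeg; lia.
    * by rewrite inE pv ltnn.
    * by move=> u; rewrite !inE Evu; lia.
Qed.

Lemma hwp_piecenew V a o Q h k : piece a -> stA V a false QQ h -> upto o V (Dhi V a QQ) h ->
  (forall h' k', stA V a true QQ h' -> (forall x, x < 36 -> vars h' x = vars h x) ->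
     (forall x, aFL n b <= x < aW n b -> hm h' x = hm h x) -> upto o V (Dlo V a QQ) h' ->
     k' <= k + cst setT + hh -> Q h' k') ->
  hwp PieceNew Q h k.
Proof.
move=> pa S U HQ; have [ql [p98 qb]] := QQ_lt LG; have [pa1 pa2 pa3] := pa.
have q0 : 0 < 2 ^ b by rewrite expn_gt0.
have [eln [_ h0]] := len_n LG; have nb := lg_hi LG.
have [[C T g] Es Ea El R] := S; have lb := len_b.
have [o1 o2 o3 o4 o5] := addr_order LG.
have bff := BF_fits (lg_big LG) (lg_lo LG) (lg_hi LG).
have QM : aT n b + QQ %/ k3 < MM by apply: adrT; lia.
have lM x : x < MM -> x < 2 ^ b by exact: (MM_lt LG).
have QW : QQ %/ b = 2 * hh by rewrite /Layout.QQ /Layout.PP mulnCA mulKn.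
(* Writing to the buffer changes no status: the low bits end where it starts, and the digits in use
   begin behind its end. *)
have ext0 (m : nat -> nat) : (forall x, ~~ (aBF n b <= x < aBF n b + hh) -> m x = hm h x) ->
    forall u, rd n b m a QQ u = fst3 V a false QQ u.
  move=> Em u; rewrite -R !rdE; case: (boolP (inpc a u)) => iu.
    apply: dig_same; apply: Em; move: iu => /andP [_ l2]; have := adrX LG l2; rewrite /aBF; lia.
  case: ifP => lpu; apply: dig_same; apply: Em.
    have : ppos a u %/ b < QQ %/ b.
      by rewrite QW ltn_divLR // mulnC mulnCA -/PP.
    by rewrite QW /aBF; lia.
  have : QQ %/ k3 <= ppos a u %/ k3 by apply: leq_div2r; lia.
  by move: bff; move: (QQ %/ k3) (ppos a u %/ k3); lia.
pose Dp i := [set v : 'I_n | (v \in Dhi V a QQ) || (a <= v < a + i)].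
have inDp i u : (u \in Dp i) = (u \in Dhi V a QQ) || (a <= u < a + i) by rewrite [LHS]in_set.
pose pre h' := [/\ forall x, x < 36 -> vars h' x = vars h x,
  forall x, ~~ (aBF n b <= x < aBF n b + hh) -> hm h' x = hm h x & env h'].
have pre_env h' : (forall x, x < 36 -> vars h' x = vars h x) ->
  (forall x, ~~ (aBF n b <= x < aBF n b + hh) -> hm h' x = hm h x) -> pre h'.
  move=> E1 E2; split=> //; split; rewrite ?E1 //.
    by apply: Csts_eq C _ => x lx; apply: E1; lia.
  by apply: (low_ext T) => x lx; apply: E2; rewrite /aBF; lia.
have setE h' r' (z : nat) x : x < r' -> vars (setv h' r' z) x = vars h' x.
  by move=> lx /=; case: eqP => // Ex; lia.
have preS h' r (z : nat) : 36 <= r -> pre h' -> pre (setv h' r z).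
  by move=> lr [E1 E2 _]; apply: pre_env => // x lx; rewrite setE ?E1 //; lia.
pose J i h' k' := [/\ pre h', upto o V (Dp i) h', k' <= k + cst [set v : 'I_n | a <= v < a + i] &
  forall j (u : 'I_n), j < i -> u = a + j :> nat -> dig 2 b (hm h') (aBF n b) j = (u \in vfin V)].
apply: hwp_seq; apply: (hwp_asg _ b_gt0 b_le_w) => //=.
apply: hwp_seq; apply: (@hwp_for _ G w b MM b_gt0 b_le_w _ _ _ PP J _ 0) => //.
- lia.
- split=> //; last exact: leq_addr.
  + by apply: preS => //; exact: pre_env.
  + case: U => l [pl El2]; exists l; split=> //; apply: part_eq pl _ => u; rewrite !in_set; lia.
- by move=> i h' k' _ _ [[_ _ [C' _ _]] _ _ _]; rewrite /= (CstsE C').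
- move=> i h1 k1 li E36 [[a1 m1 en1] u1 lk d1]; have [C1 T1 g1] := en1.
  have lai : a + i < n by lia.
  pose v := Ordinal lai.
  have iv : inpc a v by rewrite /Scans.inpc leq_addr addKn.
  apply: hwp_seq; apply: (hwp_asg _ b_gt0 b_le_w) => //=; rewrite a1 // Ea E36.
    by sp => //; lia.
  set h2 := setv _ _ _; have pre2 : pre h2 by apply: preS.
  have [a2 m2 en2] := pre2.
  have Dv : v \notin Dp i by rewrite !in_set /Pieces.ppos iv /=; lia.
  have DS u : (u \in Dp i.+1) = (u == v) || (u \in Dp i).
    by rewrite !inDp -val_eqE /=; move: (u \in Dhi V a QQ) => X; lia.
  have cS : cst [set v : 'I_n | a <= v < a + i.+1] = cst [set v : 'I_n | a <= v < a + i] + indeg G v.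
    apply: cst_step => [|u]; first by rewrite inE /=; lia.
    by rewrite !inE -val_eqE /=; lia.
  apply: hwp_seq.
  apply: (hwp_test LG (v := v) (V := V) (D := Dp i) (D' := Dp i.+1) (o := o)) => //.
  + by move=> u; rewrite !a2 // Es El ext0 // fst3_src.
  + by rewrite !a2 // Es El ext0 // /fst3 iv.
  move=> h3 k3' a3 m3 u3 e48 lk3.
  have e36 : vars h3 36 = i by rewrite a3.
  have pre3 : pre h3.
    by apply: pre_env => x lx; rewrite ?m3 ?m2 // a3 ?a2 //; lia.
  have [a3' m3' [C3 T3 g3]] := pre3.
  have e48' : (0 < vars h3 48 : nat) = (v \in vfin V).
    by rewrite e48 !inE; case: (v \in V) => //; case: (new V v).
  have ib : i %/ b < hh by rewrite ltn_divLR // mulnC.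
  have iM : aBF n b + i %/ b < MM by lia.
  apply: (@hwp_putbit _ G _ _ LG) => //=.
  + by move=> h4 [a4 _ _ _]; sp => //; rewrite !a4.
  + by rewrite (CstsE C3) e36.
  + exact: leq_b1.
  rewrite (CstsE C3) e36 e48' => h4 a4 i4 o4' m4.
  have lx2 : (v \in vfin V : nat) < 2 by case: (v \in _).
  have d4 := dig_put (rho := 2) isT b_gt0 lx2 m4.
  split; first by rewrite a4.
  split.
  + apply: preS => //; apply: pre_env => x lx; first by rewrite a4 ?a3' //; lia.
    rewrite m4 /putd; case: eqP => [Ex|_]; last exact: m3'.
    by move/negP: lx; case; rewrite Ex leq_addr ltn_add2l.
  + by case: u3 => l [pl El3]; exists l; rewrite /= o4'.
  + by rewrite cS /indeg; lia.
  + move=> j u lj Eu; rewrite /= d4; case: eqP => [Ej|ne].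
      have -> // : u = v.
      by apply: val_inj; rewrite /= Eu Ej.
    by rewrite m3; apply: d1 => //; lia.
move=> h1 k1 _ [[a1 m1 en1] u1 lk d1].
pose J2 i h' k' := [/\ forall x, x < 36 -> vars h' x = vars h x,
  (forall x, ~~ (aX b <= x < aX b + hh) -> hm h' x = hm h1 x),
  (forall j, j < i -> hm h' (aX b + j) = hm h1 (aBF n b + j)), outp h' = outp h1 & k' = k1 + i].
have C' h' : (forall x, x < 36 -> vars h' x = vars h x) -> Csts b h'.
  by move=> E; apply: Csts_eq C _ => x lx; apply: E; lia.
apply: hwp_seq; apply: (hwp_asg _ b_gt0 b_le_w) => //=.
apply: (@hwp_for _ G w b MM b_gt0 b_le_w _ _ _ hh J2 _ 0) => //.
- by apply: lM; move: (aFL_MM LG); lia.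
- split=> //=; last by rewrite addn0.
  by move=> x lx; case: eqP => [?|_]; [lia|exact: a1].
- by move=> i h' k' _ _ [E1 _ _ _ _]; rewrite /= (CstsE (C' _ E1)).
- move=> i h2 k2 li E36 [a2 m2 n2 oo2 ->]; have C2 := C' _ a2.
  apply: (hwp_wr _ b_gt0 b_le_w) => //=; rewrite !(CstsE C2) E36.
  + by sp => //; apply: lM; have := aFL_MM LG; lia.
  + by sp => //; [apply: lM|]; lia.
  + by have := aFL_MM LG; lia.
  have -> : hm h2 (aBF n b + i) = hm h1 (aBF n b + i) by apply: m2; rewrite /aBF; lia.
  split=> //; split=> //=.
  + by move=> x lx; case: eqP => [?|_]; [lia|exact: a2].
  + by move=> x nx; case: eqP => [Ex|_]; [lia|exact: m2].
  + by move=> j lj; rewrite eqn_add2l; case: eqP => [->|ne] //; apply: n2; lia.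
  + by rewrite addnS.
move=> h2 k2 E36 [a2 m2 n2 oo2 ->]; apply: HQ => //.
- split; rewrite ?a2 //.
  + split; rewrite ?a2 //; first exact: C'.
    by apply: (low_ext T) => x lx; rewrite m2 ?m1 //; [rewrite /aBF; lia|lia].
  move=> u; have lu := ltn_ord u.
  case: (boolP (inpc a u)) => iu.
    have /andP [i1 i2] := iu.
    rewrite rdE iu /fst3 iu -(d1 _ u i2) ?subnKC //.
    by rewrite /dig n2 // ltn_divLR // mulnC.
  have -> : fst3 V a true QQ u = fst3 V a false QQ u by rewrite /fst3 (negPf iu).
  rewrite -(ext0 _ m1) !rdE (negPf iu).
  by case: ifP => _; apply: dig_same; apply: m2; have := leq0n (ppos a u %/ b); have := leq0n (ppos a u %/ k3); rewrite /aT; lia.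
- by move=> x hx; rewrite m2 ?m1 //; rewrite ?/aBF; lia.
- case: u1 => l [pl El2]; exists l; split; last by rewrite oo2.
  apply: part_eq pl _ => u; rewrite inDp in_Dhi in_Dlo; move: (u \in Xset V a 0) => X.
  have lu := ltn_ord u; have := ppos_lt LG pa lu; rewrite /Scans.inpc /Pieces.ppos /Scans.inpc.
  by case: ifP; lia.
- by have := cst_le G [set v : 'I_n | a <= v < a + PP]; lia.
Qed.

(** The counter in register 46 retraces the indices under which the bits were stored, since both
    passes skip the same unflagged blocks. *)
Lemma hwp_elook V a p Q h k : chosen G b V a -> p < QQ -> env h -> vars h rlim = p.+1 ->
  (forall q, q * 8 < QQ -> dig 2 b (hm h) (aFL n b) q = flp V a q) ->
  ebok V a (hm h) 0 -> vars h 46 = cntF V a p.+1 ->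
  (forall h', (forall x, x < 60 -> x != 46 -> x != 49 -> vars h' x = vars h x) -> hm h' = hm h ->
     outp h' = outp h -> vars h' 46 = cntF V a p -> vars h' 49 = xcl G b V a p -> Q h' k) ->
  hwp ELook Q h k.
Proof.
move=> ch lp [C T g] El dF eb e46 HQ; have [ql [p98 qb]] := QQ_lt LG.
have q0 : 0 < 2 ^ b by rewrite expn_gt0.
have q1 : 1 < 2 ^ b by exact: pow_gt1.
have s8 : 8 < 2 ^ b by exact: (small_pow LG).
have cF := cntFS G V a lp.
have p8 : p %/ 8 * 8 <= p by exact: leq_divM.
have aM := aW_MM LG; have aM' := aEB_MM LG.
apply: hwp_seq; apply: (hwp_asg _ b_gt0 b_le_w) => //=; set h1 := setv _ _ _.
have C1 : Csts b h1 by apply: Csts_eq C _ => x lx /=; case: eqP => // Ex; lia.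
have T1 : Tabs b (hm h1) by [].
have E1 : vars h1 rlim = p.+1 by [].
have Efl : ev ($rFL)%hl h1 = aFL n b by rewrite -[LHS]/(vars h rFL) (CstsE C).
have Ep8 : ev (($rlim - 1) %/ Cst 8)%hl h1 = p %/ 8.
  by rewrite -[LHS]/((vars h rlim - 1) %/ 8) El subn1.
have [//| |o2' E2] := @bitE_ok n w b LG h1 ($rFL)%hl (($rlim - 1) %/ Cst 8)%hl C1 T1 I.
- by rewrite /= El; sp.
- by rewrite Efl Ep8; apply: leq_trans aM'; apply: (adrFL LG); lia.
have {}E2 : ev (bitE ($rFL)%hl (($rlim - 1) %/ Cst 8)%hl) h1 = flp V a (p %/ 8).
  by rewrite E2 Efl Ep8; apply: dF; lia.
have NX : ~~ flp V a (p %/ 8) -> xcl G b V a p = false.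
  by move=> nf; apply/negP => xp; move/negP: nf; apply; exact: flp_xcl.
apply: (hwp_cond b_gt0 b_le_w); rewrite ?E2 //; last first.
  case: (boolP (flp V a (p %/ 8))) cF NX => //= nf cF /(_ isT) NX _.
  apply: hwp_nop; apply: HQ => //=.
  - by move=> x lx n1 n2; rewrite (negPf n2).
  - by rewrite e46 cF.
  - by rewrite NX.
case: (boolP (flp V a (p %/ 8))) cF => //= fp cF _; rewrite add1n in cF.
have lE : aEB n b + cntF V a p.+1 %/ b < aW n b by apply: (adrEB LG ch (p := p)); lia.
have cb : cntF V a p.+1 < QQ.
  by have := cntF_le LG p ch; move: (leq_divM QQ 96); move: (QQ %/ 96) => z; lia.
have Eeb : ev ($rEB)%hl h1 = aEB n b by rewrite -[LHS]/(vars h rEB) (CstsE C).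
have E46 : ev ($46)%hl h1 = cntF V a p.+1 by [].
have [//|//| |o3' E3] := @bitE_ok n w b LG h1 ($rEB)%hl ($46)%hl C1 T1.
- by rewrite Eeb E46; lia.
have {}E3 : ev (bitE ($rEB)%hl ($46)%hl) h1 = xcl G b V a p.
  by rewrite E3 Eeb E46; apply: eb.
apply: hwp_seq; apply: (hwp_asg _ b_gt0 b_le_w) => //; rewrite E3.
apply: (hwp_asg _ b_gt0 b_le_w) => //=; rewrite e46 ?addn1; try by sp => //; lia.
apply: HQ => //=; try by rewrite cF.
by move=> x lx n1 n2; rewrite (negPf n1) (negPf n2).
Qed.

Lemma hwp_convlo V a o Q h k : chosen G b V a -> stA V a true QQ h ->
  (forall q, q * 8 < QQ -> dig 2 b (hm h) (aFL n b) q = flp V a q) -> ebok V a (hm h) 0 ->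
  upto o V (Dlo V a QQ) h ->
  (forall h' k', stA V a true 0 h' -> (forall x, x < 36 -> x != rlim -> vars h' x = vars h x) ->
     upto o V setT h' -> k' <= k + cst setT -> Q h' k') ->
  hwp ConvLo Q h k.
Proof.
move=> ch S dF eb U HQ; have [pa xc] := ch; have [ql [p98 qb]] := QQ_lt LG; have [pa1 pa2 _] := pa.
have q0 : 0 < 2 ^ b by rewrite expn_gt0.
have q1 : 1 < 2 ^ b by exact: pow_gt1.
have [o1 o2 o3 o4 o5] := addr_order LG.
pose I j h' k' := exists lim, [/\ j = lim, lim <= QQ, stA V a true lim h' &
  [/\ (forall x, x < 36 -> x != rlim -> vars h' x = vars h x) /\ vars h' 46 = cntF V a lim,
    (forall x, x < aW n b -> hm h' x = hm h x),
    upto o V (Dlo V a lim) h' & k' <= k + cst [set v : 'I_n | lim <= ppos a v < QQ]]].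
apply: hwp_seq; apply: (hwp_asg _ b_gt0 b_le_w) => //=.
apply: (@hwp_loop _ G w b MM b_gt0 b_le_w _ _ I _ _ _ QQ) => //; last first.
  exists QQ; split=> //.
    case: S => [[C T g] Es Ea El R]; split=> //; split=> //.
    by apply: Csts_eq C _ => x lx /=; case: eqP => // Ex; lia.
  split=> //; last exact: leq_addr.
  split; last by rewrite /= /Selection.cntF subnn.
  by move=> x lx nx /=; case: eqP => // Ex; lia.
move=> j h1 k1 [lim [-> l1 S1 [[a1 e46] m1 u1 lk]]]; have [[C T g] Es Ea El R] := S1.
split=> //=; rewrite ?El; case: ltnP => // lt _.
  have El2 : lim = 0 by lia.
  rewrite El2 in S1 u1 lk; apply: HQ => //.
    by case: u1 => l [pl El1]; exists l; split=> //; apply: part_eq pl _ => u; rewrite !in_set orbT.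
  by apply: leq_trans lk _; rewrite leq_add2l cst_le.
split=> //.
pose p := lim.-1; have Elim : lim = p.+1 by rewrite /p; lia.
have lpq : p < QQ by lia.
have lp : p < len by lia.
have [lv pv] := vertP LG pa lp; pose v := Ordinal lv.
have Evp : v = p :> nat by rewrite /= (proj2 (ppos_low LG pa lpq)).
rewrite Elim in S1 u1 lk e46 El.
have Evu u : (u == v) = (ppos a u == p) by rewrite (ppos_vert u pa lp).
have SD u : (u \in Dlo V a p) = (u == v) || (u \in Dlo V a p.+1).
  by rewrite !in_set Evu; move: (_ && _) => ?; lia.
(* The position of v is p, so v can have been dealt with only as a recorded exception. *)
have vD : (v \in Dlo V a p.+1) = excl V a v.
  by rewrite !in_set pv ltnn orbF Evp lpq.
have dF1 q : q * 8 < QQ -> dig 2 b (hm h1) (aFL n b) q = flp V a q.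
  by move=> lq; rewrite -dF //; apply: dig_same; apply: m1; have := adrFL LG lq; lia.
have eb1 : ebok V a (hm h1) 0.
  move=> p' hp fp'; rewrite -eb //; apply: dig_same; apply: m1.
  apply: (adrEB LG ch (p := p')); rewrite (cntFS G V a (p := p')) ?fp' //; lia.
apply: hwp_seq; apply: (hwp_elook ch lpq _ El) => // h2 a2 m2 oo2 e46' e49.
have S2 : stA V a true p.+1 h2.
  split; rewrite ?a2 // ?m2 //; last by rewrite -Elim.
  split; rewrite ?m2 ?a2 //.
  by apply: Csts_eq C _ => x lx; apply: a2; lia.
have [[C2 T2 g2] Es2 Ea2 El2 R2] := S2.
have e49' : vars h2 49 = excl V a v by rewrite e49 -(xclE G b V a v) Evp.
apply: (hwp_conv (v := v) (D' := Dlo V a p) (o := o) pa S2 lp) => //.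
- move=> h3 e37 a3 m3 oo3 Q1 HQ1.
  apply: (hwp_test2 LG (v := v) (V := V) (Z := Zs V a true) (D := Dlo V a p.+1) (D' := Dlo V a p) (o := o)) => //.
  + split; rewrite ?m3 //; last by rewrite !a3.
    by apply: Csts_eq C2 _ => x lx; apply: a3; lia.
  + by move=> u; rewrite !a3 // m3 Es2 El2 R2 fst3_src.
  + by move=> u; rewrite a3 // Ea2; exact: Zs_out.
  + by rewrite !a3 // m3 Es2 El2 R2 fst3_at // pv.
  + by rewrite !a3 // Ea2 e49'.
  + by rewrite a3 // Ea2 vD.
  + by case: u1 => l [pl El1]; exists l; rewrite oo3 oo2.
- move=> h3 k3' S3 a3 m3 u3 lk3; exists p; split=> //.
  + exact: ltnW.
  split=> //.
  + split; last by rewrite a3.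
    by move=> x lx nx; rewrite a3 ?a2 ?a1 //; lia.
  + by move=> x lx; rewrite m3 ?m2 ?m1.
  + rewrite (@cst_step _ G [set v : 'I_n | p.+1 <= ppos a v < QQ] _ v).
    * by rewrite /indeg; lia.
    * by rewrite inE pv ltnn.
    * by move=> u; rewrite !inE Evu; lia.
Qed.

(** Positions below lim hold final bits again. All others still hold digits, because the conversion
    went down to position 0. *)
Definition fback V a lim u : nat :=
  if inpc a u || (ppos a u < lim) then (u \in vfin V : nat) else fst3 V a true 0 u.

Lemma hwp_back V a Q h k : piece a -> stA V a true 0 h ->
  (forall h', env h' -> (forall x, x < 36 -> x != rlim -> vars h' x = vars h x) ->
     vars h' rlim = len -> (forall u, rd n b (hm h') a len u = (u \in vfin V)) ->
     outp h' = outp h -> Q h' (k + len)) ->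
  hwp Back Q h k.
Proof.
move=> pa S HQ; have [[C T g] Es Ea El R] := S; have [pa1 pa2 _] := pa; have lb := len_b.
have q0 : 0 < 2 ^ b by rewrite expn_gt0.
have q1 : 1 < 2 ^ b by exact: pow_gt1.
have [o1 o2 o3 o4 o5] := addr_order LG.
pose I j h' k' := exists lim, [/\ j + lim = len, env h', vars h' rlim = lim,
   (forall x, x < 36 -> x != rlim -> vars h' x = vars h x) &
   [/\ forall u, rd n b (hm h') a lim u = fback V a lim u, outp h' = outp h & k' = k + lim]].
apply: (@hwp_loop _ G w b MM b_gt0 b_le_w _ _ I _ _ _ len) => //; last first.
  exists 0; split=> //; first by rewrite addn0.
  split=> //; last by rewrite addn0.
  by move=> u; rewrite R /fback ltn0 orbF /fst3; case: ifP.
move=> j h1 k1 [p [Ej en1 El1 a1 [R1 oo1 ->]]]; have [C1 T1 g1] := en1.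
split=> //=; rewrite (CstsE C1) El1; case: ltnP => // lt _.
  have Ep : p = len by lia.
  rewrite Ep in El1 R1 *; apply: (HQ h1) => // u; rewrite R1 /fback.
  by have := ppos_lt LG pa (ltn_ord u); case: (inpc a u) => //= ->.
split; first lia.
have E2 h' : frm 60 h1 h' -> ok b MM (tritE ($rTb)%hl ($rlim)%hl) h' /\
    ev (tritE ($rTb)%hl ($rlim)%hl) h' = dig 3 k3 (hm h1) (aT n b) p.
  move=> [a' m' i' o']; have C' : Csts b h' by apply: Csts_eq C1 _ => x lx; apply: a'; lia.
  have T' : Tabs b (hm h') by rewrite m'.
  have [//|//| |? E] := @tritE_ok n w b LG h' ($rTb)%hl ($rlim)%hl C' T'.
    by rewrite /= (CstsE C') a' // El1; exact: adrT.
  by split=> //; rewrite E /= (CstsE C') a' // El1 m'.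
have [ok1 ev1] := E2 _ (frm_refl 60 h1).
apply: hwp_seq; apply: (@hwp_putbit _ G _ _ LG) => //.
- move=> h' f; have [ok' ev'] := E2 _ f; have [a' _ _ _] := f.
  split=> //=; rewrite ?a' //; split=> //.
  by move: ev'; rewrite -ev1 /= !a' // => ->.
- by rewrite /= (CstsE C1) El1; apply: ltn_trans (adrW LG p) (adrT lt).
- exact: leq_b1.
have -> : ev (Cst 0 < tritE ($rTb)%hl ($rlim)%hl)%hl h1 = (0 < dig 3 k3 (hm h1) (aT n b) p) by rewrite -ev1.
rewrite [ev ($rW)%hl h1]/= (CstsE C1) [ev ($rlim)%hl h1]/= El1 => h2 a2 i2 oo2 m2.
have d2 : (0 < dig 3 k3 (hm h1) (aT n b) p : nat) < 2 by case: (0 < _).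
have m2' x : x < aW n b -> hm h2 x = hm h1 x.
  by move=> lx; rewrite m2 /putd; case: eqP => // Ex; have := leq0n (p %/ b); lia.
apply: (hwp_asg _ b_gt0 b_le_w) => //=; rewrite a2 // El1 ?addn1; try by sp => //; lia.
exists p.+1; split=> //; first by lia.
- split=> //=.
  + by apply: Csts_eq C1 _ => x lx /=; case: eqP => [?|_]; [lia|apply: a2; lia].
  + by apply: (low_ext T1) => x lx; apply: m2'; lia.
  + by rewrite a2 // a1 // Es; apply: geo_piece.
- by move=> x lx nx /=; rewrite (negPf nx) a2 ?a1 //; lia.
split=> //=; last by rewrite addnS.
  move=> u; rewrite (rd_back LG pa lt d2 (ltn_ord u) m2) R1 /fback.
  have -> : (ppos a u < p.+1) = (ppos a u == p) || (ppos a u < p) by rewrite ltnS leq_eqVlt.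
  case: eqP => [Eu|ne]; last by [].
  have -> : inpc a u || (true || (ppos a u < p)) = true by rewrite orbT.
  have niu : inpc a u = false by apply/negP => iu; move: Eu; rewrite /Pieces.ppos iu; lia.
  have Ed : dig 3 k3 (hm h1) (aT n b) p = fst3 V a true 0 u.
    by have := R1 u; rewrite rdE niu /fback niu Eu ltnn.
  by rewrite Ed /fst3 niu leq0n andbT !inE; case: (u \in V) => //; case: (new V u).
by rewrite oo2.
Qed.

(** Of the passes over inneighbour lists, 96 go into the choice of the piece; the flags, the
    exceptions, the high positions, the piece and the low positions take one each. The term 4 n
    covers the exchanges, the copy of the buffer and the way back to bits. *)
Lemma hwp_crit V o Q h k : nc h V -> outp h = o ->
  (forall h' k' l, nc h' (vfin V) -> (forall x, x < 35 -> vars h' x = vars h x) ->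
     layer e V l -> outp h' = o ++ flat l ->
     k' <= k + 102 * (cst setT).+1 + 4 * n -> Q h' k') ->
  hwp Crit Q h k.
Proof.
move=> N Eo HQ; have [eln [h126 h0]] := len_n LG; have nb := lg_hi LG; have lb := len_b.
have q0 : 0 < 2 ^ b by rewrite expn_gt0.
have [o1 o2 o3 o4 o5] := addr_order LG.
have hP : hh <= PP by rewrite /Layout.PP; exact: leq_pmull.
apply: hwp_seq; apply: (hwp_choose LG N) => h1 k1 N1 a1 m1 oo1 ch lk1.
set a := vars h1 ra in ch; have [pa _] := ch; have [pa1 pa2 _] := pa.
apply: hwp_seq; apply: (hwp_mkflags LG N1) => h2 k2 N2 a2 m2 oo2 dF lk2.
have Ea2 : vars h2 ra = a by exact: a2.
rewrite -/a -Ea2 in dF; apply: hwp_seq.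
apply: (hwp_mkeb LG N2 (o := o)) => //; rewrite ?Ea2 //; first by rewrite oo2 oo1.
rewrite Ea2 in dF * => h3 k3' N3 a3 dF3 eb3 u3 lk3.
have [[C3 T3 g3] Es3 El3 R3] := N3; have Ea3 : vars h3 ra = a by rewrite a3.
apply: hwp_seq; apply: (@hwp_swap _ G _ _ LG _ _ _ _ pa C3 Ea3) => h4 a4 i4 oo4 sw4.
have [[s1 s2 s3] s4] := sw4.
apply: hwp_seq; apply: (hwp_asg _ b_gt0 b_le_w) => //=; rewrite a4 // Ea3; set h5 := setv _ _ _.
have a5 x : x < 36 -> x != rsa -> vars h5 x = vars h3 x.
  by move=> lx nx; rewrite [LHS]/= (negPf nx) a4.
have S5 : stA V a false len h5.
  split=> //; try by rewrite a5.
  + split; first by apply: Csts_eq C3 _ => x lx; apply: a5; lia.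
      by apply: (low_ext T3) => x lx; apply: s3; lia.
    by rewrite (a5 rlim) // El3; exact: geo_piece.
  move=> u; rewrite (rd_swap_in LG pa sw4 (ltn_ord u)) R3 /fst3; case: (boolP (inpc a u)) => // iu.
  have := ppos_lt LG pa (ltn_ord u); rewrite iu => lpu.
  by rewrite [len <= _]leqNgt lpu andbF; case: (u \in V).
have mF x : aFL n b <= x < aW n b -> hm h5 x = hm h3 x by move=> hx; apply: s3; lia.
have u5 : upto o V (Xset V a 0) h5 by case: u3 => l [pl El]; exists l; rewrite /= oo4.
apply: hwp_seq; apply: (hwp_convhi pa S5 u5) => h6 k6 S6 a6 m6 u6 lk6.
apply: hwp_seq; apply: (hwp_piecenew pa S6 u6) => h7 k7 S7 a7 m7 u7 lk7.
have mF7 x : aFL n b <= x < aW n b -> hm h7 x = hm h3 x.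
  by move=> hx; rewrite m7 // m6 ?mF //; lia.
apply: hwp_seq; apply: (hwp_convlo ch S7 _ _ u7).
- by move=> q lq; rewrite -dF3 //; apply: dig_same; apply: mF7; rewrite leq_addr /=; have := adrFL LG lq; lia.
- move=> p hp fp; rewrite -eb3 //; apply: dig_same; apply: mF7.
  have : aEB n b + cntF V a p.+1 %/ b < aW n b.
    by apply: (adrEB LG ch (p := p)); rewrite (cntFS G V a (p := p)) ?fp //; lia.
  by have := leq0n (cntF V a p.+1 %/ b); lia.
move=> h8 k8 S8 a8 [l [pl El8]] lk8.
apply: hwp_seq; apply: (hwp_back pa S8) => h9 en9 a9 e34 R9 oo9.
have [C9 T9 g9] := en9.
have reg9 x : x < 36 -> x != rlim -> x != rsa -> vars h9 x = vars h3 x.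
  by move=> lx n1 n2; rewrite a9 // a8 // a7 // a6 // a5.
apply: hwp_seq; apply: (@hwp_swap _ G _ _ LG _ _ _ _ pa C9); first by rewrite reg9.
move=> h10 a10 i10 oo10 sw10; have [[t1 t2 t3] t4] := sw10.
have C10 : Csts b h10 by apply: Csts_eq C9 _ => x lx; apply: a10; lia.
apply: (hwp_asg _ b_gt0 b_le_w) => //=; rewrite (CstsE C10); set h11 := setv _ _ _.
have a11 x : x < 36 -> x != rsa -> vars h11 x = vars h9 x.
  by move=> lx nx; rewrite [LHS]/= (negPf nx) a10.
apply: (HQ _ _ l).
- split=> //; last by move=> u; rewrite (rd_swap_out LG pa sw10 (ltn_ord u)) R9.
  + split; first by apply: Csts_eq C9 _ => x lx; apply: a11; lia.
      by apply: (low_ext T9) => x lx; apply: t3; lia.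
    by rewrite (a11 rlim) // e34 [vars h11 rsa]/=; split=> //; left.
  + by rewrite a11.
- move=> x lx; case: (eqVneq x rsa) => [->|ns].
    by case: N => _ e33 _ _; rewrite e33.
  case: (eqVneq x rlim) => [->|nl].
    by case: N => _ _ e34' _; rewrite e34' a11 // e34.
  by rewrite a11 ?reg9 //; try lia; rewrite a3 ?a2 ?a1 //; lia.
- by case: pl => p1 p2 p3; split=> // u; rewrite p2 inE.
- by rewrite /= oo10 oo9 El8.
- have cT : n <= cst setT.
    have : \sum_(v in [set: 'I_n]) 1 <= cst setT by apply: leq_sum.
    by rewrite sum1_card cardsT card_ord.
  lia.
Qed.

End Crit.

End Dense.
Import Dense.

(** * The search as a whole and its amortized cost *)

Module Traversal.

Definition LayerBody : cmd :=
  PhaseA ;; Clear ;;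
  Cond ($rng == 0)%hl (26 ::= 0)
    (Cond ($rng <= $rThr)%hl (PhaseB ;; PhaseC ;; Move)
       (Crit ;; Reset ;; InsertAll ;; Move)).

Definition TreeLoop : cmd := 26 ::= 1 ;; Loop ($26)%hl LayerBody.

(** A flag ends the loop, because the value n that a counter would have to reach need not fit into b
    bits. *)
Definition Forest : cmd :=
  25 ::= 0 ;; 27 ::= 1 ;;
  Loop ($27)%hl
    (Get 25 ;;
     Cond ($62 == 0)%hl
       (Out ($25)%hl ;; Out ($25)%hl ;; PutV 25 ;; 55 ::= $25 %/ Cst 64 ;; Insert ;;
        Move ;; TreeLoop) Nop ;;
     Cond ($25 < $rN1)%hl (25 ::= $25 + 1) (27 ::= 0)).

Section Search.

Variables (n : nat) (G : graph n) (w b : nat).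
Hypothesis LG : large n w b.

Let b_le_w := lg_w LG.
Let b_gt0 : 0 < b. Proof. by have := lg_big LG; lia. Qed.

Local Notation MM := (MM n b).
Local Notation len := (len n b).
Local Notation PP := (PP n b).
Local Notation hwp := (hwp G w b MM).
Local Notation hst := (hst n).
Local Notation t := (tt b).
Local Notation nF := (nF n b).
Local Notation thr := (thr n b).
Local Notation ngr := (ngr n).
Local Notation setok := (setok t nF).
Local Notation groups := (groups t).
Local Notation e := (edge G).
Local Notation env := (env b).
Local Notation nc := (nc b).
Local Notation nxt := (nxt b).
Local Notation nxtok := (nxtok b).
Local Notation cur := (cur b).
Local Notation curok := (curok b).
Local Notation new := (new_nbr e).
Local Notation vfin := (vfin G).
Local Notation cst := (cst G).
Implicit Types (V D : {set 'I_n}) (h : hst) (u v : 'I_n).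

Definition deg u := size (outnbr G u) + size (innbr G u).
Definition gc g := gcost deg g.
Definition tsum (l : seq nat) := \sum_(g <- l) gc g.
Definition tall := tsum (iota 0 ngr).
(** What a dense layer may consume, including the insertion of all groups and their probing at the
    start of the following layer. *)
Definition dense := 1 + 102 * (cst setT).+1 + 4 * n + 2 * nF + 2 * ngr + 2 * tall.
(** The share of each new vertex in the cost of a dense layer, which has more than [thr] of them. *)
Definition DD := (dense %/ thr.+1).+1.
(** What a vertex pays when it is reached: the traversals of its group in this layer and the next,
    and a share of a dense layer. Of the six copies of [gc], two pay for reporting and marking and
    two for the next probing and clearing; the others cover the handling of lists and the loop
    iteration. *)
Definition pot v := 6 * gc (v %/ 64) + DD.
Definition Wt V := \sum_(v | v \notin V) pot v.

Lemma gcost_le (f f' : 'I_n -> nat) g : (forall u, f u <= f' u) -> gcost f g <= gcost f' g.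
Proof. by move=> H; rewrite /gcost leq_add2l; apply: leq_sum => u _; exact: H. Qed.

Lemma gc_ge g : 66 <= gc g.
Proof. exact: leq_addr. Qed.

Lemma tsum_size l : 66 * size l <= tsum l.
Proof.
rewrite /tsum mulnC -[X in X * _]sum1_size big_distrl /=; apply: leq_sum => g _.
by rewrite mul1n gc_ge.
Qed.

Lemma tsum_out l : \sum_(g <- l) gcost (fun u => size (outnbr G u)) g <= tsum l.
Proof. by apply: leq_sum => g _; apply: gcost_le => u; exact: leq_addr. Qed.

Lemma tsum_in l : \sum_(g <- l) gcost (fun u => size (innbr G u)) g <= tsum l.
Proof. by apply: leq_sum => g _; apply: gcost_le => u; exact: leq_addl. Qed.

Lemma tsum_0 l : \sum_(g <- l) gcost (fun u : 'I_n => 0) g <= tsum l.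
Proof. by apply: leq_sum => g _; exact: gcost_le. Qed.

Lemma sum_sub (f : nat -> nat) l m : uniq l -> (forall g, g \in l -> g < m) ->
  \sum_(g <- l) f g <= \sum_(g <- iota 0 m) f g.
Proof.
move=> ul H; rewrite [X in _ <= X](bigID (mem l)) /= -[X in _ <= X + _]big_filter.
have E : perm_eq l [seq g <- iota 0 m | mem l g].
  apply: uniq_perm => //; first by rewrite filter_uniq ?iota_uniq.
  move=> g; rewrite mem_filter mem_iota /= add0n; case: (boolP (g \in l)) => //= gl.
  by rewrite H.
by rewrite (perm_big _ E) leq_addr.
Qed.

(** Distinct groups have distinct representatives satisfying P, so the cost of the groups can be
    charged to these vertices. *)
Lemma grp_sum (f : nat -> nat) (P : pred 'I_n) l : uniq l ->
  (forall g, g \in l -> exists2 v, P v & v %/ 64 = g) ->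
  \sum_(g <- l) f g <= \sum_(v | P v) f (v %/ 64).
Proof.
move=> ul H; apply: leq_trans (_ : \sum_(g <- l) \sum_(v | P v) (if v %/ 64 == g then f g else 0) <= _).
  rewrite big_seq [X in _ <= X]big_seq; apply: leq_sum => g /H [v Pv Ev].
  by rewrite (bigD1 v) //= Ev eqxx leq_addr.
rewrite exchange_big /=; apply: leq_sum => v _.
elim: l ul {H} => [|g l IH] /=; first by rewrite big_nil.
case/andP => gl ul; rewrite big_cons; case: eqP => [Eg|_]; last by rewrite add0n IH.
rewrite big_seq big1 ?addn0 ?Eg // => g' g'l; case: eqP => // Eg'.
by move: gl; rewrite Eg' g'l.
Qed.

Lemma Wt_fin V : Wt V = Wt (vfin V) + \sum_(v | new V v) pot v.
Proof.
rewrite /Wt (bigID (new V)) /= addnC; congr addn; apply: eq_bigl => v; rewrite ?inE ?negb_or //.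
by rewrite /new_nbr; case: (v \in V).
Qed.

Lemma nc_reg h h' V : nc h V -> (forall x, (x < 25) || (x == rsa) || (x == rlim) -> vars h' x = vars h x) ->
  hm h' = hm h -> nc h' V.
Proof.
move=> [[C T g] e1 e2 R] Ev Em; split; rewrite ?Ev ?Em //.
by split; rewrite ?Ev ?Em //; apply: Csts_eq C _ => x lx; apply: Ev; rewrite lx.
Qed.

(** The last clause justifies probing the current groups only: every edge that leaves V starts in
    one of them. *)
Definition lay V h := [/\ nc h V, curok h, nxtok h /\ nxt h = [::]
  & forall u v, u \in V -> v \notin V -> e u v -> u %/ 64 \in cur h].

(** The state between two trees: the next set is empty and the flags of the current one are cleared,
    as needed for inserting a new root. *)
Definition idle V h := [/\ nc h V, nxtok h, nxt h = [::] & forall c, c < nF -> hm h (aCF n b + c) = 0].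

Lemma nxt_pres h h' : nxtok h ->
  (forall i, i < nF -> hm h' (aNF n b + i) = hm h (aNF n b + i) /\ hm h' (aNL n b + i) = hm h (aNL n b + i)) ->
  vars h' rnl = vars h rnl -> vars h' rng = vars h rng -> nxtok h' /\ nxt h' = nxt h.
Proof.
move=> [so En gn] Em E1 E2; have lnF := setok_size so; have [_ a _ _] := so.
have Eg : nxt h' = nxt h.
  by rewrite /GroupOps.nxt E1; apply: (proj1 (groups_eq LG lnF a Em)).
split=> //; split; rewrite ?E1 ?E2 ?Eg //; exact: (proj1 (setok_eq LG so Em)).
Qed.

Lemma cur_pres h h' : curok h ->
  (forall i, i < nF -> hm h' (aCF n b + i) = hm h (aCF n b + i) /\ hm h' (aCL n b + i) = hm h (aCL n b + i)) ->
  vars h' rcl = vars h rcl -> curok h' /\ cur h' = cur h.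
Proof.
move=> [so gn] Em E1; have lnF := setok_size so; have [_ a _ _] := so.
have Eg : cur h' = cur h.
  by rewrite /Probing.cur E1; apply: (proj1 (groups_eq LG lnF a Em)).
split=> //; split; rewrite ?E1; first exact: (proj1 (setok_eq LG so Em)).
by move: Eg; rewrite /Probing.cur E1 => ->.
Qed.

Lemma nxt_uniq h : nxtok h -> uniq (nxt h).
Proof. by case=> so _ _; apply: uniq_groups so; exact: t_gt0 LG. Qed.

Lemma rnl_le h : nxtok h -> vars h rnl <= size (nxt h).
Proof. by case=> so _ _; exact: (@cells_le _ _ _ LG _ _ _ _ so). Qed.

Lemma rcl_le h : curok h -> vars h rcl <= size (cur h).
Proof. by case=> so _; exact: (@cells_le _ _ _ LG _ _ _ _ so). Qed.

Lemma tsum_all h : nxtok h -> tsum (nxt h) <= tall /\ size (nxt h) <= ngr.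
Proof.
move=> X; have u := nxt_uniq X; have [_ _ gn] := X; split; first exact: sum_sub.
rewrite -[X in _ <= X](size_iota 0); apply: uniq_leq_size => // g /gn lg.
by rewrite mem_iota.
Qed.

Lemma dense_DD : dense <= DD * thr.+1.
Proof. by rewrite /DD; apply: ltnW; rewrite ltn_ceil. Qed.

Lemma hwp_layerbody V o Q h k : lay V h -> outp h = o ->
  (forall h' k', (forall x, 25 <= x < 30 -> x != 26 -> vars h' x = vars h x) ->
     idle V h' -> outp h' = o -> vars h' 26 = 0 -> (forall v, ~~ new V v) ->
     k' <= k + 2 * tsum (cur h) -> Q h' k') ->
  (forall h' k' l, (forall x, 25 <= x < 30 -> vars h' x = vars h x) ->
     lay (vfin V) h' -> outp h' = o ++ flat l -> layer e V l -> (exists v, new V v) ->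
     k' + 1 + 2 * tsum (cur h') + Wt (vfin V) <= k + 2 * tsum (cur h) + Wt V -> Q h' k') ->
  hwp LayerBody Q h k.
Proof.
move=> [N CO [NO E0] cov] Eo HQ1 HQ2; have [r1 r2 r3 r4 r5] := area_le LG.
have q0 : 0 < 2 ^ b by rewrite expn_gt0.
have q1 : 1 < 2 ^ b by exact: pow_gt1.
apply: hwp_seq; apply: (@hwp_phaseA _ G _ _ LG V o) => // h1 k1 N1 X1 o1 a1 m1 g1 lk1.
have [CO1 Ec1] : curok h1 /\ cur h1 = cur h by apply: cur_pres => //; exact: a1.
apply: hwp_seq; apply: (@hwp_clear _ G _ _ LG V) => // h2 N2 o2 a2 e30 e31 e32 z2 m2.
have [X2 En2] : nxtok h2 /\ nxt h2 = nxt h1.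
  apply: nxt_pres => // i li; split; apply: m2; rewrite /aNL /aCL; lia.
have reg2 x : 25 <= x < 30 -> vars h2 x = vars h x.
  by move=> hx; rewrite a2 ?a1 //; lia.
have lk2 : k1 + vars h1 rcl <= k + 2 * tsum (cur h).
  have := tsum_out (cur h); have := rcl_le CO1; rewrite Ec1.
  by have := tsum_size (cur h); lia.
set k2 := k1 + vars h1 rcl in lk2 *.
have newP v : new V v -> v %/ 64 \in nxt h2.
  case/andP => nv /existsP [u /andP [uV eu]]; rewrite En2 g1; apply/hasP; exists u.
    by rewrite (mem_allverts LG); exact: (cov u v).
  by rewrite /whitenbr uV /=; apply/hasP; exists v; rewrite ?mem_outnbr // nv eqxx.
have nxtP g : g \in nxt h2 -> exists2 v, new V v & v %/ 64 = g.
  rewrite En2 g1 => /hasP [u _ /andP [uV /hasP [v]]]; rewrite mem_outnbr => eu /andP [nv /eqP Eg].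
  by exists v => //; rewrite /new_nbr nv; apply/existsP; exists u; rewrite uV.
(* An edge that leaves the enlarged set cannot start in V, since then its end would be new. So it
   starts at a new vertex, whose group is in the next set. *)
have covf u v : u \in vfin V -> v \notin vfin V -> e u v -> u %/ 64 \in nxt h2.
  rewrite !inE negb_or => /orP [uV|nu] /andP [nv nn] eu; last exact: newP.
  by case/negP: nn; rewrite /new_nbr nv; apply/existsP; exists u; rewrite uV.
have [so2 En2' gn2] := X2; have un2 := nxt_uniq X2.
have [[C2 T2 gg2] e33 e34 R2] := N2.
have nz : vars h2 rng <> 0 -> exists v, new V v.
  rewrite En2'; case E : (nxt h2) => [|g s] // _.
  by have [v nv _] := nxtP g (eq_ind_r (fun s => g \in s) (mem_head g _) E); exists v.
apply: (hwp_cond b_gt0 b_le_w) => //=; case: eqP => // E32 _.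
  apply: (hwp_asg _ b_gt0 b_le_w) => //=.
  have n0 : nxt h2 = [::] by apply/nilP; rewrite /nilp -En2' E32.
  apply: HQ1 => //.
  - by move=> x hx nx; rewrite /= (negPf nx) reg2.
  - split=> //; apply: (nc_reg N2) => // x hx /=; case: eqP => // Ex; lia.
  - by rewrite /= o2.
  - by move=> v; apply/negP => /newP; rewrite n0.
have {}nz := nz E32.
apply: (hwp_cond b_gt0 b_le_w) => //=; rewrite (CstsE C2); case: leqP => // lt _.
  have lE : 64 * size (nxt h2) <= 16 * PP by rewrite -En2' /Layout.thr in lt *; have := leq_divM PP 4; lia.
  apply: hwp_seq; apply: (@hwp_phaseB _ G _ _ LG V o) => //; first by rewrite o2.
  move=> h3 k3 l N3 o3 a3 m3 u3 p3 d3 lk3.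
  have [X3 En3] : nxtok h3 /\ nxt h3 = nxt h2.
    apply: nxt_pres; rewrite ?a3 // => i li; split; apply: m3; rewrite /aBE /aNL /aCL; lia.
  apply: hwp_seq; apply: (@hwp_phaseC _ G _ _ LG V (o ++ flat l)) => //; rewrite ?En3 //.
  move=> h4 k4 N4 o4 a4 m4 lk4.
  have mm x : aCF n b <= x < aBE n b -> hm h4 x = hm h2 x.
    by move=> /andP [x1 x2]; rewrite m4 // m3.
  have [X4 En4] : nxtok h4 /\ nxt h4 = nxt h2.
    apply: nxt_pres; rewrite ?a4 ?a3 // => i li; split; apply: mm; rewrite /aBE /aNL /aCL /aNF; lia.
  have EV : V :|: [set v in allverts n (nxt h2) | new V v] = vfin V.
    apply/setP => v; rewrite !inE (mem_allverts LG); case: (boolP (new V v)) => nn; rewrite ?andbF ?andbT //.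
    by rewrite newP // orbT.
  rewrite EV in N4.
  apply: (@hwp_move _ G _ _ LG (vfin V)) => //.
    by move=> c lc; rewrite mm ?z2 //; rewrite /aBE /aNL /aCL /aNF; lia.
  move=> h5 N5 o5 a5 CO5 X5 n5 c5.
  apply: (HQ2 _ _ l) => //.
  - by move=> x hx; rewrite a5 ?a4 ?a3 ?reg2 //; lia.
  - by split=> // u v uV nv eu; rewrite c5 En4; exact: covf uV nv eu.
  - by rewrite o5.
  - split=> //; first by rewrite u3 filter_uniq // (uniq_allverts LG un2).
    move=> v; rewrite u3 mem_filter (mem_allverts LG); case: (boolP (new V v)) => nn //=.
    by rewrite newP.
  - have H := grp_sum gc un2 nxtP; rewrite -/(tsum (nxt h2)) in H.
    have P : 6 * tsum (nxt h2) <= \sum_(v | new V v) pot v.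
      apply: leq_trans (_ : \sum_(v | new V v) 6 * gc (v %/ 64) <= _).
        by rewrite -big_distrr /= leq_mul2l H orbT.
      by apply: leq_sum => v _; exact: leq_addr.
    have S0 : 0 < size (nxt h2) by rewrite -En2'; lia.
    have := tsum_size (nxt h2); have := tsum_in (nxt h2); have := tsum_0 (nxt h2).
    have := rnl_le X4; rewrite c5 En4 (Wt_fin V); lia.
apply: hwp_seq; apply: (@hwp_crit _ G _ _ LG V o) => //; first by rewrite o2.
move=> h3 k3 l N3 a3 l3 o3 lk3.
apply: hwp_seq; apply: (@hwp_reset _ G _ _ LG (vfin V)) => // h4 N4 o4 a4 X4 e40 n4 z4.
apply: hwp_seq; apply: (@hwp_insertall _ G _ _ LG (vfin V)) => // h5 N5 o5 a5 X5 _ g5 m5.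
apply: (@hwp_move _ G _ _ LG (vfin V)) => //; first by move=> c lc; rewrite m5 ?z4.
move=> h6 N6 o6 a6 CO6 X6 n6 c6.
have [ta sa] := tsum_all X5.
apply: (HQ2 _ _ l) => //.
- by move=> x hx; rewrite a6 ?a5 ?a4 ?a3 ?reg2 //; lia.
- by split=> // u v uV nv eu; rewrite c6; apply: g5; exact: (ord_grp LG).
- by rewrite o6 o5 o4.
(* More than [thr] groups were met, each contains a new vertex, and each of these contributes
   [DD]. *)
have H := grp_sum (fun=> DD) un2 nxtP.
have P : DD * size (nxt h2) <= \sum_(v | new V v) pot v.
  apply: leq_trans (_ : \sum_(v | new V v) DD <= _); last by apply: leq_sum => v _; exact: leq_addl.
  by apply: leq_trans H; rewrite big_const_seq count_predT iter_addn_0 leqnn.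
have P2 : DD * thr.+1 <= DD * size (nxt h2) by rewrite leq_mul2l -En2' lt orbT.
have := dense_DD; rewrite /dense; have := rnl_le X5; rewrite c6 (Wt_fin V).
move: (DD * thr.+1) (DD * size (nxt h2)) P P2 => z1 z2'; lia.
Qed.

Lemma hwp_treeloop r s tr o Q h k : tree_upto e r s tr 0 -> lay (reached r tr) h ->
  outp h = o ++ flat tr ->
  (forall h' k' t', (forall x, 25 <= x < 30 -> x != 26 -> vars h' x = vars h x) ->
     bfs_tree e r s t' -> closed_out e (reached r t') -> idle (reached r t') h' ->
     outp h' = o ++ flat t' -> s \in reached r t' ->
     k' + Wt (reached r t') <= k + 1 + 2 * tsum (cur h) + Wt (reached r tr) -> Q h' k') ->
  hwp TreeLoop Q h k.
Proof.
move=> T0 L0 Eo HQ; have q0 : 0 < 2 ^ b by rewrite expn_gt0.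
have q1 : 1 < 2 ^ b by exact: pow_gt1.
set K := k + 1 + 2 * tsum (cur h) + Wt (reached r tr) in HQ.
(* Register 26 tells the two cases apart. While the tree is growing, the number of unreached
   vertices is the variant, because every further layer contains a new vertex. *)
pose I j h' k' := (forall x, 25 <= x < 30 -> x != 26 -> vars h' x = vars h x) /\
  ((exists t' d, [/\ vars h' 26 = 1, tree_upto e r s t' d, lay (reached r t') h',
       outp h' = o ++ flat t' & k' + 1 + 2 * tsum (cur h') + Wt (reached r t') <= K /\
       #|~: reached r t'| < j]) \/
   (exists t', [/\ vars h' 26 = 0, bfs_tree e r s t' /\ closed_out e (reached r t'),
       idle (reached r t') h', outp h' = o ++ flat t' & k' + Wt (reached r t') <= K])).
apply: hwp_seq; apply: (hwp_asg _ b_gt0 b_le_w) => //=.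
apply: (@hwp_loop _ G w b MM b_gt0 b_le_w _ _ I _ _ _ #|~: reached r tr|.+1) => //; last first.
  split; first by move=> x hx nx; rewrite /= (negPf nx).
  left; exists tr, 0; rewrite (_ : cur (setv h 26 1) = cur h) //; split=> //.
  case: L0 => N0 c0 x0 cov; split=> //.
  by apply: (nc_reg N0) => // x hx /=; case: eqP => // Ex; lia.
move=> j h1 k1 [a1 [[t' [d [e26 T1 L1 o1 [lk lj]]]]|[t' [e26 [B1 c1] L1 o1 lk]]]]; split=> //=; rewrite e26 //.
  move=> _; split; first by case: (j) lj.
  apply: (hwp_layerbody L1 o1) => [h2 k2 a2 i2 o2 e26' nn lk2|h2 k2 l a2 L2 o2 l2 [v nv] lk2].
    split; first by move=> x hx nx; rewrite a2 ?a1.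
    right; exists t'; split=> //; first exact: tree_done T1 nn.
    by lia.
  have ER : reached r (t' ++ l) = vfin (reached r t').
    apply/setP => u; case: l2 => _ ml _; rewrite !inE /unzip1 map_cat mem_cat -/(unzip1 t') -/(unzip1 l) ml.
    by rewrite -!orbA.
  split; first by move=> x hx nx; rewrite a2 ?a1.
  left; exists (t' ++ l), d.+1; split.
  - by rewrite a2.
  - exact: layer_tree T1 l2.
  - by rewrite ER.
  - by rewrite o2 flat_cat catA.
  split; first by rewrite ER; lia.
  have lt2 : #|~: reached r (t' ++ l)| < #|~: reached r t'|.
    apply: proper_card; rewrite ER; apply/properP; split.
      by apply/subsetP => u; rewrite !inE !negb_or => /andP [].
    have /andP [nV _] := nv.
    have vin : v \in [set u | new (reached r t') u] by rewrite inE.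
    by exists v; rewrite in_setC ?negbK // in_setU vin orbT.
  by lia.
move=> _; apply: (HQ _ _ t') => //.
by case: B1 => _ m1 _ _; rewrite !inE m1 connect0 andbT orbN.
Qed.

(** The potential of the root pays for moving its group to the current set and prepays the probing
    of this group. *)
Lemma hwp_root V (s : 'I_n) o Q h k : idle V h -> closed_out e V -> s \notin V ->
  vars h 25 = s -> outp h = o ->
  (forall h' k' tr, (forall x, 25 <= x < 30 -> x != 26 -> vars h' x = vars h x) ->
     bfs_tree e V s tr -> closed_out e (reached V tr) -> idle (reached V tr) h' ->
     outp h' = o ++ flat tr -> s \in reached V tr ->
     k' + Wt (reached V tr) <= k + Wt V -> Q h' k') ->
  hwp (Out ($25)%hl ;; Out ($25)%hl ;; PutV 25 ;; 55 ::= $25 %/ Cst 64 ;; Insert ;;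
        Move ;; TreeLoop) Q h k.
Proof.
move=> [N X n0 z] cV sV E25 Eo HQ; have [r1 r2 r3 r4 r5] := area_le LG.
have q0 : 0 < 2 ^ b by rewrite expn_gt0.
have q64 : 64 < 2 ^ b by exact: (small_pow LG).
apply: hwp_seq; apply: (hwp_out _ b_gt0 b_le_w) => //=; rewrite E25.
apply: hwp_seq; apply: (hwp_out _ b_gt0 b_le_w) => //=; rewrite E25; set h1 := out _ _.
have N1 : nc h1 V by apply: (nc_reg N).
apply: hwp_seq; apply: (@hwp_putv _ G _ _ LG 25 s V) => // h2 a2 i2 o2 m2 N2.
have [X2 En2] : nxtok h2 /\ nxt h2 = nxt h.
  apply: nxt_pres; rewrite ?a2 // => i li; split; apply: m2; rewrite /aNL /aCL /aNF; lia.
apply: hwp_seq; apply: (hwp_asg _ b_gt0 b_le_w) => //=; rewrite a2 //= E25; set h3 := setv _ _ _.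
have N3 : nc h3 (s |: V) by apply: (nc_reg N2) => // x hx /=; case: eqP => // Ex; lia.
have [[C3 T3 _] _ _ _] := N3.
have lg : s %/ 64 < ngr by exact: (ord_grp LG).
apply: hwp_seq; apply: (@hwp_insert _ G _ _ LG) => // h4 a4 i4 o4 m4 X4 n4.
have N4 : nc h4 (s |: V).
  by apply: (nc_ext LG N3) => [x lx y1 y2 _|a la]; [apply: a4 => //; lia|apply: m4; rewrite /aNL /aCL /aNF; lia].
have n4' : nxt h4 =i [:: s %/ 64] by move=> g; rewrite n4 /GroupOps.nxt /= -/(nxt h2) En2 n0.
apply: hwp_seq; apply: (@hwp_move _ G _ _ LG (s |: V)) => //.
  by move=> c lc; rewrite m4 ?m2 ?z //; rewrite /aNL /aCL /aNF; lia.
move=> h5 N5 o5 a5 CO5 X5 n5 c5.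
have pe : perm_eq (nxt h4) [:: s %/ 64] by apply: uniq_perm => //; exact: nxt_uniq.
have ER : reached V [:: (s, s)] = s |: V by apply/setP => u; rewrite !inE orbC.
have oo : outp h5 = o ++ flat [:: (s, s)].
  by rewrite o5 o4 /= o2 /= Eo -!cats1 -catA.
have L5 : lay (reached V [:: (s, s)]) h5.
  rewrite ER; split=> // u v; rewrite !inE negb_or => /orP [/eqP ->|uV] /andP [ns nv] eu.
    by rewrite c5 n4' mem_head.
  by rewrite (cV u v uV eu) in nv.
apply: (hwp_treeloop (tree_root cV sV) L5 oo) => h6 k6 tr a6 b6 c6 i6 o6 s6 lk6.
apply: (HQ _ _ tr) => //.
- move=> x hx nx; rewrite a6 // a5; try lia.
  rewrite a4; try lia. rewrite /= (_ : x == 55 = false) ?a2 //; lia.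
have ts : tsum (cur h5) = gc (s %/ 64) by rewrite c5 /tsum (perm_big _ pe) /= big_seq1.
have rn : vars h4 rnl <= 1 by have := rnl_le X4; rewrite (perm_size pe).
have W1 : Wt V = pot s + Wt (s |: V).
  rewrite /Wt (bigD1 s) //=; congr addn; apply: eq_bigl => v.
  by rewrite !inE negb_or andbC.
rewrite ER ts in lk6; have := gc_ge (s %/ 64); rewrite W1 /pot; lia.
Qed.

Lemma hwp_forest Q h k : idle set0 h -> outp h = [::] ->
  (forall h' k' o, bfs_forest e set0 o -> outp h' = flat o -> k' <= k + n + Wt set0 -> Q h' k') ->
  hwp Forest Q h k.
Proof.
move=> I0 o0 HQ; have q0 : 0 < 2 ^ b by rewrite expn_gt0.
have q1 : 1 < 2 ^ b by exact: pow_gt1.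
have n0 : 0 < n by apply: leq_ltn_trans (lg_lo LG); exact: leq0n.
have nb := lg_hi LG.
pose I j h' k' := (exists V o s, [/\ vars h' 27 = 1 /\ vars h' 25 = s, idle V h', bfs_prefix e V o, outp h' = flat o &
    [/\ s < n, forall u, u < s -> u \in V, k' + Wt V <= k + s + Wt set0 & j = n - s]]) \/
  (exists o, [/\ vars h' 27 = 0, bfs_forest e set0 o, outp h' = flat o & k' <= k + n + Wt set0]).
have idle_reg V h' r (z : nat) : 25 <= r < 30 -> idle V h' -> idle V (setv h' r z).
  move=> hr [N X z1 z2]; split=> //.
  + by apply: (nc_reg N) => // x hx /=; case: eqP => // Ex; lia.
  + have E x : 30 <= x -> vars (setv h' r z) x = vars h' x by move=> lx /=; case: eqP => // Ex; lia.
    by apply: (proj1 (nxt_pres X _ _ _)) => //; exact: E.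
  + have E x : 30 <= x -> vars (setv h' r z) x = vars h' x by move=> lx /=; case: eqP => // Ex; lia.
    by rewrite -z1; apply: (proj2 (nxt_pres X _ _ _)) => //; exact: E.
apply: hwp_seq; apply: (hwp_asg _ b_gt0 b_le_w) => //=.
apply: hwp_seq; apply: (hwp_asg _ b_gt0 b_le_w) => //=.
apply: (@hwp_loop _ G w b MM b_gt0 b_le_w _ _ I _ _ _ n) => //; last first.
  have I1 : idle set0 (setv (setv h 25 0) 27 1).
    by apply: (idle_reg) => //; apply: (idle_reg).
  left; exists set0, [::], 0; split; [by []|exact: I1|exact: bfs_prefix0|by rewrite /= o0|].
  by split=> //; rewrite ?addn0 ?subn0.
move=> j h1 k1 [[V [o [s [[e27 e25] I1 P1 o1 [ls us lk ->]]]]]|[o [e27 B1 o1 lk]]]; split=> //=; rewrite e27 //; last first.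
  by move=> _; exact: (HQ _ _ o).
move=> _; split; first lia.
pose v := Ordinal ls; have [[[C1 T1 g1] e33 e34 R1] X1 n1 z1] := I1.
apply: hwp_seq; apply: (@hwp_get _ G _ _ LG) => //; first by rewrite e25.
move=> h2 [a2 m2 i2 o2]; rewrite e33 e34 e25 (R1 v) => e62.
have I2 : idle V h2.
  have [N1 _ _ _] := I1.
  have [X2 En2] : nxtok h2 /\ nxt h2 = nxt h1.
    by apply: nxt_pres; rewrite ?a2 // => i li; rewrite m2.
  split; rewrite ?En2 ?m2 //; apply: (nc_reg N1) => // x hx; apply: a2; lia.
apply: hwp_seq.
apply: (@hwp_imp _ _ _ _ _ _ (fun h3 k3 => exists V' o', [/\ vars h3 27 = 1 /\ vars h3 25 = s,
   idle V' h3, bfs_prefix e V' o', outp h3 = flat o' &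
   (forall u, u <= s -> u \in V') /\ k3 + Wt V' <= k + s + Wt set0])).
  apply: (hwp_cond b_gt0 b_le_w) => //=; rewrite e62; last first.
    case: (boolP (v \in V)) => // vV _; apply: hwp_nop; exists V, o; split; rewrite ?o2 ?a2 //.
    split=> // u; rewrite leq_eqVlt => /orP [/eqP Eu|]; last exact: us.
    by have -> : u = v by exact: val_inj.
  case: (boolP (v \in V)) => // vV _; have [cV _] := P1.
  apply: (hwp_root (V := V) (s := v) (o := flat o)) => //; rewrite ?a2 ?o2 //.
  move=> h3 k3 tr a3 b3 c3 i3 o3 s3 lk3; exists (reached V tr), (o ++ tr); split=> //.
  - by rewrite !a3 // !a2.
  - exact: (bfs_prefix_tree P1 vV us b3 c3).
  - by rewrite o3 flat_cat.
  split; last by lia.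
  move=> u; rewrite leq_eqVlt => /orP [/eqP Eu|lu]; last by rewrite !inE us.
  by have -> : u = v by exact: val_inj.
move=> h3 k3 [V' [o' [[f27 f25] I3 P3 o3 [us3 lk3]]]].
have [[[C3 _ _] _ _ _] _ _ _] := I3.
apply: (hwp_cond b_gt0 b_le_w) => //=; rewrite f25 (CstsE C3); case: ltnP => // ls3 _.
  apply: (hwp_asg _ b_gt0 b_le_w) => //=; rewrite f25 ?addn1; try by sp => //; lia.
  left; exists V', o', s.+1; split=> //; first exact: idle_reg.
  by split=> //; lia.
apply: (hwp_asg _ b_gt0 b_le_w) => //=; right; exists o'; split=> //=; last by lia.
apply: bfs_prefixT; have <- // : V' = setT.
by apply/setP => u; rewrite inE us3 //; have := ltn_ord u; lia.
Qed.

End Search.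

End Traversal.
Import Traversal.

(** * Initialization: word length, tables, constants, cleared memory *)

Module Setup.

(** The program cannot observe b, so it computes the bit length of n - 1 by means of the numbers 2 ^
    i - 1, all of which fit into b bits. *)
Definition InitWord : cmd :=
  40 ::= 1 ;; 1 ::= 1 ;;
  Loop ($40 < $0)%hl (40 ::= (Cst 2 * $40) + 1 ;; 1 ::= $1 + 1).

Definition InitPow2 : cmd :=
  Wr (Cst 0) (Cst 1) ;; 36 ::= 1 ;;
  For 36 ($1)%hl (Wr ($36)%hl (Cst 2 * M[$36 - 1])%hl).

(** Register 40 still contains 2 ^ b - 1; comparing with a third of it ensures that the next power
    fits before it is computed. *)
Definition InitPow3 : cmd :=
  2 ::= 0 ;; 15 ::= 1 ;;
  Loop ($15 <= $40 %/ Cst 3)%hl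
    (Wr ($1 + $2)%hl ($15)%hl ;; 15 ::= Cst 3 * $15 ;; 2 ::= $2 + 1).

Definition InitConst : cmd :=
  3 ::= $1 %/ Cst 2 ;; 4 ::= $0 %/ (Cst 128 * $1) ;; 5 ::= $1 * $4 ;;
  6 ::= Cst 2 * $5 ;; 7 ::= ($0 - $5) + 1 ;; 9 ::= Cst 2 * $1 ;;
  8 ::= $9 + M[$3] ;; 10 ::= $8 + $4 ;; 11 ::= $10 + (($4 %/ Cst 4) + 1) ;;
  12 ::= $11 + (($4 %/ Cst 6) + 1) ;; 13 ::= $12 + 1 ;;
  24 ::= $13 + (($7 %/ $2) + 1) ;; 14 ::= $12 + (Cst 2 * $4) ;;
  16 ::= $5 %/ Cst 4 ;; 19 ::= ($0 %/ Cst 64) + 1 ;; 18 ::= ($19 %/ $3) + 1 ;;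
  20 ::= $12 + (($7 %/ $1) + 1) ;; 21 ::= $20 + $18 ;; 22 ::= $21 + $18 ;;
  23 ::= $22 + $18 ;; 17 ::= $23 + $18.

Definition InitLog : cmd :=
  Wr ($rTAB + 1)%hl (Cst 0) ;; 36 ::= 2 ;;
  For 36 (M[$rT])%hl (Wr ($rTAB + $36)%hl (M[$rTAB + ($36 %/ Cst 2)] + 1)%hl).

Definition InitZero : cmd :=
  36 ::= $rX ;; For 36 ($rM)%hl (Wr ($36)%hl (Cst 0)) ;;
  rcl ::= 0 ;; rnl ::= 0 ;; rng ::= 0 ;; rsa ::= $rLen ;; rlim ::= $rLen.

Definition Init : cmd :=
  InitWord ;; InitPow2 ;; InitPow3 ;; InitConst ;; InitLog ;; InitZero.

Section Initialization.

Variables (n : nat) (G : graph n) (w b : nat).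
Hypothesis LG : large n w b.

Let b_le_w := lg_w LG.
Let b_gt0 : 0 < b. Proof. by have := lg_big LG; lia. Qed.

Local Notation MM := (MM n b).
Local Notation len := (len n b).
Local Notation PP := (PP n b).
Local Notation QQ := (QQ n b).
Local Notation hh := (hh n b).
Local Notation k3 := (k3 b).
Local Notation tt := (tt b).
Local Notation hwp := (hwp G w b MM).
Local Notation hst := (hst n).
Local Notation nF := (nF n b).
Local Notation ngr := (ngr n).
Local Notation cvals := (cvals n b).
Implicit Types (h : hst).

(** The list grows by one register per assignment, so each step can rely on exactly the constants
    that are already in place. *)
Definition kn (l : seq nat) h := forall i, i \in l -> vars h i = nth 0 cvals i.

Lemma hwp_cst r e l (Q : hst -> nat -> Prop) h k : kn l h -> expr_depth e <= nvar ->
  ok b MM e h -> ev e h = nth 0 cvals r ->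
  (forall h', kn (r :: l) h' -> hm h' = hm h -> outp h' = outp h -> Q h' k) ->
  hwp (Asg r e) Q h k.
Proof.
move=> K de oe E HQ; apply: (hwp_asg _ b_gt0 b_le_w) => //; apply: HQ => // i.
by rewrite inE /= E; case: eqP => [->|_] //= /K.
Qed.

Lemma n_pow : 2 ^ b.-1 <= n.-1 /\ n.-1 < 2 ^ b.
Proof. by have := lg_lo LG; have := lg_hi LG; lia. Qed.

Lemma hwp_initword Q h k : vars h 0 = n.-1 ->
  (forall h', vars h' 0 = n.-1 -> vars h' 1 = b -> vars h' 40 = (2 ^ b).-1 -> hm h' = hm h ->
     outp h' = outp h -> forall k', k' <= k + b -> Q h' k') ->
  hwp InitWord Q h k.
Proof.
move=> E0 HQ; have [p1 p2] := n_pow.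
have q1 : 1 < 2 ^ b by exact: pow_gt1.
have q2 : 2 < 2 ^ b by exact: (small_pow LG).
have lb : b < 2 ^ b by exact: ltn_expl.
pose I j h' k' := exists i, [/\ j + i = b, 0 < i, vars h' 1 = i, vars h' 40 = (2 ^ i).-1 &
  [/\ vars h' 0 = n.-1, hm h' = hm h, outp h' = outp h & k' <= k + i]].
apply: hwp_seq; apply: (hwp_asg _ b_gt0 b_le_w) => //=.
apply: hwp_seq; apply: (hwp_asg _ b_gt0 b_le_w) => //=.
apply: (@hwp_loop _ G w b MM b_gt0 b_le_w _ _ I _ _ _ b.-1) => //; last first.
  by exists 1; split=> //; [lia|split=> //; lia].
move=> j h1 k1 [i [Ej i0 e1 e40 [e0 m1 o1 lk]]]; split=> //=; rewrite e40 e0; case: ltnP => // lt _.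
  have Eb : i = b.
    apply/eqP; rewrite eqn_leq; apply/andP; split; first lia.
    rewrite leqNgt; apply/negP => li.
    have : 2 ^ i <= 2 ^ b.-1 by rewrite leq_exp2l //; lia.
    by have : 0 < 2 ^ i by [rewrite expn_gt0]; lia.
  by rewrite Eb in e1 e40 lk; apply: HQ.
have li : i < b.
  rewrite ltnNge; apply/negP => li; have : 2 ^ b <= 2 ^ i by rewrite leq_exp2l.
  lia.
have l2 : 2 * 2 ^ i <= 2 ^ b by rewrite -expnS leq_exp2l.
have p0 : 0 < 2 ^ i by rewrite expn_gt0.
split; first lia.
apply: hwp_seq; apply: (hwp_asg _ b_gt0 b_le_w) => //=; rewrite e40; try by sp => //; lia.
apply: (hwp_asg _ b_gt0 b_le_w) => //=; rewrite e1; try by sp => //; lia.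
exists i.+1; split=> //=; [lia|lia| |].
- by rewrite expnS; lia.
- by split=> //; lia.
Qed.

Lemma tab_MM x : x < aX b -> x < MM.
Proof. by move/ltn_trans; apply; exact: (tab_fits LG). Qed.

Lemma aX_ge : 2 * b < aX b.
Proof. by rewrite /aX /aTAB; have : 0 < 2 ^ tt by [rewrite expn_gt0]; lia. Qed.

Lemma hwp_initpow2 Q h k : vars h 1 = b ->
  (forall h', (forall x, x < 36 -> vars h' x = vars h x) -> vars h' 40 = vars h 40 ->
     (forall j, j < b -> hm h' j = 2 ^ j) -> outp h' = outp h -> Q h' (k + b.-1)) ->
  hwp InitPow2 Q h k.
Proof.
move=> E1 HQ; have aX0 := aX_ge.
have q1 : 1 < 2 ^ b by exact: pow_gt1.
have q0 : 0 < 2 ^ b by exact: ltnW.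
have q2 : 2 < 2 ^ b by exact: (small_pow LG).
have lb : b < 2 ^ b by exact: ltn_expl.
pose J i h' k' := [/\ 0 < i, forall x, x < 36 -> vars h' x = vars h x, vars h' 40 = vars h 40,
  forall j, j < i -> hm h' j = 2 ^ j & outp h' = outp h /\ k' + 1 = k + i].
apply: hwp_seq; apply: (hwp_wr _ b_gt0 b_le_w) => //=; first by apply: tab_MM; lia.
apply: hwp_seq; apply: (hwp_asg _ b_gt0 b_le_w) => //=.
apply: (@hwp_for _ G w b MM b_gt0 b_le_w _ _ _ b J _ 1) => //.
- split=> //=.
  + by move=> x lx; case: eqP => // Ex; lia.
  + by case=> // j; rewrite ltnS.
- by move=> i h' k' _ _ [_ a _ _ _]; rewrite /= a.
- move=> i h1 k1 li E36 [i0 a1 e40 m1 [o1 lk]].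
  have Em : hm h1 (i - 1) = 2 ^ i.-1 by rewrite subn1 m1 //; lia.
  have Ei : 2 * 2 ^ i.-1 = 2 ^ i by rewrite -expnS prednK.
  have li2 : 2 ^ i < 2 ^ b by rewrite ltn_exp2l.
  apply: (hwp_wr _ b_gt0 b_le_w) => //=; rewrite E36 ?Em ?Ei.
  + by sp => //; apply: tab_MM; lia.
  + by apply: tab_MM; lia.
  split=> //; split=> //=.
  + by move=> x lx; case: eqP => [?|_]; [lia|exact: a1].
  + by move=> j lj; case: eqP => [->|ne] //; apply: m1; lia.
  + by split=> //; lia.
move=> h1 k1 _ [_ a1 e40 m1 [o1 lk]]; have -> : k1 = k + b.-1 by lia.
exact: HQ.
Qed.

Lemma hwp_initpow3 Q h k : vars h 1 = b -> vars h 40 = (2 ^ b).-1 -> (forall j, j < b -> hm h j = 2 ^ j) ->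
  (forall h' k', (forall x, x < 36 -> x != 2 -> x != 15 -> vars h' x = vars h x) ->
     vars h' 2 = k3 -> vars h' 15 = 3 ^ k3 -> (forall j, j < b -> hm h' j = 2 ^ j) ->
     (forall j, j < k3 -> hm h' (b + j) = 3 ^ j) -> outp h' = outp h -> k' <= k + b -> Q h' k') ->
  hwp InitPow3 Q h k.
Proof.
move=> E1 E40 m0 HQ; have aX0 := aX_ge.
have q1 : 1 < 2 ^ b by exact: pow_gt1.
have q0 : 0 < 2 ^ b by exact: ltnW.
have q3 : 3 < 2 ^ b by exact: (small_pow LG).
have lb : b < 2 ^ b by exact: ltn_expl.
have k2 := k3_two_thirds (lg_big LG) (lg_lo LG) (lg_hi LG).
have mx0 : 0 < (2 ^ b).-1 by lia.
have kb : k3 < b by have := k3_half (lg_big LG) (lg_lo LG) (lg_hi LG); lia.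
have kP i : 3 ^ i <= (2 ^ b).-1 -> i <= k3.
  by move=> l; exact: trunc_log_max.
pose I j h' k' := exists i, [/\ j + i = k3, vars h' 2 = i, vars h' 15 = 3 ^ i /\ 3 ^ i <= (2 ^ b).-1,
   (forall x, x < 36 -> x != 2 -> x != 15 -> vars h' x = vars h x) /\ vars h' 40 = (2 ^ b).-1 &
  [/\ (forall j, j < b -> hm h' j = 2 ^ j), (forall j, j < i -> hm h' (b + j) = 3 ^ j),
     outp h' = outp h & k' <= k + i]].
apply: hwp_seq; apply: (hwp_asg _ b_gt0 b_le_w) => //=.
apply: hwp_seq; apply: (hwp_asg _ b_gt0 b_le_w) => //=.
apply: (@hwp_loop _ G w b MM b_gt0 b_le_w _ _ I _ _ _ k3) => //; last first.
  exists 0; split=> //; first by rewrite addn0.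
    by split=> // x lx /negPf n1 /negPf n2 /=; rewrite n1 n2.
  by split=> //; rewrite addn0.
move=> j h1 k1 [i [Ej e2 [e15 l15] [a1 e40] [m1 m2 o1 lk]]]; split=> //=; rewrite e15 e40; case: (leqP (3 ^ i) _) => // lt _.
  have Ek : i = k3.
    apply/eqP; rewrite eqn_leq kP //= /Layout.k3 -ltnS -(@ltn_exp2l 3) //.
    apply: leq_ltn_trans (_ : (2 ^ b).-1 < _); first exact: trunc_logP.
    by rewrite ltn_divLR // -expnSr in lt.
  by rewrite Ek in e2 e15 m2 lk; apply: HQ => //; lia.
have l3 : 3 ^ i.+1 <= (2 ^ b).-1 by rewrite expnSr -leq_divRL.
have lk3 := kP _ l3.
split; first lia.
have e1 : vars h1 1 = b by rewrite a1.
have E3 : 3 * 3 ^ i = 3 ^ i.+1 by rewrite expnS.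
apply: hwp_seq; apply: (hwp_wr _ b_gt0 b_le_w) => //=; rewrite e1 e2.
- by sp => //; apply: (MM_lt LG); apply: tab_MM; lia.
- by apply: tab_MM; lia.
apply: hwp_seq; apply: (hwp_asg _ b_gt0 b_le_w) => //=; rewrite e15 E3; try by sp => //; lia.
apply: (hwp_asg _ b_gt0 b_le_w) => //=; rewrite e2; try by sp => //; lia.
exists i.+1; split=> //=; [lia|lia| |].
- by split=> // x lx n1 n2; rewrite (negPf n1) (negPf n2) a1.
split=> //=.
- by move=> j' lj; case: eqP => [Ex|_]; [lia|exact: m1].
- by move=> j' lj; rewrite eqn_add2l; case: eqP => [->|ne] //; apply: m2; lia.
- by lia.
Qed.

Lemma addr_chain : [/\ aFL n b <= MM, aEB n b <= MM, aW n b <= MM & aT n b <= MM].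
Proof.
rewrite /Layout.MM /aT /aW /aEB; move: (len %/ k3) (hh %/ 4) (hh %/ 6) (aFL n b) => x y z t.
by split; lia.
Qed.

Lemma init_facts : [/\ 128 * b < 2 ^ b, b * hh < 2 ^ b, 2 * PP < 2 ^ b, PP <= n.-1 & n.-1 - PP + 1 = len] /\
  [/\ tt < b, tt < MM, QQ <= len & 0 < 128 * b].
Proof.
have [p1 p2] := n_pow; have [eln [h126 h0]] := len_n LG.
have /andP [hb1 _] := hh_bounds (lg_big LG) (lg_lo LG) (lg_hi LG).
have bP : b <= PP by rewrite /Layout.PP; exact: leq_pmulr.
have lt : tt < b by have /andP [] := tt_bounds (lg_big LG) (lg_lo LG) (lg_hi LG); have := b_gt0; lia.
split; first by rewrite -/PP; split; lia.
split=> //.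
- by apply: tab_MM; have := aX_ge; lia.
- by rewrite /Layout.QQ; lia.
- by have := b_gt0; lia.
Qed.

Lemma hwp_initconst Q h k : kn [:: 15; 2; 1; 0] h -> (forall j, j < b -> hm h j = 2 ^ j) ->
  (forall h', Csts b h' -> hm h' = hm h -> outp h' = outp h -> Q h' k) ->
  hwp InitConst Q h k.
Proof.
move=> K0 m2 HQ.
have q1 : 1 < 2 ^ b by exact: pow_gt1.
have sm x : x < 64 * 64 -> x < 2 ^ b by exact: (small_pow LG).
have s2 := sm 2 isT; have s4 := sm 4 isT; have s6 := sm 6 isT; have s64 := sm 64 isT; have s128 := sm 128 isT.
have lb : b < 2 ^ b by exact: ltn_expl.
have [[f1 f2 f3 f4 eLen] [ttb ltM Ql f1']] := init_facts.
have [r1 r2 r3 r4 r5] := area_le LG; have [o1 o2 o3 o4 o5] := addr_order LG.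
have t0 := t_gt0 LG; have k0 := k3_gt0 (lg_big LG) (lg_lo LG) (lg_hi LG).
have MMb := MM_small (lg_big LG) (lg_lo LG) (lg_hi LG).
have ff := BF_fits (lg_big LG) (lg_lo LG) (lg_hi LG).
have lM : aT n b + (len %/ k3 + 1) = MM by rewrite addn1.
have mtt : 2 ^ tt = hm h tt by rewrite m2.
have d5 : QQ %/ k3 <= len %/ k3 by exact: leq_div2r.
have eEB : aFL n b + (hh %/ 4 + 1) = aEB n b by rewrite addn1.
have eW : aEB n b + (hh %/ 6 + 1) = aW n b by rewrite addn1.
have eT : aW n b + 1 = aT n b by [].
have eCF : aW n b + (len %/ b + 1) = aCF n b by rewrite addn1.
have eG : n.-1 %/ 64 + 1 = ngr by rewrite addn1.
have eF : ngr %/ tt + 1 = nF by rewrite addn1.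
have eX : aTAB b + 2 ^ tt = aX b by [].
have M4 : aNL n b <= MM by apply: leq_trans r5; rewrite -r4 leq_addr.
have M3 : aCL n b <= MM by apply: leq_trans M4; rewrite -r3 leq_addr.
have M2 : aNF n b <= MM by apply: leq_trans M3; rewrite -r2 leq_addr.
have M1 : aCF n b <= MM by apply: leq_trans M2; rewrite -r1 leq_addr.
have nFM : nF <= MM by apply: leq_trans (leq_addl (aNL n b) _) _; rewrite r4.
have lng : ngr < 2 ^ b by exact: ngr_lt LG.
have stp r e l (Q' : hst -> nat -> Prop) c h' : kn l h' -> hm h' = hm h -> outp h' = outp h -> expr_depth e <= nvar ->
    (kn l h' -> hm h' = hm h -> ok b MM e h' /\ ev e h' = nth 0 cvals r) ->
    (forall h2, kn (r :: l) h2 -> hm h2 = hm h -> outp h2 = outp h -> hwp c Q' h2 k) ->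
    hwp (r ::= e ;; c) Q' h' k.
  move=> K Em Eo de He Hc; have [He1 He2] := He K Em.
  apply: hwp_seq; apply: (hwp_cst K de He1 He2) => h2 K2 m2' o2'; apply: Hc => //; by rewrite ?m2' ?o2'.
have F x : x <= MM -> x < 2 ^ b by move/leq_ltn_trans; apply.
have f5 : n.-1 - PP + 1 < 2 ^ b by rewrite eLen; exact: (len_b LG).
have f6 : 2 * b < 2 ^ b by apply: (MM_lt LG); apply: tab_MM; exact: aX_ge.
have [N1 N2 N3 N4] := addr_chain.
have f7 : aTAB b + 2 ^ tt < 2 ^ b by rewrite eX; apply: F; apply: ltnW; exact: (tab_fits LG).
have f8 : aX b + hh < 2 ^ b by rewrite o1; apply: F.
have f9 : hh %/ 4 + 1 < 2 ^ b by apply: F; apply: leq_trans (leq_addl (aFL n b) _) _; rewrite eEB.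
have f10 : aFL n b + (hh %/ 4 + 1) < 2 ^ b by rewrite eEB; apply: F.
have f11 : hh %/ 6 + 1 < 2 ^ b by apply: F; apply: leq_trans (leq_addl (aEB n b) _) _; rewrite eW.
have f12 : aEB n b + (hh %/ 6 + 1) < 2 ^ b by rewrite eW; apply: F.
have f13 : aW n b + 1 < 2 ^ b by rewrite eT; apply: F.
have f14 : len %/ k3 + 1 < 2 ^ b by apply: F; apply: leq_trans (leq_addl (aT n b) _) _; rewrite lM.
have f15 : aT n b + (len %/ k3 + 1) < 2 ^ b by rewrite lM.
have f16' : aW n b + 2 * hh <= MM.
  apply: leq_trans (leq_addr hh _) _; apply: leq_trans ff _.
  by rewrite -lM leq_add2l; apply: leq_trans d5 (leq_addr _ _).
have f16 : aW n b + 2 * hh < 2 ^ b by exact: F.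
have f17 : 2 * hh < 2 ^ b by apply: F; apply: leq_trans (leq_addl _ _) f16'.
have f18 : n.-1 %/ 64 + 1 < 2 ^ b by rewrite eG.
have f19 : ngr %/ tt + 1 < 2 ^ b by rewrite eF; apply: F.
have f20 : len %/ b + 1 < 2 ^ b by apply: F; apply: leq_trans (leq_addl (aW n b) _) _; rewrite eCF.
have f21 : aW n b + (len %/ b + 1) < 2 ^ b by rewrite eCF; apply: F.
have f22 : aCF n b + nF < 2 ^ b by rewrite r1; apply: F.
have f23 : aNF n b + nF < 2 ^ b by rewrite r2; apply: F.
have f24 : aCL n b + nF < 2 ^ b by rewrite r3; apply: F.
have f25 : aNL n b + nF < 2 ^ b by rewrite r4; apply: F.
clear d5 ff.
apply: (stp _ _ _ _ _ _ K0) => // [K Em|h1 K1 Mh1 O1].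
  rewrite [ok _ _ _ _]/= [ev _ _]/= !(K 1 isT); rewrite [nth _ _ _]/=; split=> //; sp => //.
apply: (stp _ _ _ _ _ _ K1) => // [K Em|h2 K2 Mh2 O2].
  rewrite [ok _ _ _ _]/= [ev _ _]/= !(K 0 isT) !(K 1 isT); rewrite [nth _ _ _]/=; split=> //; sp => //.
apply: (stp _ _ _ _ _ _ K2) => // [K Em|h3 K3 Mh3 O3].
  rewrite [ok _ _ _ _]/= [ev _ _]/= !(K 1 isT) !(K 4 isT); rewrite [nth _ _ _]/=; split=> //; sp => //.
apply: (stp _ _ _ _ _ _ K3) => // [K Em|h4 K4 Mh4 O4].
  rewrite [ok _ _ _ _]/= [ev _ _]/= !(K 5 isT); rewrite [nth _ _ _]/=; split=> //; sp => //.
apply: (stp _ _ _ _ _ _ K4) => // [K Em|h5 K5 Mh5 O5].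
  rewrite [ok _ _ _ _]/= [ev _ _]/= !(K 0 isT) !(K 5 isT); rewrite [nth _ _ _]/=; split=> //; sp => //.
apply: (stp _ _ _ _ _ _ K5) => // [K Em|h6 K6 Mh6 O6].
  rewrite [ok _ _ _ _]/= [ev _ _]/= !(K 1 isT); rewrite [nth _ _ _]/=; split=> //; sp => //.
apply: (stp _ _ _ _ _ _ K6) => // [K Em|h7 K7 Mh7 O7].
  rewrite [ok _ _ _ _]/= [ev _ _]/= !(K 9 isT) !(K 3 isT); rewrite [nth _ _ _]/= Em -mtt; split=> //; sp => //.
apply: (stp _ _ _ _ _ _ K7) => // [K Em|h8 K8 Mh8 O8].
  rewrite [ok _ _ _ _]/= [ev _ _]/= !(K 8 isT) !(K 4 isT); rewrite [nth _ _ _]/=; split=> //; sp => //.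
apply: (stp _ _ _ _ _ _ K8) => // [K Em|h9 K9 Mh9 O9].
  rewrite [ok _ _ _ _]/= [ev _ _]/= !(K 10 isT) !(K 4 isT); rewrite [nth _ _ _]/=; split=> //; sp => //.
apply: (stp _ _ _ _ _ _ K9) => // [K Em|h10 K10 Mh10 O10].
  rewrite [ok _ _ _ _]/= [ev _ _]/= !(K 11 isT) !(K 4 isT); rewrite [nth _ _ _]/=; split=> //; sp => //.
apply: (stp _ _ _ _ _ _ K10) => // [K Em|h11 K11 Mh11 O11].
  rewrite [ok _ _ _ _]/= [ev _ _]/= !(K 12 isT); rewrite [nth _ _ _]/=; split=> //; sp => //.
apply: (stp _ _ _ _ _ _ K11) => // [K Em|h12 K12 Mh12 O12].
  rewrite [ok _ _ _ _]/= [ev _ _]/= !(K 13 isT) !(K 7 isT) !(K 2 isT); rewrite [nth _ _ _]/=; split=> //; sp => //.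
apply: (stp _ _ _ _ _ _ K12) => // [K Em|h13 K13 Mh13 O13].
  rewrite [ok _ _ _ _]/= [ev _ _]/= !(K 12 isT) !(K 4 isT); rewrite [nth _ _ _]/=; split=> //; sp => //.
apply: (stp _ _ _ _ _ _ K13) => // [K Em|h14 K14 Mh14 O14].
  rewrite [ok _ _ _ _]/= [ev _ _]/= !(K 5 isT); rewrite [nth _ _ _]/=; split=> //; sp => //.
apply: (stp _ _ _ _ _ _ K14) => // [K Em|h15 K15 Mh15 O15].
  rewrite [ok _ _ _ _]/= [ev _ _]/= !(K 0 isT); rewrite [nth _ _ _]/=; split=> //; sp => //.
apply: (stp _ _ _ _ _ _ K15) => // [K Em|h16 K16 Mh16 O16].
  rewrite [ok _ _ _ _]/= [ev _ _]/= !(K 19 isT) !(K 3 isT); rewrite [nth _ _ _]/=; split=> //; sp => //.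
apply: (stp _ _ _ _ _ _ K16) => // [K Em|h17 K17 Mh17 O17].
  rewrite [ok _ _ _ _]/= [ev _ _]/= !(K 12 isT) !(K 7 isT) !(K 1 isT); rewrite [nth _ _ _]/=; split=> //; sp => //.
apply: (stp _ _ _ _ _ _ K17) => // [K Em|h18 K18 Mh18 O18].
  rewrite [ok _ _ _ _]/= [ev _ _]/= !(K 20 isT) !(K 18 isT); rewrite [nth _ _ _]/=; split=> //; sp => //.
apply: (stp _ _ _ _ _ _ K18) => // [K Em|h19 K19 Mh19 O19].
  rewrite [ok _ _ _ _]/= [ev _ _]/= !(K 21 isT) !(K 18 isT); rewrite [nth _ _ _]/=; split=> //; sp => //.
apply: (stp _ _ _ _ _ _ K19) => // [K Em|h20 K20 Mh20 O20].
  rewrite [ok _ _ _ _]/= [ev _ _]/= !(K 22 isT) !(K 18 isT); rewrite [nth _ _ _]/=; split=> //; sp => //.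
apply: (hwp_cst K20) => //.
- by rewrite /= !(K20 23 isT) !(K20 18 isT); sp.
- by rewrite /= !(K20 23 isT) !(K20 18 isT).
move=> h21 K21 M21 O21; apply: HQ; rewrite ?M21 ?O21 // => i li; apply: K21.
by do 25 (case: i li => [//|i] li).
Qed.

Lemma hwp_initlog Q h k : Csts b h -> (forall j, j < b -> hm h j = 2 ^ j) -> (forall j, j < k3 -> hm h (b + j) = 3 ^ j) ->
  (forall h' k', Csts b h' -> Tabs b (hm h') -> outp h' = outp h -> k' <= k + n -> Q h' k') ->
  hwp InitLog Q h k.
Proof.
move=> C m2 m3 HQ; have aX0 := aX_ge.
have q1 : 1 < 2 ^ b by exact: pow_gt1.
have q0 : 0 < 2 ^ b by exact: ltnW.
have q2 : 2 < 2 ^ b by exact: (small_pow LG).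
have t0 := t_gt0 LG; have tb : 2 * tt <= b by have /andP [] := tt_bounds (lg_big LG) (lg_lo LG) (lg_hi LG).
have ltM : tt < MM by apply: tab_MM; lia.
have eX : aTAB b + 2 ^ tt = aX b by [].
have eT : aTAB b = 2 * b by [].
have lM x : x < aX b -> x < 2 ^ b by move=> lx; apply: (MM_lt LG); exact: tab_MM.
have k2 := k3_two_thirds (lg_big LG) (lg_lo LG) (lg_hi LG).
have tlo : 2 <= 2 ^ tt by rewrite -[X in X <= _]expn1 leq_exp2l.
(* The table has only O(sqrt n) entries; n is a generous bound on the time to fill it. *)
have th : 2 ^ tt <= n.
  have hb := hh_big (lg_big LG) (lg_lo LG) (lg_hi LG).
  have hn : hh <= n.-1 by exact: leq_div.
  have : 2 ^ tt <= b * (2 * b + 2 ^ tt + 4).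
    by apply: leq_trans (_ : 1 * (2 * b + 2 ^ tt + 4) <= _); [lia|rewrite leq_mul2r b_gt0 orbT].
  lia.
pose J i h' k' := [/\ 1 < i, Csts b h', (forall x, x < 2 * b -> hm h' x = hm h x) /\ outp h' = outp h,
  forall x, 0 < x < i -> hm h' (aTAB b + x) = trunc_log 2 x & k' + 2 = k + i].
apply: hwp_seq; apply: (hwp_wr _ b_gt0 b_le_w) => //=; rewrite (CstsE C).
- by sp => //; apply: lM; lia.
- by apply: tab_MM; lia.
apply: hwp_seq; apply: (hwp_asg _ b_gt0 b_le_w) => //=.
apply: (@hwp_for _ G w b MM b_gt0 b_le_w _ _ _ (2 ^ tt) J _ 2) => //.
- by apply: lM; rewrite -eX; lia.
- split=> //=.
  + by apply: Csts_eq C _ => x lx /=; case: eqP => // Ex; lia.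
  + by split=> // x lx; case: eqP => // Ex; lia.
  + by move=> x hx; have -> : x = 1 by [lia]; rewrite eqxx.
- move=> i h' k' _ _ [_ C' [m' _] _ _]; rewrite /= (CstsE C'); split=> //.
  by rewrite m' ?m2 //; lia.
- move=> i h1 k1 li E36 [i1 C1 [m1 o1] l1 Ek].
  have i2 : i %/ 2 < i by apply: ltn_Pdiv; lia.
  have i3 : 0 < i %/ 2 by rewrite divn_gt0.
  have Et : hm h1 (aTAB b + i %/ 2) + 1 = trunc_log 2 i.
    by rewrite l1 ?i3 // [RHS]trunc_log2S // -divn2 addn1.
  have lt2 : trunc_log 2 i < 2 ^ b.
    have t1 : 2 ^ trunc_log 2 i <= i by apply: trunc_logP => //; lia.
    have t2 : trunc_log 2 i < 2 ^ trunc_log 2 i by exact: ltn_expl.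
    by have := lM i; lia.
  apply: (hwp_wr _ b_gt0 b_le_w) => //=; rewrite (CstsE C1) E36.
  + by sp => //; apply: lM; lia.
  + rewrite Et; sp => //; [apply: lM; lia|apply: tab_MM; lia].
  + by apply: tab_MM; lia.
  split=> //; split=> //=; first by lia.
  + by apply: Csts_eq C1 _ => x lx /=; case: eqP => // Ex; lia.
  + by split=> // x lx; case: eqP => [Ex|_]; [lia|exact: m1].
  + by move=> x hx; rewrite eqn_add2l; case: eqP => [->|ne] //; apply: l1; lia.
  + by lia.
move=> h1 k1 _ [i1 C1 [m1 o1] l1 Ek]; apply: HQ => //; last by lia.
split; [by move=> j lj; rewrite m1 ?m2 //; lia|by move=> j lj; rewrite m1 ?m3 //; lia|exact: l1].
Qed.

Lemma hwp_initzero Q h k : Csts b h -> Tabs b (hm h) ->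
  (forall h' k', idle b set0 h' -> outp h' = outp h -> k' <= k + n -> Q h' k') ->
  hwp InitZero Q h k.
Proof.
move=> C T HQ.
have q0 : 0 < 2 ^ b by rewrite expn_gt0.
have [r1 r2 r3 r4 r5] := area_le LG; have [o1 o2 o3 o4 o5] := addr_order LG.
have MMb := MM_small (lg_big LG) (lg_lo LG) (lg_hi LG).
(* The memory is arbitrary at the start, and clearing it takes linear time because there are at most
   n cells. *)
have MMn : MM <= n.
  have := MM_space (lg_big LG) (lg_lo LG) (lg_hi LG).
  by apply: leq_trans; exact: leq_pmulr.
have tf := tab_fits LG.
pose J i h' k' := [/\ aX b <= i, (forall x, x < 25 -> vars h' x = vars h x), outp h' = outp h,
  (forall x, x < aX b -> hm h' x = hm h x) /\ (forall x, aX b <= x < i -> hm h' x = 0) & k' + aX b = k + i].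
have C' h' : (forall x, x < 25 -> vars h' x = vars h x) -> Csts b h' by exact: Csts_eq.
apply: hwp_seq; apply: (hwp_asg _ b_gt0 b_le_w) => //=; rewrite (CstsE C).
apply: hwp_seq; apply: (@hwp_for _ G w b MM b_gt0 b_le_w _ _ _ MM J _ (aX b)) => //.
- exact: ltnW.
- split=> //=.
  + by move=> x lx; case: eqP => // Ex; lia.
  + by split=> // x hx; lia.
- by move=> i h' k' _ _ [_ a _ _ _]; rewrite /= (CstsE (C' _ a)).
- move=> i h1 k1 li E36 [i0 a1 oo1 [m1 z1] Ek].
  apply: (hwp_wr _ b_gt0 b_le_w) => //=; rewrite E36 //.
  split=> //; split=> //=; first lia.
  + by move=> x lx; case: eqP => [Ex|_]; [lia|exact: a1].
  + split=> x hx; first by case: eqP => [Ex|_]; [lia|exact: m1].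
    by case: eqP => // ne; apply: z1; lia.
  + by lia.
move=> h1 k1 _ [_ a1 oo1 [m1 z1] Ek]; have C1 := C' _ a1.
do 3 (apply: hwp_seq; apply: (hwp_asg _ b_gt0 b_le_w) => //=).
apply: hwp_seq; apply: (hwp_asg _ b_gt0 b_le_w) => //=; rewrite (CstsE C1).
apply: (hwp_asg _ b_gt0 b_le_w) => //=; rewrite (CstsE C1).
set h2 := setv _ rlim _.
have a2 x : x < 25 -> vars h2 x = vars h1 x.
  by move=> lx; rewrite /h2 /=; do 5 (case: eqP => [Ex|_]; [lia|]).
have z2 x : aX b <= x < MM -> hm h2 x = 0 by exact: z1.
have rd0 (u : 'I_n) : rd n b (hm h2) len len u = 0.
  rewrite rdE; case: (boolP (inpc n b len u)) => iu.
    by rewrite /dig z2 ?div0n ?mod0n //; move: iu => /andP [_ l2]; have := adrX LG l2; have := aFL_MM LG; have := leq0n ((u - len) %/ b); lia.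
  have ul : u < len by move: iu; rewrite /inpc; have := ltn_ord u; have [eln _] := len_n LG; lia.
  have lp : ppos n b len u < len by rewrite /ppos (negPf iu) ul.
  rewrite lp /dig z2 ?div0n ?mod0n //; have := adrW LG (ppos n b len u); have := adrT lp.
  by have := leq0n (ppos n b len u %/ b); lia.
apply: HQ => //; last by lia.
have zc c : c < nF -> hm h2 (aCF n b + c) = 0 by move=> lc; apply: z2; lia.
have so : GroupSets.setok tt nF (hm h2) (aNF n b) (aNL n b) 0.
  by apply: setok0 => c lc; apply: z2; move: r2 r3 r4; rewrite /aNL /aCL /aNF; lia.
split=> //; split=> //.
- split; first by apply: Csts_eq C1 _.
    by apply: (Tabs_ext LG) T => x lx; exact: m1.
  by split=> //; left.
- by move=> u; rewrite [LHS]rd0 inE.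
Qed.

Lemma hwp_init Q h k : vars h 0 = n.-1 ->
  (forall h' k', idle b set0 h' -> outp h' = outp h -> k' <= k + 5 * n -> Q h' k') ->
  hwp Init Q h k.
Proof.
move=> E0 HQ; have bn : b <= n by have [eln [h126 h0]] := len_n LG; have : b <= PP by [rewrite /Layout.PP; exact: leq_pmulr]; lia.
apply: hwp_seq; apply: hwp_initword => // h1 e0 e1 e40 m1 o1 k1 lk1.
apply: hwp_seq; apply: hwp_initpow2 => // h2 a2 e40' m2 o2.
apply: hwp_seq; apply: hwp_initpow3 => //; [by rewrite a2|by rewrite e40'|].
move=> h3 k3' a3 e2 e15 m3 p3 o3 lk3.
apply: hwp_seq; apply: hwp_initconst => //.
  by move=> i; rewrite !inE => /or4P [] /eqP -> //=; rewrite a3 // a2.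
move=> h4 C4 m4 o4; apply: hwp_seq; apply: hwp_initlog => //; rewrite ?m4 //.
move=> h5 k5 C5 T5 o5 lk5; apply: hwp_initzero => // h6 k6 I6 o6 lk6.
apply: HQ => //; first by rewrite o6 o5 o4 o3 o2.
lia.
Qed.

End Initialization.

End Setup.
Import Setup.

(** * Decision trees for small graphs, and sums of degrees *)

Module SmallGraphs.

Section SmallPrograms.

Variable n : nat.

Local Notation pair := ('I_n * 'I_n)%type.

(** The adjacency matrix is kept in registers, one per entry, whose number is bounded as long as n
    is. The offset 100 keeps them apart from all other variables. *)
Definition pvar (p : pair) : nat := 100 + (p.1 * n + p.2).

Arguments pvar : simpl never.

Definition ReadPair (p : pair) : cmd :=
  pvar p ::= 0 ;; Iter true 1 (Cst p.1) ;;
  Loop (More 1) (Nxt 1 50 ;; Cond ($50 == Cst p.2)%hl (pvar p ::= 1) Nop).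

Fixpoint ReadPairs (ps : seq pair) : cmd :=
  if ps is p :: ps then ReadPair p ;; ReadPairs ps else Nop.

Fixpoint OutAll (ws : seq nat) : cmd :=
  if ws is x :: ws then Out (Cst x) ;; OutAll ws else Nop.

Fixpoint Match (f : {ffun pair -> bool}) (ps : seq pair) (c : cmd) : cmd :=
  if ps is p :: ps then Cond ($(pvar p) == Cst (f p))%hl (Match f ps c) Nop else c.

(** The answer for each matrix is picked by choice from the existence proof and becomes a constant
    of the program. *)
Definition forest_of (f : {ffun pair -> bool}) : seq pair :=
  sval (cid (forest_exists (fun u v => f (u, v)))).

Fixpoint Answer (fs : seq {ffun pair -> bool}) : cmd :=
  if fs is f :: fs then Match f (enum {: pair}) (OutAll (flat (forest_of f))) ;; Answer fs
  else Nop.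

Definition SmallForest : cmd := ReadPairs (enum {: pair}) ;; Answer (enum {: {ffun pair -> bool}}).

Variables (G : graph n) (w b : nat).
Hypotheses (b_gt0 : 0 < b) (b_le_w : b <= w) (n_b : n <= 2 ^ b).
Local Notation hwp := (hwp G w b 0).
Implicit Types (h : hst n) (p : pair).

Lemma pvar_inj : injective pvar.
Proof.
move=> [u v] [u' v']; rewrite /pvar => /addnI /= E.
have n0 : 0 < n by apply: leq_ltn_trans (ltn_ord u).
have Eu : u = u :> nat by [].
have := congr1 (fun x => x %/ n) E; rewrite !divnMDl // !divn_small // !addn0 => E1.
have := congr1 (fun x => x %% n) E; rewrite !modnMDl !modn_small // => E2.
by congr (_, _); exact: val_inj.
Qed.

Lemma ord_b (u : 'I_n) : u < 2 ^ b.
Proof. exact: leq_trans (ltn_ord u) n_b. Qed.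

Definition known (S : pred pair) h := forall p, S p -> vars h (pvar p) = edge G p.1 p.2.

Lemma hwp_readpair p (S : pred pair) Q h k : known S h ->
  (forall h' k', known (fun q => (q == p) || S q) h' -> outp h' = outp h -> k' <= k + n -> Q h' k') ->
  hwp (ReadPair p) Q h k.
Proof.
move=> K HQ; have q1 : 1 < 2 ^ b by exact: pow_gt1.
have q0 : 0 < 2 ^ b by exact: ltnW.
have pv q : (pvar q == 50) = false by apply/eqP; rewrite /pvar; lia.
pose I j h' k' := exists r l, [/\ outnbr G p.1 = r ++ l, j = size l, its h' 1 = l,
   vars h' (pvar p) = (p.2 \in r) & [/\ forall q, q != p -> vars h' (pvar q) = vars h (pvar q),
   outp h' = outp h & k' = k + size r]].
apply: hwp_seq; apply: (hwp_asg _ b_gt0 b_le_w) => //=.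
apply: hwp_seq; apply: (hwp_iter (u := p.1) b_gt0 b_le_w) => //=; first exact: ord_b.
apply: (@hwp_loop _ G w b 0 b_gt0 b_le_w _ _ I _ _ _ (size (outnbr G p.1))) => //; last first.
  exists [::], (outnbr G p.1); split=> //=; first by rewrite eqxx.
  split=> // [q nq|]; last by rewrite addn0.
  by rewrite (inj_eq pvar_inj) (negPf nq).
move=> j h1 k1 [r [l [Er -> El ep [a1 o1 ->]]]]; split=> //=; rewrite El; case: l Er El => [|u l] //= Er El _.
  apply: HQ => //.
    move=> q; case: (eqVneq q p) => [-> _|nq /= Sq]; last by rewrite a1 // K.
    by rewrite ep -mem_outnbr Er cats0.
  rewrite leq_add2l; have := outnbr_uniq G p.1; rewrite Er cats0 => /card_uniqP <-.
  by rewrite -[X in _ <= X]card_ord max_card.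
split=> //; apply: hwp_seq; apply: (@hwp_nxt _ G w b 0 b_gt0 b_le_w 1 50 _ _ _ u l El (ord_b u)).
have Er' : outnbr G p.1 = rcons r u ++ l by rewrite cat_rcons.
have a2 q : vars (setv (seti h1 1 l) 50 u) (pvar q) = vars h1 (pvar q) by rewrite /= ?pv.
apply: (hwp_cond b_gt0 b_le_w) => //=; first by sp; exact: ord_b.
  case: eqP => // Eu _; apply: (hwp_asg _ b_gt0 b_le_w) => //=.
  have {}Eu : u = p.2 by exact: val_inj.
  exists (rcons r u), l; split=> //=; first by rewrite eqxx mem_rcons Eu mem_head.
  split=> // [q nq|]; last by rewrite size_rcons addnS.
  by rewrite (inj_eq pvar_inj) (negPf nq) ?pv a1.
case: eqP => // nu _; apply: hwp_nop; exists (rcons r u), l; split=> //=.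
  by rewrite ?pv ep mem_rcons inE; case: eqP => // Eu; case: nu; rewrite Eu.
by split; rewrite // size_rcons addnS.
Qed.

Lemma hwp_readpairs ps (S : pred pair) Q h k : known S h ->
  (forall h' k', known (fun q => (q \in ps) || S q) h' -> outp h' = outp h ->
     k' <= k + size ps * n -> Q h' k') ->
  hwp (ReadPairs ps) Q h k.
Proof.
elim: ps S h k => [|p ps IH] S h k K HQ /=.
  by apply: hwp_nop; apply: HQ => //; exact: leq_addr.
apply: hwp_seq; apply: (hwp_readpair (p := p) K) => h1 k1 K1 o1 lk1.
apply: (IH _ _ _ K1) => h2 k2 K2 o2 lk2; apply: HQ.
- by move=> q; rewrite inE -orbA orbCA; exact: K2.
- by rewrite o2.
- by rewrite /= mulSn addnA; apply: leq_trans lk2 _; rewrite leq_add2r.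
Qed.

Lemma hwp_outall ws Q h k : all (fun x => x < 2 ^ b) ws ->
  (forall h', vars h' = vars h -> outp h' = outp h ++ ws -> Q h' k) ->
  hwp (OutAll ws) Q h k.
Proof.
elim: ws h => [|x ws IH] h /=; first by move=> _ HQ; apply: hwp_nop; apply: HQ; rewrite ?cats0.
case/andP => lx lw HQ; apply: hwp_seq; apply: (hwp_out _ b_gt0 b_le_w) => //=.
by apply: IH => // h' Ev Eo; apply: HQ => //; rewrite Eo /= cat_rcons.
Qed.

Lemma hwp_match (f : {ffun pair -> bool}) ps c Q h k : known predT h ->
  (all (fun p => f p == edge G p.1 p.2) ps -> hwp c Q h k) ->
  (~~ all (fun p => f p == edge G p.1 p.2) ps -> Q h k) ->
  hwp (Match f ps c) Q h k.
Proof.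
move=> K; have q1 : 1 < 2 ^ b by exact: pow_gt1.
have q0 : 0 < 2 ^ b by exact: ltnW.
elim: ps => [|p ps IH] /= H1 H2; first exact: H1.
apply: (hwp_cond b_gt0 b_le_w) => //=; rewrite ?K //.
- by split=> //; case: (f p).
- case: eqP => // E _; have Ef : f p == edge G p.1 p.2 by move: E; case: (f p); case: (edge _ _ _).
  by apply: IH => A; [apply: H1|apply: H2]; rewrite Ef.
- case: eqP => // E _; apply: hwp_nop; apply: H2; rewrite negb_and; apply/orP; left.
  by apply/eqP => Ef; case: E; rewrite Ef.
Qed.

(** All matrices are tried in turn. As they are distinct, exactly one test succeeds when the actual
    matrix is among them, so exactly one answer is written. *)
Lemma hwp_answer fs Q h k : known predT h -> uniq fs -> 
  (forall h' o, (if [ffun p => edge G p.1 p.2] \in fs then bfs_forest (edge G) set0 o else o = [::]) ->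
     vars h' = vars h -> outp h' = outp h ++ flat o -> Q h' k) ->
  hwp (Answer fs) Q h k.
Proof.
set f0 := [ffun p => edge G p.1 p.2].
elim: fs h => [|f fs IH] h K /=.
  by move=> _ HQ; apply: hwp_nop; apply: (HQ _ [::]); rewrite ?cats0.
case/andP => nf uf HQ; apply: hwp_seq.
have Ef : all (fun p => f p == edge G p.1 p.2) (enum {: pair}) = (f == f0).
  apply/allP/eqP => [A|-> p _]; last by rewrite ffunE.
  by apply/ffunP => p; rewrite ffunE; apply/eqP; apply: A; rewrite mem_enum.
apply: hwp_match => //; rewrite Ef => E.
  apply: hwp_outall.
    by apply/allP => x /flattenP [_ /mapP [y _ ->]]; rewrite !inE => /orP [] /eqP ->; exact: ord_b.
  move=> h1 v1 o1; apply: IH => //; first by move=> p Sp; rewrite v1 K.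
  move=> h2 o; rewrite -(eqP E) (negPf nf) => Eo v2 o2; rewrite Eo in o2.
  apply: (HQ _ (forest_of f)).
  - rewrite -(eqP E) mem_head /forest_of; case: cid => o' /=.
    have -> // : (fun u v => f (u, v)) = edge G.
    by apply/funext => u; apply/funext => v; rewrite (eqP E) ffunE.
  - by rewrite v2.
  - by rewrite o2 o1 -catA cats0.
apply: IH => // h2 o H v2 o2; apply: (HQ _ o) => //.
by rewrite inE eq_sym (negPf E).
Qed.

Lemma hwp_smallforest Q h k : outp h = [::] ->
  (forall h' k' o, bfs_forest (edge G) set0 o -> outp h' = flat o -> k' <= k + n * n * n -> Q h' k') ->
  hwp SmallForest Q h k.
Proof.
move=> o0 HQ; apply: hwp_seq; apply: (@hwp_readpairs _ pred0) => // h1 k1 K1 o1 lk1.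
apply: hwp_answer; first by move=> p _; apply: K1; rewrite mem_enum.
  exact: enum_uniq.
move=> h2 o H v2 o2; rewrite mem_enum inE in H.
apply: (HQ _ _ o) => //; first by rewrite o2 o1 o0.
by move: lk1; rewrite -cardE card_prod !card_ord.
Qed.

End SmallPrograms.

Section Degrees.

Variables (n : nat) (G : graph n).

Lemma size_outnbr u : size (outnbr G u) = \sum_v (edge G u v : nat).
Proof.
have /card_uniqP <- := outnbr_uniq G u.
rewrite -sum1_card big_mkcond; apply: eq_bigr => v _; rewrite mem_outnbr.
by case: (edge G u v).
Qed.

Lemma size_innbr u : size (innbr G u) = \sum_v (edge G v u : nat).
Proof.
have /card_uniqP <- := innbr_uniq G u.
rewrite -sum1_card big_mkcond; apply: eq_bigr => v _; rewrite mem_innbr.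
by case: (edge G v u).
Qed.

Lemma card_edges : \sum_u \sum_v (edge G u v : nat) = #|[set p : 'I_n * 'I_n | edge G p.1 p.2]|.
Proof.
rewrite pair_big /= -sum1_card big_mkcond /= [RHS]big_mkcond; apply: eq_bigr => p _.
by rewrite inE; case: edge.
Qed.

(** An unordered pair comes from at most two ordered ones, which are told apart by the order of
    their entries. *)
Lemma card_sets (A : {set 'I_n * 'I_n}) :
  #|A| <= 2 * #|[set [set p.1; p.2] | p in A]|.
Proof.
pose g (p : 'I_n * 'I_n) := ([set p.1; p.2], (p.1 < p.2)%N).
have gi : {in A &, injective g}.
  move=> [a c] [a' c'] _ _ [] E El; have Ea : a \in [set a'; c'] by rewrite -E !inE eqxx.
  have Ec : c \in [set a'; c'] by rewrite -E !inE eqxx orbT.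
  have Ea' : a' \in [set a; c] by rewrite E !inE eqxx.
  have Ec' : c' \in [set a; c] by rewrite E !inE eqxx orbT.
  move: Ea Ec Ea' Ec'; rewrite !inE -!val_eqE /= => h1 h2 h3 h4.
  by congr (_, _); apply: val_inj => /=; lia.
rewrite -(card_in_imset gi).
apply: leq_trans (_ : #|setX [set [set p.1; p.2] | p in A] [set: bool]| <= _).
  apply: subset_leq_card; apply/subsetP => _ /imsetP [p pA ->].
  by rewrite !inE andbT; apply: imset_f.
by rewrite cardsX cardsT card_bool mulnC.
Qed.

Lemma edges_le : #|[set p : 'I_n * 'I_n | edge G p.1 p.2]| <= 2 * nedges G.
Proof.
rewrite /nedges; case: (directed G); first by rewrite mul2n -addnn leq_addr.
apply: leq_trans (card_sets _) _; rewrite leq_mul2l /=; apply: subset_leq_card.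
by apply/subsetP => x /imsetP [p]; rewrite inE => pe ->; apply: imset_f; rewrite inE.
Qed.

Lemma sum_outdeg : \sum_u size (outnbr G u) <= 2 * nedges G.
Proof. by rewrite (eq_bigr _ (fun u _ => size_outnbr u)) card_edges edges_le. Qed.

Lemma sum_indeg : \sum_u size (innbr G u) <= 2 * nedges G.
Proof.
rewrite (eq_bigr _ (fun u _ => size_innbr u)) exchange_big card_edges; exact: edges_le.
Qed.

End Degrees.

End SmallGraphs.
Import SmallGraphs.

(** * The total potential is linear in n + m *)

Section Budget.

Variables (n : nat) (G : graph n) (w b : nat).
Hypothesis LG : large n w b.

Local Notation ngr := (ngr n).
Local Notation deg := (deg G).
Local Notation m := (nedges G).

Lemma sum_groups (H : 'I_n -> nat) :
  \sum_v H v = \sum_(g <- iota 0 ngr) \sum_(v <- verts n g) H v.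
Proof.
have -> : \sum_(g <- iota 0 ngr) \sum_(v <- verts n g) H v = \sum_(v <- allverts n (iota 0 ngr)) H v.
  by rewrite /allverts big_flatten big_map.
rewrite -big_enum; apply: perm_big; apply: uniq_perm.
- exact: enum_uniq.
- by apply: (uniq_allverts LG); exact: iota_uniq.
- by move=> v; rewrite mem_enum (mem_allverts LG) mem_iota add0n leq0n (ord_grp LG).
Qed.

Lemma tall_le : tall G <= 66 * ngr + 4 * m.
Proof.
rewrite /tall /tsum /gc /gcost.
have -> : \sum_(g <- iota 0 ngr) (66 + \sum_(v <- verts n g) deg v) = 66 * ngr + \sum_v deg v.
  rewrite (sum_groups deg) big_split; congr addn.
  by rewrite big_const_seq count_predT size_iota iter_addn_0.
rewrite leq_add2l.
rewrite big_split; apply: leq_trans (leq_add (sum_outdeg G) (sum_indeg G)) _; lia.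
Qed.

(** A group has at most 64 vertices, so its cost is counted at most 64 times. This is where the
    constant size of groups yields linear time. *)
Lemma sum_gc : \sum_(v : 'I_n) gc G (v %/ 64) <= 64 * tall G.
Proof.
rewrite sum_groups /tall /tsum big_distrr /=; apply: leq_sum => g _.
have -> : \sum_(v <- verts n g) gc G (v %/ 64) = \sum_(v <- verts n g) gc G g.
  rewrite big_seq [RHS]big_seq; apply: eq_bigr => v; by rewrite (mem_verts LG) => /eqP ->.
by rewrite big_const_seq count_predT iter_addn_0 mulnC leq_mul2r (size_verts _ g) orbT.
Qed.

Lemma ngr_le : 0 < n -> ngr <= n.
Proof. by rewrite /Layout.ngr; have := leq_div n.-1 64; lia. Qed.

Lemma Wt_le : Wt G b set0 <= 1024 * 400 * (n + m).
Proof.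
have [eln [h126 h0]] := len_n LG.
have b0 : 0 < b by have := lg_big LG; lia.
have n0 : 0 < n by apply: leq_ltn_trans (lg_lo LG).
have /andP [_ hb2] := hh_bounds (lg_big LG) (lg_lo LG) (lg_hi LG).
have bP : b <= PP n b by rewrite /Layout.PP; exact: leq_pmulr.
have gn := ngr_le n0; have tl := tall_le; have sg := sum_gc.
have cs : cst G [set: 'I_n] <= n + 2 * m.
  rewrite /cst /indeg (eq_bigl predT); last by move=> v; rewrite inE.
  have -> : \sum_(v : 'I_n) (size (innbr G v)).+1 = n + \sum_v size (innbr G v).
    rewrite -[X in X + _]card_ord -sum1_card -big_split /=; apply: eq_bigr => v _; by rewrite add1n.
  by rewrite leq_add2l sum_indeg.
have nF1 : nF n b <= n.
  have [r1 r2 r3 r4 r5] := area_le LG; have := MM_space (lg_big LG) (lg_lo LG) (lg_hi LG).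
  have : MM n b <= MM n b * (k3 b).+1 by exact: leq_pmulr.
  by have := leq_addl (aNL n b) (nF n b); lia.
(* The passes over all vertices give 204 n + 204 m, using 1 <= n; the traversal of all groups gives
   132 n + 8 m, and the remaining terms at most 9 n. *)
have dl : dense G b <= 345 * n + 212 * m by rewrite /dense; lia.
(* [thr] is a quarter of [PP], and [PP] is at least n / 256. *)
have nt : n <= 1024 * (thr n b).+1.
  have : PP n b < 4 * (thr n b).+1 by rewrite mulnC ltn_ceil.
  lia.
have dd : n * DD G b <= 1024 * dense G b + n.
  rewrite /DD mulnS addnC leq_add2r.
  apply: leq_trans (_ : 1024 * (thr n b).+1 * (dense G b %/ (thr n b).+1) <= _); first by rewrite leq_mul2r nt orbT.
  by rewrite -mulnA leq_mul2l /= mulnC leq_divM.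
have -> : Wt G b set0 = 6 * \sum_(v : 'I_n) gc G (v %/ 64) + n * DD G b.
  rewrite /Wt (eq_bigl predT); last by move=> v; rewrite inE.
  by rewrite /pot big_split /= -big_distrr /= sum_nat_const card_ord.
lia.
Qed.

Lemma hwp_largeforest (Q : hst n -> nat -> Prop) h k : vars h 0 = n.-1 -> outp h = [::] ->
  (forall h' k' o, bfs_forest (edge G) set0 o -> outp h' = flat o ->
     k' <= k + (6 + 1024 * 400) * (n + m) -> Q h' k') ->
  hwp G w b (MM n b) (Init ;; Forest) Q h k.
Proof.
move=> E0 Eo HQ; apply: hwp_seq; apply: (@hwp_init _ G _ _ LG) => // h1 k1 I1 o1 lk1.
apply: (@hwp_forest _ G _ _ LG) => //; first by rewrite o1.
move=> h2 k2 o bo o2 lk2; apply: (HQ _ _ o) => //; have := Wt_le; lia.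
Qed.

End Budget.

(** * One program for all n, and its execution on the machine *)

Fixpoint Chain (f i : nat) : cmd :=
  if f is f'.+1 then Cond ($0 == Cst i)%hl (SmallForest i.+1) (Chain f' i.+1)
  else Init ;; Forest.

Lemma hwp_chain_large n (G : graph n) w b M (Q : hst n -> nat -> Prop) f i h k :
  0 < b -> b <= w -> n <= 2 ^ b -> vars h 0 = n.-1 -> i + f <= n.-1 ->
  hwp G w b M (Init ;; Forest) Q h k -> hwp G w b M (Chain f i) Q h k.
Proof.
move=> b0 bw nb E0; elim: f i => [|f IH] i //= lf H.
apply: (hwp_cond b0 bw) => //=; rewrite ?E0; first by split=> //; lia.
  by case: eqP => // Ei; lia.
by move=> _; apply: IH => //; lia.
Qed.

Lemma hwp_chain_small n (G : graph n) w b (Q : hst n -> nat -> Prop) f i h k :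
  0 < b -> b <= w -> n <= 2 ^ b -> 0 < n -> vars h 0 = n.-1 -> i <= n.-1 < i + f ->
  hwp G w b 0 (SmallForest n) Q h k -> hwp G w b 0 (Chain f i) Q h k.
Proof.
move=> b0 bw nb n0 E0; elim: f i => [|f IH] i /=; first by lia.
move=> hi H; apply: (hwp_cond b0 bw) => //=; rewrite ?E0; first by split=> //; lia.
  by case: eqP => // Ei _; rewrite -Ei prednK.
by case: eqP => // ne _; apply: IH => //; lia.
Qed.

(** Hidden behind an existential quantifier, this huge unary number stays symbolic wherever the
    program depends on it. *)
Lemma threshold : exists N, (forall b, b < 64 * 64 -> 2 ^ b <= N) /\
  (forall b, 64 * 64 <= b -> N <= 2 ^ b.-1).
Proof.
move: (64 * 64) => c; exists (2 ^ c.-1).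
by split=> b lb; rewrite leq_exp2l //; lia.
Qed.

(** [LastVertex] is executed once, before the compiled code, and its cost n + m is accounted for
    separately. All variables other than the one it sets start with arbitrary contents. *)
Lemma exec_program n (G : graph n) w b M c (Q : seq nat -> nat -> Prop) s :
  n.-1 < 2 ^ b -> initial b s ->
  (forall h : hst n, vars h 0 = n.-1 -> outp h = [::] ->
     hwp G w b M c (fun h' j => Q (outp h') j) h 0) ->
  exists t s' j, [/\ exec G w b M (Seq (Do (LastVertex nvar)) (compile c)) s t s',
    t <= n + nedges G + cmd_size c * (1 + j) & Q (written s') j].
Proof.
move=> nb [ir ic ii iw] H.
pose s1 := State [eta regs s with nvar |-> n.-1] (cells s) (iters s) (written s).
pose h := Hst (fun r => regs s1 (nvar + r)) (cells s1) (iters s1) (written s1).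
have S1 : sim b h s1.
  split=> //; split=> //= r; case: eqP => // _; exact: ir.
have [] := H h; rewrite /= ?addn0 ?eqxx //.
move=> /(_ s1 S1) [t [s' [h' [j [E [_ _ _ Ew _] lt q]]]]].
exists (n + nedges G + t), s', j; split.
- econstructor; last exact: E.
  by constructor; rewrite /= /set_reg nb.
- by rewrite leq_add2l.
- by rewrite -Ew.
Qed.

(** * Space in terms of real logarithms *)

Section Reals.

Import Order.TTheory GRing.Theory Num.Theory.
Local Open Scope ring_scope.

Variable R : realType.

Let ln2_gt0 : 0 < ln (2 : R).
Proof. by apply: ln_gt0; rewrite ltr1n. Qed.

Lemma ln_pow (p k : nat) : (0 < p)%N -> ln ((p ^ k)%:R : R) = k%:R * ln (p%:R : R).
Proof. by move=> p0; rewrite natrX lnXn ?ltr0n // mulr_natl. Qed.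

Lemma ln_le (x y : nat) : (0 < x)%N -> (0 < y)%N -> (ln (x%:R : R) <= ln (y%:R : R)) = (x <= y)%N.
Proof. by move=> x0 y0; rewrite ler_ln ?posrE ?ltr0n // ler_nat. Qed.

Lemma log2_word (n w : nat) : (0 < n)%N -> log2 (n%:R : R) <= w%:R -> (n <= 2 ^ w)%N.
Proof.
move=> n0; rewrite /log2 ler_pdivrMr // -(@ln_pow 2) // ln_le //.
by rewrite expn_gt0.
Qed.

Lemma log2_ge1 (n : nat) : (1 < n)%N -> 1 <= log2 (n%:R : R).
Proof.
by move=> n1; rewrite /log2 ler_pdivlMr // mul1r ln_le // ltnW.
Qed.

(** Rounding up adds at most 1, and 1 <= log2 n. *)
Lemma uplog_log2 (n : nat) : (1 < n)%N -> (up_log 2 n)%:R <= 2 * log2 (n%:R : R).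
Proof.
move=> n1; have L1 := log2_ge1 n1.
have u0 : (0 < up_log 2 n)%N by rewrite up_log_gt0.
have : ((up_log 2 n).-1)%:R <= log2 (n%:R : R).
  rewrite /log2 ler_pdivlMr // -(@ln_pow 2) // ln_le ?expn_gt0 //; last exact: ltnW.
  by apply: ltnW; exact: up_log_gtn.
have -> : (up_log 2 n)%:R = ((up_log 2 n).-1)%:R + 1 :> R by rewrite natr1 prednK.
by move=> H; rewrite mulr_natl mulr2n lerD.
Qed.

(** The second premise says that a cell of b bits is worth at most k trits, the first that M cells
    of k trits make at most n trits. *)
Lemma trit_space (n b M k : nat) : (M * k <= n)%N -> (2 ^ b <= 3 ^ k)%N ->
  (M * b)%:R <= n%:R * log2 (3 : R).
Proof.
move=> Mk bk.
have T0 : 0 <= log2 (3 : R).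
  by apply: le_trans (log2_ge1 (isT : (1 < 3)%N)); exact: ler01.
have bT : b%:R <= k%:R * log2 (3 : R).
  rewrite /log2 mulrA ler_pdivlMr // -(@ln_pow 2) // -(@ln_pow 3) // ln_le ?expn_gt0 //.
rewrite natrM; apply: le_trans (_ : M%:R * (k%:R * log2 (3 : R)) <= _).
  by rewrite ler_wpM2l.
by rewrite mulrA -natrM ler_wpM2r // ler_nat.
Qed.

(** A register or an iterator takes O(log n) bits, and a logarithm that is at least 1 is bounded by
    its square. *)
Lemma word_space (n b r i : nat) : (1 < n)%N -> b = maxn 1 (up_log 2 n) ->
  (r * b + i * itr_bits n)%:R <= (2 * r + 8 * i)%:R * log2 (n%:R : R) ^+ 2.
Proof.
move=> n1 ->; have L1 := log2_ge1 n1; have L2 := uplog_log2 n1.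
have u0 : (0 < up_log 2 n)%N by rewrite up_log_gt0.
have -> : maxn 1 (up_log 2 n) = up_log 2 n by apply/maxn_idPr.
have ib : (itr_bits n <= 4 * up_log 2 n)%N.
  have : (up_log 2 n.+1 <= (up_log 2 n).+1)%N.
    apply: up_log_min => //; rewrite expnS.
    have := up_logP n (isT : (1 < 2)%N); lia.
  rewrite /itr_bits; lia.
set L := log2 _ in L1 L2 *; set u := up_log 2 n in L2 ib *.
have LL : L <= L ^+ 2 by rewrite expr2 ler_peMl // (le_trans ler01).
apply: le_trans (_ : (r + 4 * i)%:R * u%:R <= _).
  rewrite -natrM ler_nat; have : (i * itr_bits n <= i * (4 * u))%N by rewrite leq_mul2l ib orbT.
  by rewrite mulnDl; lia.
have -> : (2 * r + 8 * i)%:R = (r + 4 * i)%:R * 2 :> R by rewrite -natrM; congr _%:R; lia.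
rewrite -mulrA; apply: ler_wpM2l => //.
by apply: le_trans L2 _; rewrite ler_pM2l.
Qed.

Lemma space_le (C n b r i M k : nat) : (1 < n)%N -> b = maxn 1 (up_log 2 n) ->
  (M * k <= n)%N -> (2 ^ b <= 3 ^ k)%N ->
  ((r + M) * b + i * itr_bits n)%:R <=
    n%:R * log2 (3 : R) + (C + (2 * r + 8 * i))%:R * log2 (n%:R : R) ^+ 2.
Proof.
move=> n1 Eb Mk bk; have -> : ((r + M) * b + i * itr_bits n = M * b + (r * b + i * itr_bits n))%N.
  by rewrite mulnDl; lia.
rewrite natrD; apply: lerD; first exact: trit_space bk.
apply: le_trans (word_space r i n1 Eb) _; apply: ler_wpM2r; first exact: sqr_ge0.
by rewrite ler_nat leq_addl.
Qed.

End Reals.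

Theorem theorem4p1 (R : realType) :
  exists (P : prog) (C : nat),
  forall n w : nat, 0 < n -> 0 < w -> (log2 (n%:R : R) <= w%:R)%R ->
  exists b M : nat,
    [/\ b <= w,
        1 < n ->
          ((space_bits P n b M)%:R <=
             n%:R * log2 (3 : R) + C%:R * log2 (n%:R : R) ^+ 2)%R
      & forall (G : graph n) (s : state n), initial b s ->
        exists (t : nat) (s' : state n),
          [/\ exec G w b M P s t s',
              t <= C * (n + nedges G)
            & bfs_output G (written s')]].
Proof.
have [N [Nlo Nhi]] := threshold.
pose c := Chain N 0; pose P := Seq (Do (LastVertex nvar)) (compile c).
(* The cube bounds the iterations of the decision trees, and the other summands, times n + m, those
   of the initialization and the search. *)
pose J := N * N * N + 6 + 1024 * 400.
pose C1 := 1 + cmd_size c * (1 + J); pose C2 := 2 * nreg P + 8 * nitr P.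
exists P, (C1 + C2) => n w n0 w0 nw.
(* The maximum matters for n = 1, where b = 0 would leave no room for the truth value 1. *)
pose b := maxn 1 (up_log 2 n).
have b0 : 0 < b by rewrite /b leq_max.
have nb : n <= 2 ^ b.
  by apply: leq_trans (up_logP n (isT : 1 < 2)) _; rewrite leq_exp2l // leq_maxr.
have nb' : n.-1 < 2 ^ b by lia.
have bw : b <= w by rewrite geq_max w0 /= up_log_min // (log2_word n0 nw).
have time (G : graph n) t j : j <= J * (n + nedges G) -> t <= n + nedges G + cmd_size c * (1 + j) ->
    t <= (C1 + C2) * (n + nedges G).
  move=> lj lt; apply: leq_trans lt _.
  apply: leq_trans (_ : C1 * (n + nedges G) <= _); last by rewrite leq_mul2r leq_addr orbT.
  have l1 : 1 + j <= (1 + J) * (n + nedges G) by rewrite mulnDl mul1n leq_add // addn_gt0 n0.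
  by rewrite /C1 mulnDl mul1n leq_add2l -mulnA leq_mul2l l1 orbT.
have fin (G : graph n) M s : initial b s ->
    (forall h : hst n, vars h 0 = n.-1 -> outp h = [::] ->
     hwp G w b M c (fun h' j => (exists2 o, bfs_forest (edge G) set0 o & outp h' = flat o) /\ j <= J * (n + nedges G)) h 0) ->
    exists t s', [/\ exec G w b M P s t s', t <= (C1 + C2) * (n + nedges G) & bfs_output G (written s')].
  move=> si H.
  have [t [s' [j [E lt [Ho lj]]]]] := exec_program (Q := fun ws j => (exists2 o, bfs_forest (edge G) set0 o & ws = flat o) /\ j <= J * (n + nedges G)) nb' si H.
  by exists t, s'; split=> //; exact: time lj lt.
case: (ltnP b (64 * 64)) => lb.
  (* Decision trees work in registers alone. Without memory cells the premises on trits hold with k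
     = b. *)
  exists b, 0; split=> //.
    move=> n1; apply: (@space_le R C1 n b (nreg P) (nitr P) 0 b) => //.
    by rewrite leq_exp2r.
  move=> G s si; apply: fin => // h E0 Eo.
  have nN : n <= N := leq_trans nb (Nlo _ lb).
  apply: hwp_chain_small => //; first by rewrite leq0n add0n; lia.
  apply: hwp_smallforest => // h' k' o bo oo lk; split; first by exists o.
  apply: leq_trans lk _; rewrite add0n; apply: leq_trans (_ : J <= _).
    by rewrite /J -addnA; apply: leq_trans (leq_addr _ _); rewrite !leq_mul.
  by apply: leq_pmulr; rewrite addn_gt0 n0.
have n1 : 1 < n.
  rewrite ltnNge; apply/negP => le1; move: lb; rewrite /b.
  by have -> : up_log 2 n = 0 by [apply/eqP; rewrite up_log_eq0 le1 orbT].
have LG : large n w b.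
  split=> //; rewrite /b; have -> : maxn 1 (up_log 2 n) = up_log 2 n.
    by apply/maxn_idPr; rewrite up_log_gt0.
  exact: up_log_gtn.
exists b, (MM n b); split=> //.
  move=> _; apply: (@space_le R C1 n b (nreg P) (nitr P) (MM n b) (k3 b).+1) => //.
    exact: MM_space (lg_big LG) (lg_lo LG) (lg_hi LG).
  exact: k3_lo (lg_big LG) (lg_lo LG) (lg_hi LG).
move=> G s si; apply: fin => // h E0 Eo.
apply: hwp_chain_large => //.
  by rewrite add0n; have := lg_lo LG; have := Nhi _ lb; lia.
apply: (hwp_largeforest LG) => // h' k' o bo oo lk; split; first by exists o.
by apply: leq_trans lk _; rewrite add0n leq_mul2r; apply/orP; right; rewrite /J -addnA leq_addl.
Qed.
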